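(* Let $b\in\{1,\dots,d-1\}$ and let $N_{n,b}=\#\{h\in\mathcal S: a(h)=b\}$ for a multi-base representation $a$ of $n$ chosen uniformly at random among all $P(n)$ representations. Then \[ \mathbb E[N_{n,b}]=\frac{\kappa}{d\log d}(\log n)^m+O\big((\log n)^{m-1}\log\log n\big),\qquad \operatorname{Var}[N_{n,b}]=\frac{\kappa(d-1)}{d^2\log d}(\log n)^m+O\big((\log n)^{m-1}\log\log n\big), \] and $(N_{n,b}-\mathbb E[N_{n,b}])/\sqrt{\operatorname{Var}[N_{n,b}]}$ converges in distribution to a standard Gaussian random variable as $n\to\infty$.
   Context: Fix integers $d\geq 2$ and $m\geq 2$, and integers $1<p_1<p_2<\dots<p_m$ with $\gcd(p_i,p_j)=1$ for $i\neq j$. Let $\mathcal S=\{p_1^{\alpha_1}p_2^{\alpha_2}\cdots p_m^{\alpha_m}:\alpha_1,\dots,\alpha_m\in\mathbb Z_{\ge 0}\}$. A multi-base representation of a positive integer $n$ (with bases $p_1,\dots,p_m$ and digit set $\{0,1,\dots,d-1\}$) is a function $a:\mathcal S\to\{0,1,\dots,d-1\}$ with finite support such that $\sum_{h\in\mathcal S}a(h)\,h=n$. Let $P(n)$ be the (finite) number of multi-base representations of $n$. Set $\kappa=\frac{\log d}{m!}\prod_{j=1}^m\frac{1}{\log p_j}$. *)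

(* Defs.v *)
From Stdlib Require Import Reals Lra ClassicalEpsilon.
From mathcomp Require Import all_boot.
Unset Printing Implicit Defensive.

Definition inS (m : nat) (p : 'I_m -> nat) (h : nat) : Prop :=
  exists alpha : 'I_m -> nat, h = (\prod_(i < m) p i ^ alpha i)%N.

Definition inSb (m : nat) (p : 'I_m -> nat) (h : nat) : bool :=
  if excluded_middle_informative (inS m p h) then true else false.

(** A multi-base representation of n with digits {0,..,d-1}: a function
    a : S -> {0..d-1} of finite support with Σ a(h) h = n.  Since every h with
    a(h) > 0 satisfies h <= n, such an a is the same as its restriction to
    {h ∈ S : h <= n}; we encode it as a : 'I_(n+1) -> 'I_d vanishing off S. *)
Definition is_rep (d m : nat) (p : 'I_m -> nat) (n : nat)
  (a : {ffun 'I_n.+1 -> 'I_d}) : bool :=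
  [forall h : 'I_n.+1, (~~ inSb m p h) ==> (nat_of_ord (a h) == 0%N)]
  && ((\sum_(h < n.+1) a h * h)%N == n).

Definition Pn (d m : nat) (p : 'I_m -> nat) (n : nat) : nat :=
  #|[pred a : {ffun 'I_n.+1 -> 'I_d} | is_rep d m p n a]|.

Definition Nb (d n b : nat) (a : {ffun 'I_n.+1 -> 'I_d}) : nat :=
  #|[pred h : 'I_n.+1 | nat_of_ord (a h) == b]|.

Local Open Scope R_scope.

Definition ExpN (d m : nat) (p : 'I_m -> nat) (n b : nat) : R :=
  (\big[Rplus/0]_(a : {ffun 'I_n.+1 -> 'I_d} | is_rep d m p n a) INR (Nb d n b a))
  / INR (Pn d m p n).

Definition VarN (d m : nat) (p : 'I_m -> nat) (n b : nat) : R :=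
  (\big[Rplus/0]_(a : {ffun 'I_n.+1 -> 'I_d} | is_rep d m p n a)
      (INR (Nb d n b a) - ExpN d m p n b) ^ 2)
  / INR (Pn d m p n).

Definition cdfZ (d m : nat) (p : 'I_m -> nat) (b n : nat) (x : R) : R :=
  INR #|[pred a : {ffun 'I_n.+1 -> 'I_d} | is_rep d m p n a &&
          (if Rle_dec ((INR (Nb d n b a) - ExpN d m p n b) / sqrt (VarN d m p n b)) x
           then true else false)]|
  / INR (Pn d m p n).

Definition kappa (d m : nat) (p : 'I_m -> nat) : R :=
  ln (INR d) / INR (m`!)%N * \big[Rmult/1]_(j < m) (/ ln (INR (p j))).

Definition gauss (t : R) : R := exp (- (t ^ 2) / 2) / sqrt (2 * PI).

Lemma gauss_integrable (a b : R) : Riemann_integrable gauss a b.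
Proof.
  assert (C : forall x, continuity_pt gauss x).
  { intro x. unfold gauss. apply continuity_pt_div.
    - apply (continuity_pt_comp (fun t => - (t ^ 2) / 2) exp).
      + apply continuity_pt_div. apply continuity_pt_opp.
        apply derivable_continuous_pt. apply derivable_pt_pow.
        apply continuity_pt_const. intros u v; reflexivity.
        lra.
      + apply derivable_continuous_pt. apply derivable_pt_exp.
    - apply continuity_pt_const. intros u v; reflexivity.
    - apply Rgt_not_eq. apply sqrt_lt_R0. pose proof PI_RGT_0. lra. }
  destruct (Rle_dec a b) as [H|H].
  - apply continuity_implies_RiemannInt; auto.
  - apply RiemannInt_P1. apply continuity_implies_RiemannInt; auto. lra.
Qed.

Definition gauss_int (a b : R) : R := RiemannInt (gauss_integrable a b).

(* Main.v *)
Require Import Defs.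
From HB Require Import structures.
From Stdlib Require Import Reals Lra Lia ZArith ClassicalEpsilon.
From mathcomp Require Import all_boot.
From Coquelicot Require Import Coquelicot.

Set Implicit Arguments.
Unset Strict Implicit.
Local Open Scope R_scope.

(** Let the digits [a h] be independent with laws proportional to [exp (- r * j * h)], where [r] is the saddle point at which the sum [X] of the [a h * h] has mean [n]; conditioned on [X = n] this product law is uniform on the representations of [n].  Write [L = ln n].  The elements above [n / L^K] together with the [p^a q^b], [b = O(ln L)], where [p] and [q] are two of the bases, form a set [U] of only [O(L^(m-1) ln L)] elements, while on the remaining set [T] the digits are uniform up to a factor [1 + o(1 / #T)].

    Fourier analysis modulo a large integer shows that [P(X = n)] has the order of the inverse standard deviation of [X], that point masses of the part of [X] carried by [U] have at most this order, and that they vary slowly.  On the minor arcs this rests on chains [p^a q^b], along which the digits are nearly equidistributed modulo [p^A].  The last fact makes the digits on [T] nearly independent of the event [X = n].  The first two, applied after splitting [S] into two halves by a parity, bound the conditional variance of the digit count over either half of [U] by a multiple of its unconditional variance, since the other half absorbs the condition.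

    Hence the digit count is a binomial variable with parameters [#T] and [1 / d] plus an error of variance [O(L^(m-1) ln L)], with [#T] equal to the number of elements of [S] up to [n], within [O(#U)]; the central limit theorem follows from the binomial one. *)

(** Only about [L^m] elements of [S] lie below [n], so all cancellation has to come from
    multiplicative structure. For frequencies [|y| <= n^(-1/2)] a window of [S] just below
    [min(1/r, 1/|y|)] gives decay. Beyond that only chains [p^a q^b] are under control: with [b] up
    to a multiple of [ln L] a chain saves a fixed power of [L] at each frequency, while a bound of
    order [1/n] is wanted on average. Three disjoint sets supply it: one saves a power of [L]
    pointwise, and for the other two the mean square is, by Parseval, a collision probability, at
    most a power of [L] over [n]. The length [ln L] of these chains, like the logarithmic width of
    the range from [n / L^K] to [n], is the origin of the factor [ln ln n] in the error terms.

    Two kinds of control are kept apart. Slow variation of point masses saves any power of [L]; this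
    is needed because its error gets multiplied by quantities as large as [L^(2m)]. The bound on the
    variance over [U] may lose only a constant, so it rests on point masses of one half of [S]
    having the same order as [P(X = n)]. *)

HB.instance Definition _ := Monoid.isComLaw.Build R 0 Rplus
  (fun x y z => esym (Rplus_assoc x y z)) Rplus_comm Rplus_0_l.
HB.instance Definition _ := Monoid.isComLaw.Build R 1 Rmult
  (fun x y z => esym (Rmult_assoc x y z)) Rmult_comm Rmult_1_l.
HB.instance Definition _ := Monoid.isMulLaw.Build R 0 Rmult Rmult_0_l Rmult_0_r.
HB.instance Definition _ := Monoid.isAddLaw.Build R Rmult Rplus
  Rmult_plus_distr_r Rmult_plus_distr_l.
HB.instance Definition _ := Monoid.isComLaw.Build C (RtoC 0) Cplus
  Cplus_assoc Cplus_comm Cplus_0_l.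
HB.instance Definition _ := Monoid.isComLaw.Build C (RtoC 1) Cmult
  Cmult_assoc Cmult_comm Cmult_1_l.
HB.instance Definition _ := Monoid.isMulLaw.Build C (RtoC 0) Cmult Cmult_0_l Cmult_0_r.
HB.instance Definition _ := Monoid.isAddLaw.Build C Cmult Cplus
  Cmult_plus_distr_r Cmult_plus_distr_l.

Definition indic (b : bool) : R := if b then 1 else 0.

(** * Sums, products and product measures *)

Section BigR.
Variables (I : Type).
Implicit Types (r : seq I) (P : pred I) (F G : I -> R).

Lemma rsum_ge0 r P F : (forall i, P i -> 0 <= F i) ->
  0 <= \big[Rplus/0]_(i <- r | P i) F i.
Proof. by move=> h; elim/big_ind: _ => //; [lra | move=> x y; lra]. Qed.

Lemma rsum_le r P F G : (forall i, P i -> F i <= G i) ->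
  \big[Rplus/0]_(i <- r | P i) F i <= \big[Rplus/0]_(i <- r | P i) G i.
Proof. by move=> h; elim/big_ind2: _ => //; [lra | move=> x y z t; lra]. Qed.

Lemma rsum_abs r P F :
  Rabs (\big[Rplus/0]_(i <- r | P i) F i) <= \big[Rplus/0]_(i <- r | P i) Rabs (F i).
Proof.
elim/big_ind2: _ => //; [by rewrite Rabs_R0; lra | move=> x y z t h1 h2 | by move=> *; lra].
by apply: Rle_trans (Rabs_triang _ _) _; lra.
Qed.

Lemma rsum_opp r P F :
  \big[Rplus/0]_(i <- r | P i) (- F i) = - \big[Rplus/0]_(i <- r | P i) F i.
Proof. by elim/big_ind2: _ => //; [lra | move=> x y z t; lra]. Qed.

Lemma rsum_sub r P F G :
  \big[Rplus/0]_(i <- r | P i) (F i - G i) =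
  \big[Rplus/0]_(i <- r | P i) F i - \big[Rplus/0]_(i <- r | P i) G i.
Proof. by rewrite /Rminus -rsum_opp -big_split. Qed.

Lemma rsum_ind r P F :
  \big[Rplus/0]_(i <- r | P i) F i = \big[Rplus/0]_(i <- r) (indic (P i) * F i).
Proof.
rewrite big_mkcond; apply: eq_bigr => i _; rewrite /indic.
by case: (P i); rewrite ?Rmult_1_l ?Rmult_0_l.
Qed.

Lemma rprod_ge0 r P F : (forall i, P i -> 0 <= F i) ->
  0 <= \big[Rmult/1]_(i <- r | P i) F i.
Proof. by move=> h; elim/big_ind: _ => //; [lra | move=> x y; nra]. Qed.

Lemma rprod_gt0 r P F : (forall i, P i -> 0 < F i) ->
  0 < \big[Rmult/1]_(i <- r | P i) F i.
Proof. by move=> h; elim/big_ind: _ => //; [lra | move=> x y; nra]. Qed.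

Lemma rprod_le r P F G : (forall i, P i -> 0 <= F i <= G i) ->
  0 <= \big[Rmult/1]_(i <- r | P i) F i <= \big[Rmult/1]_(i <- r | P i) G i.
Proof. by move=> h; elim/big_ind2: _ => //; [lra | move=> x y z t; nra]. Qed.

Lemma rprod_le1 r P F : (forall i, P i -> 0 <= F i <= 1) ->
  0 <= \big[Rmult/1]_(i <- r | P i) F i <= 1.
Proof. by move=> h; elim/big_ind: _ => //; [lra | move=> x y; nra]. Qed.

Lemma rprod_exp r P F :
  \big[Rmult/1]_(i <- r | P i) exp (F i) = exp (\big[Rplus/0]_(i <- r | P i) F i).
Proof.
by elim/big_ind2: _ => //; [rewrite exp_0 | move=> x y z t -> ->; rewrite exp_plus].
Qed.

Lemma INR_sum r P (F : I -> nat) :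
  INR (\sum_(i <- r | P i) F i) = \big[Rplus/0]_(i <- r | P i) INR (F i).
Proof. by elim/big_ind2: _ => // x y z t <- <-; rewrite plus_INR. Qed.

Lemma Cmod_prod r P (F : I -> C) :
  Cmod (\big[Cmult/RtoC 1]_(i <- r | P i) F i) = \big[Rmult/1]_(i <- r | P i) Cmod (F i).
Proof.
by elim/big_ind2: _ => //; [rewrite Cmod_1 | move=> x y z t; rewrite Cmod_mult => -> ->].
Qed.

Lemma Cmod_sum r P (F : I -> C) :
  Cmod (\big[Cplus/RtoC 0]_(i <- r | P i) F i) <= \big[Rplus/0]_(i <- r | P i) Cmod (F i).
Proof.
elim/big_ind2: _ => //; [by rewrite Cmod_0; lra | move=> x y z t h1 h2 | by move=> *; lra].
by apply: Rle_trans (Cmod_triangle _ _) _; lra.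
Qed.

Lemma Re_sum r P (F : I -> C) :
  Re (\big[Cplus/RtoC 0]_(i <- r | P i) F i) = \big[Rplus/0]_(i <- r | P i) Re (F i).
Proof. by elim/big_ind2: _ => // x y z t <- <-. Qed.

End BigR.

Section BigFin.
Variable (I : finType).
Implicit Types (P Q : pred I) (F : I -> R).

Lemma rsum_const P (c : R) : \big[Rplus/0]_(i | P i) c = INR #|P| * c.
Proof.
rewrite big_const; elim: #|_| => [|k ih]; first by rewrite /=; lra.
by rewrite S_INR /= ih; lra.
Qed.

Lemma rprod_sub P Q F : (forall i, P i -> 0 <= F i <= 1) -> (forall i, Q i -> P i) ->
  0 <= \big[Rmult/1]_(i | P i) F i <= \big[Rmult/1]_(i | Q i) F i.
Proof.
move=> h QP; rewrite big_mkcond [X in _ <= _ <= X]big_mkcond; apply: rprod_le => i _.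
have := h i; have := QP i; case: (Q i); case: (P i) => // a b; try lra.
- by case: (b isT); lra.
- by have := a isT.
- by case: (b isT); lra.
Qed.

Lemma rsum_sub_le P Q F : (forall i, P i -> 0 <= F i) -> (forall i, Q i -> P i) ->
  \big[Rplus/0]_(i | Q i) F i <= \big[Rplus/0]_(i | P i) F i.
Proof.
move=> h QP; rewrite big_mkcond [X in _ <= X]big_mkcond; apply: rsum_le => i _.
have := h i; have := QP i; case: (Q i); case: (P i) => // a b; try lra.
- by have := a isT.
- by have := b isT; lra.
Qed.

Lemma rsum_card P : \big[Rplus/0]_i indic (P i) = INR #|P|.
Proof.
have := rsum_const P 1; rewrite rsum_ind Rmult_1_r => <-.
by apply: eq_bigr => i _; lra.
Qed.

End BigFin.

Section Expectation.
Variables (I J : finType) (w : I -> J -> R).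
Implicit Types (A B : pred I) (F G : {ffun I -> J} -> R).

Definition wt (a : {ffun I -> J}) : R := \big[Rmult/1]_i w i (a i).
Definition Ex F : R := \big[Rplus/0]_a (wt a * F a).
Definition ExC (F : {ffun I -> J} -> C) : C := \big[Cplus/RtoC 0]_a (RtoC (wt a) * F a)%C.

Definition merge (A : pred I) (a a' : {ffun I -> J}) : {ffun I -> J} :=
  [ffun i => if A i then a i else a' i].
Definition depends_on (A : pred I) (T : Type) (f : {ffun I -> J} -> T) : Prop :=
  forall a a' : {ffun I -> J}, (forall i, A i -> a i = a' i) -> f a = f a'.

Hypothesis w_ge0 : forall i j, 0 <= w i j.
Hypothesis w_sum1 : forall i, \big[Rplus/0]_j w i j = 1.

Lemma wt_ge0 a : 0 <= wt a.
Proof. exact: rprod_ge0. Qed.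

Lemma Ex_prod (f : I -> J -> R) :
  Ex (fun a => \big[Rmult/1]_i f i (a i)) =
  \big[Rmult/1]_i \big[Rplus/0]_j (w i j * f i j).
Proof. by rewrite bigA_distr_bigA; apply: eq_bigr => a _; rewrite /wt -big_split. Qed.

Lemma ExC_prod (f : I -> J -> C) :
  ExC (fun a => \big[Cmult/RtoC 1]_i f i (a i)) =
  \big[Cmult/RtoC 1]_i \big[Cplus/RtoC 0]_j (RtoC (w i j) * f i j)%C.
Proof.
rewrite bigA_distr_bigA; apply: eq_bigr => a _; rewrite big_split; congr (_ * _)%C.
by rewrite /wt; elim/big_ind2: _ => // x y z t <- <-; rewrite RtoC_mult.
Qed.

Lemma wt_sum1 : \big[Rplus/0]_a wt a = 1.
Proof.
rewrite /wt -(bigA_distr_bigA (fun i j => w i j)).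
by rewrite big1 // => i _; rewrite w_sum1.
Qed.

Lemma Ex_ext F G : (forall a, F a = G a) -> Ex F = Ex G.
Proof. by move=> h; apply: eq_bigr => a _; rewrite h. Qed.

Lemma Ex_const c : Ex (fun _ => c) = c.
Proof. by rewrite /Ex -big_distrl /= wt_sum1 Rmult_1_l. Qed.

Lemma Ex_add F G : Ex (fun a => F a + G a) = Ex F + Ex G.
Proof. by rewrite /Ex -big_split; apply: eq_bigr => a _ /=; lra. Qed.

Lemma Ex_scal c F : Ex (fun a => c * F a) = c * Ex F.
Proof. by rewrite /Ex big_distrr; apply: eq_bigr => a _ /=; lra. Qed.

Lemma Ex_sub F G : Ex (fun a => F a - G a) = Ex F - Ex G.
Proof.
by rewrite /Ex -rsum_sub; apply: eq_bigr => a _; lra.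
Qed.

Lemma Ex_sum (K : Type) (r : seq K) (P : pred K) (F : K -> {ffun I -> J} -> R) :
  Ex (fun a => \big[Rplus/0]_(k <- r | P k) F k a) = \big[Rplus/0]_(k <- r | P k) Ex (F k).
Proof.
rewrite /Ex exchange_big; apply: eq_bigr => a _; by rewrite big_distrr.
Qed.

Lemma Ex_le F G : (forall a, F a <= G a) -> Ex F <= Ex G.
Proof. by move=> h; apply: rsum_le => a _; have := wt_ge0 a; have := h a; nra. Qed.

Lemma Ex_ge0 F : (forall a, 0 <= F a) -> 0 <= Ex F.
Proof. by move=> h; apply: rsum_ge0 => a _; have := wt_ge0 a; have := h a; nra. Qed.

Lemma Ex_abs F : Rabs (Ex F) <= Ex (fun a => Rabs (F a)).
Proof.
apply: Rle_trans (rsum_abs _ _ _) _; apply: rsum_le => a _.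
by rewrite Rabs_mult (Rabs_pos_eq (wt a)); [lra | exact: wt_ge0].
Qed.

Lemma merge_dep_l A T (f : {ffun I -> J} -> T) a a' :
  depends_on A f -> f (merge A a a') = f a.
Proof. by move=> h; apply: h => i Ai; rewrite ffunE Ai. Qed.

Lemma merge_dep_r A B T (f : {ffun I -> J} -> T) a a' :
  depends_on B f -> (forall i, B i -> ~~ A i) -> f (merge A a a') = f a'.
Proof. by move=> h AB; apply: h => i /AB/negbTE Ai; rewrite ffunE Ai. Qed.

(* Swapping the coordinates outside [A] between two independent copies preserves the product weight. *)
Lemma Ex_merge A F : Ex F = Ex (fun a => Ex (fun a' => F (merge A a a'))).
Proof.
transitivity (Ex (fun a => Ex (fun a' => F a))).
  by apply: Ex_ext => a; rewrite Ex_const.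
transitivity (\big[Rplus/0]_(u : {ffun I -> J} * {ffun I -> J})
   (wt u.1 * wt u.2 * F u.1)).
  rewrite /Ex -(pair_big xpredT xpredT (fun a a' => wt a * wt a' * F a)) /=.
  by apply: eq_bigr => a _; rewrite big_distrr; apply: eq_bigr => a' _ /=; lra.
pose s (u : {ffun I -> J} * {ffun I -> J}) := (merge A u.1 u.2, merge A u.2 u.1).
have sK : involutive s.
  case=> a a'; rewrite /s /=; congr (_, _); apply/ffunP => i; rewrite !ffunE;
  by case: (A i).
rewrite (reindex_inj (inv_inj sK)) /Ex.
rewrite (eq_bigr (fun u => wt u.1 * wt u.2 * F (merge A u.1 u.2))).
  rewrite -(pair_big xpredT xpredT (fun a a' => wt a * wt a' * F (merge A a a'))) /=.
  by apply: eq_bigr => a _; rewrite big_distrr; apply: eq_bigr => a' _ /=; lra.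
move=> [a a'] _ /=; congr (_ * _); rewrite /wt -!big_split; apply: eq_bigr => i _ /=.
by rewrite !ffunE; case: (A i); lra.
Qed.

Lemma Ex_indep A B F G : depends_on A F -> depends_on B G -> (forall i, B i -> ~~ A i) ->
  Ex (fun a => F a * G a) = Ex F * Ex G.
Proof.
move=> hF hG AB; rewrite (Ex_merge A) Rmult_comm -Ex_scal; apply: Ex_ext => a.
rewrite Rmult_comm -Ex_scal; apply: Ex_ext => a'.
by rewrite (merge_dep_l _ _ hF) (merge_dep_r _ _ hG AB).
Qed.

Lemma depends_mono A B T (f : {ffun I -> J} -> T) :
  (forall i, A i -> B i) -> depends_on A f -> depends_on B f.
Proof. by move=> AB h a a' e; apply: h => i /AB; apply: e. Qed.

Lemma Ex_coord i0 (f : J -> R) : Ex (fun a => f (a i0)) = \big[Rplus/0]_j (w i0 j * f j).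
Proof.
transitivity (Ex (fun a => \big[Rmult/1]_i (if i == i0 then f (a i) else 1))).
  apply: Ex_ext => a; rewrite (bigD1 i0) //= eqxx big1 ?Rmult_1_r // => i /negbTE ->.
  by [].
rewrite (Ex_prod (fun i j => if i == i0 then f j else 1)) (bigD1 i0) //= eqxx.
rewrite [X in _ * X]big1 ?Rmult_1_r // => i /negbTE ->.
by rewrite -[RHS](w_sum1 i); apply: eq_bigr => j _; lra.
Qed.

End Expectation.

Arguments Ex_ext [I J w F G] _.

(** * Discrete Fourier analysis *)

(** The character [e^(2 pi i x)] of the reals modulo 1. *)
Definition ce (x : R) : C := (cos (2 * PI * x), sin (2 * PI * x)).

Lemma ce0 : ce 0 = RtoC 1.
Proof. by rewrite /ce Rmult_0_r cos_0 sin_0. Qed.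

Lemma ceD x y : ce (x + y) = (ce x * ce y)%C.
Proof. by rewrite /ce Rmult_plus_distr_l cos_plus sin_plus /Cmult /=; f_equal; ring. Qed.

Lemma Cmod_ce x : Cmod (ce x) = 1.
Proof.
rewrite /Cmod /= !Rmult_1_r Rplus_comm -[X in sqrt X]/(Rsqr _ + Rsqr _).
by rewrite sin2_cos2 sqrt_1.
Qed.

Lemma ce_nat k : ce (INR k) = RtoC 1.
Proof.
elim: k => [|k ih]; first exact: ce0.
rewrite S_INR ceD ih /ce Rmult_1_r cos_2PI sin_2PI; exact: Cmult_1_l.
Qed.

Lemma ce_opp_nat k : ce (- INR k) = RtoC 1.
Proof.
by rewrite -[LHS]Cmult_1_l -{1}(ce_nat k) -ceD Rplus_opp_r ce0.
Qed.

Lemma ce_conj x : ce (- x) = Cconj (ce x).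
Proof. by rewrite /ce /Cconj /= Ropp_mult_distr_r_reverse cos_neg sin_neg. Qed.

Lemma ce_neq1 x : x <> 0 -> Rabs x < 1 -> ce x <> RtoC 1.
Proof.
move=> x0 x1 [hc _].
have hs : sin (PI * x) = 0.
  apply: Rsqr_0_uniq; move: hc.
  by rewrite (_ : 2 * PI * x = 2 * (PI * x)) ?cos_2a_sin /Rsqr; [move=> ?; lra | lra].
have P := PI_RGT_0.
case: (Rdichotomy _ _ x0) => h.
  have : 0 < sin (PI * - x).
    by apply: sin_gt_0; case: (Rabs_def2 _ _ x1); nra.
  by rewrite Ropp_mult_distr_r_reverse sin_neg hs; lra.
have : 0 < sin (PI * x).
  by apply: sin_gt_0; case: (Rabs_def2 _ _ x1); nra.
by rewrite hs; lra.
Qed.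

Lemma ce_geom (x : R) (M : nat) : ce (INR M * x) = RtoC 1 ->
  \big[Cplus/RtoC 0]_(k < M) ce (INR k * x) =
  if excluded_middle_informative (ce x = RtoC 1) then RtoC (INR M) else RtoC 0.
Proof.
move=> hM; case: excluded_middle_informative => h /=.
  have e k : ce (INR k * x) = RtoC 1.
    elim: k => [|k ih]; first by rewrite Rmult_0_l ce0.
    by rewrite S_INR Rmult_plus_distr_r Rmult_1_l ceD ih h Cmult_1_l.
  rewrite (eq_bigr (fun _ => RtoC 1)) => [|k _]; last exact: e.
  rewrite big_const card_ord /=; elim: M {hM} => [|M ih] //.
  by rewrite iterS ih S_INR -RtoC_plus Rplus_comm.
have key N : ((ce x - RtoC 1) * \big[Cplus/RtoC 0]_(k < N) ce (INR k * x))%C =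
   (ce (INR N * x) - RtoC 1)%C.
  elim: N => [|N ih]; first by rewrite big_ord0 Rmult_0_l ce0; ring.
  rewrite S_INR big_ord_recr /= Cmult_plus_distr_l ih Rmult_plus_distr_r Rmult_1_l ceD.
  by ring.
have := key M; rewrite hM => k0.
have nz : (ce x - RtoC 1)%C <> RtoC 0.
  move=> z; apply: h; have -> : ce x = ((ce x - RtoC 1) + RtoC 1)%C by ring.
  by rewrite z Cplus_0_l.
rewrite -[LHS]Cmult_1_l -(Cinv_l _ nz) -Cmult_assoc k0; ring.
Qed.

(* Frequencies are centred: [freq q j] runs through the multiples of 1/(2q+1) in (-1/2, 1/2). *)
Definition freq (q j : nat) : R := (INR j - INR q) / INR (2 * q).+1.

Lemma INR_gt0 k : (0 < k)%N -> 0 < INR k.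
Proof. by move=> h; apply: lt_0_INR; apply/ltP. Qed.

Lemma INR_leq m n : (m <= n)%N -> INR m <= INR n.
Proof. by move=> h; apply: le_INR; apply/leP. Qed.

Lemma INR_ltn m n : (m < n)%N -> INR m < INR n.
Proof. by move=> h; apply: lt_INR; apply/ltP. Qed.

(** Orthogonality of characters modulo [2q+1]. Both numbers lie below the modulus, so congruence is
    equality; centring the frequencies only factors out one phase. *)
Lemma fourier_ind (q x k : nat) : (x < (2 * q).+1)%N -> (k < (2 * q).+1)%N ->
  indic (x == k) = / INR (2 * q).+1 *
    \big[Rplus/0]_(j < (2 * q).+1) Re (ce (freq q j * (INR x - INR k))).
Proof.
move=> hx hk; set Q := (2 * q).+1.
have Q0 : 0 < INR Q by apply: INR_gt0.
set z := (INR x - INR k) / INR Q.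
have hz : ce (INR Q * z) = RtoC 1.
  rewrite (_ : INR Q * z = INR x + - INR k); last by rewrite /z; field; lra.
  by rewrite ceD ce_nat ce_opp_nat Cmult_1_l.
have e j : ce (freq q j * (INR x - INR k)) = (ce (- INR q * z) * ce (INR j * z))%C.
  by rewrite -ceD; congr ce; rewrite /freq /z -/Q; field; lra.
rewrite -Re_sum; under eq_bigr => j _ do rewrite e.
rewrite -(big_distrr (ce (- INR q * z))) (ce_geom hz).
rewrite -[X in Re X]/(Cmult (ce (- INR q * z)) _).
case: eqP => [xk|xk].
  have z0 : z = 0 by rewrite /z xk; lra.
  rewrite z0 Rmult_0_r ce0; case: excluded_middle_informative => [h|//].
  by rewrite Cmult_1_l -[Re _]/(INR Q) Rinv_l //; lra.
case: excluded_middle_informative => h; last by rewrite Cmult_0_r -[Re _]/0 Rmult_0_r.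
exfalso; move: h; apply: ce_neq1.
  move=> z0; apply: xk; apply: INR_eq.
  have h2 : INR Q * z = INR x - INR k by rewrite /z; field; lra.
  by rewrite z0 in h2; lra.
rewrite /z /Rdiv Rabs_mult (Rabs_pos_eq (/ _)); last by left; apply: Rinv_0_lt_compat.
apply/(Rmult_lt_reg_r (INR Q)) => //; rewrite Rmult_assoc Rinv_l ?Rmult_1_r ?Rmult_1_l; last lra.
have := INR_ltn hx; have := INR_ltn hk; have := pos_INR x; have := pos_INR k.
by rewrite -/Q => *; apply: Rabs_def1; lra.
Qed.

Lemma Cmul_sub1 (x y z : C) : (x * y * z - y * z)%C = (y * (z * (x - RtoC 1)))%C.
Proof. ring. Qed.

Section Phi.
Variables (n d : nat) (w : 'I_n.+1 -> 'I_d -> R).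
Hypothesis w_ge0 : forall i j, 0 <= w i j.
Hypothesis w_sum1 : forall i, \big[Rplus/0]_j w i j = 1.
Implicit Types (G : pred 'I_n.+1) (a : {ffun 'I_n.+1 -> 'I_d}).

(* [XG G] is the part of the sum [\sum_h a h * h] carried by [G], and [phi G] its characteristic function. *)
Definition XG G a : nat := (\sum_(h < n.+1 | G h) a h * h)%N.
Definition cf (h : 'I_n.+1) (y : R) : C :=
  \big[Cplus/RtoC 0]_(j < d) (RtoC (w h j) * ce (INR (j * h) * y))%C.
Definition phi G (y : R) : C := ExC w (fun a => ce (INR (XG G a) * y)).

Lemma XG_dep G : depends_on G (XG G).
Proof. by move=> a a' h; apply: eq_bigr => i Gi; rewrite h. Qed.

Lemma XGU G1 G2 a : (forall h, G1 h -> ~~ G2 h) ->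
  XG (fun h => G1 h || G2 h) a = (XG G1 a + XG G2 a)%N.
Proof.
move=> dj; rewrite /XG big_mkcond [X in (X + _)%N]big_mkcond [X in (_ + X)%N]big_mkcond.
rewrite -big_split; apply: eq_bigr => h _ /=.
by have := dj h; case: (G1 h); case: (G2 h) => //=; rewrite ?addn0 //; move/(_ isT).
Qed.

Lemma phi_prod G y : phi G y = \big[Cmult/RtoC 1]_(h | G h) cf h y.
Proof.
rewrite /phi; transitivity (ExC w (fun a => \big[Cmult/RtoC 1]_h
   (if G h then ce (INR (a h * h) * y) else RtoC 1))).
  apply: eq_bigr => a _; congr (_ * _)%C; rewrite -big_mkcond /XG.
  by elim/big_ind2: _ => [||//]; [rewrite Rmult_0_l ce0 |
    move=> x1 x2 y1 y2 <- <-; rewrite plus_INR Rmult_plus_distr_r ceD].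
rewrite (ExC_prod w (fun h j => if G h then ce (INR (j * h) * y) else RtoC 1)).
rewrite [RHS]big_mkcond; apply: eq_bigr => h _; case: (G h) => //.
rewrite (eq_bigr (fun j => RtoC (w h j))) => [|j _]; last by rewrite Cmult_1_r.
rewrite -[RHS]/(RtoC 1) -(w_sum1 h).
by elim/big_ind2: _ => // x y1 z t -> ->; rewrite RtoC_plus.
Qed.

Lemma Cmod_phi G y : Cmod (phi G y) = \big[Rmult/1]_(h | G h) Cmod (cf h y).
Proof. by rewrite phi_prod Cmod_prod. Qed.

Lemma Cmod_cf_le1 h y : Cmod (cf h y) <= 1.
Proof.
apply: Rle_trans (Cmod_sum _ _ _) _; rewrite -(w_sum1 h); apply: rsum_le => j _.
by rewrite Cmod_mult Cmod_ce Cmod_R Rabs_pos_eq //; lra.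
Qed.

(** Only the digits 0 and 1 are used. With weights [a] and [b], [|a + b e(t)|^2 = (a+b)^2 - 4ab s^2]
    where [s = sin(pi t)], and since [a + b <= 1] this is at most [(a + b - 2ab s^2)^2]. The
    remaining digits contribute at most their total mass. *)
Lemma Cmod_cf_bound h y (j0 j1 : 'I_d) : val j0 = 0%N -> val j1 = 1%N ->
  Cmod (cf h y) <= 1 - 2 * (w h j0 * w h j1) * sin (PI * (INR h * y)) ^ 2.
Proof.
move=> e0 e1; have n01 : j1 != j0 by rewrite -val_eqE /= e0 e1.
have s1 := w_sum1 h; rewrite (bigD1 j0) //= (bigD1 j1) //= in s1.
rewrite /cf (bigD1 j0) //= (bigD1 j1) //= e0 e1 mul0n mul1n Rmult_0_l ce0 Cmult_1_r.
set r := \big[Cplus/_]_(i | _) _.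
have hr : Cmod r <= 1 - (w h j0 + w h j1).
  apply: Rle_trans (Cmod_sum _ _ _) _.
  rewrite (eq_bigr (fun i => w h i)) => [|i _]; first lra.
  by rewrite Cmod_mult Cmod_ce Cmod_R Rabs_pos_eq //; lra.
rewrite Cplus_assoc; apply: Rle_trans (Cmod_triangle _ _) _.
set t := INR h * y; set s := sin _.
suff : Cmod (RtoC (w h j0) + RtoC (w h j1) * ce t)%C <=
   (w h j0 + w h j1) - 2 * (w h j0 * w h j1) * s ^ 2 by lra.
have a0 := w_ge0 h j0; have b0 := w_ge0 h j1.
have s_le : s ^ 2 <= 1 by have := SIN_bound (PI * t); rewrite -/s; nra.
have s_ge := pow2_ge_0 s.
have : w h j0 + w h j1 <= 1.
  rewrite -[X in _ <= X]s1 -Rplus_assoc -[X in X <= _]Rplus_0_r.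
  by apply: Rplus_le_compat_l; exact: rsum_ge0.
move: (w h j0) (w h j1) a0 b0 => {hr r s1} a b a0 b0 ab.
rewrite /Cmod; apply: Rle_trans (_ : sqrt ((a + b - 2 * (a * b) * s ^ 2) ^ 2) <= _).
  apply: sqrt_le_1_alt; rewrite /= (_ : 2 * PI * t = 2 * (PI * t)); last ring.
  rewrite cos_2a_sin -/s.
  have := sin2_cos2 (2 * (PI * t)); rewrite /Rsqr cos_2a_sin -/s => e2.
  have S2 : sin (2 * (PI * t)) ^ 2 = 1 - (1 - 2 * s * s) ^ 2 by rewrite /= !Rmult_1_r; lra.
  have : (b * sin (2 * (PI * t))) ^ 2 = b ^ 2 * (1 - (1 - 2 * s * s) ^ 2).
    by rewrite Rpow_mult_distr S2.
  have ab0 : 0 <= a * b by nra.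
  have : (a * b) * s ^ 2 * (1 - (a + b)) >= 0 by apply: Rle_ge; apply: Rmult_le_pos; nra.
  have : 0 <= (a * b * s ^ 2) ^ 2 by apply: pow2_ge_0.
  by rewrite /= => *; nra.
rewrite -Rsqr_pow2 sqrt_Rsqr; first lra.
have : a * b * s ^ 2 <= a * b * 1 by apply: Rmult_le_compat_l; nra.
by nra.
Qed.

Lemma Cmod_phi_sub G1 G2 y : (forall h, G2 h -> G1 h) -> Cmod (phi G1 y) <= Cmod (phi G2 y).
Proof.
move=> h; rewrite !Cmod_phi; apply: (proj2 (rprod_sub _ h)) => i _.
by split; [exact: Cmod_ge_0 | exact: Cmod_cf_le1].
Qed.

Lemma Cmod_phi_le1 G y : Cmod (phi G y) <= 1.
Proof.
rewrite Cmod_phi; apply: (proj2 (rprod_le1 _ _)) => i _.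
by split; [exact: Cmod_ge_0 | exact: Cmod_cf_le1].
Qed.

Lemma Cmod_phiU G1 G2 y : (forall h, G1 h -> ~~ G2 h) ->
  Cmod (phi (fun h => G1 h || G2 h) y) = Cmod (phi G1 y) * Cmod (phi G2 y).
Proof.
move=> dj; rewrite !Cmod_phi big_mkcond [X in X * _]big_mkcond [X in _ * X]big_mkcond.
rewrite -big_split; apply: eq_bigr => h _ /=.
by have := dj h; case: (G1 h); case: (G2 h) => //=; rewrite ?Rmult_1_r ?Rmult_1_l //; move/(_ isT).
Qed.

Definition avg (q : nat) (f : R -> R) : R :=
  / INR (2 * q).+1 * \big[Rplus/0]_(j < (2 * q).+1) f (freq q j).

Lemma ExC_mull (z : C) F : ExC w (fun a => z * F a)%C = (z * ExC w F)%C.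
Proof.
rewrite /ExC big_distrr; apply: eq_bigr => a _.
have H (A B : C) : (A * (z * B) = z * (A * B))%C by ring.
exact: H.
Qed.

Lemma Re_ExC_gen F : Re (ExC w F) = Ex w (fun a => Re (F a)).
Proof.
rewrite /ExC Re_sum; apply: eq_bigr => a _.
have H r (z : C) : Re (RtoC r * z)%C = r * Re z by rewrite /Re /=; ring.
exact: H.
Qed.

(** Fourier inversion; the modulus is so large that no sum wraps around. The offset [u] stands for
    the part of the sum carried by coordinates that are already fixed, and it only turns the
    phase. *)
Lemma prob_fourier G (q u k : nat) : (k < (2 * q).+1)%N ->
  (forall a, XG G a + u < (2 * q).+1)%N ->
  Ex w (fun a => indic (XG G a + u == k)%N) =
  avg q (fun y => Re (ce (y * (INR u - INR k)) * phi G y)%C).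
Proof.
move=> hk hX; rewrite /avg.
transitivity (Ex w (fun a => / INR (2 * q).+1 * \big[Rplus/0]_(j < (2 * q).+1)
    Re (ce (freq q j * (INR u - INR k)) * ce (INR (XG G a) * freq q j))%C)).
  apply: Ex_ext => a; rewrite (fourier_ind (hX a) hk); congr (_ * _).
  apply: eq_bigr => j _; rewrite -ceD plus_INR; congr (Re (ce _)); ring.
rewrite Ex_scal Ex_sum; congr (_ * _); apply: eq_bigr => j _.
by rewrite /phi -ExC_mull Re_ExC_gen.
Qed.

Lemma avg_le q f g : (forall j, (j < (2 * q).+1)%N -> f (freq q j) <= g (freq q j)) ->
  avg q f <= avg q g.
Proof.
move=> h; apply: Rmult_le_compat_l; first by left; apply: Rinv_0_lt_compat; apply: INR_gt0.
by apply: rsum_le => j _; apply: h.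
Qed.

Lemma avg_add q f g : avg q (fun y => f y + g y) = avg q f + avg q g.
Proof. by rewrite /avg big_split Rmult_plus_distr_l. Qed.

Lemma avg_scal q c f : avg q (fun y => c * f y) = c * avg q f.
Proof.
rewrite /avg -big_distrr -[X in _ * X = _]/(Rmult c _).
by rewrite -!Rmult_assoc (Rmult_comm c).
Qed.

Lemma avg_sub q f g : avg q (fun y => f y - g y) = avg q f - avg q g.
Proof. by rewrite /avg rsum_sub Rmult_minus_distr_l. Qed.

Lemma avg_abs q f : Rabs (avg q f) <= avg q (fun y => Rabs (f y)).
Proof.
have h : 0 < / INR (2 * q).+1 by apply: Rinv_0_lt_compat; apply: INR_gt0.
rewrite /avg Rabs_mult Rabs_pos_eq; last lra.
by apply: Rmult_le_compat_l; [lra | exact: rsum_abs].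
Qed.

Lemma prob_le_avg G (q u k : nat) : (k < (2 * q).+1)%N ->
  (forall a, XG G a + u < (2 * q).+1)%N ->
  Ex w (fun a => indic (XG G a + u == k)%N) <= avg q (fun y => Cmod (phi G y)).
Proof.
move=> hk hX; rewrite (prob_fourier hk hX); apply: avg_le => j _.
apply: Rle_trans (Rle_abs _) _; apply: Rle_trans (re_le_Cmod _) _.
by rewrite Cmod_mult Cmod_ce; lra.
Qed.

Lemma ce_dist x : Cmod (ce x - 1)%C <= Rmin 2 (2 * PI * Rabs x).
Proof.
have e : Cmod (ce x - 1)%C = 2 * Rabs (sin (PI * x)).
  rewrite /Cmod /= (_ : 2 * PI * x = 2 * (PI * x)); last ring.
  set t := PI * x; have := sin2_cos2 (2 * t); rewrite /Rsqr cos_2a_sin => h.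
  rewrite -[RHS]Rabs_pos_eq; last by have := Rabs_pos (sin t); lra.
  rewrite -sqrt_Rsqr_abs; congr sqrt; rewrite /Rsqr.
  have : Rabs (sin t) * Rabs (sin t) = sin t * sin t.
    by rewrite -Rabs_mult Rabs_pos_eq //; nra.
  by move=> *; nra.
have P := PI_RGT_0.
rewrite e; apply: Rmin_glb.
  have := SIN_bound (PI * x) => hb; have : Rabs (sin (PI * x)) <= 1 by apply: Rabs_le.
  by lra.
suff : Rabs (sin (PI * x)) <= PI * Rabs x by lra.
rewrite -{2}(Rabs_pos_eq PI); last lra.
rewrite -Rabs_mult; move: (PI * x) => t {e}.
have pos u : 0 <= u -> Rabs (sin u) <= u.
  move=> u0; have h1 : sin u <= u by case: u0 => [/sin_lt_x|<-]; rewrite ?sin_0; lra.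
  apply: Rabs_le; split => //.
  case: (Rle_lt_dec u PI) => hu; first by have := sin_ge_0 u u0 hu; lra.
  by have := SIN_bound u; have := PI2_1; lra.
case: (Rle_lt_dec 0 t) => ht; first by rewrite (Rabs_pos_eq t) //; apply: pos.
by rewrite (Rabs_left t) // -Rabs_Ropp -sin_neg; apply: pos; lra.
Qed.

(** Moving the offset by [t] multiplies the transform by [e(ty)], so frequencies with [t |y|] small
    contribute little to the difference. *)
Lemma prob_shift G (q u t k : nat) : (k < (2 * q).+1)%N ->
  (forall a, XG G a + (t + u) < (2 * q).+1)%N ->
  Rabs (Ex w (fun a => indic (XG G a + (t + u) == k)%N) -
        Ex w (fun a => indic (XG G a + u == k)%N)) <=
  avg q (fun y => Cmod (phi G y) * Rmin 2 (2 * PI * Rabs (INR t * y))).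
Proof.
move=> hk hX.
have hX' a : (XG G a + u < (2 * q).+1)%N.
  by apply: leq_ltn_trans (hX a); rewrite leq_add2l leq_addl.
rewrite (prob_fourier hk hX) (prob_fourier hk hX') -avg_sub.
apply: Rle_trans (avg_abs _ _) _; apply: avg_le => j _; set y := freq q j.
rewrite -[_ - _]/(Re (_ - _)%C); apply: Rle_trans (re_le_Cmod _) _.
rewrite plus_INR (_ : y * (INR t + INR u - INR k) = INR t * y + y * (INR u - INR k)); last ring.
rewrite ceD (_ : _ - _ = (ce (y * (INR u - INR k)) * (phi G y * (ce (INR t * y) - 1))))%C.
  rewrite !Cmod_mult Cmod_ce Rmult_1_l; apply: Rmult_le_compat_l; first exact: Cmod_ge_0.
  exact: ce_dist.
exact: Cmul_sub1.
Qed.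

(** The right side is the collision probability of two independent copies, hence at most the largest
    point mass. This is how a point mass bound for chains becomes a mean square bound on their
    characteristic function. *)
Lemma parseval G q : (forall a, XG G a < (2 * q).+1)%N ->
  avg q (fun y => Cmod (phi G y) ^ 2) =
  Ex w (fun a => Ex w (fun a' => indic (XG G a' == XG G a))).
Proof.
move=> hX; rewrite /avg.
transitivity (Ex w (fun a => Ex w (fun a' =>
  / INR (2 * q).+1 * \big[Rplus/0]_(j < (2 * q).+1)
    Re (ce (freq q j * (INR (XG G a') - INR (XG G a))))))); last first.
  by do 2!apply: Ex_ext => ?; rewrite -fourier_ind.
under [RHS]eq_bigr => a _ do rewrite Ex_scal Ex_sum.
rewrite -/(Ex _ _) Ex_scal Ex_sum; congr (_ * _); apply: eq_bigr => j _.
set y := freq q j.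
transitivity (Re (phi G y * Cconj (phi G y))%C); first by rewrite -Cmod2_conj.
have conjE : Cconj (phi G y) = ExC w (fun a => ce (- (INR (XG G a) * y))).
  rewrite /phi /ExC; elim/big_ind2: _ => [|x1 x2 y1 y2 <- <-|a _].
  - by rewrite /Cconj /= Ropp_0.
  - by rewrite Cplus_conj.
  - by rewrite ce_conj Cmult_conj; congr (_ * _)%C; rewrite /Cconj /= Ropp_0.
rewrite conjE -ExC_mull Re_ExC_gen; apply: Ex_ext => a.
rewrite Cmult_comm -ExC_mull Re_ExC_gen; apply: Ex_ext => a'.
by rewrite -ceD; congr (Re (ce _)); ring.
Qed.

End Phi.

(** * Chains [P^a Q^b] and minor arcs *)

Lemma sin_sq_lower x eta : 0 <= eta -> (forall k : Z, eta <= Rabs (x - IZR k)) ->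
  eta ^ 2 <= sin (PI * x) ^ 2.
Proof.
move=> e0 hk; have P3 := PI2_3_2; have P4 := PI_4.
have sq k : sin (PI * (x - IZR k)) ^ 2 = sin (PI * x) ^ 2.
  rewrite Rmult_minus_distr_l sin_minus.
  have s0 : sin (PI * IZR k) = 0 by apply: sin_eq_0_1; exists k; ring.
  have := sin2_cos2 (PI * IZR k); rewrite /Rsqr s0 => c1.
  have c2 : cos (PI * IZR k) ^ 2 = 1 by rewrite /=; lra.
  by rewrite Rmult_0_r Rminus_0_r Rpow_mult_distr c2 Rmult_1_r.
have [k hx] : exists k : Z, Rabs (x - IZR k) <= / 2.
  exists (up (x - / 2)); have [] := archimed (x - / 2) => *; apply: Rabs_le; lra.
have := hk k; rewrite -(sq k); move: (x - IZR k) hx => f hf he.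
have key t : 0 <= t <= / 2 -> t <= sin (PI * t).
  move=> ht; have a0 : 0 <= PI * t by nra.
  have a2 : PI * t <= 2 by nra.
  (* Two terms of the sine series suffice: for [a = PI * t <= 2], [a - a^3/6 >= a/3 >= t]. *)
  have [] := pre_sin_bound (PI * t) 0 a0 ltac:(lra).
  rewrite /sin_approx /sin_term /= => h _; apply: Rle_trans h.
  have h3 : 3 * t <= PI * t by nra.
  move: (PI * t) a0 a2 h3 => a a0 a2 h3.
  have : 0 <= a * ((2 - a) * (2 + a)) by do 2?[apply: Rmult_le_pos]; lra.
  by move=> *; lra.
have {key} : Rabs f <= Rabs (sin (PI * f)).
  case: (Rle_lt_dec 0 f) => h.
    rewrite Rabs_pos_eq // in hf *.
    by apply: Rle_trans (Rle_abs _); apply: key; lra.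
  rewrite Rabs_left // in hf *.
  apply: Rle_trans (key _ _) _; first lra.
  by rewrite Ropp_mult_distr_r_reverse sin_neg -Rabs_Ropp; exact: Rle_abs.
rewrite -(pow2_abs (sin _)) => h; apply: pow_incr; lra.
Qed.

Lemma frac_dist (z N : nat) (k : Z) : (0 < N)%N -> ~~ (N %| z)%N ->
  / INR N <= Rabs (INR z / INR N - IZR k).
Proof.
move=> N0 nd; have N1 := INR_gt0 N0.
have e : INR z / INR N - IZR k = IZR (Z.of_nat z - k * Z.of_nat N) * / INR N.
  by rewrite minus_IZR mult_IZR -!INR_IZR_INZ; field; lra.
rewrite e Rabs_mult (Rabs_pos_eq (/ _)); last by left; apply: Rinv_0_lt_compat.
rewrite -{1}[/ _]Rmult_1_l; apply: Rmult_le_compat_r.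
  by left; apply: Rinv_0_lt_compat.
rewrite -abs_IZR; apply: IZR_le.
suff : (Z.of_nat z - k * Z.of_nat N)%Z <> 0%Z by lia.
move=> h; move/negP: nd; apply; apply/dvdnP; exists (Z.to_nat k).
have N2 : (0 < N)%coq_nat by apply/ltP.
have k0 : (0 <= k)%Z by nia.
by apply: Nat2Z.inj; rewrite -multE Nat2Z.inj_mul Z2Nat.id //; lia.
Qed.

(* [P] need not be prime: as the bases are pairwise coprime, the exponent of [P] is read off at its least prime factor. *)
Definition vp (P h : nat) : nat := (logn (pdiv P) h %/ logn (pdiv P) P)%N.

Section Valuation.
Variable P : nat.
Hypothesis P1 : (1 < P)%N.

Lemma logn_pdiv_gt0 : (0 < logn (pdiv P) P)%N.
Proof. by rewrite logn_gt0 mem_primes pdiv_prime // ltnW //= pdiv_dvd. Qed.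

Lemma vp1 : vp P 1 = 0%N.
Proof. by rewrite /vp logn1 div0n. Qed.

Lemma vp_mul h : (0 < h)%N -> vp P (P * h) = (vp P h).+1.
Proof.
move=> h0; rewrite /vp lognM ?(ltnW P1) //.
by rewrite divnDl // divnn logn_pdiv_gt0.
Qed.

Lemma vp_coprime Q h : coprime P Q -> (0 < Q)%N -> (0 < h)%N -> vp P (Q * h) = vp P h.
Proof.
move=> cPQ Q0 h0; rewrite /vp lognM // (_ : logn (pdiv P) Q = 0%N) //.
apply/eqP; rewrite lognE pdiv_prime // Q0 /=; case: ifP => // dQ.
have : (pdiv P %| gcdn P Q)%N by rewrite dvdn_gcd pdiv_dvd.
rewrite (eqP cPQ) dvdn1 => /eqP h1.
by have := pdiv_prime P1; rewrite h1.
Qed.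

Lemma vp_expn a h : (0 < h)%N -> vp P (P ^ a * h) = (a + vp P h)%N.
Proof.
move=> h0; elim: a => [|a ih]; first by rewrite mul1n.
by rewrite expnS -mulnA vp_mul ?ih // muln_gt0 expn_gt0 (ltnW P1).
Qed.

Lemma vp_coprime_expn Q b h : coprime P Q -> (0 < Q)%N -> (0 < h)%N ->
  vp P (Q ^ b * h) = vp P h.
Proof. by move=> c Q0 h0; apply: vp_coprime; rewrite ?coprimeXr // expn_gt0 Q0. Qed.

End Valuation.

Section PhiBound.
Variables (n d : nat) (w : 'I_n.+1 -> 'I_d -> R).
Hypothesis w_ge0 : forall i j, 0 <= w i j.
Hypothesis w_sum1 : forall i, \big[Rplus/0]_j w i j = 1.
Variables (j0 j1 : 'I_d).
Hypotheses (hj0 : val j0 = 0%N) (hj1 : val j1 = 1%N).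
Variable dl : R.
Implicit Types (G : pred 'I_n.+1).

Lemma Cmod_phi_exp G (g : 'I_n.+1 -> R) y :
  (forall h, G h -> dl <= w h j0 * w h j1) -> 0 <= dl ->
  (forall h : 'I_n.+1, G h -> g h <= sin (PI * (INR h * y)) ^ 2) ->
  Cmod (phi w G y) <= exp (- (2 * dl * \big[Rplus/0]_(h | G h) g h)).
Proof.
move=> hw dl0 hg; rewrite Cmod_phi // big_distrr -rsum_opp -rprod_exp /=.
apply: (proj2 (rprod_le _ _)) => h Gh; split; first exact: Cmod_ge_0.
apply: Rle_trans (Cmod_cf_bound w_ge0 w_sum1 h y hj0 hj1) _.
set s := sin _; apply: Rle_trans (exp_ineq1_le _).
suff : dl * g h <= w h j0 * w h j1 * s ^ 2 by lra.
have s0 := pow2_ge_0 s; have := hg h Gh; have := hw h Gh; rewrite -/s => *; nra.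
Qed.

Lemma Cmod_phi_card G (c : R) y :
  (forall h, G h -> dl <= w h j0 * w h j1) -> 0 <= dl ->
  (forall h : 'I_n.+1, G h -> c <= sin (PI * (INR h * y)) ^ 2) ->
  Cmod (phi w G y) <= exp (- (2 * dl * (INR #|G| * c))).
Proof. by move=> hw dl0 hc; rewrite -(rsum_const G); apply: Cmod_phi_exp. Qed.

End PhiBound.

Section Chain.
Variables (n d : nat) (w : 'I_n.+1 -> 'I_d -> R).
Hypothesis w_ge0 : forall i j, 0 <= w i j.
Hypothesis w_sum1 : forall i, \big[Rplus/0]_j w i j = 1.
Variables (j0 j1 : 'I_d).
Hypotheses (hj0 : val j0 = 0%N) (hj1 : val j1 = 1%N).
Variables (dl : R) (P Q A B c : nat).
Hypotheses (P1 : (1 < P)%N) (Q1 : (1 < Q)%N) (cPQ : coprime P Q) (dl0 : 0 <= dl).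
Hypothesis c6 : (c < 6)%N.

Definition pq_pow (h : nat) : bool := (h == P ^ vp P h * Q ^ vp Q h)%N.
(* Modulo 6, each parity class splits into three, so that it contains two disjoint chains and a disjoint [wset]. *)
Definition cls (h : nat) : nat := ((vp P h + vp Q h) %% 6)%N.

Lemma vp_pq a b : vp P (P ^ a * Q ^ b) = a.
Proof.
have Q0 := ltnW Q1.
rewrite vp_expn ?expn_gt0 ?Q0 // -[(Q ^ b)%N]muln1 vp_coprime_expn // vp1 // addn0.
by [].
Qed.

Lemma vq_pq a b : vp Q (P ^ a * Q ^ b) = b.
Proof.
have P0 := ltnW P1.
rewrite vp_coprime_expn // ?expn_gt0 ?(ltnW Q1) // 1?coprime_sym //.
by rewrite -[(Q ^ b)%N]muln1 vp_expn // vp1 // addn0.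
Qed.

Lemma pq_pow_pq a b : pq_pow (P ^ a * Q ^ b).
Proof. by rewrite /pq_pow vp_pq vq_pq. Qed.

Lemma cls_pq a b : cls (P ^ a * Q ^ b) = ((a + b) %% 6)%N.
Proof. by rewrite /cls vp_pq vq_pq. Qed.

Definition chain : pred 'I_n.+1 :=
  fun h => [&& pq_pow h, vp P h < A, vp Q h < 6 * B & cls h == c]%N.
Definition below (a : nat) : pred 'I_n.+1 := fun h => chain h && (vp P h < a)%N.
Definition level (a : nat) : pred 'I_n.+1 := fun h => chain h && (vp P h == a)%N.

Hypothesis hw : forall h, chain h -> dl <= w h j0 * w h j1.
Hypothesis hn : (P ^ A * Q ^ (6 * B) <= n)%N.

Lemma level_card a : (a < A)%N -> (B <= #|level a|)%N.
Proof.
(* Membership in class [c] forces [b = c - a] modulo 6, written [c + 5a] to stay in the natural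
   numbers. *)
move=> aA; pose b (i : nat) := (6 * i + (c + 5 * a) %% 6)%N.
have b6 (i : 'I_B) : (b i < 6 * B)%N.
  apply: leq_trans (_ : 6 * i.+1 <= _)%N; last by rewrite leq_mul2l ltn_ord.
  by rewrite mulnSr ltn_add2l ltn_mod.
have lt (i : 'I_B) : (P ^ a * Q ^ b i < n.+1)%N.
  apply: leq_trans hn; apply: leq_mul; first by rewrite leq_exp2l // ltnW.
  by rewrite leq_exp2l // ltnW.
pose f (i : 'I_B) : 'I_n.+1 := Ordinal (lt i).
have fi : injective f.
  move=> i i' /(congr1 (fun h : 'I_n.+1 => vp Q h)) /=; rewrite !vq_pq /b => /eqP.
  by rewrite eqn_add2r eqn_mul2l /= => /eqP/val_inj.
rewrite -[B]card_ord -(card_codom fi); apply: subset_leq_card.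
apply/subsetP => h /codomP [i ->]; rewrite unfold_in /level /chain /= pq_pow_pq vp_pq vq_pq cls_pq.
rewrite aA b6 eqxx /= andbT /b addnCA mulnC modnMDl modnDmr addnCA -mulSn mulnC addnC.
by rewrite modnMDl modn_small.
Qed.

(** Every element of the level is [P^a] times a power of [Q], so unless [P^a] divides [u] the event
    is empty. Otherwise a Fourier sum over the [P] frequencies [k / P^(a+1)] detects it: [k = 0]
    gives 1, and for the others [h k / P^(a+1) = Q^b k / P] is at distance at least [1/P] from the
    integers, since [Q] is coprime to [P]. *)
Lemma level_prob a u : (a < A)%N ->
  Ex w (fun x => indic (P ^ a.+1 %| XG (level a) x + u)%N) <=
  / INR P * (1 + INR P * exp (- (2 * dl * (INR B * (/ INR P) ^ 2)))).
Proof.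
move=> aA; have P0 : 0 < INR P by apply: INR_gt0; apply: ltnW.
have Pi : 0 < / INR P by apply: Rinv_0_lt_compat.
set th := exp _; have th0 : 0 < th by apply: exp_pos.
have Xdiv x : (P ^ a %| XG (level a) x)%N.
  apply: dvdn_sum => h /andP [/andP [/eqP eh _] /eqP va].
  by rewrite dvdn_mull // eh va dvdn_mulr.
case: (boolP (P ^ a %| u)%N) => hu; last first.
  rewrite (Ex_ext (G := fun _ => 0)) => [|x].
    by rewrite Ex_const //; apply: Rmult_le_pos; nra.
  rewrite /indic; case: ifP => // hd; case/negP: hu.
  by rewrite -(dvdn_addr _ (Xdiv d x)); apply: dvdn_trans hd; rewrite expnS dvdn_mull.
pose y (k : nat) := INR k / INR (P ^ a.+1).
have PA0 : 0 < INR (P ^ a.+1) by apply: INR_gt0; rewrite expn_gt0 ltnW.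
have repr x : indic (P ^ a.+1 %| XG (level a) x + u)%N <= / INR P *
    \big[Rplus/0]_(k < P) Re (ce (INR u * y k) * ce (INR (XG (level a) x) * y k))%C.
  set z := (_ + u)%N; have hz : (P ^ a %| z)%N by rewrite dvdn_add.
  have e k : (ce (INR u * y k) * ce (INR (XG (level a) x) * y k))%C =
     ce (INR k * (INR z / INR (P ^ a.+1))).
    by rewrite -ceD /z plus_INR; congr ce; rewrite /y; field; lra.
  rewrite -Re_sum; under eq_bigr => k _ do rewrite e.
  have h1 : ce (INR P * (INR z / INR (P ^ a.+1))) = RtoC 1.
    case/dvdnP: hz => t ->; rewrite expnS !mult_INR.
    have Pa : 0 < INR (P ^ a) by apply: INR_gt0; rewrite expn_gt0 ltnW.
    rewrite (_ : _ * _ = INR t) ?ce_nat //; field; lra.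
  rewrite (ce_geom h1) /indic; case: ifP => [/dvdnP [t et]|_].
    case: excluded_middle_informative => [h|h].
      by rewrite -[Re _]/(INR P) Rinv_l; lra.
    case: h; rewrite et mult_INR (_ : _ / _ = INR t) ?ce_nat //; field; lra.
  case: excluded_middle_informative => [h|h].
    by rewrite -[Re _]/(INR P) Rinv_l; lra.
  by rewrite -[Re _]/0; lra.
apply: Rle_trans (Ex_le w_ge0 (@repr d)) _; rewrite Ex_scal Ex_sum.
apply: Rmult_le_compat_l; first lra.
have bnd (k : 'I_P) : Ex w (fun x => Re (ce (INR u * y k) * ce (INR (XG (level a) x) * y k))%C)
   <= Cmod (phi w (level a) (y k)).
  rewrite -Re_ExC_gen ExC_mull; apply: Rle_trans (Rle_abs _) _.
  by apply: Rle_trans (re_le_Cmod _) _; rewrite Cmod_mult Cmod_ce Rmult_1_l; apply: Rle_refl.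
apply: Rle_trans (rsum_le _ (fun k _ => bnd k)) _.
rewrite (bigD1 (Ordinal (ltnW P1))) //=; apply: Rplus_le_compat.
  exact: Cmod_phi_le1.
apply: Rle_trans (_ : \big[Rplus/0]_(k < P) th <= _); last first.
  by rewrite rsum_const card_ord; apply: Rle_refl.
apply: Rle_trans (rsum_sub_le (P := xpredT) _ _); [|by move=> *; lra|by []].
apply: rsum_le => k k0.
have -> : th = exp (- (2 * dl * (INR B * (/ INR P) ^ 2))) by [].
apply: Rle_trans (Cmod_phi_card w_ge0 w_sum1 hj0 hj1 (dl := dl) (c := (/ INR P) ^ 2) _ dl0 _) _.
- by move=> h /andP [? _]; apply: hw.
- move=> h /andP [/andP [/eqP eh _] /eqP va]; apply: sin_sq_lower; first lra.
  move=> z; rewrite (_ : INR h * y k = INR (Q ^ vp Q h * k) / INR P).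
    apply: frac_dist; first exact: ltnW.
    have k1 : (0 < k)%N by move: k0; rewrite -val_eqE /= -lt0n.
    rewrite Gauss_dvdr ?coprimeXr //; apply/negP => /(dvdn_leq k1).
    by rewrite leqNgt ltn_ord.
  rewrite {1}eh va /y !mult_INR expnS mult_INR.
  have Pa : 0 < INR (P ^ a) by apply: INR_gt0; rewrite expn_gt0 ltnW.
  by field; lra.
have : INR B <= INR #|level a| by apply: INR_leq; apply: level_card.
have q0 : 0 <= (/ INR P) ^ 2 by apply: pow2_ge_0.
move=> hB; suff h : 2 * dl * (INR B * (/ INR P) ^ 2) <= 2 * dl * (INR #|level a| * (/ INR P) ^ 2).
  by case: (Rle_lt_or_eq_dec _ _ h) => [h'|->]; [left; apply: exp_increasing; lra | right].
by apply: Rmult_le_compat_l; [lra | apply: Rmult_le_compat_r].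
Qed.

(** Levels from [a] on are divisible by [P^a], so divisibility by [P^a] is decided by the levels
    below. Once these are fixed, the next level must hit one residue of the next [P]-adic digit, and
    [level_prob] bounds this uniformly in what was fixed: the factors multiply. *)
Lemma below_prob a u : (a <= A)%N ->
  Ex w (fun x => indic (P ^ a %| XG (below a) x + u)%N) <=
  (/ INR P * (1 + INR P * exp (- (2 * dl * (INR B * (/ INR P) ^ 2))))) ^ a.
Proof.
set s := _ * _; have P0 : 0 < INR P by apply: INR_gt0; apply: ltnW.
have s0 : 0 <= s.
  have Pi : 0 < / INR P by apply: Rinv_0_lt_compat.
  have := exp_pos (- (2 * dl * (INR B * (/ INR P) ^ 2))) => e0.
  by apply: Rmult_le_pos; nra.
elim: a => [|a ih] aA.
  rewrite (Ex_ext (G := fun _ => 1)) ?Ex_const //=; first lra.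
  by move=> x; rewrite expn0 dvd1n.
have dj h : below a h -> ~~ level a h.
  by case/andP => _ hl; rewrite /level negb_and (ltn_eqF hl) orbT.
have XE x : XG (below a.+1) x = (XG (below a) x + XG (level a) x)%N.
  rewrite -XGU //; apply: eq_bigl => h; rewrite /below /level ltnS leq_eqVlt orbC.
  by rewrite andb_orr.
rewrite (Ex_ext (G := fun x => indic (P ^ a.+1 %| XG (below a) x + XG (level a) x + u)%N));
  last by move=> x; rewrite XE.
rewrite (Ex_merge w_sum1 (below a)).
have Xdiv x : (P ^ a %| XG (level a) x)%N.
  apply: dvdn_sum => h /andP [/andP [/eqP eh _] /eqP va].
  by rewrite dvdn_mull // eh va dvdn_mulr.
apply: Rle_trans (_ : Ex w (fun x => s * indic (P ^ a %| XG (below a) x + u)%N) <= _); last first.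
  by rewrite Ex_scal /=; apply: Rmult_le_compat_l => //; apply: ih; apply: ltnW.
apply: Ex_le => // x.
rewrite (Ex_ext (G := fun x' => indic (P ^ a.+1 %| XG (level a) x' + (XG (below a) x + u))%N));
  last first.
  move=> x'; rewrite (merge_dep_l _ _ (@XG_dep _ _ _)).
  rewrite (merge_dep_r _ _ (@XG_dep _ _ (level a))); last first.
    by move=> h hl; apply/negP => /dj; rewrite hl.
  by rewrite addnCA addnA.
case: (boolP (P ^ a %| XG (below a) x + u)%N) => hu.
  by rewrite /indic Rmult_1_r; apply: level_prob.
rewrite (Ex_ext (G := fun _ => 0)) => [|x']; first by rewrite Ex_const // /indic; lra.
rewrite /indic; case: ifP => // hd; case/negP: hu.
by rewrite -(dvdn_addr _ (Xdiv d x')); apply: dvdn_trans hd; rewrite expnS dvdn_mull.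
Qed.

Lemma chain_prob k :
  Ex w (fun x => indic (XG chain x == k)) <=
  (/ INR P * (1 + INR P * exp (- (2 * dl * (INR B * (/ INR P) ^ 2))))) ^ A.
Proof.
(* The event is weakened to a congruence modulo [P^A]; the offset [k (P^A - 1)] is congruent to
   [-k]. *)
apply: Rle_trans (below_prob (k * (P ^ A).-1) (leqnn A)); apply: Ex_le => // x.
have -> : XG (below A) x = XG chain x.
  by apply: eq_bigl => h; rewrite /below andb_idr // => /and4P [].
rewrite /indic; case: eqP => [->|_]; last by case: ifP => _; lra.
rewrite -{1}[k]muln1 -mulnDr add1n prednK ?expn_gt0 ?(ltnW P1) // dvdn_mull //; lra.
Qed.

End Chain.

(** A lower bound for the distance to the nearest integer, phrased so that no nearest integer has to
    be chosen. *)
Definition far (t x : R) : Prop := forall k : Z, t <= Rabs (x - IZR k).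

Lemma far_le s t x : s <= t -> far t x -> far s x.
Proof. by move=> st h k; apply: Rle_trans (h k). Qed.

Lemma not_far t x : ~ far t x -> exists k : Z, Rabs (x - IZR k) < t.
Proof. by move=> /not_all_ex_not [k /Rnot_le_lt h]; exists k. Qed.

Lemma far_div (N : nat) t x : (0 < N)%N -> far t (INR N * x) -> far (t / INR N) x.
Proof.
move=> N0 h k; have N1 := INR_gt0 N0; have := h (Z.of_nat N * k)%Z.
rewrite mult_IZR -INR_IZR_INZ -Rmult_minus_distr_l Rabs_mult (Rabs_pos_eq (INR N)); last lra.
move=> h1; apply: (Rmult_le_reg_l (INR N)) => //.
by rewrite (_ : INR N * (t / INR N) = t); [|field; lra].
Qed.

Lemma IZR_abs_ge1 (k : Z) : k <> 0%Z -> 1 <= Rabs (IZR k).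
Proof. by move=> h; rewrite -abs_IZR; apply: IZR_le; lia. Qed.

(** When [x] is within [1/(2P)] of an integer [k], the nearest integer to [P x] is [P k] and the
    distance grows exactly by the factor [P]. *)
Lemma far_step (P : nat) t x : (1 < P)%N -> 0 < t -> far t x ->
  far (/ (2 * INR P)) x \/ (far (INR P * t) (INR P * x) /\ INR P * t <= / 2).
Proof.
move=> P1 t0 h; have PI1 : 2 <= INR P by rewrite -[2]/(INR 2); apply: INR_leq.
case: (classic (far (/ (2 * INR P)) x)) => [|/not_far [k hk]]; [by left | right].
have tk := h k; move: tk hk; set f := Rabs _ => tk hk.
have Pf : INR P * f < / 2.
  apply: (Rmult_lt_reg_l (/ INR P)); first by apply: Rinv_0_lt_compat; lra.
  by rewrite -Rmult_assoc Rinv_l ?Rmult_1_l -?Rinv_mult 1?Rmult_comm //; lra.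
split; last by nra.
have e1 : Rabs (INR P * x - IZR (Z.of_nat P * k)) = INR P * f.
  rewrite mult_IZR -INR_IZR_INZ -Rmult_minus_distr_l Rabs_mult (Rabs_pos_eq (INR P)) //; lra.
move=> k'; case: (Z.eq_dec k' (Z.of_nat P * k)) => [->|ne]; first by rewrite e1; nra.
have : 1 <= Rabs (IZR (Z.of_nat P * k - k')) by apply: IZR_abs_ge1; lia.
rewrite minus_IZR => g1.
have := Rabs_triang_inv (IZR (Z.of_nat P * k) - IZR k') (IZR (Z.of_nat P * k) - INR P * x).
rewrite -(Rabs_Ropp (_ - INR P * x)) Ropp_minus_distr e1.
rewrite (_ : _ - (_ - INR P * x) = INR P * x - IZR k'); last ring.
by nra.
Qed.

(** Iterates [far_step], which must stop because distances never exceed 1/2. The last clause limits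
    the exponent spent, and thereby the size of the element [P^a]. *)
Lemma far_climb (P : nat) : (1 < P)%N -> forall (N : nat) t x, 0 < t -> / 2 < INR P ^ N * t ->
  far t x -> exists a : nat, far (/ (2 * INR P)) (INR P ^ a * x) /\
  (a = 0%N \/ INR P ^ a * t <= / 2).
Proof.
move=> P1; have PI1 : 2 <= INR P by rewrite -[2]/(INR 2); apply: INR_leq.
elim=> [|N ih] t x t0 ht fx.
  exists 0%N; split; last by left.
  rewrite /= Rmult_1_l; apply: far_le fx; rewrite /= in ht.
  apply: Rle_trans (_ : / 2 <= _); last lra.
  by apply: Rinv_le_contravar; lra.
case: (far_step P1 t0 fx) => [h|[h1 h2]].
  by exists 0%N; split; [rewrite /= Rmult_1_l | left].
have ht' : / 2 < INR P ^ N * (INR P * t).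
  by move: ht; rewrite /= -Rmult_assoc (Rmult_comm (_ ^ N)).
have Pt : 0 < INR P * t by nra.
have [a [ha hb]] := ih _ _ Pt ht' h1.
exists a.+1; split; first by rewrite /= (Rmult_comm (INR P)) Rmult_assoc.
right; rewrite /= (Rmult_comm (INR P)) Rmult_assoc.
by case: hb => [-> /=|//]; lra.
Qed.

Lemma INR_exp (P a : nat) : INR (P ^ a)%N = INR P ^ a.
Proof. by elim: a => [|a ih] //; rewrite expnS mult_INR ih. Qed.

Lemma pow_unbounded (P : nat) t : (1 < P)%N -> 0 < t -> exists N, / 2 < INR P ^ N * t.
Proof.
move=> P1 t0; have PI1 : 2 <= INR P by rewrite -[2]/(INR 2); apply: INR_leq.
have [N hN] := Pow_x_infinity (INR P) ltac:(by rewrite Rabs_pos_eq; lra) (/ t).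
exists N; have := hN N (le_n N); rewrite Rabs_pos_eq; last by apply: pow_le; lra.
move=> h; have : / t * t <= INR P ^ N * t by apply: Rmult_le_compat_r; lra.
by rewrite Rinv_l; lra.
Qed.

Section Minor.
Variables (P Q B c M n : nat) (eta y : R).
Hypotheses (P1 : (1 < P)%N) (Q1 : (1 < Q)%N) (cPQ : coprime P Q) (c6 : (c < 6)%N).
Hypothesis (eta0 : 0 < eta).
Hypothesis (hPB : INR P ^ (6 * B) * eta <= / 2).
Hypothesis (hM : INR Q ^ (6 * B) * (/ (2 * eta)) <= INR M).
Hypothesis (Mn : (M <= n)%N).

Definition wset : pred 'I_n.+1 :=
  fun h => [&& pq_pow P Q h, vp Q h < 6 * B, cls P Q h == c & h <= M]%N.

Lemma pq_le_M a b : INR P ^ a * eta <= / 2 -> (b <= 6 * B)%N -> (P ^ a * Q ^ b <= M)%N.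
Proof.
move=> ha hb; have PI1 : 2 <= INR P by rewrite -[2]/(INR 2); apply: INR_leq.
have QI1 : 2 <= INR Q by rewrite -[2]/(INR 2); apply: INR_leq.
apply/leP; apply: INR_le; apply: Rle_trans hM; rewrite mult_INR !INR_exp Rmult_comm.
have qa : 0 < INR P ^ a by apply: pow_lt; lra.
have qb : 0 < INR Q ^ b by apply: pow_lt; lra.
apply: Rmult_le_compat; try lra; first by apply: Rle_pow; [lra | apply/leP].
apply: (Rmult_le_reg_r eta) => //; apply: Rle_trans ha _; right.
by rewrite Rinv_mult; field; lra.
Qed.

Lemma minor_injection : far eta y -> exists f : 'I_B -> 'I_n.+1,
  [/\ injective f, forall i, wset (f i) &
   forall i, far (/ (2 * INR P ^ 6 * INR Q)) (INR (f i) * y)].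
Proof.
move=> fy; have PI1 : 2 <= INR P by rewrite -[2]/(INR 2); apply: INR_leq.
have QI1 : 2 <= INR Q by rewrite -[2]/(INR 2); apply: INR_leq.
have P6 : 1 <= INR P ^ 6 by apply: pow_R1_Rle; lra.
case: (classic (forall b, (b < 6 * B)%N -> far eta (INR Q ^ b * y))) => [h|].
  have ex (i : 'I_B) : exists a : nat, (P ^ (6 * a) * Q ^ (6 * i + c) <= M)%N /\
     far (/ (2 * INR P ^ 6 * INR Q)) (INR (P ^ (6 * a) * Q ^ (6 * i + c)) * y).
    have b6 : (6 * i + c < 6 * B)%N.
      apply: leq_trans (_ : 6 * i.+1 <= _)%N; last by rewrite leq_mul2l ltn_ord.
      by rewrite mulnSr ltn_add2l.
    have [N hN] := pow_unbounded P1 eta0.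
    have [a [fa ha]] := far_climb P1 eta0 hN (h _ b6).
    (* Rounding the exponent of [P] down to a multiple of 6 leaves the class equal to [c]; it costs
       at most a factor [P^5] in the distance. *)
    exists (a %/ 6)%N; set a' := (6 * (a %/ 6))%N.
    have a'a : (a' <= a)%N by rewrite /a' mulnC leq_trunc_div.
    have aE : a = (a %% 6 + a')%N by rewrite {1}(divn_eq a 6) addnC /a' mulnC.
    have r5 : (a %% 6 <= 5)%N by rewrite -ltnS ltn_mod.
    split.
      apply: pq_le_M (ltnW b6); apply: Rle_trans (_ : INR P ^ a * eta <= _).
        apply: Rmult_le_compat_r; first lra.
        by apply: Rle_pow; [lra | apply/leP].
      case: ha => [a0|//]; rewrite a0 /= Rmult_1_l.
      apply: Rle_trans hPB; rewrite -{1}[eta]Rmult_1_l.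
      by apply: Rmult_le_compat_r; [lra | apply: pow_R1_Rle; lra].
    have : far (/ (2 * INR P) / INR (P ^ (a %% 6)))
       (INR (P ^ a' * Q ^ (6 * i + c)) * y).
      apply: far_div; first by rewrite expn_gt0 ltnW.
      rewrite mult_INR !INR_exp -!Rmult_assoc -pow_add -[(_ + _)%coq_nat]/(_ + _)%N -aE.
      by rewrite Rmult_assoc.
    apply: far_le; rewrite INR_exp /Rdiv -Rinv_mult; apply: Rinv_le_contravar.
      by apply: Rmult_lt_0_compat; [lra | apply: pow_lt; lra].
    apply: Rle_trans (_ : 2 * INR P ^ 6 * 1 <= _); last by apply: Rmult_le_compat_l; lra.
    rewrite Rmult_1_r Rmult_assoc; apply: Rmult_le_compat_l; first lra.
    rewrite -[INR P * _]/(INR P ^ (a %% 6).+1); apply: Rle_pow; first lra.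
    by apply/leP; rewrite ltnS.
  have [f hf] := ClassicalEpsilon.choice _ ex.
  have lt i : (P ^ (6 * f i) * Q ^ (6 * i + c) < n.+1)%N.
    by rewrite ltnS; apply: leq_trans Mn; have [] := hf i.
  exists (fun i => Ordinal (lt i)); split=> [i i'|i|i] /=; last by have [] := hf i.
    move/(congr1 (fun h : 'I_n.+1 => vp Q h)) => /=; rewrite !vq_pq // => /eqP.
    by rewrite eqn_add2r eqn_mul2l /= => /eqP/val_inj.
  rewrite /wset /= pq_pow_pq // vq_pq // cls_pq //; have [-> _] := hf i.
  have -> : ((6 * f i + (6 * i + c)) %% 6)%N = c.
    by rewrite addnA -mulnDr mulnC modnMDl modn_small.
  rewrite eqxx !andbT.
  apply: leq_trans (_ : 6 * i.+1 <= _)%N; last by rewrite leq_mul2l ltn_ord.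
  by rewrite mulnSr ltn_add2l.
move=> hn.
have [b [hb1 [hb2 hb3]]] : exists b, (b.+1 < 6 * B)%N /\ far eta (INR Q ^ b * y) /\
    ~ far eta (INR Q ^ b.+1 * y).
  apply: NNPP => hne; apply: hn; elim=> [_|b ih hb]; first by rewrite /= Rmult_1_l.
  apply: NNPP => nf; apply: hne; exists b; split=> //; split=> //.
  by apply: ih; apply: ltnW.
have [k hk] := not_far hb3; set z := INR Q ^ b * y.
rewrite /= Rmult_assoc -/z in hk; rewrite -/z in hb2.
(* If [Q] divided [k], then [Q^b y] itself would be within [eta / Q] of an integer. *)
have Qk : ~ (Z.of_nat Q | k)%Z.
  case=> k' ek; have := hb2 k'; rewrite ek mult_IZR -INR_IZR_INZ in hk.
  move: hk; rewrite (Rmult_comm (IZR k')) -Rmult_minus_distr_l Rabs_mult Rabs_pos_eq; last lra.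
  by have := Rabs_pos (z - IZR k') => *; nra.
have fa a : (a <= 6 * B)%N -> far (/ (2 * INR Q)) (INR P ^ a * z).
  move=> ha k'.
  have Pa0 : 0 < INR P ^ a by apply: pow_lt; lra.
  have Pa : INR P ^ a * eta <= / 2.
    apply: Rle_trans hPB; apply: Rmult_le_compat_r; first lra.
    by apply: Rle_pow; [lra | apply/leP].
  have e : INR P ^ a * z - IZR k' = / INR Q *
     (IZR (Z.of_nat (P ^ a) * k - Z.of_nat Q * k') + INR P ^ a * (INR Q * z - IZR k)).
    rewrite minus_IZR !mult_IZR -!INR_IZR_INZ INR_exp; field; lra.
  rewrite e Rabs_mult (Rabs_pos_eq (/ _)); last by left; apply: Rinv_0_lt_compat; lra.
  rewrite Rinv_mult Rmult_comm; apply: Rmult_le_compat_l.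
    by left; apply: Rinv_0_lt_compat; lra.
  have g1 : 1 <= Rabs (IZR (Z.of_nat (P ^ a) * k - Z.of_nat Q * k')).
    apply: IZR_abs_ge1 => h0; apply: Qk.
    have : (Z.of_nat Q | Z.of_nat (P ^ a) * k)%Z by exists k'; lia.
    move=> hd; apply: (Znumtheory.Gauss _ _ _ hd); apply/Znumtheory.Zgcd_1_rel_prime.
    have := coprimeXl a cPQ; rewrite coprime_sym /coprime => /eqP.
    move=> hg; apply: Z.bezout_1_gcd.
    have [u v huv _] := egcdnP (P ^ a)%N (ltnW Q1).
    move: huv; rewrite hg => huv.
    exists (Z.of_nat u), (- Z.of_nat v)%Z.
    by have := congr1 Z.of_nat huv; rewrite -multE -plusE Nat2Z.inj_add !Nat2Z.inj_mul; lia.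
  have g2 : Rabs (INR P ^ a * (INR Q * z - IZR k)) <= / 2.
    rewrite Rabs_mult (Rabs_pos_eq (_ ^ _)); last lra.
    by apply: Rle_trans Pa; apply: Rmult_le_compat_l; lra.
  set u := IZR (_ - _) in g1 *; set v := INR P ^ a * _ in g2 *.
  have := Rabs_triang_inv u (- v); rewrite Rabs_Ropp /Rminus Ropp_involutive; lra.
(* The residue [c - b] modulo 6, written [c + 5b], puts [P^(g i) Q^b] into class [c]. *)
pose g (i : 'I_B) := (6 * i + (c + 5 * b) %% 6)%N.
have g6 i : (g i < 6 * B)%N.
  apply: leq_trans (_ : 6 * i.+1 <= _)%N; last by rewrite leq_mul2l ltn_ord.
  by rewrite mulnSr ltn_add2l ltn_mod.
have le i : (P ^ g i * Q ^ b <= M)%N.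
  apply: pq_le_M; last by apply: ltnW; apply: ltnW.
  apply: Rle_trans hPB; apply: Rmult_le_compat_r; first lra.
  by apply: Rle_pow; [lra | apply/leP; apply: ltnW].
have lt i : (P ^ g i * Q ^ b < n.+1)%N by rewrite ltnS; apply: leq_trans Mn.
exists (fun i => Ordinal (lt i)); split=> [i i'|i|i] /=.
- move/(congr1 (fun h : 'I_n.+1 => vp P h)) => /=; rewrite !vp_pq // /g => /eqP.
  by rewrite eqn_add2r eqn_mul2l /= => /eqP/val_inj.
- rewrite /wset /= pq_pow_pq // vq_pq // cls_pq // le (ltnW hb1) andbT /=.
  rewrite /g addnC addnCA mulnC modnMDl modnDmr addnCA -mulSn mulnC addnC.
  by rewrite modnMDl modn_small.
rewrite mult_INR !INR_exp (Rmult_assoc _ _ y) -/z; apply: far_le (fa _ (ltnW (g6 i))).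
apply: Rinv_le_contravar; first lra.
rewrite -Rmult_assoc; apply: Rmult_le_compat_r; lra.
Qed.

End Minor.

Section MinorPhi.
Variables (n d : nat) (w : 'I_n.+1 -> 'I_d -> R).
Hypothesis w_ge0 : forall i j, 0 <= w i j.
Hypothesis w_sum1 : forall i, \big[Rplus/0]_j w i j = 1.
Variables (j0 j1 : 'I_d).
Hypotheses (hj0 : val j0 = 0%N) (hj1 : val j1 = 1%N).
Variables (dl : R) (P Q B c M : nat) (eta y : R).
Hypotheses (P1 : (1 < P)%N) (Q1 : (1 < Q)%N) (cPQ : coprime P Q) (c6 : (c < 6)%N).
Hypothesis (eta0 : 0 < eta).
Hypothesis (hPB : INR P ^ (6 * B) * eta <= / 2).
Hypothesis (hM : INR Q ^ (6 * B) * (/ (2 * eta)) <= INR M).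
Hypothesis (Mn : (M <= n)%N).
Hypotheses (dl0 : 0 <= dl).
Hypothesis hw : forall h : 'I_n.+1, wset P Q B c M h -> dl <= w h j0 * w h j1.

Lemma minor_phi : far eta y ->
  Cmod (phi w (wset (n := n) P Q B c M) y) <=
  exp (- (2 * dl * (INR B * (/ (2 * INR P ^ 6 * INR Q)) ^ 2))).
Proof.
move=> /(minor_injection P1 Q1 cPQ c6 eta0 hPB hM Mn) [f [fi fw ff]].
pose G : pred 'I_n.+1 := [pred h | h \in codom f].
have GW h : G h -> wset P Q B c M h by case/codomP => i ->; apply: fw.
apply: Rle_trans (Cmod_phi_sub w_ge0 w_sum1 y GW) _.
have <- : #|G| = B by rewrite -[RHS]card_ord -(card_codom fi).
apply: (Cmod_phi_card w_ge0 w_sum1 hj0 hj1 _ dl0) => h Gh; first by apply: hw; apply: GW.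
case/codomP: Gh => i ->; apply: sin_sq_lower (ff i).
left; apply: Rinv_0_lt_compat.
by repeat apply: Rmult_lt_0_compat; try apply: pow_lt; try apply: INR_gt0; try exact: ltnW; lra.
Qed.

End MinorPhi.

(** * Counting products of coprime bases *)

Fixpoint gen (ps : seq nat) (h : nat) : Prop :=
  if ps is p :: ps' then exists a s, h = (p ^ a * s)%N /\ gen ps' s else h = 1%N.

(* Lists the elements [h] of the multiplicative monoid generated by [ps] with [c * h <= n]; the accumulator [c] makes the recursion on [ps] structural. *)
Fixpoint genl (ps : seq nat) (c n : nat) : seq nat :=
  if ps is p :: ps' then
    flatten [seq [seq (p ^ a * s)%N | s <- genl ps' (c * p ^ a) n] | a <- seq.iota 0 n.+1]
  else if (c <= n)%N then [:: 1%N] else [::].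

Fixpoint coprime_bases (ps : seq nat) : Prop :=
  if ps is p :: ps' then (1 < p)%N /\ (forall q, q \in ps' -> coprime p q) /\ coprime_bases ps'
  else True.

Lemma genl_cons p ps c n : genl (p :: ps) c n =
  flatten [seq [seq (p ^ a * s)%N | s <- genl ps (c * p ^ a) n] | a <- seq.iota 0 n.+1].
Proof. by []. Qed.

Lemma genlP ps c n h : coprime_bases ps -> (0 < c)%N ->
  reflect (gen ps h /\ (c * h <= n)%N) (h \in genl ps c n).
Proof.
elim: ps c h => [|p ps ih] c h.
  move=> _ c0 /=; apply: (iffP idP).
    by case: ifP => // cn; rewrite inE => /eqP ->; rewrite muln1.
  by case=> ->; rewrite muln1 => ->; rewrite inE.
case=> p1 [_ cps] c0.
have cp a : (0 < c * p ^ a)%N by rewrite muln_gt0 c0 expn_gt0 ltnW.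
rewrite genl_cons; apply: (iffP flatten_mapP).
  case=> a _ /mapP [s /(ih _ _ cps (cp a)) [gs hs] ->].
  by split; [exists a, s | rewrite mulnA].
case=> [[a [s [-> gs]]]]; rewrite mulnA => hs; exists a.
  rewrite mem_iota add0n ltnS /=; apply: leq_trans hs.
  have s0 : (0 < s)%N.
    elim: (ps) cps s gs => [|q qs ihq] /=; first by move=> _ s ->.
    case=> q1 [_ cqs] s [b [s' [-> gs']]].
    by rewrite muln_gt0 expn_gt0 (ltnW q1) (ihq cqs _ gs').
  apply: leq_trans (ltnW (ltn_expl a p1)) _.
  by apply: leq_trans (leq_pmull _ c0) (leq_pmulr _ s0).
by apply/mapP; exists s => //; apply/(ih _ _ cps (cp a)).
Qed.

Lemma gen_gt0 ps h : coprime_bases ps -> gen ps h -> (0 < h)%N.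
Proof.
elim: ps h => [|p ps ih] h /=; first by move=> _ ->.
case=> p1 [_ cps] [a [s [-> gs]]].
by rewrite muln_gt0 expn_gt0 (ltnW p1) (ih _ cps gs).
Qed.

Lemma gen_coprime ps p h : (forall q, q \in ps -> coprime p q) -> gen ps h -> coprime p h.
Proof.
elim: ps h => [|q ps ih] h /= hc; first by move=> ->; rewrite coprimen1.
case=> a [s [-> gs]]; rewrite coprimeMr coprimeXr /=.
  by apply: ih gs => q' hq'; apply: hc; rewrite inE hq' orbT.
by apply: hc; rewrite inE eqxx.
Qed.

Lemma vp_gen p ps a s : (1 < p)%N -> (forall q, q \in ps -> coprime p q) ->
  coprime_bases ps -> gen ps s -> vp p (p ^ a * s) = a.
Proof.
move=> p1 hc cps gs; rewrite vp_expn ?(gen_gt0 cps gs) //.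
rewrite -[s]muln1 (vp_coprime p1) ?(gen_coprime hc gs) ?(gen_gt0 cps gs) //.
by rewrite vp1 addn0.
Qed.

Lemma genl_uniq ps c n : coprime_bases ps -> (0 < c)%N -> uniq (genl ps c n).
Proof.
elim: ps c => [|p ps ih] c; first by move=> /=; case: ifP.
case=> p1 [hc cps] c0; rewrite genl_cons.
have cp a : (0 < c * p ^ a)%N by rewrite muln_gt0 c0 expn_gt0 ltnW.
have : uniq (seq.iota 0 n.+1) by apply: iota_uniq.
elim: (seq.iota 0 n.+1) => [|a r ihr] //= /andP [ar ur].
rewrite cat_uniq ihr // andbT map_inj_uniq ?ih //=; last first.
  by move=> s s' /eqP; rewrite eqn_pmul2l ?expn_gt0 ?(ltnW p1) // => /eqP.
apply/hasPn => h /flatten_mapP [a' a'r /mapP [s' /(genlP _ _ cps (cp a')) [gs' _] ->]].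
apply/negP => /mapP [s /(genlP _ _ cps (cp a)) [gs _] e].
have := congr1 (vp p) e; rewrite !(vp_gen _ p1 hc cps) // => aa'.
by move: ar; rewrite -aa' a'r.
Qed.

(** The volume of the simplex of nonnegative exponent vectors [x] with [sum x_i ln p_i <= 1], that
    is, the leading coefficient in the count of products of the bases. *)
Definition genl_vol (ps : seq nat) : R :=
  / INR (size ps)`! * \big[Rmult/1]_(q <- ps) / ln (INR q).

(** The order of the boundary of the simplex, one power below the main term; for no bases the count
    is exact. *)
Definition err (k : nat) (t : R) : R := if k is k'.+1 then (1 + t) ^ k' else 0.

Lemma pow_diff (k : nat) (u v : R) : 0 <= v <= u ->
  INR k.+1 * (u - v) * v ^ k <= u ^ k.+1 - v ^ k.+1 <= INR k.+1 * (u - v) * u ^ k.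
Proof.
move=> vu; elim: k => [|k [ih1 ih2]]; first by rewrite /=; lra.
have vk : 0 <= v ^ k by apply: pow_le; lra.
have uk : v ^ k <= u ^ k by apply: pow_incr.
have k0 := pos_INR k.+1; rewrite (S_INR k.+1).
set K := INR k.+1 in ih1 ih2 k0 *.
rewrite -![_ ^ k.+2]/(_ * _ ^ k.+1) -![_ ^ k.+1]/(_ * _ ^ k) in ih1 ih2 *.
move: (u ^ k) (v ^ k) vk uk ih1 ih2 => U W vk uk ih1 ih2.
have h1 : u * (K * (u - v) * W) <= u * (u * U - v * W) by apply: Rmult_le_compat_l; lra.
have h2 : u * (u * U - v * W) <= u * (K * (u - v) * U) by apply: Rmult_le_compat_l; lra.
have h3 : 0 <= (u - v) * W by apply: Rmult_le_pos; lra.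
have h4 : (K * v) * ((u - v) * W) <= (K * u) * ((u - v) * W).
  by apply: Rmult_le_compat_r => //; apply: Rmult_le_compat_l; lra.
have h5 : 0 <= (u - v) * (u * U - v * W).
  apply: Rmult_le_pos; first lra.
  have : v * W <= u * U by apply: Rmult_le_compat; lra.
  by lra.
split; nra.
Qed.

(** Comparison of a Riemann sum of step [lam] with the integral of [u^k / lam], whose antiderivative
    is [f]. The term [f lam] pays for the last, incomplete step and [t^k] for the first point. *)
Lemma power_sum (k : nat) (lam : R) : 0 < lam -> forall (N : nat) t,
  INR N * lam <= t < INR N.+1 * lam ->
  let f u := u ^ k.+1 / (INR k.+1 * lam) in
  f t - f lam <= \big[Rplus/0]_(a < N.+1) (t - INR a * lam) ^ k <= f t + t ^ k.
Proof.
move=> l0 N t + f; have K0 : 0 < INR k.+1 by apply: INR_gt0.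
have df u v : 0 <= v <= u -> (u - v) / lam * v ^ k <= f u - f v <= (u - v) / lam * u ^ k.
  move=> vu; have [h1 h2] := pow_diff k vu; rewrite /f.
  have i0 : 0 < / (INR k.+1 * lam) by apply: Rinv_0_lt_compat; nra.
  have e : u ^ k.+1 / (INR k.+1 * lam) - v ^ k.+1 / (INR k.+1 * lam) =
    (u ^ k.+1 - v ^ k.+1) * / (INR k.+1 * lam) by rewrite /Rdiv; ring.
  rewrite e (_ : _ / lam * v ^ k = INR k.+1 * (u - v) * v ^ k * / (INR k.+1 * lam)).
  rewrite (_ : _ / lam * u ^ k = INR k.+1 * (u - v) * u ^ k * / (INR k.+1 * lam)).
    by split; apply: Rmult_le_compat_r; lra.
  by field; lra.
  by field; lra.
elim: N t => [|N ih] t ht.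
  rewrite big_ord_recr big_ord0 /= in ht *.
  rewrite Rmult_0_l Rminus_0_r Rplus_0_l in ht *.
  have := df lam t ltac:(lra); have tk : 0 <= t ^ k by apply: pow_le; lra.
  have ft : 0 <= f t.
    by apply: Rmult_le_pos; [apply: pow_le; lra | left; apply: Rinv_0_lt_compat; nra].
  have : 0 <= (lam - t) / lam.
    by apply: Rmult_le_pos; [lra | left; apply: Rinv_0_lt_compat].
  by move=> *; nra.
have N0 := pos_INR N; rewrite !S_INR in ht.
have [ih1 ih2] := ih (t - lam) ltac:(rewrite !S_INR; lra).
rewrite big_ord_recl /= Rmult_0_l Rminus_0_r.
have -> : \big[Rplus/0]_(i < N.+1) (t - INR (bump 0 i) * lam) ^ k =
   \big[Rplus/0]_(a < N.+1) (t - lam - INR a * lam) ^ k.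
  by apply: eq_bigr => i _; rewrite /bump add1n S_INR; congr (_ ^ _); ring.
have := df t (t - lam) ltac:(nra).
rewrite (_ : (t - (t - lam)) / lam = 1); last by field; lra.
lra.
Qed.

Lemma ln_INR_expn (p a : nat) : (0 < p)%N -> ln (INR (p ^ a)) = INR a * ln (INR p).
Proof. by move=> p0; rewrite INR_exp ln_pow //; apply: INR_gt0. Qed.

Lemma ln_INR_le (a b : nat) : (0 < a)%N -> (a <= b)%N -> ln (INR a) <= ln (INR b).
Proof.
move=> a0 ab; have [h|->] := Rle_lt_or_eq_dec _ _ (INR_leq ab); last lra.
by left; apply: ln_increasing => //; apply: INR_gt0.
Qed.

Lemma ln_INR_gt0 (a : nat) : (1 < a)%N -> 0 < ln (INR a).
Proof.
by move=> a1; rewrite -ln_1; apply: ln_increasing; [lra | rewrite -[1]/(INR 1); apply: INR_ltn].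
Qed.

Lemma genl_nil ps c n : (n < c)%N -> coprime_bases ps -> size (genl ps c n) = 0%N.
Proof.
move=> nc cps; have c0 : (0 < c)%N by apply: leq_ltn_trans nc.
case E: (genl ps c n) => [|h s] //.
have : h \in genl ps c n by rewrite E inE eqxx.
case/(genlP _ _ cps c0) => gs hs; have := gen_gt0 cps gs => h0.
by have := leq_trans (leq_pmulr c h0) hs; rewrite leqNgt nc.
Qed.

(** Lattice points in a simplex, by induction on its dimension. Fixing the exponent [a] of the first
    base [p] replaces [t = ln(n/c)] by [t - a ln p], so the main terms form the sum of [power_sum];
    there are at most [t / ln p + 1] values of [a], so the errors gain one power of [1 + t]. *)
Lemma genl_count ps : coprime_bases ps -> exists Cst, 0 <= Cst /\
  forall c n, (0 < c)%N -> (c <= n)%N ->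
  Rabs (INR (size (genl ps c n)) - genl_vol ps * (ln (INR n) - ln (INR c)) ^ size ps)
  <= Cst * err (size ps) (ln (INR n) - ln (INR c)).
Proof.
elim: ps => [|p ps ih] /=.
  move=> _; exists 0; split; first lra.
  move=> c n c0 cn; rewrite cn /genl_vol big_nil /= Rmult_1_r Rinv_1 Rmult_1_l.
  by rewrite Rminus_eq_0 Rabs_R0; lra.
case=> p1 [hc cps]; have [C0 [C00 hC0]] := ih cps.
set lam := ln (INR p); have l0 : 0 < lam by apply: ln_INR_gt0.
set k := size ps in hC0 *; have k0 : 0 < INR k.+1 by apply: INR_gt0.
have V0 : 0 <= genl_vol ps.
  apply: Rmult_le_pos; first by left; apply: Rinv_0_lt_compat; apply: INR_gt0; apply: fact_gt0.
  rewrite big_seq; apply: rprod_ge0 => q qps; left; apply: Rinv_0_lt_compat.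
  apply: ln_INR_gt0; elim: (ps) cps qps => // r rs ihr /= [r1 [_ crs]].
  by rewrite inE => /orP [/eqP ->|/(ihr crs)].
pose fl := lam ^ k.+1 / (INR k.+1 * lam).
have fl0 : 0 <= fl.
  by apply: Rmult_le_pos; [apply: pow_le; lra | left; apply: Rinv_0_lt_compat; nra].
exists (genl_vol ps * (fl + 1) + C0 * (/ lam + 1)).
have il : 0 < / lam by apply: Rinv_0_lt_compat.
split; first by apply: Rplus_le_le_0_compat; apply: Rmult_le_pos; lra.
move=> c n c0 cn; set t := ln _ - ln _.
have t0 : 0 <= t by have := ln_INR_le c0 cn; rewrite /t; lra.
have nc0 : (0 < n %/ c)%N by rewrite divn_gt0.
set N := trunc_log p (n %/ c).
have hN a : (c * p ^ a <= n)%N = (a < N.+1)%N.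
  rewrite mulnC -leq_divRL // ltnS; apply/idP/idP => h; first exact: trunc_log_max.
  by apply: leq_trans (trunc_logP p1 nc0); rewrite leq_exp2l.
have szE : INR (size (genl (p :: ps) c n)) =
   \big[Rplus/0]_(a < N.+1) INR (size (genl ps (c * p ^ a) n)).
  rewrite genl_cons size_flatten /shape -map_comp sumnE big_map -INR_sum; congr INR.
  rewrite -[seq.iota 0 n.+1]/(index_iota 0%N n.+1) /comp.
  under eq_bigr => a _ do rewrite size_map.
  rewrite -(big_mkord xpredT (fun a => size (genl ps (c * p ^ a) n))).
  have Nn : (N.+1 <= n.+1)%N.
    rewrite ltnS; apply: leq_trans (ltnW (ltn_expl N p1)) _.
    by apply: leq_trans (trunc_logP p1 nc0) (leq_div _ _).
  rewrite (big_cat_nat _ Nn) //=.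
  have -> : (\sum_(N.+1 <= i < n.+1) size (genl ps (c * p ^ i) n) = 0)%N; last first.
    by rewrite addn0.
  rewrite big_nat_cond big1 // => a /andP [/andP [aN _] _]; apply: genl_nil => //.
  by rewrite ltnNge hN -leqNgt.
rewrite -[X in INR X]/(size (genl (p :: ps) c n)) szE.
have ua (a : nat) : ln (INR n) - ln (INR (c * p ^ a)) = t - INR a * lam.
  rewrite mult_INR ln_mult ?ln_INR_expn /t /lam; try ring; try exact: ltnW.
    exact: INR_gt0.
  by apply: INR_gt0; rewrite expn_gt0 ltnW.
have tN : INR N * lam <= t < INR N.+1 * lam.
  have hNn : (c * p ^ N <= n)%N by rewrite hN.
  have cpN : (0 < c * p ^ N)%N by rewrite muln_gt0 c0 expn_gt0 ltnW.
  have h1 := ln_INR_le cpN hNn.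
  have h2 := ua N; have h3 := ua N.+1.
  have hNn' : (n < c * p ^ N.+1)%N by rewrite ltnNge hN ltnn.
  have h4 : ln (INR n) < ln (INR (c * p ^ N.+1)).
    by apply: ln_increasing; [apply: INR_gt0; apply: leq_trans cn | apply: INR_ltn].
  rewrite /t in h2 h3 *; split; lra.
have [ps1 ps2] := power_sum k l0 tN.
have volE : genl_vol (p :: ps) * t ^ k.+1 = genl_vol ps * (t ^ k.+1 / (INR k.+1 * lam)).
  rewrite /genl_vol big_cons -[size (p :: ps)]/k.+1 -/k -/lam factS mult_INR.
  set Bq := \big[Rmult/1]_(q <- ps) _; set K := INR k.+1 in k0 *.
  have kf : 0 < INR k`! by apply: INR_gt0; apply: fact_gt0.
  rewrite -[t ^ k.+1]/(t * t ^ k); field; lra.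
rewrite volE.
set T := _ / (_ * lam) in ps1 ps2 *.
set S1 := \big[Rplus/0]_(a < N.+1) INR _.
set S2 := \big[Rplus/0]_(a < N.+1) _ in ps1 ps2.
have d1 : Rabs (S1 - genl_vol ps * S2) <= C0 * (/ lam + 1) * (1 + t) ^ k.
  rewrite /S1 /S2 big_distrr -rsum_sub.
  apply: Rle_trans (rsum_abs _ _ _) _.
  apply: Rle_trans (_ : \big[Rplus/0]_(a < N.+1) (C0 * err k t) <= _).
    apply: rsum_le => a _; have ha : (c * p ^ a <= n)%N by rewrite hN.
    have cp : (0 < c * p ^ a)%N by rewrite muln_gt0 c0 expn_gt0 ltnW.
    have := hC0 _ _ cp ha; rewrite ua => h; apply: Rle_trans h _.
    apply: Rmult_le_compat_l => //; rewrite /err; case: (k) => [|k']; first lra.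
    apply: pow_incr; have := ln_INR_le cp ha; have := ua a.
    have := pos_INR a => *; split; nra.
  rewrite rsum_const card_ord; set K1 := INR N.+1.
  have : K1 <= / lam * t + 1.
    rewrite /K1 S_INR; suff : INR N <= / lam * t by lra.
    by apply: (Rmult_le_reg_l lam) => //; rewrite -Rmult_assoc Rinv_r ?Rmult_1_l; lra.
  move=> hN1; rewrite /err; case: (k) => [|k'] /=.
    have : 0 <= C0 * (/ lam + 1) by apply: Rmult_le_pos; lra.
    by lra.
  have pk : 0 <= (1 + t) ^ k' by apply: pow_le; lra.
  have q0 : K1 <= (/ lam + 1) * (1 + t) by nra.
  have := Rmult_le_compat_r (C0 * (1 + t) ^ k') _ _ (Rmult_le_pos _ _ C00 pk) q0.
  by lra.
have tk : t ^ k <= (1 + t) ^ k by apply: pow_incr; lra.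
have p1k : 1 <= (1 + t) ^ k by apply: pow_R1_Rle; lra.
have d2 : Rabs (genl_vol ps * S2 - genl_vol ps * T) <= genl_vol ps * (fl + 1) * (1 + t) ^ k.
  rewrite -Rmult_minus_distr_l Rabs_mult (Rabs_pos_eq (genl_vol _)) // Rmult_assoc.
  apply: Rmult_le_compat_l => //; have : 0 <= t ^ k by apply: pow_le.
  by rewrite -/fl in ps1 => *; apply: Rabs_le; split; nra.
have := Rabs_triang (S1 - genl_vol ps * S2) (genl_vol ps * S2 - genl_vol ps * T).
rewrite (_ : S1 - _ + _ = S1 - genl_vol ps * T); last ring.
by rewrite /err; lra.
Qed.

Section Counting.
Variables (ps : seq nat) (k : nat).
Hypotheses (cps : coprime_bases ps) (szk : size ps = k.+1).

Definition cS (x : nat) : nat := size (genl ps 1 x).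

Lemma coprime_bases_gt1 q : q \in ps -> (1 < q)%N.
Proof.
elim: (ps) cps => // r rs ihr /= [r1 [_ crs]].
by rewrite inE => /orP [/eqP ->|/(ihr crs)].
Qed.

Lemma genl_vol_gt0 : 0 < genl_vol ps.
Proof.
apply: Rmult_lt_0_compat; first by apply: Rinv_0_lt_compat; apply: INR_gt0; apply: fact_gt0.
rewrite big_seq; apply: rprod_gt0 => q qps; apply: Rinv_0_lt_compat.
by apply: ln_INR_gt0; apply: coprime_bases_gt1.
Qed.

Lemma card_cS (n x : nat) (P : pred nat) :
  (forall h, reflect (gen ps h) (P h)) -> (x <= n)%N ->
  #|[pred h : 'I_n.+1 | P h && (h <= x)%N]| = cS x.
Proof.
move=> hP xn; rewrite /cS cardE -(size_map (@nat_of_ord n.+1)); apply: perm_size.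
apply: uniq_perm; [|exact: genl_uniq|].
  by rewrite map_inj_uniq ?enum_uniq //; exact: val_inj.
move=> h; apply/mapP/(genlP _ _ cps (isT : (0 < 1)%N)).
  by case=> h'; rewrite mem_enum => /andP [/hP gh hx] ->; rewrite mul1n.
rewrite mul1n => [[gh hx]]; have hn : (h < n.+1)%N by rewrite ltnS; apply: leq_trans xn.
by exists (Ordinal hn) => //; rewrite mem_enum; apply/andP; split => //; apply/hP.
Qed.

Lemma cS_count : exists Cst, 0 <= Cst /\ forall x, (0 < x)%N ->
  Rabs (INR (cS x) - genl_vol ps * ln (INR x) ^ k.+1) <= Cst * (1 + ln (INR x)) ^ k.
Proof.
have [C [C0 hC]] := genl_count cps; exists C; split => // x x0.
by have := hC 1%N x isT x0; rewrite szk /= ln_1 Rminus_0_r.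
Qed.

Lemma ln_INR_ge0 (x : nat) : 0 <= ln (INR x).
Proof.
case: x => [|x]; first by (unfold ln; destruct Rlt_dec as [h|h]; [exfalso; simpl in h|]; lra).
by rewrite -ln_1; have := @ln_INR_le 1 x.+1 isT isT.
Qed.

Lemma cS_upper : exists Cst, 0 < Cst /\ forall x x', (0 < x')%N -> (x' <= x)%N ->
  INR (cS x) - INR (cS x') <= Cst * (1 + (ln (INR x) - ln (INR x'))) * (1 + ln (INR x)) ^ k.
Proof.
have [C [C0 hC]] := cS_count; have V0 := genl_vol_gt0.
have k0 : 0 < INR k.+1 by apply: INR_gt0.
exists (genl_vol ps * INR k.+1 + 2 * C); split; first by nra.
move=> x x' x'0 xx'; have x0 : (0 < x)%N by apply: leq_trans xx'.
have /Rabs_le_between [h1 h1'] := hC _ x0; have /Rabs_le_between [h2 h2'] := hC _ x'0.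
have lx := ln_INR_le x'0 xx'; have lx0 := ln_INR_ge0 x'.
have [_ h3] := pow_diff k (conj lx0 lx).
set a := ln (INR x) in lx h1' h1 h3 *; set b := ln (INR x') in lx lx0 h2 h2' h3 *.
have p1 : (1 + b) ^ k <= (1 + a) ^ k by apply: pow_incr; lra.
have p2 : a ^ k <= (1 + a) ^ k by apply: pow_incr; lra.
have p3 : 0 <= (1 + b) ^ k by apply: pow_le; lra.
set A := (1 + a) ^ k in p1 p2 h1 h1' *; set K := INR k.+1 in k0 h3 *.
have e1 : C * (1 + b) ^ k <= C * A by apply: Rmult_le_compat_l.
have e2 : K * (a - b) * a ^ k <= K * (a - b) * A.
  by apply: Rmult_le_compat_l => //; apply: Rmult_le_pos; lra.
have e3 : genl_vol ps * (a ^ k.+1 - b ^ k.+1) <= genl_vol ps * (K * (a - b) * A).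
  by apply: Rmult_le_compat_l; lra.
have e4 : 0 <= C * (a - b) * A by apply: Rmult_le_pos; [apply: Rmult_le_pos|]; lra.
have e5 : 0 <= genl_vol ps * K * A by apply: Rmult_le_pos; nra.
lra.
Qed.

Lemma cS_lower : exists (Rr : nat) c0, (1 < Rr)%N /\ 0 < c0 /\ exists x0, forall x, (x0 <= x)%N ->
  c0 * ln (INR x) ^ k <= INR (cS x) - INR (cS (x %/ Rr)).
Proof.
have [C [C0 hC]] := cS_count; have V0 := genl_vol_gt0.
(* The main term of the window is at least [genl_vol * ln Rr * L^k], and each of the two counting
   errors is at most [C 2^k L^k]; [ln Rr >= t] leaves at least [L^k]. *)
pose t := (2 * C * 2 ^ k + 1) / genl_vol ps.
have [Rr [R1 hR]] : exists Rr : nat, (1 < Rr)%N /\ t <= ln (INR Rr).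
  have [N hN] := INR_unbounded (exp t); exists (N.+2); split => //.
  have : INR N <= INR N.+2 by apply: INR_leq; rewrite -addn2 leq_addr.
  move=> h; rewrite -[t]ln_exp; left; apply: ln_increasing; [exact: exp_pos | lra].
exists Rr, 1; split => //; split; first lra.
have [N hN] := INR_unbounded (exp 1).
exists (maxn Rr N) => x; rewrite geq_max => /andP [xR xN].
have R0 : (0 < Rr)%N by apply: ltnW.
have x0 : (0 < x)%N by apply: leq_trans xR.
have x'0 : (0 < x %/ Rr)%N by rewrite divn_gt0.
have /Rabs_le_between [h1 h1'] := hC _ x0; have /Rabs_le_between [h2 h2'] := hC _ x'0.
have lx0 := ln_INR_ge0 (x %/ Rr).
have lx : ln (INR (x %/ Rr)) <= ln (INR x) - ln (INR Rr).
  have := ln_INR_le _ (leq_divM x Rr); rewrite mult_INR ln_mult; [|exact: INR_gt0..].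
  by move=> h; have := h ltac:(by rewrite muln_gt0 x'0); lra.
have l1 : 1 <= ln (INR x).
  rewrite -{1}[1]ln_exp; left; apply: ln_increasing; first exact: exp_pos.
  by have := INR_leq xN; lra.
set a := ln (INR x) in lx h1 h1' l1 *; set b := ln (INR (x %/ Rr)) in lx lx0 h2 h2'.
have lR : 0 < ln (INR Rr) by apply: ln_INR_gt0.
have ak : 0 < a ^ k by apply: pow_lt; lra.
have bk : b ^ k <= a ^ k by apply: pow_incr; lra.
have bk0 : 0 <= b ^ k by apply: pow_le.
have g1 : ln (INR Rr) * a ^ k <= a ^ k.+1 - b ^ k.+1.
  rewrite -![_ ^ k.+1]/(_ * _ ^ k).
  have : b * b ^ k <= (a - ln (INR Rr)) * a ^ k by apply: Rmult_le_compat; lra.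
  by lra.
have g2 : (1 + a) ^ k <= 2 ^ k * a ^ k by rewrite -Rpow_mult_distr; apply: pow_incr; lra.
have g3 : (1 + b) ^ k <= 2 ^ k * a ^ k by rewrite -Rpow_mult_distr; apply: pow_incr; lra.
have g4 : C * (1 + a) ^ k <= C * (2 ^ k * a ^ k) by apply: Rmult_le_compat_l.
have g5 : C * (1 + b) ^ k <= C * (2 ^ k * a ^ k) by apply: Rmult_le_compat_l.
have g6 : genl_vol ps * (ln (INR Rr) * a ^ k) <= genl_vol ps * (a ^ k.+1 - b ^ k.+1).
  by apply: Rmult_le_compat_l; lra.
have g7 : (2 * C * 2 ^ k + 1) <= genl_vol ps * ln (INR Rr).
  rewrite (_ : 2 * C * 2 ^ k + 1 = genl_vol ps * t); last by rewrite /t; field; lra.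
  by apply: Rmult_le_compat_l; lra.
have g8 : (2 * C * 2 ^ k + 1) * a ^ k <= genl_vol ps * ln (INR Rr) * a ^ k.
  by apply: Rmult_le_compat_r; lra.
lra.
Qed.

End Counting.

(** Two geometric series meeting where [A 2^i] passes 1. The bound splits at [A = 1] so that it is
    stable under the step [A -> 2A] of the induction. *)
Lemma trunc_sum (N : nat) : forall A : R, 0 < A ->
  \big[Rplus/0]_(i < N) Rmin (A * 2 ^ i) (/ (A * 2 ^ i)) <= (if Rle_dec 1 A then 2 / A else 4 - 2 * A).
Proof.
elim: N => [|N ih] A A0.
  rewrite big_ord0; case: Rle_dec => h /=; last lra.
  by apply: Rmult_le_pos; [lra | left; apply: Rinv_0_lt_compat].
rewrite big_ord_recl /= Rmult_1_r.
have -> : \big[Rplus/0]_(i < N) Rmin (A * 2 ^ bump 0 i) (/ (A * 2 ^ bump 0 i)) =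
   \big[Rplus/0]_(i < N) Rmin (2 * A * 2 ^ i) (/ (2 * A * 2 ^ i)).
  by apply: eq_bigr => i _; rewrite /bump add1n /= (Rmult_comm 2 A) Rmult_assoc.
have := ih (2 * A) ltac:(lra); have m1 := Rmin_l A (/ A); have m2 := Rmin_r A (/ A).
have i0 : 0 < / A by apply: Rinv_0_lt_compat.
have e : 2 / (2 * A) = / A by field; lra.
have AA : A * / A = 1 by rewrite Rinv_r; lra.
case: Rle_dec => h; case: Rle_dec => h' /= h2; rewrite /Rdiv ?e in h2 *; nra.
Qed.

Section Bases.
Variables (m : nat) (p : 'I_m -> nat).
Hypotheses (hp1 : forall i : 'I_m, (1 < p i)%N)
  (hcop : forall i j : 'I_m, i <> j -> coprime (p i) (p j)).

Definition bases : seq nat := [seq p i | i <- enum 'I_m].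

Lemma size_bases : size bases = m.
Proof. by rewrite size_map size_enum_ord. Qed.

Lemma coprime_bases_map (s : seq 'I_m) : uniq s -> coprime_bases [seq p i | i <- s].
Proof.
elim: s => //= i s ih /andP [is_ us]; split; first exact: hp1.
split; last exact: ih.
move=> q /mapP [j js ->]; apply: hcop => ij; by rewrite ij js in is_.
Qed.

Lemma coprime_bases_bases : coprime_bases bases.
Proof. by apply: coprime_bases_map; apply: enum_uniq. Qed.

Lemma gen_map (s : seq 'I_m) h : uniq s ->
  gen [seq p i | i <- s] h <-> exists al : 'I_m -> nat, h = (\prod_(i <- s) p i ^ al i)%N.
Proof.
elim: s h => [|i s ih] h /=.
  by move=> _; split=> [->|[al ->]]; [exists (fun _ => 0%N) |]; rewrite big_nil.
case/andP => is_ us; split.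
  case=> a [h' [-> /(ih _ us) [al ->]]].
  exists (fun j => if j == i then a else al j); rewrite big_cons eqxx; congr (_ * _)%N.
  apply: eq_big_seq => j js; case: eqP => // ji; by rewrite -ji js in is_.
case=> al ->; rewrite big_cons; exists (al i), (\prod_(j <- s) p j ^ al j)%N; split=> //.
by apply/ih => //; exists al.
Qed.

Lemma inSP h : reflect (gen bases h) (inSb m p h).
Proof.
rewrite /inSb; case: excluded_middle_informative => hS; constructor.
  have [al ->] := hS; apply/gen_map; first exact: enum_uniq.
  by exists al; rewrite big_enum.
move=> /gen_map; move=> /(_ (enum_uniq _)) [al e]; apply: hS; exists al.
by rewrite e big_enum.
Qed.

Lemma kappa_vol d : (1 < d)%N -> kappa d m p = ln (INR d) * genl_vol bases.
Proof.
move=> d1; rewrite /kappa /genl_vol size_bases /bases big_map big_enum /=.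
rewrite /Rdiv Rmult_assoc; congr (_ * (_ * _)); by [].
Qed.

End Bases.

Lemma pow_exp_bound (j : nat) (x : R) : 0 <= x -> x ^ j * exp (- x) <= INR j`!.
Proof.
move=> x0; have h : x ^ j <= INR j`! * exp x.
  elim: j x x0 => [|j ih] x x0; first by have := exp_ineq1_le x; rewrite /=; lra.
  pose f t := INR j.+1`! * exp t - t ^ j.+1.
  have df t : is_derive f t (INR j.+1`! * exp t - INR j.+1 * t ^ j).
    rewrite /f; auto_derive => //.
    change (match j with 0%N => 1 | _.+1 => INR j + 1 end) with (INR j.+1); ring.
  case: x0 => [x0|<-]; last first.
    rewrite exp_0 Rmult_1_r /= Rmult_0_l; exact: pos_INR.
  have [c [hc1 hc2]] := MVT_gen f 0 x _ (fun t _ => df t)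
    (fun t _ => derivable_continuous_pt f t (ex_derive_Reals_0 f t (ex_intro _ _ (df t)))).
  rewrite Rmin_left ?Rmax_right in hc1; [|lra..].
  have ihc := ih c ltac:(lra).
  have j0 := pos_INR j.+1; have f0 : 0 <= f 0.
    by rewrite /f /= Rmult_0_l exp_0; have := pos_INR (j.+1)`!; rewrite factS; lra.
  have : 0 <= (INR j.+1`! * exp c - INR j.+1 * c ^ j) * (x - 0).
    apply: Rmult_le_pos; last lra.
    rewrite factS mult_INR; have := Rmult_le_compat_l _ _ _ j0 ihc; lra.
  by rewrite -hc2 {1}/f; lra.
have e0 := exp_pos (- x).
have := Rmult_le_compat_r _ _ _ (Rlt_le _ _ e0) h.
by rewrite Rmult_assoc -exp_plus Rplus_opp_r exp_0 Rmult_1_r.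
Qed.

(** [min(x, 1/x)] decays geometrically along dyadic scales on both sides of 1, which makes moment
    sums over [S] comparable to the contribution of the single scale [1/r]. *)
Lemma pow_exp_min (j : nat) (x : R) : 0 < x ->
  x ^ j.+1 * exp (- x) <= INR j.+2`! * Rmin x (/ x).
Proof.
move=> x0; have i0 : 0 < / x by apply: Rinv_0_lt_compat.
have f0 : INR j`! <= INR j.+2`!.
  by apply: INR_leq; rewrite !factS; apply: leq_trans (leq_pmull _ _) (leq_pmull _ _).
rewrite /Rmin; case: Rle_dec => _ /=.
  have := pow_exp_bound j (Rlt_le _ _ x0) => h.
  have : x * (x ^ j * exp (- x)) <= x * INR j.+2`! by apply: Rmult_le_compat_l; lra.
  by lra.
have := pow_exp_bound j.+2 (Rlt_le _ _ x0) => h.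
have := Rmult_le_compat_l _ _ _ (Rlt_le _ _ i0) h.
rewrite -[x ^ j.+2]/(x * (x * x ^ j)) (_ : / x * (x * (x * x ^ j) * exp (- x)) = x * x ^ j * exp (- x)).
  by lra.
by field; lra.
Qed.

(** * Windows and moment sums over [S] *)

Section Model.
Variables (d m : nat) (p : 'I_m -> nat).
Hypotheses (hd : (2 <= d)%N) (hm : (2 <= m)%N)
  (hp1 : forall i : 'I_m, (1 < p i)%N)
  (hcop : forall i j : 'I_m, i <> j -> coprime (p i) (p j)).

Let S := inSb m p.
Let k := m.-1.

Lemma S_gt0 h : S h -> (0 < h)%N.
Proof. by move=> /inSP; apply: gen_gt0; apply: coprime_bases_bases. Qed.

Lemma S_inS h : S h <-> inS m p h.
Proof. by rewrite /S /inSb; case: excluded_middle_informative. Qed.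

Lemma S_1 : S 1.
Proof. by apply/S_inS; exists (fun _ => 0%N); rewrite big1. Qed.

Lemma S_mul i h : S h -> S (p i * h)%N.
Proof.
move=> /S_inS [al ->]; apply/S_inS; exists (fun j => if j == i then (al j).+1 else al j).
rewrite (bigD1 i) //= [RHS](bigD1 i) //= eqxx expnS -!mulnA; congr (_ * (_ * _))%N.
by apply: eq_bigr => j /negbTE ->.
Qed.

Lemma S_pq i j a b : S (p i ^ a * p j ^ b)%N.
Proof.
elim: a => [|a ih]; last by rewrite expnS -mulnA; apply: S_mul.
elim: b => [|b ih]; first exact: S_1.
rewrite expn0 mul1n in ih; by rewrite mul1n expnS; apply: S_mul.
Qed.

Lemma size_bases_k : size (bases p) = k.+1.
Proof. by rewrite size_bases /k prednK // ltnW. Qed.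

Lemma cbb : coprime_bases (bases p).
Proof. exact: coprime_bases_bases. Qed.

Definition cnt (x : nat) : nat := cS (bases p) x.

Lemma card_cnt (n x : nat) : (x <= n)%N -> #|[pred h : 'I_n.+1 | S h && (h <= x)%N]| = cnt x.
Proof. by apply: card_cS; [exact: cbb | move=> h; exact: inSP]. Qed.

Lemma card_window (n x x' : nat) : (x' <= x)%N -> (x <= n)%N ->
  INR #|[pred h : 'I_n.+1 | S h && (x' < h <= x)%N]| = INR (cnt x) - INR (cnt x').
Proof.
move=> x'x xn; rewrite -(card_cnt xn) -(card_cnt (leq_trans x'x xn)).
suff -> : #|[pred h : 'I_n.+1 | S h && (h <= x)%N]| =
   (#|[pred h : 'I_n.+1 | S h && (h <= x')%N]| + #|[pred h : 'I_n.+1 | S h && (x' < h <= x)%N]|)%N.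
  by rewrite plus_INR; ring.
rewrite -cardUI [X in (_ + X)%N](_ : _ = 0%N) ?addn0.
  apply: eq_card => h; rewrite !inE -andb_orr; congr (_ && _).
  case: (leqP h x') => hx' /=; last by [].
  by rewrite (leq_trans hx' x'x).
by apply: eq_card0 => h; rewrite !inE; case: (leqP h x'); rewrite ?andbF // => _; rewrite andbF.
Qed.

(** Each dyadic block contains [O((1 + ln n)^k)] elements of [S], and over the blocks the summand
    decays geometrically away from [1/r]; the bound is therefore uniform in [r]. *)
Lemma S_sum_min : exists C1, 0 < C1 /\ forall (n : nat) r, (0 < n)%N -> 0 < r ->
  \big[Rplus/0]_(h < n.+1 | S h) Rmin (r * INR h) (/ (r * INR h)) <=
  C1 * (1 + ln (INR n)) ^ k.
Proof.
have [C [C0 hC]] := cS_upper cbb size_bases_k.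
have l4 : 0 < ln 4 by rewrite -ln_1; apply: ln_increasing; lra.
exists (8 * (C * (1 + ln 4) + INR (cnt 1))).
have c1 := pos_INR (cnt 1).
have c2 : 0 < C * (1 + ln 4) by apply: Rmult_lt_0_compat; lra.
split; first lra.
move=> n r n0 r0; set Lm := (1 + ln (INR n)) ^ k.
have Lm1 : 1 <= Lm by apply: pow_R1_Rle; have := ln_INR_ge0 n; lra.
set D := C * (1 + ln 4) + INR (cnt 1).
rewrite (partition_big (fun h : 'I_n.+1 => inord (trunc_log 2 h) : 'I_n.+1) xpredT) //=.
apply: Rle_trans (_ : \big[Rplus/0]_(i < n.+1)
   (2 * D * Lm * Rmin (r * 2 ^ i) (/ (r * 2 ^ i))) <= _).
  apply: rsum_le => i _.
  have ri : 0 < r * 2 ^ i by apply: Rmult_lt_0_compat => //; apply: pow_lt; lra.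
  have rii : 0 < / (r * 2 ^ i) by apply: Rinv_0_lt_compat.
  have hin (h : 'I_n.+1) : S h -> inord (trunc_log 2 h) = i -> (2 ^ i <= h < 2 ^ i.+1)%N.
    move=> /S_gt0 h0 <-; rewrite inordK; last first.
      rewrite ltnS; apply: leq_trans (ltnW (ltn_expl _ (isT : (1 < 2)%N))) _.
      by apply: leq_trans (trunc_logP _ h0) _; rewrite // -ltnS.
    by rewrite trunc_logP // trunc_log_ltn.
  have Rm0 : 0 <= Rmin (r * 2 ^ i) (/ (r * 2 ^ i)) by apply: Rmin_glb; lra.
  apply: Rle_trans (_ : \big[Rplus/0]_(h < n.+1 | S h && (inord (trunc_log 2 h) == i))
     (2 * Rmin (r * 2 ^ i) (/ (r * 2 ^ i))) <= _).
    apply: rsum_le => h /andP [Sh /eqP hi]; have /andP [h1 h2] := hin h Sh hi.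
    have g1 : 2 ^ i <= INR h by rewrite -(INR_exp 2); apply: INR_leq.
    have g2 : INR h <= 2 * 2 ^ i.
      by rewrite -[2 * 2 ^ i]/(2 ^ i.+1) -(INR_exp 2); apply: INR_leq; apply: ltnW.
    have g3 : / (r * INR h) <= / (r * 2 ^ i).
      by apply: Rinv_le_contravar => //; apply: Rmult_le_compat_l; lra.
    have g4 : r * INR h <= 2 * (r * 2 ^ i) by nra.
    rewrite -[2]/(IZR 2); have := Rmin_l (r * INR h) (/ (r * INR h)).
    have := Rmin_r (r * INR h) (/ (r * INR h)).
    by move=> *; rewrite {2}/Rmin; case: Rle_dec => _ /=; lra.
  rewrite rsum_const.
  suff hc : INR #|[pred h : 'I_n.+1 | S h && (inord (trunc_log 2 h) == i)]| <= D * Lm.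
    rewrite (_ : 2 * D * Lm * _ = D * Lm * (2 * Rmin (r * 2 ^ i) (/ (r * 2 ^ i)))); last ring.
    by apply: Rmult_le_compat_r; [lra | exact: hc].
  case: (leqP (2 ^ i) n) => hin2; last first.
    rewrite (_ : #|_| = 0%N); first by apply: Rmult_le_pos; rewrite /D; lra.
    apply: eq_card0 => h; rewrite !inE; apply/negP => /andP [Sh /eqP hi].
    have /andP [h1 _] := hin h Sh hi.
    by have := leq_ltn_trans h1 (ltn_ord h); rewrite ltnS leqNgt hin2.
  case: (posnP i) => i0.
    apply: Rle_trans (_ : INR (cnt 1) <= _); last by rewrite /D; nra.
    rewrite -(card_cnt n0); apply: INR_leq; apply: subset_leq_card; apply/subsetP => h.
    rewrite !inE => /andP [Sh /eqP hi]; have /andP [_] := hin h Sh hi.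
    by rewrite i0 Sh.
  (* Starting the window at [2^(i-1)] lets its strict lower end include [2^i]; the ratio of its ends
     is then at most 4. *)
  have lx : (2 ^ i.-1 <= minn (2 ^ i.+1) n)%N.
    rewrite leq_min leq_exp2l // (leq_trans (leq_pred _) (leqnSn _)) /=.
    by apply: leq_trans hin2; rewrite leq_exp2l // leq_pred.
  have p0 : (0 < 2 ^ i.-1)%N by rewrite expn_gt0.
  apply: Rle_trans (_ : INR #|[pred h : 'I_n.+1 | S h && (2 ^ i.-1 < h <= minn (2 ^ i.+1) n)%N]| <= _).
    apply: INR_leq; apply: subset_leq_card; apply/subsetP => h.
    rewrite !inE => /andP [Sh /eqP hi]; have /andP [h1 h2] := hin h Sh hi.
    have hn : (h <= n)%N by rewrite -ltnS ltn_ord.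
    rewrite Sh leq_min (ltnW h2) hn !andbT; apply: leq_trans h1.
    by rewrite ltn_exp2l // prednK.
  rewrite card_window //; last exact: geq_minr.
  apply: Rle_trans (hC _ _ p0 lx) _; set x := minn _ _ in lx *.
  have x0 : (0 < x)%N by apply: leq_trans lx.
  have lxn : ln (INR x) <= ln (INR n) by apply: ln_INR_le => //; exact: geq_minr.
  have lx4 : ln (INR x) - ln (INR (2 ^ i.-1)) <= ln 4.
    have : ln (INR x) <= ln (INR (4 * 2 ^ i.-1)).
      apply: ln_INR_le => //; apply: leq_trans (geq_minl _ _) _.
      by rewrite -{1}(prednK i0) !expnS mulnA.
    rewrite mult_INR ln_mult; [|by apply: INR_gt0|by apply: INR_gt0].
    by rewrite (_ : INR 4 = 4) /=; lra.
  have lxx := ln_INR_le p0 lx; have lx0 := ln_INR_ge0 x.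
  have q1 : (1 + ln (INR x)) ^ k <= Lm by apply: pow_incr; lra.
  have q0 : 0 <= (1 + ln (INR x)) ^ k by apply: pow_le; lra.
  apply: Rle_trans (_ : C * (1 + ln 4) * Lm <= _); last by rewrite /D; nra.
  apply: Rmult_le_compat => //; first by apply: Rmult_le_pos; lra.
  by apply: Rmult_le_compat_l; lra.
rewrite -(big_distrr (2 * D * Lm)) -[X in X <= _]/(Rmult _ _).
have h4 : \big[Rplus/0]_(i < n.+1) Rmin (r * 2 ^ i) (/ (r * 2 ^ i)) <= 4.
  apply: Rle_trans (trunc_sum _ r0) _; case: Rle_dec => h /=; last lra.
  have : / r <= / 1 by apply: Rinv_le_contravar; lra.
  by rewrite /Rdiv Rinv_1; lra.
have : 2 * D * Lm * \big[Rplus/0]_(i < n.+1) Rmin (r * 2 ^ i) (/ (r * 2 ^ i)) <= 2 * D * Lm * 4.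
  apply: Rmult_le_compat_l => //; rewrite /D; nra.
by rewrite -/D => h5; apply: Rle_trans h5 _; lra.
Qed.

Lemma S_moment : exists C1, 0 < C1 /\ forall (n j : nat) r, (0 < n)%N -> 0 < r ->
  \big[Rplus/0]_(h < n.+1 | S h) (INR h ^ j.+1 * exp (- (r * INR h))) <=
  INR j.+2`! * C1 * (1 + ln (INR n)) ^ k / r ^ j.+1.
Proof.
have [C1 [C10 hC]] := S_sum_min; exists C1; split=> // n j r n0 r0.
have rj : 0 < r ^ j.+1 by apply: pow_lt.
apply: (Rmult_le_reg_l (r ^ j.+1)) => //.
rewrite (_ : r ^ j.+1 * (_ / _) = INR j.+2`! * (C1 * (1 + ln (INR n)) ^ k)); last first.
  by field; lra.
rewrite big_distrr -[X in X <= _]/(\big[Rplus/0]_(h < n.+1 | S h) _).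
apply: Rle_trans (_ : INR j.+2`! *
   \big[Rplus/0]_(h < n.+1 | S h) Rmin (r * INR h) (/ (r * INR h)) <= _); last first.
  by apply: Rmult_le_compat_l; [exact: pos_INR | exact: hC].
rewrite big_distrr; apply: rsum_le => h Sh.
rewrite -[X in X <= _]/(Rmult _ (Rmult _ _)) -[X in _ <= X]/(Rmult _ _) -Rmult_assoc.
rewrite -Rpow_mult_distr; apply: pow_exp_min.
by apply: Rmult_lt_0_compat => //; apply: INR_gt0; apply: S_gt0.
Qed.

Variables (i0 i1 : 'I_m).
Hypothesis i01 : i0 <> i1.
Let P := p i0.
Let Q := p i1.

Lemma cPQ : coprime P Q. Proof. exact: hcop. Qed.

(** As 6 is even, reduction modulo 6 keeps the parity of [vp P h + vp Q h], so every class of [cls]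
    lies in one half of [S]. *)
Definition par (h : nat) : bool := odd (cls P Q h).

Lemma par_mul h : (0 < h)%N -> par (P * h) = ~~ par h.
Proof.
move=> h0; have cQP : coprime Q P by rewrite coprime_sym cPQ.
rewrite /par /cls vp_mul ?hp1 // vp_coprime ?hp1 //; last exact: ltnW (hp1 i0).
by rewrite !odd_mod //= !addSn.
Qed.

Lemma cnt_window : exists (Rr : nat) c0, (1 < Rr)%N /\ 0 < c0 /\
  exists x0, forall x, (x0 <= x)%N ->
  c0 * ln (INR x) ^ k <= INR (cnt x) - INR (cnt (x %/ Rr)).
Proof. exact: cS_lower cbb size_bases_k. Qed.

(* Multiplication by [P] flips the parity, so each parity class holds at least half of a window. *)
Lemma par_window : exists (Rr : nat) c0, (1 < Rr)%N /\ 0 < c0 /\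
  exists x0, forall (n x : nat) (e : bool), (x0 <= x)%N -> (P * x <= n)%N ->
  c0 * ln (INR x) ^ k <=
  INR #|[pred h : 'I_n.+1 | [&& S h, par h == e & (x %/ Rr < h <= P * x)%N]]|.
Proof.
have [Rr [c0 [R1 [c00 [x0 hx0]]]]] := cnt_window.
exists Rr, (c0 / 2); split=> //; split; first lra.
exists x0 => n x e xx0 Pxn.
have P1 : (1 < P)%N := hp1 i0.
have xPx : (x <= P * x)%N by rewrite leq_pmull // ltnW.
have xn : (x <= n)%N := leq_trans xPx Pxn.
have := hx0 _ xx0; rewrite -(@card_window n x (x %/ Rr)) ?leq_div //.
set W := [pred h : 'I_n.+1 | _]; set G := [pred h : 'I_n.+1 | _].
suff : (#|W| <= #|G| + #|G|)%N.
  by move/INR_leq; rewrite plus_INR; lra.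
pose W1 := [pred h : 'I_n.+1 | W h && (par h == e)].
pose W2 := [pred h : 'I_n.+1 | W h && (par h != e)].
have -> : #|W| = (#|W1| + #|W2|)%N.
  rewrite -cardUI [X in (_ + X)%N](_ : _ = 0%N) ?addn0.
    by apply: eq_card => h; rewrite !inE -andb_orr orbN andbT.
  by apply: eq_card0 => h; rewrite !inE; case: eqP; rewrite ?andbF.
apply: leq_add.
  apply: subset_leq_card; apply/subsetP => h; rewrite !inE => /andP [/andP [-> /andP [-> hx]] ->].
  by rewrite (leq_trans hx xPx).
pose f (h : 'I_n.+1) : 'I_n.+1 := inord (P * h).
have fE h : W h -> f h = (P * h)%N :> nat.
  case/andP => Sh /andP [_ hx]; rewrite /f inordK // ltnS.
  by apply: leq_trans Pxn; rewrite leq_mul2l hx orbT.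
have fi : {in W2 &, injective f}.
  move=> h h' /andP [/fE e1 _] /andP [/fE e2 _] /(congr1 (@nat_of_ord _)).
  by rewrite e1 e2 => /eqP; rewrite eqn_pmul2l ?(ltnW P1) // => /eqP/val_inj.
rewrite -(card_in_image fi); apply: subset_leq_card; apply/subsetP => h.
case/imageP => h' /andP [Wh' pe] ->; rewrite !inE (fE _ Wh').
case/andP: Wh' => Sh' /andP [h1 h2].
rewrite S_mul // par_mul ?S_gt0 // leq_mul2l h2 orbT andbT /=.
rewrite (leq_trans h1) ?leq_pmull ?(ltnW P1) // andbT.
by move: pe; case: (par h'); case: (e).
Qed.

End Model.

(** * Tilted weights and the saddle point *)

Section Weights.
Variables (d : nat) (S : pred nat) (r : R).
Hypotheses (hd : (2 <= d)%N) (r0 : 0 <= r).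

Definition Zh (h : nat) : R := \big[Rplus/0]_(j < d) exp (- (r * INR (j * h))).
(* Digits off [S] are forced to be 0. *)
Definition wS (n : nat) (h : 'I_n.+1) (j : 'I_d) : R :=
  if S h then exp (- (r * INR (j * h))) / Zh h else indic (val j == 0%N).

Definition jd0 : 'I_d := Ordinal (ltnW hd).
Definition jd1 : 'I_d := Ordinal hd.

Lemma d_gt0 : 0 < INR d. Proof. by apply: INR_gt0; apply: ltnW. Qed.

Lemma Zh_ge1 h : 1 <= Zh h.
Proof.
rewrite /Zh (bigD1 jd0) //= ?mul0n Rmult_0_r Ropp_0 exp_0.
rewrite -[X in X <= _]Rplus_0_r; apply: Rplus_le_compat_l.
by apply: rsum_ge0 => j _; left; apply: exp_pos.
Qed.

Lemma exp_le1 x : x <= 0 -> exp x <= 1.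
Proof. by case=> [h|->]; [rewrite -exp_0; left; apply: exp_increasing | rewrite exp_0; lra]. Qed.

Lemma exp_le x y : x <= y -> exp x <= exp y.
Proof. by case=> [h|->]; [left; apply: exp_increasing | lra]. Qed.

Lemma Zh_le_d h : Zh h <= INR d.
Proof.
apply: Rle_trans (_ : \big[Rplus/0]_(j < d) 1 <= _); last first.
  by rewrite rsum_const card_ord; lra.
apply: rsum_le => j _; apply: exp_le1.
by have := Rmult_le_pos _ _ r0 (pos_INR (j * h)); lra.
Qed.

Variable n : nat.
Notation w := (@wS n).

Lemma wS_ge0 (h : 'I_n.+1) (j : 'I_d) : 0 <= w h j.
Proof.
rewrite /wS; case: (S h); last by rewrite /indic; case: ifP => _; lra.
apply: Rmult_le_pos; first by left; apply: exp_pos.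
by left; apply: Rinv_0_lt_compat; have := Zh_ge1 h; lra.
Qed.

Lemma wS_sum1 (h : 'I_n.+1) : \big[Rplus/0]_j w h j = 1.
Proof.
rewrite /wS; case: (S h).
  rewrite -big_distrl -[LHS]/(Zh h * / Zh h) Rinv_r //; have := Zh_ge1 h; lra.
rewrite (bigD1 jd0) //= /indic /= big1 ?Rplus_0_r // => j.
by rewrite -val_eqE /=; case: eqP.
Qed.

Lemma wS_le (h : 'I_n.+1) (j : 'I_d) : S h -> w h j <= exp (- (r * INR (j * h))).
Proof.
move=> Sh; rewrite /wS Sh -[X in _ <= X]Rmult_1_r.
apply: Rmult_le_compat_l; first by left; apply: exp_pos.
by rewrite -Rinv_1; apply: Rinv_le_contravar; [lra | exact: Zh_ge1].
Qed.

Lemma wS_ge (h : 'I_n.+1) (j : 'I_d) : S h -> exp (- (r * INR (j * h))) / INR d <= w h j.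
Proof.
move=> Sh; rewrite /wS Sh; apply: Rmult_le_compat_l; first by left; apply: exp_pos.
by apply: Rinv_le_contravar (Zh_le_d h); have := Zh_ge1 h; lra.
Qed.

Lemma wS_prod (h : 'I_n.+1) : S h -> r * INR h <= 1 ->
  exp (-1) / INR d ^ 2 <= w h jd0 * w h jd1.
Proof.
move=> Sh rh; have d0 := d_gt0; have i0 : 0 < / INR d by apply: Rinv_0_lt_compat.
have := wS_ge jd0 Sh; have := wS_ge jd1 Sh; rewrite /= ?mul0n mul1n ?Rmult_0_r Ropp_0 exp_0 => h1 h0.
have h1' : exp (-1) / INR d <= w h jd1.
  by apply: Rle_trans h1; apply: Rmult_le_compat_r; [lra | apply: exp_le; lra].
have e0 := exp_pos (-1).
rewrite (_ : exp (-1) / INR d ^ 2 = 1 / INR d * (exp (-1) / INR d)); last by field; lra.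
by apply: Rmult_le_compat => //; apply: Rmult_le_pos; lra.
Qed.

(** All unnormalised weights lie in [[exp(-d r h), 1]], and hence so does their mean [Zh / d]. *)
Lemma wS_near (h : 'I_n.+1) (j : 'I_d) : S h -> exp (- (INR d * (r * INR h))) / INR d <= w h j <=
  exp (INR d * (r * INR h)) / INR d.
Proof.
move=> Sh; have d0 := d_gt0; have i0 : 0 < / INR d by apply: Rinv_0_lt_compat.
have rh : 0 <= r * INR h by apply: Rmult_le_pos => //; exact: pos_INR.
have bj (j' : 'I_d) : exp (- (INR d * (r * INR h))) <= exp (- (r * INR (j' * h))).
  apply: exp_le; rewrite mult_INR; have jd : INR j' <= INR d by apply: INR_leq; apply: ltnW.
  have := Rmult_le_compat_r _ _ _ rh jd; lra.
split.
  by apply: Rle_trans (wS_ge _ Sh); apply: Rmult_le_compat_r; [lra | exact: bj].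
have Zl : INR d * exp (- (INR d * (r * INR h))) <= Zh h.
  rewrite -{1}(card_ord d) -(rsum_const xpredT); apply: rsum_le => j' _; exact: bj.
have e0 := exp_pos (- (INR d * (r * INR h))).
rewrite /wS Sh; apply: Rle_trans (_ : 1 / (INR d * exp (- (INR d * (r * INR h)))) <= _).
  apply: Rmult_le_compat; first by left; apply: exp_pos.
  - by left; apply: Rinv_0_lt_compat; have := Zh_ge1 h; lra.
  - apply: exp_le1; have := Rmult_le_pos _ _ r0 (pos_INR (j * h)); lra.
  - by apply: Rinv_le_contravar => //; apply: Rmult_lt_0_compat.
right; rewrite exp_Ropp; field; split; first lra.
by have := exp_pos (INR d * (r * INR h)); lra.
Qed.

Definition digit_mean (h : 'I_n.+1) : R := \big[Rplus/0]_(j < d) (w h j * INR j).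
Definition total_mean : R := \big[Rplus/0]_(h < n.+1 | S h) (INR h * digit_mean h).

Lemma digit_mean_le (h : 'I_n.+1) : S h -> digit_mean h <= INR d ^ 2 * exp (- (r * INR h)).
Proof.
move=> Sh; have d0 := d_gt0.
rewrite (_ : INR d ^ 2 * _ = INR #|'I_d| * (exp (- (r * INR h)) * INR d)); last first.
  by rewrite card_ord; ring.
rewrite -(rsum_const xpredT); apply: rsum_le => j _.
case: (posnP j) => j0.
  rewrite j0 /= Rmult_0_r; apply: Rmult_le_pos; [left; exact: exp_pos | lra].
apply: Rmult_le_compat; [exact: wS_ge0 | exact: pos_INR | | by apply: INR_leq; apply: ltnW].
apply: Rle_trans (wS_le _ Sh) _; apply: exp_le; apply: Ropp_le_contravar.
by apply: Rmult_le_compat_l => //; apply: INR_leq; rewrite leq_pmull.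
Qed.

Lemma digit_mean_ge (h : 'I_n.+1) : S h -> exp (- (r * INR h)) / INR d <= digit_mean h.
Proof.
move=> Sh; rewrite /digit_mean (bigD1 jd1) //=.
have h1 := wS_ge jd1 Sh; rewrite /= mul1n in h1.
apply: Rle_trans h1 _; rewrite -[X in X <= _]Rplus_0_r Rmult_1_r; apply: Rplus_le_compat_l.
by apply: rsum_ge0 => j _; apply: Rmult_le_pos; [exact: wS_ge0 | exact: pos_INR].
Qed.

End Weights.

(** The tilted weight of a representation of [n] is [exp(-r n)] over the total partition function,
    the same for all of them, whatever [r] is; digit vectors that do not vanish off [S] have weight
    0. Uniform averages thus become conditional expectations under a product law, with [r] still
    free. *)
Lemma rep_sum (d m n : nat) (p : 'I_m -> nat) (r : R) (hd : (2 <= d)%N) :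
  exists K, 0 < K /\ forall F : {ffun 'I_n.+1 -> 'I_d} -> R,
  \big[Rplus/0]_(a : {ffun 'I_n.+1 -> 'I_d} | is_rep d m p n a) F a =
  K * Ex (@wS d (inSb m p) r n) (fun a => F a * indic (XG xpredT a == n)).
Proof.
set S := inSb m p; set w := @wS d S r n.
pose Zt := \big[Rmult/1]_(h < n.+1 | S h) Zh d r h.
have Zt0 : 0 < Zt by apply: rprod_gt0 => h _; have := Zh_ge1 r hd h; lra.
exists (Zt * exp (r * INR n)); split; first by apply: Rmult_lt_0_compat => //; exact: exp_pos.
move=> F; rewrite rsum_ind /Ex big_distrr; apply: eq_bigr => a _.
rewrite -[RHS]/(_ * (wt w a * _)) /is_rep.
case: forallP => /= [hv|hv]; last first.
  rewrite /indic Rmult_0_l; have [h hh] : exists h : 'I_n.+1, ~~ (~~ S h ==> (val (a h) == 0%N)).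
    by apply/existsP; rewrite -negb_forall; apply/forallP => h; apply: hv => h'; exact: h.
  suff -> : wt w a = 0 by ring.
  rewrite /wt (bigD1 h) //= /w /wS; move: hh; rewrite negb_imply => /andP [/negbTE -> /negbTE ->].
  by rewrite /indic Rmult_0_l.
have {}hv (h : 'I_n.+1) : ~~ S h ==> (val (a h) == 0%N) := hv h.
have -> : (\sum_(h < n.+1) a h * h)%N = XG xpredT a by [].
rewrite /indic; case: eqP => hX; last by ring.
have : wt w a = exp (- (r * INR n)) / Zt; last first.
  move=> ->; rewrite exp_Ropp; field; split; last lra.
  by have := exp_pos (r * INR n); lra.
have -> : wt w a = \big[Rmult/1]_(h < n.+1 | S h) (exp (- (r * INR (a h * h))) * / Zh d r h).
  rewrite /wt [RHS]big_mkcond; apply: eq_bigr => h _; rewrite /w /wS.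
  by have := hv h; case: (S h) => //= ->.
rewrite big_split -[LHS]/(Rmult _ _) rprod_exp rsum_opp; congr (exp (- _) * _).
  rewrite -[X in _ = _ * INR X]hX /XG INR_sum big_distrr big_mkcond; apply: eq_bigr => h _ /=.
  by have := hv h; case: (S h) => //= /eqP ->; rewrite /= Rmult_0_r.
rewrite /Zt; have nz h : Zh d r h <> 0 by have := Zh_ge1 r hd h; lra.
elim/big_ind2: _ => [|x y z t -> ->|//]; first by rewrite Rinv_1.
by rewrite Rinv_mult.
Qed.

Lemma continuity_pt_sum (I : Type) (s : seq I) (P : pred I) (F : I -> R -> R) x :
  (forall i, P i -> continuity_pt (F i) x) ->
  continuity_pt (fun r => \big[Rplus/0]_(i <- s | P i) F i r) x.
Proof.
move=> h; elim: s => [|i s ih].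
  apply: (continuity_pt_ext (fun _ => 0)); first by move=> r; rewrite big_nil.
  by apply: continuity_pt_const.
case Pi: (P i); last first.
  by apply: continuity_pt_ext ih => r; rewrite big_cons Pi.
apply: (continuity_pt_ext (fun r => F i r + \big[Rplus/0]_(i <- s | P i) F i r)).
  by move=> r; rewrite big_cons Pi.
by apply: continuity_pt_plus => //; apply: h.
Qed.

Lemma total_mean_continuous (d n : nat) (S : pred nat) (hd : (2 <= d)%N) :
  continuity (fun r => total_mean d S r n).
Proof.
move=> r; apply: continuity_pt_sum => h Sh.
have ce x : continuity_pt (fun r => exp (- (r * x))) r.
  apply: derivable_continuous_pt; apply: ex_derive_Reals_0.
  by auto_derive.
apply: continuity_pt_mult; first by apply: continuity_pt_const.
apply: continuity_pt_sum => j _.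
apply: continuity_pt_mult; last by apply: continuity_pt_const.
apply: (continuity_pt_ext (fun r => exp (- (r * INR (j * h))) / Zh d r h)).
  by move=> t; rewrite /wS Sh.
apply: continuity_pt_div => //; first by apply: continuity_pt_sum => j' _.
by have := Zh_ge1 r hd h; lra.
Qed.

Lemma total_mean_ivt (d n : nat) (S : pred nat) (hd : (2 <= d)%N) r1 r2 (c : R) :
  r1 <= r2 -> c <= total_mean d S r1 n -> total_mean d S r2 n <= c ->
  exists r, r1 <= r <= r2 /\ total_mean d S r n = c.
Proof.
move=> r12 h1 h2.
have cf : continuity (fun r => total_mean d S r n - c).
  move=> r; apply: continuity_pt_minus; first exact: total_mean_continuous.
  by apply: continuity_pt_const.
have [r [hr hr0]] := IVT_cor _ r1 r2 cf r12 ltac:(nra).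
by exists r; split=> //; lra.
Qed.

Section Saddle.
Variables (d m : nat) (p : 'I_m -> nat).
Hypotheses (hd : (2 <= d)%N) (hm : (2 <= m)%N)
  (hp1 : forall i : 'I_m, (1 < p i)%N)
  (hcop : forall i j : 'I_m, i <> j -> coprime (p i) (p j)).

Lemma ln_large (A : R) : exists N, forall n, (N <= n)%N -> (0 < n)%N /\ A <= ln (INR n).
Proof.
have [N hN] := INR_unbounded (exp A); exists N.+1 => n hn; split; first by apply: leq_trans hn.
rewrite -{1}[A]ln_exp; left; apply: ln_increasing; first exact: exp_pos.
by have := INR_leq (ltnW hn); lra.
Qed.

(** The mean is continuous in [r]. At [r = 1/n] the window [(n/Rr, n]] alone makes it exceed [n],
    since it has at least [c0 L^(m-1)] elements and [m >= 2]; at [r = d^2 (n+1)] it is below [n].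
    The upper bound on the solution follows from [n <= d^2 * sum h exp(-r h) = O(L^(m-1) / r)]. *)
Lemma saddle_exists : exists C2 N0, 0 < C2 /\ forall n, (N0 <= n)%N -> exists r,
  [/\ / INR n <= r, r <= C2 * (1 + ln (INR n)) ^ m.-1 / INR n &
      total_mean d (inSb m p) r n = INR n].
Proof.
have [Rr [c0 [R1 [c00 [x0 hw]]]]] := cnt_window hm hp1 hcop.
have [C1 [C10 hmom]] := S_moment hm hp1 hcop.
have d0 : 0 < INR d by apply: INR_gt0; apply: ltnW.
have R0 : 0 < INR Rr by apply: INR_gt0; apply: ltnW.
have e1 := exp_pos (-1).
have [N1 hN1] := ln_large (1 + INR Rr * INR d / (exp (-1) * c0)).
(* The factor [d^2] comes from [digit_mean_le], the rest from the first moment of [S_moment]. *)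
exists (INR d ^ 2 * (INR 2`! * C1)), (maxn x0 N1).
have f2 : 0 < INR 2`! by apply: INR_gt0.
split; first by apply: Rmult_lt_0_compat; [apply: pow_lt | apply: Rmult_lt_0_compat].
move=> n; rewrite geq_max => /andP [nx0 /hN1 [n0 hL]].
have nR : 0 < INR n by apply: INR_gt0.
have in0 : 0 < / INR n by apply: Rinv_0_lt_compat.
set S := inSb m p.
have Dc : 0 < INR Rr * INR d / (exp (-1) * c0).
  by apply: Rmult_lt_0_compat; [nra | apply: Rinv_0_lt_compat; nra].
have low : INR n <= total_mean d S (/ INR n) n.
  pose W := [pred h : 'I_n.+1 | S h && (n %/ Rr < h <= n)%N].
  apply: Rle_trans (_ : \big[Rplus/0]_(h | W h) (INR n / INR Rr * (exp (-1) / INR d)) <= _); last first.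
    apply: Rle_trans (_ : \big[Rplus/0]_(h < n.+1 | W h) (INR h * digit_mean d S (/ INR n) h) <= _); last first.
      apply: rsum_sub_le => h; last by case/andP.
      move=> Sh; apply: Rmult_le_pos; first exact: pos_INR.
      apply: Rle_trans (digit_mean_ge hd _ Sh); last lra.
      by apply: Rmult_le_pos; [left; exact: exp_pos | left; apply: Rinv_0_lt_compat].
    apply: rsum_le => h /andP [Sh /andP [h1 h2]]; apply: Rmult_le_compat.
    - by apply: Rmult_le_pos; [lra | left; apply: Rinv_0_lt_compat].
    - by apply: Rmult_le_pos; [lra | left; apply: Rinv_0_lt_compat].
    - apply: (Rmult_le_reg_r (INR Rr)) => //.
      rewrite /Rdiv Rmult_assoc Rinv_l ?Rmult_1_r; last lra.
      by rewrite -mult_INR; apply: INR_leq; apply: ltnW; rewrite -ltn_divLR // ltnW.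
    - apply: Rle_trans (digit_mean_ge hd _ Sh); last lra.
      apply: Rmult_le_compat_r; first by left; apply: Rinv_0_lt_compat.
      apply: exp_le; have : INR h <= INR n by apply: INR_leq.
      by move=> hh; have := Rmult_le_compat_l _ _ _ (Rlt_le _ _ in0) hh; rewrite Rinv_l; lra.
  rewrite rsum_const card_window ?leq_div //.
  have := hw n nx0; set D := _ - _ => hD.
  have hLk : ln (INR n) <= ln (INR n) ^ m.-1.
    rewrite -{1}[ln _]pow_1; apply: Rle_pow; first lra.
    by apply/leP; rewrite -ltnS prednK // ltnW.
  have hD2 : INR Rr * INR d / exp (-1) <= D.
    apply: Rle_trans hD; apply: Rle_trans (_ : c0 * (INR Rr * INR d / (exp (-1) * c0)) <= _).
      by right; field; lra.
    by apply: Rmult_le_compat_l; lra.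
  have h2 : 0 <= INR n / INR Rr * (exp (-1) / INR d).
    by apply: Rmult_le_pos; apply: Rmult_le_pos; try lra; left; apply: Rinv_0_lt_compat.
  apply: Rle_trans (Rmult_le_compat_r _ _ _ h2 hD2).
  by right; field; lra.
have high : total_mean d S (INR d ^ 2 * INR n.+1) n <= INR n.
  set r := INR d ^ 2 * INR n.+1.
  have r0 : 0 < r by apply: Rmult_lt_0_compat; [apply: pow_lt | apply: INR_gt0].
  apply: Rle_trans (_ : \big[Rplus/0]_(h < n.+1 | S h) (INR d ^ 2 / r) <= _).
    apply: rsum_le => h Sh.
    have := digit_mean_le hd (Rlt_le _ _ r0) Sh => h1.
    apply: Rle_trans (Rmult_le_compat_l _ _ _ (pos_INR h) h1) _.
    have rh : 0 <= r * INR h by apply: Rmult_le_pos; [lra | exact: pos_INR].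
    have := pow_exp_bound 1 rh; rewrite pow_1 => h2.
    rewrite (_ : INR h * _ = INR d ^ 2 / r * (r * INR h * exp (- (r * INR h)))); last by field; lra.
    rewrite -[X in _ <= X]Rmult_1_r; apply: Rmult_le_compat_l => //.
    by apply: Rmult_le_pos; [apply: pow_le; lra | left; apply: Rinv_0_lt_compat].
  rewrite rsum_const; have : INR #|[pred h : 'I_n.+1 | S h]| <= INR n.+1.
    by apply: INR_leq; rewrite -[X in (_ <= X)%N]card_ord; exact: max_card.
  have n1 : 0 < INR n.+1 by apply: INR_gt0.
  have -> : INR d ^ 2 / r = / INR n.+1 by rewrite /r; field; lra.
  have i1 : 0 < / INR n.+1 by apply: Rinv_0_lt_compat.
  move=> h1; have := Rmult_le_compat_r _ _ _ (Rlt_le _ _ i1) h1; rewrite Rinv_r; last lra.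
  have : 1 <= INR n by apply: (@INR_leq 1).
  by move=> *; apply: Rle_trans (_ : 1 <= _) => //; lra.
have r12 : / INR n <= INR d ^ 2 * INR n.+1.
  have : / INR n <= / 1.
    by apply: Rinv_le_contravar; [lra | apply: (@INR_leq 1)].
  have n1 : 1 <= INR n.+1 by apply: (@INR_leq 1).
  have d1 : 1 <= INR d by apply: (@INR_leq 1); apply: ltnW.
  by rewrite Rinv_1 => *; nra.
have [r [[hr1 hr2] hr]] := total_mean_ivt hd r12 low high.
exists r; split=> //.
have r0 : 0 < r by lra.
have h1 : INR n <= INR d ^ 2 * (INR 2`! * C1 * (1 + ln (INR n)) ^ m.-1 / r ^ 1).
  rewrite -{1}hr; apply: Rle_trans (Rmult_le_compat_l _ _ _ _ (hmom n 0%N r n0 r0)); last first.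
    by apply: pow_le; lra.
  rewrite big_distrr; apply: rsum_le => h Sh.
  rewrite -[X in _ <= X]/(Rmult _ (Rmult _ _)) pow_1 -Rmult_assoc (Rmult_comm (_ ^ 2)) Rmult_assoc.
  by apply: Rmult_le_compat_l; [exact: pos_INR | apply: digit_mean_le => //; lra].
apply: (Rmult_le_reg_r (INR n)) => //.
rewrite (_ : _ / INR n * INR n = INR d ^ 2 * (INR 2`! * C1 * (1 + ln (INR n)) ^ m.-1 / r ^ 1) * r).
  by have := Rmult_le_compat_r _ _ _ (Rlt_le _ _ r0) h1; lra.
by field; lra.
Qed.

End Saddle.

(** * Asymptotic comparisons and averages over frequencies *)

Definition ev (A : nat -> Prop) : Prop := exists N, forall n, (N <= n)%N -> A n.

Lemma ev_and A B : ev A -> ev B -> ev (fun n => A n /\ B n).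
Proof.
move=> [N hN] [M hM]; exists (maxn N M) => n; rewrite geq_max => /andP [h1 h2].
by split; [apply: hN | apply: hM].
Qed.

Lemma ev_imp (A B : nat -> Prop) : (forall n, A n -> B n) -> ev A -> ev B.
Proof. by move=> h [N hN]; exists N => n /hN /h. Qed.

Lemma ev_ge N : ev (fun n => (N <= n)%N).
Proof. by exists N. Qed.

Notation L n := (ln (INR n)).

Lemma ev_ln A : ev (fun n => A <= L n).
Proof. by have [N hN] := ln_large A; exists N => n /hN []. Qed.

Lemma exp_L n : (0 < n)%N -> exp (L n) = INR n.
Proof. by move=> n0; rewrite exp_ln //; apply: INR_gt0. Qed.

(** Powers of [L] against powers of [n]: [exp (c * L n)] is [n^c], and [exp (/ 2 * L n)] below is
    the square root of [n]. *)
Lemma ev_pow_exp (M c : R) (K : nat) : 0 < c -> ev (fun n => M * L n ^ K <= exp (c * L n)).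
Proof.
move=> c0; have cK : 0 < c ^ K.+1 by apply: pow_lt.
have icK : 0 < / c ^ K.+1 by apply: Rinv_0_lt_compat.
pose T := Rabs M * INR K.+1`! / c ^ K.+1.
apply: ev_imp (ev_ln (Rmax 1 T)) => n hn.
have L1 : 1 <= L n by apply: Rle_trans hn; exact: Rmax_l.
have LT : T <= L n by apply: Rle_trans hn; exact: Rmax_r.
have := pow_exp_bound K.+1 (x := c * L n) ltac:(nra).
rewrite Rpow_mult_distr => h; have e0 := exp_pos (c * L n).
have h2 : c ^ K.+1 * L n ^ K.+1 <= INR K.+1`! * exp (c * L n).
  have := Rmult_le_compat_r _ _ _ (Rlt_le _ _ e0) h.
  by rewrite Rmult_assoc -exp_plus Rplus_opp_l exp_0; lra.
have LK : 0 < L n ^ K by apply: pow_lt; lra.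
have f0 := pos_INR K.+1`!.
have h3 : M * L n ^ K <= Rabs M * L n ^ K.
  by apply: Rmult_le_compat_r; [lra | exact: Rle_abs].
apply: Rle_trans h3 _.
have a0 := Rabs_pos M.
have h4 : T * c ^ K.+1 = Rabs M * INR K.+1`! by rewrite /T; field; lra.
have fp : 0 < INR K.+1`! by apply: INR_gt0; apply: fact_gt0.
apply: (Rmult_le_reg_l (INR K.+1`!)) => //.
apply: Rle_trans h2.
have -> : INR K.+1`! * (Rabs M * L n ^ K) = T * c ^ K.+1 * L n ^ K by rewrite h4; ring.
rewrite -[L n ^ K.+1]/(L n * L n ^ K).
have : T * (c ^ K.+1 * L n ^ K) <= L n * (c ^ K.+1 * L n ^ K).
  by apply: Rmult_le_compat_r => //; apply: Rmult_le_pos; lra.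
by move=> *; lra.
Qed.

Lemma nat_floor z : 0 <= z -> exists x : nat, INR x <= z < INR x + 1.
Proof. by move=> z0; have [x hx] := nfloor_ex z z0; exists x. Qed.

(** The Cauchy profile replaces Gaussian integrals because its sum telescopes: [1 / (t^2 + (x+1)^2)]
    is at most [2 / ((t+x)(t+x+1))]. Frequency 0 gives [1/(2q+1)] and each side gives [2s]. *)
Lemma avg_cauchy q s : 0 < s ->
  avg q (fun y => / (1 + (y / s) ^ 2)) <= / INR (2 * q).+1 + 4 * s.
Proof.
move=> s0; rewrite /avg; set Q := INR (2 * q).+1.
have Q0 : 0 < Q by apply: INR_gt0.
pose t := Q * s; have t0 : 0 < t by apply: Rmult_lt_0_compat.
pose g (i : nat) := / (1 + (INR i / t) ^ 2).
have gs N : \big[Rplus/0]_(i < N) g i.+1 <= 2 * t - 2 * t ^ 2 / (t + INR N).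
  elim: N => [|N ih].
    by rewrite big_ord0 /= Rplus_0_r; right; field; lra.
  rewrite big_ord_recr; have N0 := pos_INR N.
  have hg : g N.+1 <= 2 * t ^ 2 / (t + INR N) - 2 * t ^ 2 / (t + INR N.+1).
    rewrite /g S_INR; set x := INR N in N0 *.
    have -> : 2 * t ^ 2 / (t + x) - 2 * t ^ 2 / (t + (x + 1)) =
      2 * t ^ 2 / ((t + x) * (t + (x + 1))) by field; lra.
    have -> : / (1 + ((x + 1) / t) ^ 2) = t ^ 2 / (t ^ 2 + (x + 1) ^ 2) by field; split; nra.
    rewrite (_ : 2 * t ^ 2 / _ = t ^ 2 * (2 / ((t + x) * (t + (x + 1))))); last by field; lra.
    apply: Rmult_le_compat_l; first by apply: pow_le; lra.
    rewrite (_ : 2 / _ = / (((t + x) * (t + (x + 1))) / 2)); last by field; lra.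
    have sq := pow2_ge_0 (t - (x + 1)); apply: Rinv_le_contravar; first by nra.
    by have : 0 <= t ^ 2 by [apply: pow2_ge_0]; nra.
  by apply: Rle_trans (Rplus_le_compat _ _ _ _ ih hg) _; lra.
have gs2 N : \big[Rplus/0]_(i < N) g i.+1 <= 2 * t.
  apply: Rle_trans (gs N) _; have N0 := pos_INR N.
  suff : 0 <= 2 * t ^ 2 / (t + INR N) by lra.
  by apply: Rmult_le_pos; [have := pow_le t 2; lra | left; apply: Rinv_0_lt_compat; lra].
have g0 i : 0 < g i by apply: Rinv_0_lt_compat; have := pow2_ge_0 (INR i / t); lra.
suff h : \big[Rplus/0]_(j < (2 * q).+1) / (1 + (freq q j / s) ^ 2) <= 1 + 4 * t.
  have iQ : 0 < / Q by apply: Rinv_0_lt_compat.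
  apply: Rle_trans (Rmult_le_compat_l _ _ _ (Rlt_le _ _ iQ) h) _.
  by rewrite /t; right; field; lra.
have fE (j : nat) : / (1 + (freq q j / s) ^ 2) = / (1 + ((INR j - INR q) / t) ^ 2).
  by congr (/ (1 + _ ^ 2)); rewrite /freq -/Q /t; field; lra.
rewrite (eq_bigr (fun j : 'I_(2 * q).+1 => / (1 + ((INR j - INR q) / t) ^ 2))) => [|j _ //].
rewrite -(big_mkord xpredT (fun j => / (1 + ((INR j - INR q) / t) ^ 2))).
have q2 : (q <= (2 * q).+1)%N by rewrite mul2n -addnn -addnS leq_addr.
rewrite (big_cat_nat _ q2) // -[X in X <= _]/(Rplus _ _) [X in _ + X <= _](_ : _ = 1 + \big[Rplus/0]_(i < q) g i.+1); last first.
  rewrite -{1}[q]add0n big_addn (_ : (2 * q).+1 - q = q.+1)%N; last first.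
    by rewrite mul2n -addnn -addSn addnK.
  rewrite big_mkord big_ord_recl; congr (_ + _).
    by rewrite add0n Rminus_eq_0 /Rdiv Rmult_0_l /= Rmult_0_l Rplus_0_r Rinv_1.
  apply: eq_bigr => i _; rewrite /g; congr (/ (1 + (_ / _) ^ 2)).
  by rewrite -[(0 + bump 0 i + q)%N]/(i.+1 + q)%N plus_INR; ring.
rewrite [X in X + _ <= _](_ : _ = \big[Rplus/0]_(i < q) g i.+1); last first.
  rewrite big_nat_rev big_mkord; apply: eq_bigr => i _; rewrite /g add0n.
  congr (/ (1 + _)); rewrite -[in RHS](pow2_abs) -[in LHS](pow2_abs); congr (_ ^ 2).
  rewrite (minus_INR q i.+1); last by apply/leP.
  rewrite -Rabs_Ropp; congr (Rabs _); rewrite /Rdiv; ring.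
have := gs2 q; lra.
Qed.

(** * Bounds for characteristic functions *)

Section Arcs.
Variables (d m : nat) (p : 'I_m -> nat).
Hypotheses (hd : (2 <= d)%N) (hm : (2 <= m)%N)
  (hp1 : forall i : 'I_m, (1 < p i)%N)
  (hcop : forall i j : 'I_m, i <> j -> coprime (p i) (p j)).
Variables (i0 i1 : 'I_m).
Hypothesis i01 : i0 <> i1.
Variable C2 : R.

Let S := inSb m p.
Let k := m.-1.
Let P := p i0.
Let Q := p i1.
Let pr := par p i0 i1.

(* The tilt [r] for which the tilted law has mean [n]. *)
Definition saddle (n : nat) (r : R) : Prop :=
  [/\ / INR n <= r, r <= C2 * (1 + L n) ^ k / INR n & total_mean d S r n = INR n].

Definition wr (n : nat) (r : R) : 'I_n.+1 -> 'I_d -> R := @wS d S r n.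
Definition Gp (n : nat) (e : bool) : pred 'I_n.+1 := fun h => S h && (pr h == e).
Arguments wr : clear implicits.
Arguments Gp : clear implicits.

Lemma wr_ge0 n r h j : 0 <= wr n r h j.
Proof. exact: wS_ge0. Qed.

Lemma wr_sum1 n r h : \big[Rplus/0]_j wr n r h j = 1.
Proof. exact: wS_sum1. Qed.

(** The bound of [wS_prod] for the weights of the digits 0 and 1 at elements with [r h <= 1]. *)
Definition dlow : R := exp (-1) / INR d ^ 2.

Lemma dlow_gt0 : 0 < dlow.
Proof.
apply: Rmult_lt_0_compat; first exact: exp_pos.
by apply: Rinv_0_lt_compat; apply: pow_lt; apply: INR_gt0; apply: ltnW.
Qed.

Lemma Lam_bounds n : 1 <= L n -> L n ^ k <= (1 + L n) ^ k <= 2 ^ k * L n ^ k.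
Proof.
by move=> h; split; [apply: pow_incr; lra | rewrite -Rpow_mult_distr; apply: pow_incr; lra].
Qed.

Lemma k_gt0 : (0 < k)%N.
Proof. by rewrite /k -ltnS prednK // ltnW. Qed.

Lemma ev_saddle_r : ev (fun n => forall r, saddle n r -> 0 < r /\ r * exp (/ 2 * L n) <= 1).
Proof.
have := ev_pow_exp (Rabs C2 * 2 ^ k) k (ltac:(lra) : 0 < / 2).
move/ev_and => /(_ _ (ev_ln 1)); move/ev_and => /(_ _ (ev_ge 1)).
apply: ev_imp => n [[h1 L1] n0] r [hr1 hr2 _].
have nR : 0 < INR n by apply: INR_gt0.
have in0 : 0 < / INR n by apply: Rinv_0_lt_compat.
split; first lra.
have [_ hL] := Lam_bounds L1.
have e0 := exp_pos (/ 2 * L n).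
have eE : exp (/ 2 * L n) * exp (/ 2 * L n) = INR n.
  by rewrite -exp_plus -{3}(exp_L n0); congr exp; field.
have p0 : 0 <= (1 + L n) ^ k by apply: pow_le; lra.
have hC : C2 * (1 + L n) ^ k <= exp (/ 2 * L n).
  apply: Rle_trans h1; apply: Rle_trans (_ : Rabs C2 * (1 + L n) ^ k <= _).
    by apply: Rmult_le_compat_r => //; exact: Rle_abs.
  by rewrite Rmult_assoc; apply: Rmult_le_compat_l => //; exact: Rabs_pos.
apply: Rle_trans (Rmult_le_compat_r _ _ _ (Rlt_le _ _ e0) hr2) _.
apply: (Rmult_le_reg_r (INR n)) => //.
rewrite (_ : _ / INR n * _ * INR n = C2 * (1 + L n) ^ k * exp (/ 2 * L n)); last by field; lra.
by rewrite Rmult_1_l -[X in _ <= X]eE; apply: Rmult_le_compat_r; lra.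
Qed.

Lemma far_small x : Rabs x <= / 2 -> far (Rabs x) x.
Proof.
move=> hx z; case: (Z.eq_dec z 0) => [->|nz]; first by rewrite Rminus_0_r; lra.
have := IZR_abs_ge1 nz; have := Rabs_triang_inv (IZR z) x.
by rewrite -(Rabs_Ropp (x - _)) Ropp_minus_distr; lra.
Qed.

(** Decay comes from a window of elements with [r h <= 1], where the digits 0 and 1 have weight
    bounded below, and with [|h y| <= 1/2], where [|h y|] is the distance to the nearest integer.
    Since [|y|] and [r] are at most [n^(-1/2)], the window lies above a constant times [n^(1/2)] and
    still has order [L^k] elements of each parity. *)
Lemma major_phi : exists c, 0 < c /\ ev (fun n => forall r, saddle n r -> forall e y,
  Rabs y * exp (/ 2 * L n) <= 1 ->
  Cmod (phi (wr n r) (Gp n e) y) <= exp (- (c * (1 + L n) ^ k * Rmin 1 ((y / r) ^ 2)))).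
Proof.
have [Rr [c0 [R1 [c00 [x0 hw]]]]] := par_window hm hp1 hcop i01.
have P1 : (1 < P)%N := hp1 i0.
have P0 : 1 < INR P by apply: (@INR_ltn 1).
have R0 : 1 < INR Rr by apply: (@INR_ltn 1).
have dl := dlow_gt0.
(* The window sits at some [x] with [ln x >= L/4 >= (1+L)/8], whence [8^k]; its elements exceed
   [x/Rr], and rounding and the halved minimum cost a factor 4 in [|h y|]. *)
pose c := 2 * dlow * (c0 / 8 ^ k * (/ (4 * INR Rr * INR P)) ^ 2).
have c80 : 0 < c0 / 8 ^ k.
  by apply: Rmult_lt_0_compat => //; apply: Rinv_0_lt_compat; apply: pow_lt; lra.
have RP0 : 0 < / (4 * INR Rr * INR P) by apply: Rinv_0_lt_compat; nra.
exists c; split.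
  apply: Rmult_lt_0_compat; first lra.
  by apply: Rmult_lt_0_compat => //; apply: pow_lt.
have := ev_saddle_r; move/ev_and => /(_ _ (ev_ge 1)).
move/ev_and => /(_ _ (ev_ln 1)); move/ev_and => /(_ _ (ev_ln (4 * ln (4 * INR P)))).
move/ev_and => /(_ _ (ev_ln (2 * ln (4 * INR P * (INR x0 + 1))))).
apply: ev_imp => n [[[[hr n0] L1] L2] L3] r sr e y hy.
have [r0 hr1] := hr r sr.
case: (Req_dec y 0) => [->|y0].
  rewrite /Rdiv Rmult_0_l pow_i; last by lia.
  by rewrite Rmin_right ?Rmult_0_r ?Ropp_0 ?exp_0; [apply: Cmod_phi_le1; [exact: wr_ge0 | exact: wr_sum1] | lra].
have ay : 0 < Rabs y by apply: Rabs_pos_lt.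
set E := exp (/ 2 * L n) in hr1 hy.
have E0 : 0 < E by apply: exp_pos.
(* The window ends at [P x], as [par_window] needs room for multiplication by [P]; hence the
   division by [P]. *)
pose z := Rmin (/ r) (/ (2 * Rabs y)) / INR P.
have zE : E / (2 * INR P) <= z.
  rewrite /z /Rdiv Rinv_mult -Rmult_assoc; apply: Rmult_le_compat_r.
    by left; apply: Rinv_0_lt_compat; lra.
  apply: Rmin_glb.
    apply: (Rmult_le_reg_r r) => //; rewrite Rinv_l; last lra.
    by nra.
  apply: (Rmult_le_reg_r (2 * Rabs y)); first lra.
  by rewrite Rinv_l; [lra | lra].
have E4 : 4 * INR P * (INR x0 + 1) <= E.
  rewrite -[X in X <= _]exp_ln; first by apply: exp_le; lra.
  by have := pos_INR x0 => *; nra.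
have X0 := pos_INR x0.
have z2 : 2 * (INR x0 + 1) <= z.
  apply: Rle_trans zE; apply: (Rmult_le_reg_r (2 * INR P)); first lra.
  by rewrite (_ : E / (2 * INR P) * (2 * INR P) = E); [lra | field; lra].
have [x [hx1 hx2]] := nat_floor (z := z) ltac:(lra).
have xz : z / 2 <= INR x by lra.
have xx0 : (x0 <= x)%N by apply/leP; apply: INR_le; lra.
have zP : z * INR P = Rmin (/ r) (/ (2 * Rabs y)) by rewrite /z; field; lra.
have PxH : INR (P * x) <= / r.
  rewrite mult_INR; apply: Rle_trans (_ : z * INR P <= _); first by nra.
  by rewrite zP; exact: Rmin_l.
have Pxy : INR (P * x) * Rabs y <= / 2.
  have h1 : INR (P * x) <= / (2 * Rabs y).
    rewrite mult_INR; apply: Rle_trans (_ : z * INR P <= _); first by nra.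
    by rewrite zP; exact: Rmin_r.
  apply: Rle_trans (Rmult_le_compat_r _ _ _ (Rlt_le _ _ ay) h1) _.
  by right; field; lra.
have nr : / r <= INR n.
  rewrite -[INR n]Rinv_inv; apply: Rinv_le_contravar; last by case: sr.
  by apply: Rinv_0_lt_compat; apply: INR_gt0.
have Pxn : (P * x <= n)%N by apply/leP; apply: INR_le; lra.
have lx : L n / 4 <= ln (INR x).
  have -> : L n / 4 = ln (exp (L n / 4)) by rewrite ln_exp.
  have : exp (L n / 4) <= INR x.
    apply: Rle_trans xz; apply: Rle_trans (_ : E / (4 * INR P) <= _); last first.
      by move: zE; rewrite /Rdiv !Rinv_mult; lra.
    apply: (Rmult_le_reg_r (4 * INR P)); first lra.
    rewrite /Rdiv [X in _ <= X]Rmult_assoc Rinv_l ?Rmult_1_r; last lra.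
    rewrite -{1}[4 * INR P]exp_ln; last lra.
    by rewrite -exp_plus; apply: exp_le; lra.
  case=> [h|->]; last lra.
  by left; apply: ln_increasing => //; exact: exp_pos.
pose W := [pred h : 'I_n.+1 | [&& S h, pr h == e & (x %/ Rr < h <= P * x)%N]].
have WG h : W h -> Gp n e h by case/and3P => h1 h2 _; rewrite /Gp h1.
apply: Rle_trans (Cmod_phi_sub (@wr_ge0 n r) (@wr_sum1 n r) y WG) _.
pose cc := (/ (4 * INR Rr * INR P)) ^ 2 * Rmin 1 ((y / r) ^ 2).
have Wh h : W h -> S h /\ r * INR h <= 1.
  case/and3P => Sh _ /andP [_ h2]; split=> //.
  have : INR h <= / r by apply: Rle_trans PxH; apply: INR_leq.
  by move=> h3; have := Rmult_le_compat_l _ _ _ (Rlt_le _ _ r0) h3; rewrite Rinv_r; lra.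
have m0 : 0 <= Rmin 1 ((y / r) ^ 2) by apply: Rmin_glb; [lra | exact: pow2_ge_0].
have bound := Cmod_phi_card (@wr_ge0 n r) (@wr_sum1 n r)
   (erefl : val (jd0 hd) = 0%N) (erefl : val (jd1 hd) = 1%N) (dl := dlow) (G := W) (c := cc) (y := y).
apply: Rle_trans (bound _ _ _) _.
- by move=> h /Wh [Sh rh]; apply: wS_prod => //; lra.
- lra.
- move=> h hWh; have /and3P [_ _ /andP [h1 h2]] := hWh.
  have hy2 : Rabs (INR h * y) <= / 2.
    rewrite Rabs_mult (Rabs_pos_eq (INR h)); last exact: pos_INR.
    by apply: Rle_trans Pxy; apply: Rmult_le_compat_r; [lra | apply: INR_leq].
  apply: Rle_trans (sin_sq_lower (Rabs_pos _) (far_small hy2)).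
  have hlow : / (4 * INR Rr * INR P) * Rmin 1 (Rabs y / r) <= Rabs (INR h * y).
    rewrite Rabs_mult (Rabs_pos_eq (INR h)); last exact: pos_INR.
    have hR : INR x <= INR h * INR Rr.
      by rewrite -mult_INR; apply: INR_leq; apply: ltnW; rewrite -ltn_divLR // ltnW.
    have hm2 : Rmin 1 (Rabs y / r) / 2 <= z * INR P * Rabs y.
      rewrite zP {2}/Rmin; case: Rle_dec => _ /=.
        by have := Rmin_r 1 (Rabs y / r); have : 0 <= Rabs y / r by [apply: Rmult_le_pos; [lra | left; apply: Rinv_0_lt_compat]]; rewrite /Rdiv; nra.
      have -> : / (2 * Rabs y) * Rabs y = / 2 by field; lra.
      by have := Rmin_l 1 (Rabs y / r); lra.
    have Rp : 0 < INR Rr * INR P by nra.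
    apply: (Rmult_le_reg_r (2 * INR Rr * INR P)); first lra.
    rewrite (_ : _ * _ * (2 * _ * _) = Rmin 1 (Rabs y / r) / 2); last by field; lra.
    apply: Rle_trans hm2 _.
    have : z <= 2 * (INR h * INR Rr) by lra.
    move=> hz; have := Rmult_le_compat_r (INR P * Rabs y) _ _ ltac:(nra) hz; lra.
  have mm : Rmin 1 ((y / r) ^ 2) <= (Rmin 1 (Rabs y / r)) ^ 2.
    have -> : (y / r) ^ 2 = (Rabs y / r) ^ 2.
      by rewrite /Rdiv !Rpow_mult_distr pow2_abs.
    have u0 : 0 <= Rabs y / r by apply: Rmult_le_pos; [lra | left; apply: Rinv_0_lt_compat].
    case: (Rle_dec 1 (Rabs y / r)) => h0.
      by rewrite (Rmin_left _ _ h0) pow1; exact: Rmin_l.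
    by rewrite (Rmin_right 1 (Rabs y / r)); [exact: Rmin_r | lra].
  apply: Rle_trans (_ : (/ (4 * INR Rr * INR P) * Rmin 1 (Rabs y / r)) ^ 2 <= _).
    by rewrite Rpow_mult_distr; apply: Rmult_le_compat_l => //; exact: pow2_ge_0.
  apply: pow_incr; split=> //; apply: Rmult_le_pos; first lra.
  by apply: Rmin_glb; [lra | apply: Rmult_le_pos; [lra | left; apply: Rinv_0_lt_compat]].
apply: exp_le; apply: Ropp_le_contravar.
have hcard := hw n x e xx0 Pxn.
have hc2 : c0 / 8 ^ k * (1 + L n) ^ k <= INR #|W|.
  apply: Rle_trans hcard; rewrite /Rdiv Rmult_assoc; apply: Rmult_le_compat_l; first lra.
  have -> : / 8 ^ k * (1 + L n) ^ k = ((1 + L n) / 8) ^ k.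
    by rewrite /Rdiv Rpow_mult_distr pow_inv Rmult_comm.
  by apply: pow_incr; lra.
have cc0 : 0 <= cc by apply: Rmult_le_pos => //; exact: pow2_ge_0.
rewrite /c (_ : _ * _ = 2 * dlow * (c0 / 8 ^ k * (1 + L n) ^ k * cc)); last first.
  by rewrite /cc; ring.
apply: Rmult_le_compat_l; first lra.
by apply: Rmult_le_compat_r.
Qed.

End Arcs.

Arguments saddle d {m} p C2 n r.
Arguments wr d {m} p n r.
Arguments Gp {m} p i0 i1 n e.

(** An integer version of [ln ln n], the scale of the chains in the direction of [Q]: by [exp_lnn] a
    multiple of it is long enough to save any power of [L], and by [pow_lnn] powers of [Q] of this
    length are only powers of [L]. *)
Definition lnn (n : nat) : nat := Z.to_nat (up (ln (L n))).

Lemma exp_INR_ln (K : nat) x : 0 < x -> exp (INR K * ln x) = x ^ K.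
Proof.
move=> x0; elim: K => [|K ih]; first by rewrite /= Rmult_0_l exp_0.
by rewrite S_INR Rmult_plus_distr_r Rmult_1_l exp_plus ih exp_ln //= Rmult_comm.
Qed.

Lemma nat_above (x : R) : exists K : nat, x <= INR K.
Proof. by have [N hN] := INR_unbounded x; exists N; lra. Qed.

Lemma lnn_bounds : ev (fun n => 1 <= ln (L n) /\ ln (L n) <= INR (lnn n) <= ln (L n) + 1).
Proof.
apply: ev_imp (ev_ln (exp 1)) => n hn.
have l1 : 1 <= ln (L n).
  rewrite -{1}[1]ln_exp; case: hn => [h|<-]; last lra.
  by left; apply: ln_increasing => //; exact: exp_pos.
split=> //; have [h1 h2] := archimed (ln (L n)).
have u0 : (0 <= up (ln (L n)))%Z by apply: le_IZR; lra.
have -> : INR (lnn n) = IZR (up (ln (L n))) by rewrite (INR_IZR_INZ (lnn n)) /lnn Z2Nat.id.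
by lra.
Qed.

Lemma ev_L_gt1 : ev (fun n => 1 <= L n). Proof. exact: ev_ln. Qed.

Lemma pow_lnn (Qn C0 : nat) : (0 < Qn)%N -> exists K', ev (fun n => INR Qn ^ (C0 * lnn n) <= L n ^ K').
Proof.
move=> Q0; have lq : 0 <= ln (INR Qn) by apply: ln_INR_ge0.
have [K' hK] := nat_above (2 * (INR C0 * ln (INR Qn))).
exists K'; apply: ev_imp (ev_and lnn_bounds ev_L_gt1) => n [[l1 [_ l2]] L1].
rewrite -exp_INR_ln; last exact: INR_gt0.
rewrite -exp_INR_ln; last lra.
apply: exp_le; rewrite mult_INR.
have c0 := pos_INR C0; have cq : 0 <= INR C0 * ln (INR Qn) by apply: Rmult_le_pos.
have h1 : INR (lnn n) <= 2 * ln (L n) by lra.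
have := Rmult_le_compat_l _ _ _ cq h1.
have := Rmult_le_compat_r (ln (L n)) _ _ ltac:(lra) hK.
by move=> *; lra.
Qed.

Lemma exp_lnn (c : R) (K : nat) : 0 < c ->
  exists C0, ev (fun n => exp (- (c * INR (C0 * lnn n))) <= / L n ^ K).
Proof.
move=> c0; have [C0 hC] := nat_above (INR K / c).
exists C0; apply: ev_imp (ev_and lnn_bounds ev_L_gt1) => n [[l1 [l2 _]] L1].
rewrite -exp_INR_ln; last lra.
rewrite -exp_Ropp; apply: exp_le; apply: Ropp_le_contravar; rewrite mult_INR.
have h1 : INR K <= c * INR C0.
  by rewrite (_ : INR K = c * (INR K / c)); [apply: Rmult_le_compat_l; lra | field; lra].
rewrite -Rmult_assoc; apply: Rmult_le_compat => //; [exact: pos_INR | lra].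
Qed.

Lemma freq_half q j : (j < (2 * q).+1)%N -> Rabs (freq q j) <= / 2.
Proof.
move=> hj; rewrite /freq; have Q0 : 0 < INR (2 * q).+1 by apply: INR_gt0.
rewrite /Rdiv Rabs_mult (Rabs_pos_eq (/ _)); last by left; apply: Rinv_0_lt_compat.
apply: (Rmult_le_reg_r (INR (2 * q).+1)) => //; rewrite Rmult_assoc Rinv_l ?Rmult_1_r; last lra.
have : INR j <= INR (2 * q) by apply: INR_leq.
rewrite S_INR mult_INR; have := pos_INR j; have := pos_INR q.
rewrite (_ : INR 2 = 2) // => *; apply: Rabs_le; lra.
Qed.

Definition gei (a b : R) : R := if Rle_dec a b then 1 else 0.

Section MinorArcs.
Variables (d m : nat) (p : 'I_m -> nat).
Hypotheses (hd : (2 <= d)%N) (hm : (2 <= m)%N)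
  (hp1 : forall i : 'I_m, (1 < p i)%N)
  (hcop : forall i j : 'I_m, i <> j -> coprime (p i) (p j)).
Variables (i0 i1 : 'I_m).
Hypothesis i01 : i0 <> i1.
Variable C2 : R.
Hypothesis C20 : 0 < C2.

Let S := inSb m p.
Let k := m.-1.
Let P := p i0.
Let Q := p i1.
Let pr := par p i0 i1.

Notation saddle := (saddle d p C2).
Notation wr := (wr d p).

Definition zset (n : nat) (e : bool) (Kb : nat) : pred 'I_n.+1 :=
  fun h => [&& pq_pow P Q h, vp Q h < Kb * lnn n & pr h == e]%N.
Arguments zset : clear implicits.

(** The integer [x] is the integral part of [1/r]: up to [x] the digits 0 and 1 have weight bounded
    below, and the last bound says that [x] is smaller than [n] only by a power of [L]. *)
Lemma saddle_floor : ev (fun n => forall r, saddle n r ->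
  0 < r /\ exists x : nat, [/\ (x <= n)%N, INR x <= / r, / r <= 2 * INR x &
     INR n <= C2 * 2 ^ k.+1 * L n ^ k * INR x]).
Proof.
have := ev_saddle_r d p C2; move/ev_and => /(_ _ ev_L_gt1).
move/ev_and => /(_ _ (ev_ge 1)).
move/ev_and => /(_ _ (ev_ln (2 * ln 2))).
apply: ev_imp => n [[[hr L1] n0] L2] r sr; have [r0 hr1] := hr r sr.
split=> //; have ir : 0 < / r by apply: Rinv_0_lt_compat.
have [x [hx1 hx2]] := nat_floor (Rlt_le _ _ ir).
have nR : 0 < INR n by apply: INR_gt0.
have nr : / r <= INR n.
  rewrite -[INR n]Rinv_inv; apply: Rinv_le_contravar; last by case: sr.
  by apply: Rinv_0_lt_compat.
have r2 : 2 <= / r.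
  apply: (Rmult_le_reg_r r) => //; rewrite Rinv_l; last lra.
  have : 2 <= exp (/ 2 * L n) by rewrite -{1}[2]exp_ln; [apply: exp_le|]; lra.
  by nra.
exists x; split=> //; first by apply/leP; apply: INR_le; lra.
  lra.
have hr2 : r <= C2 * (1 + L n) ^ k / INR n by case: sr.
have hL : (1 + L n) ^ k <= 2 ^ k * L n ^ k := proj2 (Lam_bounds m L1).
have Lk : 0 < L n ^ k by apply: pow_lt; lra.
have h1 : r * INR n <= C2 * (2 ^ k * L n ^ k).
  apply: Rle_trans (_ : C2 * (1 + L n) ^ k <= _); last by apply: Rmult_le_compat_l; lra.
  have := Rmult_le_compat_r _ _ _ (Rlt_le _ _ nR) hr2.
  by rewrite /Rdiv Rmult_assoc Rinv_l; lra.
have := Rmult_le_compat_r _ _ _ (Rlt_le _ _ ir) h1.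
rewrite (_ : r * INR n * / r = INR n); last by field; lra.
move=> h2; apply: Rle_trans h2 _.
rewrite (_ : C2 * 2 ^ k.+1 * L n ^ k * INR x = C2 * (2 ^ k * L n ^ k) * (2 * INR x)); last by rewrite /=; ring.
apply: Rmult_le_compat_l; last lra.
by apply: Rmult_le_pos; [lra | apply: Rmult_le_pos; [apply: pow_le; lra | lra]].
Qed.

Lemma wr_low n r (h : 'I_n.+1) : 0 < r -> S h -> INR h <= / r ->
  dlow d <= wr n r h (jd0 hd) * wr n r h (jd1 hd).
Proof.
move=> r0 Sh hr; apply: wS_prod => //; first lra.
by have := Rmult_le_compat_l _ _ _ (Rlt_le _ _ r0) hr; rewrite Rinv_r; lra.
Qed.

(** [A] is taken maximal with [P^A Q^(6B) <= x]. As [Q^(6B)] and [n/x] are powers of [L], [P^A] is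
    [n] up to a power of [L], and by [chain_prob] point masses are essentially [P^(-A)]. *)
Lemma chain_collision : exists KC C0, ev (fun n => forall r, saddle n r -> exists A,
  forall c, (c < 6)%N ->
  (forall j, Ex (wr n r) (fun a => indic (XG (chain P Q A (C0 * lnn n) c) a == j)) <= L n ^ KC / INR n)).
Proof.
have P1 : (1 < P)%N := hp1 i0; have Q1 : (1 < Q)%N := hp1 i1.
have P0 : 2 <= INR P by apply: (@INR_leq 2).
have dl := dlow_gt0 hd.
have cc0 : 0 < 2 * dlow d * (/ INR P) ^ 2.
  by apply: Rmult_lt_0_compat; [lra | apply: pow_lt; apply: Rinv_0_lt_compat; lra].
(* With the exponent 2, the [A = O(L)] factors [1 + P L^(-2)] in [chain_prob] have a product at most
   3. *)
have [C0 hC0] := exp_lnn 2 cc0.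
have [K1 hK1] := pow_lnn (6 * C0) (ltnW Q1).
exists (K1 + k + 1)%N, C0.
have := saddle_floor; move/ev_and => /(_ _ hC0); move/ev_and => /(_ _ hK1).
move/ev_and => /(_ _ (ev_ge 1)); move/ev_and => /(_ _ ev_L_gt1).
move/ev_and => /(_ _ (ev_ln (2 * INR P))).
move/ev_and => /(_ _ (ev_ln (6 * INR P * (C2 * 2 ^ k.+1)))).
move/ev_and => /(_ _ (ev_pow_exp (C2 * 2 ^ k.+1) (k + K1) (ltac:(lra) : 0 < 1))).
apply: ev_imp => n [[[[[[[hfl hC] hK] n0] L1] L2] L3] L4] r sr.
have [r0 [x [xn hx1 hx2 hx3]]] := hfl r sr.
have nR : 0 < INR n by apply: INR_gt0.
have LK1 : 0 < L n ^ K1 by apply: pow_lt; lra.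
have Lk : 0 < L n ^ k by apply: pow_lt; lra.
set B := (C0 * lnn n)%N in hC *.
have hQB : INR (Q ^ (6 * B)) <= L n ^ K1 by rewrite INR_exp /B mulnA.
have QB0 : (0 < Q ^ (6 * B))%N by rewrite expn_gt0 ltnW.
have QBR : 0 < INR (Q ^ (6 * B)) by apply: INR_gt0.
have D0 : 0 < C2 * 2 ^ k.+1 * L n ^ k.
  by apply: Rmult_lt_0_compat => //; apply: Rmult_lt_0_compat => //; apply: pow_lt; lra.
have QBx : (Q ^ (6 * B) <= x)%N.
  apply/leP; apply: INR_le; apply: (Rmult_le_reg_l (C2 * 2 ^ k.+1 * L n ^ k)) => //.
  apply: Rle_trans hx3; rewrite Rmult_1_l (exp_L n0) in L4; apply: Rle_trans L4.
  apply: Rle_trans (_ : C2 * 2 ^ k.+1 * L n ^ k * L n ^ K1 <= _).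
    by apply: Rmult_le_compat_l; lra.
  by right; rewrite pow_add; ring.
have y0 : (0 < x %/ Q ^ (6 * B))%N by rewrite divn_gt0.
set y := (x %/ _)%N in y0.
exists (trunc_log P y); set A := trunc_log P y => c c6 j.
have PAQ : (P ^ A * Q ^ (6 * B) <= x)%N.
  by rewrite -leq_divRL // -/y; apply: trunc_logP.
have low h : chain P Q A B c h -> dlow d <= wr n r h (jd0 hd) * wr n r h (jd1 hd).
  case/and4P => /eqP eh h1 h2 _; apply: wr_low => //.
    by rewrite eh; apply: S_pq.
  apply: Rle_trans hx1; apply: INR_leq; apply: leq_trans PAQ; rewrite {1}eh.
  by apply: leq_mul; rewrite leq_exp2l // ltnW.
apply: Rle_trans (chain_prob (wr_ge0 p hd r) (wr_sum1 p hd r) (erefl : val (jd0 hd) = 0%N) (erefl : val (jd1 hd) = 1%N)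
   P1 Q1 (hcop i01) (Rlt_le _ _ dl) c6 low (leq_trans PAQ xn) j) _.
set E := exp _.
have hE : E <= / L n ^ 2.
  apply: Rle_trans hC; right; rewrite /E; congr exp; ring.
have E0 : 0 < E by apply: exp_pos.
have PA0 : 0 < INR P ^ A by apply: pow_lt; lra.
have AL : INR A <= 2 * L n.
  have h1 : INR A * ln (INR P) <= L n.
    rewrite -ln_INR_expn; last exact: ltnW.
    apply: ln_INR_le; first by rewrite expn_gt0 ltnW.
    apply: leq_trans xn; apply: leq_trans PAQ; exact: leq_pmulr.
  have h2 : / 2 <= ln (INR P).
    have h3 : / 2 < ln 2 by exact: ln_lt_2.
    have : ln 2 <= ln (INR P) by case: P0 => [h|<-]; [left; apply: ln_increasing; lra | lra].
    by lra.
  have := Rmult_le_compat_l _ _ _ (pos_INR A) h2; lra.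
have iPA : 0 < / INR P ^ A by apply: Rinv_0_lt_compat.
have sA : (/ INR P * (1 + INR P * E)) ^ A <= 3 * / INR P ^ A.
  rewrite Rpow_mult_distr pow_inv Rmult_comm; apply: Rmult_le_compat_r; first lra.
  apply: Rle_trans (_ : exp (INR P * E) ^ A <= _).
    by apply: pow_incr; split; [nra | exact: exp_ineq1_le].
  have -> : exp (INR P * E) ^ A = exp (INR A * (INR P * E)).
    by rewrite -exp_INR_ln ?ln_exp //; exact: exp_pos.
  apply: Rle_trans exp_le_3; apply: exp_le.
  apply: Rle_trans (_ : 2 * L n * (INR P * / L n ^ 2) <= _).
    apply: Rmult_le_compat => //; [exact: pos_INR | nra |].
    by apply: Rmult_le_compat_l; lra.
  apply: (Rmult_le_reg_r (L n)); first lra.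
  rewrite (_ : _ * L n = 2 * INR P); [lra | field; lra].
apply: Rle_trans sA _.
have hA : INR x <= INR P * INR P ^ A * L n ^ K1.
  apply: Rle_trans (_ : INR (P ^ A.+1) * INR (Q ^ (6 * B)) <= _); last first.
    by rewrite INR_exp /=; apply: Rmult_le_compat_l => //; nra.
  rewrite -mult_INR; apply: INR_leq; apply: ltnW.
  rewrite -ltn_divLR //; exact: trunc_log_ltn.
have h1 : INR n <= C2 * 2 ^ k.+1 * L n ^ k * (INR P * INR P ^ A * L n ^ K1).
  by apply: Rle_trans hx3 _; apply: Rmult_le_compat_l; lra.
apply: (Rmult_le_reg_r (INR P ^ A)) => //; rewrite Rmult_assoc Rinv_l ?Rmult_1_r; last lra.
apply: (Rmult_le_reg_r (INR n)) => //.
rewrite (_ : L n ^ (K1 + k + 1) / INR n * INR P ^ A * INR n = L n ^ (K1 + k + 1) * INR P ^ A); last by field; lra.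
rewrite !pow_add pow_1.
apply: Rle_trans (Rmult_le_compat_l 3 _ _ ltac:(lra) h1) _.
have h2 : 0 < L n ^ K1 * L n ^ k * INR P ^ A by repeat apply: Rmult_lt_0_compat.
have h3 : 6 * INR P * (C2 * 2 ^ k.+1) * (L n ^ K1 * L n ^ k * INR P ^ A) <= L n * (L n ^ K1 * L n ^ k * INR P ^ A).
  by apply: Rmult_le_compat_r; lra.
have h4 : 0 <= INR P * (C2 * 2 ^ k.+1) * (L n ^ K1 * L n ^ k * INR P ^ A).
  apply: Rmult_le_pos; last lra; apply: Rmult_le_pos; first lra.
  by apply: Rmult_le_pos; [lra | apply: pow_le; lra].
lra.
Qed.

(** [G] contains a [wset] and two chains, in three different classes modulo 6, so [|phi|] is at most
    the product of three moduli. The [wset] gives [L^(-(K+KC))] pointwise; the product over the two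
    chains is at most half the sum of their squares, whose averages are at most [L^KC / n] by
    Parseval and [chain_collision]. *)
Lemma minor_arcs (K : nat) : exists Kb K0, ev (fun n => forall r, saddle n r ->
  forall (e : bool) (G : pred 'I_n.+1), (forall h, zset n e Kb h -> G h) ->
  forall q, (forall a : {ffun 'I_n.+1 -> 'I_d}, XG xpredT a < (2 * q).+1)%N ->
  avg q (fun y => gei (L n ^ K0 / INR n) (Rabs y) * Cmod (phi (wr n r) G y)) <= / L n ^ K / INR n).
Proof.
have P1 : (1 < P)%N := hp1 i0; have Q1 : (1 < Q)%N := hp1 i1.
have P0 : 2 <= INR P by apply: (@INR_leq 2).
have Q0 : 2 <= INR Q by apply: (@INR_leq 2).
have dl := dlow_gt0 hd.
have [KC [C0 hch]] := chain_collision.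
have PQ0 : 0 < 2 * INR P ^ 6 * INR Q.
  by repeat apply: Rmult_lt_0_compat; try apply: pow_lt; lra.
have cc0 : 0 < 2 * dlow d * (/ (2 * INR P ^ 6 * INR Q)) ^ 2.
  by apply: Rmult_lt_0_compat; [lra | apply: pow_lt; apply: Rinv_0_lt_compat].
have [C1 hC1] := exp_lnn (K + KC) cc0.
have [K2 hK2] := pow_lnn (6 * C1) (ltnW P1).
have [K3 hK3] := pow_lnn (6 * C1) (ltnW Q1).
(* [K0] is dictated by the hypothesis [hM] of the [wset]: [Q^(6B)/(2 eta) <= x] with
   [eta = L^K0 / n], where [Q^(6B) <= L^K3] and [n/x = O(L^k)]; one further [L] absorbs the
   constant. *)
exists (6 * (C0 + C1))%N, (K3 + k + 1)%N; set K0 := (K3 + k + 1)%N.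
have := saddle_floor; move/ev_and => /(_ _ hC1); move/ev_and => /(_ _ hK2); move/ev_and => /(_ _ hK3).
move/ev_and => /(_ _ (ev_ge 1)); move/ev_and => /(_ _ ev_L_gt1).
move/ev_and => /(_ _ hch).
move/ev_and => /(_ _ (ev_ln (C2 * 2 ^ k.+1))).
move/ev_and => /(_ _ (ev_pow_exp 2 (K2 + K0) (ltac:(lra) : 0 < 1))).
apply: ev_imp => n [[[[[[[[hfl hC] hK2'] hK3'] n0] L1] hcol] L3] L4] r sr e G zG q hq.
have [r0 [x [xn hx1 hx2 hx3]]] := hfl r sr.
have [A hA] := hcol r sr.
have nR : 0 < INR n by apply: INR_gt0.
have LL j : 0 < L n ^ j by apply: pow_lt; lra.
set B0 := (C0 * lnn n)%N in hA *; set B1 := (C1 * lnn n)%N in hC *.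
pose cW : nat := e; pose c1 := (e + 2)%N; pose c2 := (e + 4)%N.
have c6 : [/\ cW < 6, c1 < 6 & c2 < 6]%N by rewrite /cW /c1 /c2; case: (e).
have [cW6 c16 c26] := c6.
pose W : pred 'I_n.+1 := @wset P Q B1 cW x n.
pose D1 : pred 'I_n.+1 := chain P Q A B0 c1.
pose D2 : pred 'I_n.+1 := chain P Q A B0 c2.
have bK : (6 * B0 <= 6 * (C0 + C1) * lnn n)%N by rewrite /B0 -mulnA leq_mul2l /= leq_mul2r leq_addr orbT.
have bK1 : (6 * B1 <= 6 * (C0 + C1) * lnn n)%N by rewrite /B1 -mulnA leq_mul2l /= leq_mul2r leq_addl orbT.
have WZ h : W h -> zset n e (6 * (C0 + C1)) h.
  case/and4P => h1 h2 /eqP h3 _; rewrite /zset h1 (leq_trans h2 bK1) /=.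
  by rewrite /pr /par h3 /cW; case: (e).
have DZ c h : (odd c = e) -> chain P Q A B0 c h -> zset n e (6 * (C0 + C1)) h.
  move=> oc /and4P [h1 _ h2 /eqP h3]; rewrite /zset h1 (leq_trans h2 bK) /=.
  by rewrite /pr /par h3 oc eqxx.
have o1 : odd c1 = e by rewrite /c1; case: (e).
have o2 : odd c2 = e by rewrite /c2; case: (e).
pose G' : pred 'I_n.+1 := fun h => W h || (D1 h || D2 h).
have G'G h : G' h -> G h.
  by case/or3P => hh; apply: zG; [apply: WZ | apply: DZ hh | apply: DZ hh].
have clsD c h : chain P Q A B0 c h -> cls P Q h = c by case/and4P => _ _ _ /eqP.
have clsW h : W h -> cls P Q h = cW by case/and4P => _ _ /eqP.
have dj1 h : D1 h -> ~~ D2 h.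
  by move/clsD => h1; apply/negP => /clsD; rewrite h1 /c1 /c2; case: (e).
have dj2 h : W h -> ~~ (D1 h || D2 h).
  move/clsW => h1; apply/negP => /orP [] /clsD; rewrite h1 /cW /c1 /c2; by case: (e).
have phiE y : Cmod (phi (wr n r) G y) <=
    Cmod (phi (wr n r) W y) * (Cmod (phi (wr n r) D1 y) * Cmod (phi (wr n r) D2 y)).
  apply: Rle_trans (Cmod_phi_sub (wr_ge0 p hd r) (wr_sum1 p hd r) y G'G) _.
  by rewrite -(Cmod_phiU (wr_sum1 p hd r)) // -(Cmod_phiU (wr_sum1 p hd r)) //; apply: Rle_refl.
set eta := L n ^ K0 / INR n.
have eta0 : 0 < eta by apply: Rmult_lt_0_compat => //; apply: Rinv_0_lt_compat.
have hPB : INR P ^ (6 * B1) * eta <= / 2.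
  apply: Rle_trans (_ : L n ^ K2 * eta <= _).
    by apply: Rmult_le_compat_r; [lra | rewrite /B1 mulnA].
  apply: (Rmult_le_reg_r (2 * INR n)); first lra.
  rewrite (_ : _ * _ * _ = 2 * L n ^ (K2 + K0)); last by rewrite pow_add /eta; field; lra.
  by rewrite Rmult_1_l (exp_L n0) in L4; lra.
have hM : INR Q ^ (6 * B1) * (/ (2 * eta)) <= INR x.
  apply: Rle_trans (_ : L n ^ K3 * (/ (2 * eta)) <= _).
    apply: Rmult_le_compat_r; first by left; apply: Rinv_0_lt_compat; lra.
    by rewrite /B1 mulnA.
  apply: (Rmult_le_reg_r (2 * eta)); first lra.
  rewrite Rmult_assoc Rinv_l ?Rmult_1_r; last lra.
  apply: (Rmult_le_reg_r (INR n)) => //.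
  rewrite (_ : INR x * _ * _ = 2 * INR x * L n ^ K0); last by rewrite /eta; field; lra.
  apply: Rle_trans (Rmult_le_compat_l _ _ _ (Rlt_le _ _ (LL K3)) hx3) _.
  rewrite /K0 !pow_add pow_1.
  have h0 : 0 <= L n ^ K3 * L n ^ k * INR x.
    by apply: Rmult_le_pos; [have := LL K3; have := LL k; nra | exact: pos_INR].
  have := Rmult_le_compat_r _ _ _ h0 L3; nra.
have wlow h : W h -> dlow d <= wr n r h (jd0 hd) * wr n r h (jd1 hd).
  case/and4P => /eqP h1 _ _ h2; apply: wr_low => //; first by rewrite h1; apply: S_pq.
  by apply: Rle_trans hx1; apply: INR_leq.
have far_phi y : Rabs y <= / 2 -> eta <= Rabs y -> Cmod (phi (wr n r) W y) <= / L n ^ (K + KC).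
  move=> y2 ye; apply: Rle_trans hC.
  have fy : far eta y by apply: far_le (far_small y2).
  apply: Rle_trans (minor_phi (wr_ge0 p hd r) (wr_sum1 p hd r) (erefl : val (jd0 hd) = 0%N)
    (erefl : val (jd1 hd) = 1%N) P1 Q1 (hcop i01) cW6 eta0 hPB hM xn (Rlt_le _ _ dl) wlow fy) _.
  by right; congr exp; ring.
have il : 0 < / L n ^ (K + KC) by apply: Rinv_0_lt_compat.
apply: Rle_trans (_ : avg q (fun y => / L n ^ (K + KC) * / 2 *
   (Cmod (phi (wr n r) D1 y) ^ 2 + Cmod (phi (wr n r) D2 y) ^ 2)) <= _).
  apply: avg_le => j hj; set y := freq q j; rewrite /gei.
  have a0 := Cmod_ge_0 (phi (wr n r) D1 y); have b0 := Cmod_ge_0 (phi (wr n r) D2 y).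
  have := phiE y; move: (Cmod (phi (wr n r) D1 y)) (Cmod (phi (wr n r) D2 y)) a0 b0 => a b a0 b0 hphi.
  have hab : a * b <= / 2 * (a ^ 2 + b ^ 2) by have := pow2_ge_0 (a - b); nra.
  have q0 : 0 <= a * b by apply: Rmult_le_pos.
  case: Rle_dec => hy /=; last first.
    by rewrite Rmult_0_l Rmult_assoc; apply: Rmult_le_pos; nra.
  have h1 := far_phi y (freq_half hj) hy.
  rewrite Rmult_1_l Rmult_assoc; apply: Rle_trans hphi _.
  apply: Rmult_le_compat => //; exact: Cmod_ge_0.
rewrite avg_scal avg_add.
have hX (D : pred 'I_n.+1) (a : {ffun 'I_n.+1 -> 'I_d}) : (XG D a < (2 * q).+1)%N.
  apply: leq_ltn_trans (hq a); rewrite /XG big_mkcond; apply: leq_sum => h _.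
  by case: (D h).
have col c : (c < 6)%N -> avg q (fun y => Cmod (phi (wr n r) (chain P Q A B0 c) y) ^ 2) <= L n ^ KC / INR n.
  move=> hc; rewrite parseval; last exact: hX.
  apply: Rle_trans (_ : Ex (wr n r) (fun _ => L n ^ KC / INR n) <= _).
    by apply: Ex_le; [exact: wr_ge0 | move=> a; apply: hA].
  by rewrite Ex_const; [lra | exact: wr_sum1].
have hh := Rplus_le_compat _ _ _ _ (col _ c16) (col _ c26).
apply: Rle_trans (Rmult_le_compat_l _ _ _ _ hh) _; first by nra.
rewrite pow_add; right; field.
by have := LL K; have := LL KC; split; lra.
Qed.

End MinorArcs.

Lemma gei01 a b : 0 <= gei a b <= 1.
Proof. by rewrite /gei; case: Rle_dec => _ /=; lra. Qed.

Lemma geiT a b : a <= b -> gei a b = 1.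
Proof. by move=> h; rewrite /gei; case: Rle_dec. Qed.

Lemma geiF a b : b < a -> gei a b = 0.
Proof. by move=> h; rewrite /gei; case: Rle_dec => // h'; lra. Qed.

Lemma avg_below q s : 0 < s -> avg q (fun y => 1 - gei s (Rabs y)) <= 2 * (/ INR (2 * q).+1 + 4 * s).
Proof.
move=> s0; apply: Rle_trans (Rmult_le_compat_l _ _ _ _ (avg_cauchy q s0)); last lra.
rewrite -avg_scal; apply: avg_le => j _; set y := freq q j.
have sq := pow2_ge_0 (y / s).
case: (Rle_lt_dec s (Rabs y)) => h; rewrite ?(geiT h) ?(geiF h).
  by rewrite Rminus_eq_0; apply: Rmult_le_pos; [lra | left; apply: Rinv_0_lt_compat; lra].
have h1 : (y / s) ^ 2 <= 1.
  rewrite -(pow2_abs (y / s)) -[X in _ <= X](pow1 2); apply: pow_incr; split; first exact: Rabs_pos.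
  rewrite /Rdiv Rabs_mult (Rabs_pos_eq (/ s)); last by left; apply: Rinv_0_lt_compat.
  by apply: (Rmult_le_reg_r s) => //; rewrite Rmult_assoc Rinv_l; lra.
have h2 : / 2 <= / (1 + (y / s) ^ 2) by apply: Rinv_le_contravar; lra.
by lra.
Qed.

Lemma avg_below_ge q s : 0 < s -> s <= / 2 -> s <= avg q (fun y => 1 - gei s (Rabs y)).
Proof.
move=> s0 s2; have Q0 : 0 < INR (2 * q).+1 by apply: INR_gt0.
have QE : INR (2 * q).+1 = 2 * INR q + 1 by rewrite S_INR mult_INR.
set T := INR (2 * q).+1 * s.
have T0 : 0 < T by apply: Rmult_lt_0_compat.
have [x [hx1 hx2]] := nat_floor (Rlt_le _ _ T0).
(* [N] is [T] rounded up: the frequencies [i/(2q+1)] with [0 <= i < N] all lie below [s], and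
   [N <= q+1] keeps them among those sampled. *)
have [N [hN1 hN2 hN3]] : exists N : nat, [/\ T <= INR N, INR N < T + 1 & (N <= q.+1)%N].
  case: (Req_dec (INR x) T) => e.
    exists x; split; try lra; apply/leP; apply: INR_le; rewrite S_INR.
    have : T <= INR (2 * q).+1 * / 2 by apply: Rmult_le_compat_l; lra.
    by have := pos_INR q; lra.
  exists x.+1; split; try (rewrite S_INR; lra).
  apply/ltP; apply: INR_lt.
  rewrite S_INR; have : T <= INR (2 * q).+1 * / 2 by apply: Rmult_le_compat_l; lra.
  by lra.
rewrite /avg; apply: (Rmult_le_reg_l (INR (2 * q).+1)) => //.
rewrite -Rmult_assoc Rinv_r ?Rmult_1_l -/T; last lra.
have lt (i : 'I_N) : (q + i < (2 * q).+1)%N.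
  rewrite ltnS mul2n -addnn leq_add2l -ltnS; apply: leq_trans hN3; exact: ltn_ord.
pose f (i : 'I_N) : 'I_(2 * q).+1 := Ordinal (lt i).
have fi : injective f by move=> i i' /(congr1 val) /= /eqP; rewrite eqn_add2l => /eqP/val_inj.
pose D : pred 'I_(2 * q).+1 := [pred j | j \in codom f].
apply: Rle_trans (_ : \big[Rplus/0]_(j < (2 * q).+1 | D j) 1 <= _).
  rewrite rsum_const Rmult_1_r; apply: Rle_trans hN1 _; apply: INR_leq.
  by rewrite -{1}[N]card_ord -(card_codom fi).
apply: Rle_trans (_ : \big[Rplus/0]_(j < (2 * q).+1 | D j) (1 - gei s (Rabs (freq q j))) <= _).
  apply: rsum_le => j /codomP [i ->]; rewrite /gei; case: Rle_dec => h /=; last lra.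
  exfalso; move: h; rewrite /freq /= plus_INR; set I := INR i.
  have -> : INR q + I - INR q = I by ring.
  have hI : I <= INR N - 1.
    have : INR i.+1 <= INR N by apply: INR_leq; exact: ltn_ord.
    by rewrite S_INR -/I; lra.
  have I0 : 0 <= I by apply: pos_INR.
  have iQ : 0 < / INR (2 * q).+1 by apply: Rinv_0_lt_compat.
  rewrite /Rdiv Rabs_pos_eq; last by apply: Rmult_le_pos; [exact: I0 | exact: Rlt_le].
  move=> h; have := Rmult_le_compat_l _ _ _ (Rlt_le _ _ Q0) h.
  rewrite (Rmult_comm I) -Rmult_assoc Rinv_r ?Rmult_1_l -/T; lra.
apply: rsum_sub_le => // j _; have := gei01 s (Rabs (freq q j)); lra.
Qed.

(** * Second-order expansion of a centred digit *)

Lemma nonneg_of_deriv (f f' : R -> R) : (forall t, is_derive f t (f' t)) ->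
  (forall t, 0 <= t -> 0 <= f' t) -> f 0 = 0 -> forall x, 0 <= x -> 0 <= f x.
Proof.
move=> df f'0 f0 x [x0|<-]; last lra.
have [c [hc1 hc2]] := MVT_gen f 0 x _ (fun t _ => df t)
  (fun t _ => derivable_continuous_pt f t (ex_derive_Reals_0 f t (ex_intro _ _ (df t)))).
rewrite Rmin_left ?Rmax_right in hc1; [|lra..].
have : 0 <= f' c * (x - 0) by apply: Rmult_le_pos; [apply: f'0; lra | lra].
by rewrite -hc2; lra.
Qed.

(** Each inequality integrates an earlier one, starting from [cos <= 1]. The crude lower bound [s3]
    for the sine is the one that integrates to the cubic upper bound [c2] for the cosine. *)
Lemma trig_taylor x : Rabs (cos x - (1 - x ^ 2 / 2)) <= Rabs x ^ 3 / 2 /\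
  Rabs (sin x - x) <= Rabs x ^ 3 / 2.
Proof.
have s1 t : 0 <= t -> 0 <= t - sin t.
  apply: (nonneg_of_deriv (f := fun t => t - sin t) (f' := fun t => 1 - cos t)); last by rewrite sin_0; ring.
    by move=> u; auto_derive => //; ring.
  by move=> u _; have := COS_bound u; lra.
have c1 t : 0 <= t -> 0 <= cos t - (1 - t ^ 2 / 2).
  apply: (nonneg_of_deriv (f := fun t => cos t - (1 - t ^ 2 / 2)) (f' := fun t => t - sin t)) => //; last by rewrite cos_0; field.
  by move=> u; auto_derive => //; field.
have s2 t : 0 <= t -> 0 <= sin t - (t - t ^ 3 / 2).
  apply: (nonneg_of_deriv (f := fun t => sin t - (t - t ^ 3 / 2)) (f' := fun t => cos t - (1 - 3 * t ^ 2 / 2))); last by rewrite sin_0; field.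
    by move=> u; auto_derive => //; field.
  by move=> u u0; have := c1 u u0; have := pow2_ge_0 u; lra.
have s3 t : 0 <= t -> 0 <= sin t - (t - 3 * t ^ 2 / 2).
  apply: (nonneg_of_deriv (f := fun t => sin t - (t - 3 * t ^ 2 / 2)) (f' := fun t => cos t - (1 - 3 * t))); last by rewrite sin_0; field.
    by move=> u; auto_derive => //; field.
  move=> u u0; case: (Rle_dec u 1) => h; first by have := c1 u u0; nra.
  by have := COS_bound u; nra.
have c2 t : 0 <= t -> 0 <= 1 - t ^ 2 / 2 + t ^ 3 / 2 - cos t.
  apply: (nonneg_of_deriv (f := fun t => 1 - t ^ 2 / 2 + t ^ 3 / 2 - cos t) (f' := fun t => sin t - (t - 3 * t ^ 2 / 2))) => //; last by rewrite cos_0; field.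
  by move=> u; auto_derive => //; field.
have key t : 0 <= t -> Rabs (cos t - (1 - t ^ 2 / 2)) <= t ^ 3 / 2 /\ Rabs (sin t - t) <= t ^ 3 / 2.
  move=> t0; have t3 : 0 <= t ^ 3 by apply: pow_le.
  by split; apply: Rabs_le; have := s1 t t0; have := c1 t t0; have := s2 t t0; have := c2 t t0; lra.
case: (Rle_lt_dec 0 x) => h; first by rewrite (Rabs_pos_eq x) //; apply: key.
have := key (- x) ltac:(lra); rewrite cos_neg sin_neg (Rabs_left x) //.
rewrite (_ : (- x) ^ 2 = x ^ 2); last ring.
by rewrite -(Rabs_Ropp (sin x - x)) (_ : - (sin x - x) = - sin x - - x); last ring.
Qed.

Lemma Cprod_diff (I : Type) (s : seq I) (A : pred I) (a b : I -> C) :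
  (forall i, A i -> Cmod (a i) <= 1) -> (forall i, A i -> Cmod (b i) <= 1) ->
  Cmod (\big[Cmult/RtoC 1]_(i <- s | A i) a i - \big[Cmult/RtoC 1]_(i <- s | A i) b i)%C <=
  \big[Rplus/0]_(i <- s | A i) Cmod (a i - b i)%C.
Proof.
move=> ha hb.
suff : Cmod (\big[Cmult/RtoC 1]_(i <- s | A i) a i) <= 1 /\
   Cmod (\big[Cmult/RtoC 1]_(i <- s | A i) a i - \big[Cmult/RtoC 1]_(i <- s | A i) b i)%C <=
  \big[Rplus/0]_(i <- s | A i) Cmod (a i - b i)%C by case.
elim: s => [|i s [ih1 ih2]].
  by rewrite !big_nil Cmod_1 /Cminus Cplus_opp_r Cmod_0; lra.
rewrite !big_cons; case Ai: (A i) => //.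
move: ih1 ih2; set x := \big[Cmult/_]_(j <- s | A j) a j; set y := \big[Cmult/_]_(j <- s | A j) b j.
set z := \big[Rplus/0]_(j <- s | _) _ => ih1 ih2.
have := ha i Ai; have := hb i Ai; have := Cmod_ge_0 (a i); have := Cmod_ge_0 (b i).
have := Cmod_ge_0 x => x0 b0 a0 b1 a1; rewrite !Cmod_mult; split; first by nra.
have -> : (a i * x - b i * y = (a i - b i) * x + b i * (x - y))%C by ring.
apply: Rle_trans (Cmod_triangle _ _) _; rewrite !Cmod_mult.
have := Cmod_ge_0 (a i - b i)%C; have := Cmod_ge_0 (x - y)%C => *; nra.
Qed.

Lemma rprod_ge_1sub (I : Type) (s : seq I) (A : pred I) (v : I -> R) :
  (forall i, A i -> 0 <= v i <= 1) ->
  1 - \big[Rplus/0]_(i <- s | A i) v i <= \big[Rmult/1]_(i <- s | A i) (1 - v i).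
Proof.
move=> hv; elim: s => [|i s ih]; first by rewrite !big_nil; lra.
rewrite !big_cons; case Ai: (A i) => //.
have h0 : 0 <= \big[Rmult/1]_(j <- s | A j) (1 - v j) <= 1.
  by apply: rprod_le1 => j /hv; lra.
have v0 : 0 <= \big[Rplus/0]_(j <- s | A j) v j by apply: rsum_ge0 => j /hv; lra.
by have := hv i Ai; nra.
Qed.

Lemma RtoC_prod (I : Type) (s : seq I) (A : pred I) (f : I -> R) :
  RtoC (\big[Rmult/1]_(i <- s | A i) f i) = \big[Cmult/RtoC 1]_(i <- s | A i) RtoC (f i).
Proof. by elim/big_ind2: _ => // x y z t <- <-; rewrite RtoC_mult. Qed.

Lemma sumC_pair (I : Type) (s : seq I) (f g : I -> R) :
  \big[Cplus/RtoC 0]_(i <- s) ((f i, g i) : C) =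
  (\big[Rplus/0]_(i <- s) f i, \big[Rplus/0]_(i <- s) g i).
Proof. by elim: s => [|i s ih]; rewrite ?big_nil // !big_cons ih. Qed.

Lemma sumC_sub (I : Type) (s : seq I) (f g : I -> C) :
  (\big[Cplus/RtoC 0]_(i <- s) f i - \big[Cplus/RtoC 0]_(i <- s) g i)%C =
  \big[Cplus/RtoC 0]_(i <- s) (f i - g i)%C.
Proof.
elim: s => [|i s ih]; first by rewrite !big_nil /Cminus Cplus_opp_r.
by rewrite !big_cons -ih; ring.
Qed.

Section Factor.
Variables (d : nat) (wt : 'I_d -> R) (mu y : R).
Hypotheses (w0 : forall j, 0 <= wt j) (w1 : \big[Rplus/0]_j wt j = 1).
Hypothesis (hmu : \big[Rplus/0]_j (wt j * INR j) = mu).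

Let x (j : 'I_d) : R := 2 * PI * y * (INR j - mu).
Let z (j : 'I_d) : R := y * (INR j - mu).
Let u (j : 'I_d) : C := (1 - x j ^ 2 / 2, x j).
Let V : R := 1 - \big[Rplus/0]_j (wt j * (2 * PI * y * (INR j - mu)) ^ 2) / 2.

(** The expansion of [e(z)] to second order; the linear terms cancel because the digit is centred at
    its mean, and the remainder is a third absolute moment. *)
Lemma centred_factor :
  Cmod (\big[Cplus/RtoC 0]_j (RtoC (wt j) * ce (z j))
        - RtoC V)%C <=
  \big[Rplus/0]_j (wt j * Rabs (2 * PI * y * (INR j - mu)) ^ 3).
Proof.
have c0 : \big[Rplus/0]_j (wt j * x j) = 0.
  rewrite (eq_bigr (fun j => 2 * PI * y * (wt j * INR j) - 2 * PI * y * mu * wt j)); last first.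
    by move=> j _; rewrite /x; ring.
  rewrite rsum_sub -!big_distrr -[X in X - _]/(Rmult _ _) -[X in _ - X]/(Rmult _ _).
  by rewrite w1 hmu; ring.
have hE : RtoC V =
   \big[Cplus/RtoC 0]_j (RtoC (wt j) * u j)%C.
  have e1 : V = 1 - \big[Rplus/0]_j (wt j * x j ^ 2) / 2 by [].
  have e2 : 1 - \big[Rplus/0]_j (wt j * x j ^ 2) / 2 = \big[Rplus/0]_j (wt j * (1 - x j ^ 2 / 2)).
    rewrite [RHS](eq_bigr (fun j => wt j - / 2 * (wt j * x j ^ 2))); last by move=> j _; field.
    by rewrite rsum_sub w1 -big_distrr /Rdiv Rmult_comm.
  transitivity ((\big[Rplus/0]_j (wt j * (1 - x j ^ 2 / 2)), \big[Rplus/0]_j (wt j * x j)) : C).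
    by rewrite c0 e1 e2.
  rewrite -sumC_pair; apply: eq_bigr => j _.
  by rewrite /Cmult /u /=; congr (_, _); ring.
rewrite hE.
rewrite sumC_sub.
rewrite (eq_bigr (fun j => RtoC (wt j) * (ce (z j) - u j))%C); last by move=> j _; ring.
apply: Rle_trans (Cmod_sum _ _ _) _; apply: rsum_le => j _.
rewrite Cmod_mult Cmod_R Rabs_pos_eq //; apply: Rmult_le_compat_l => //.
have [h1 h2] := trig_taylor (x j).
rewrite /ce (_ : 2 * PI * z j = x j); last by rewrite /x /z; ring.
rewrite /u /Cminus /Copp /Cplus /=.
apply: Rle_trans (Cmod_2Rmax _) _ => /=; rewrite -!/(Rminus _ _).
set M := Rmax _ _; set T := Rabs (x j) ^ 3 in h1 h2.
have hM : M <= T / 2 by apply: Rmax_lub.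
have M0 : 0 <= M by apply: Rle_trans (Rmax_l _ _); exact: Rabs_pos.
have s2 : sqrt 2 <= 2.
  have := sqrt_pos 2; have := sqrt_sqrt 2 ltac:(lra); nra.
apply: Rle_trans (_ : T <= _); last by right.
by nra.
Qed.

End Factor.

Arguments zset {m} p i0 i1 n e Kb.

Lemma inv_le_of_mul (a b : R) : 0 < a -> 1 <= a * b -> / a <= b.
Proof.
move=> a0 h; apply: (Rmult_le_reg_l a) => //; rewrite Rinv_r; lra.
Qed.

(** * Local limit bounds *)

Section LocalLimit.
Variables (d m : nat) (p : 'I_m -> nat).
Hypotheses (hd : (2 <= d)%N) (hm : (2 <= m)%N)
  (hp1 : forall i : 'I_m, (1 < p i)%N)
  (hcop : forall i j : 'I_m, i <> j -> coprime (p i) (p j)).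
Variables (i0 i1 : 'I_m).
Hypothesis i01 : i0 <> i1.
Variable C2 : R.
Hypothesis C20 : 0 < C2.

Let S := inSb m p.
Let k := m.-1.
Let P := p i0.
Let Q := p i1.
Let pr := par p i0 i1.

Notation saddle := (saddle d p C2).
Notation wr := (wr d p).
Notation Gp := (Gp p i0 i1).
Notation zset := (zset p i0 i1).

(** Chosen so that the modulus [2 qn + 1] exceeds [n] plus every possible value of the sum. *)
Definition qn (n : nat) : nat := (d * n.+1 ^ 2)%N.
Definition Lam (n : nat) : R := (1 + L n) ^ k.
(* Comparable to the inverse standard deviation of the sum under the tilted law. *)
Definition rt (n : nat) (r : R) : R := r / sqrt (Lam n).

Lemma XG_qn (n : nat) (G : pred 'I_n.+1) (a : {ffun 'I_n.+1 -> 'I_d}) :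
  (XG G a + n < (2 * qn n).+1)%N.
Proof.
rewrite ltnS /qn mul2n -addnn leq_add //; last first.
  apply: leq_trans (leqnSn n) _; rewrite -mulnn mulnA leq_pmull // muln_gt0 andbT.
  exact: ltnW.
apply: leq_trans (_ : \sum_(h < n.+1) d * n.+1 <= _)%N.
  rewrite /XG big_mkcond; apply: leq_sum => h _; case: (G h) => //.
  by apply: leq_mul; apply: ltnW; exact: ltn_ord.
by rewrite sum_nat_const card_ord mulnCA mulnn.
Qed.

Lemma n_lt_qn n : (n < (2 * qn n).+1)%N.
Proof. by apply: leq_ltn_trans (XG_qn xpredT [ffun=> jd0 hd]); exact: leq_addl. Qed.

Lemma zset_Gp n e Kb h : zset n e Kb h -> Gp n e h.
Proof. by case/and3P => /eqP eh _ he; rewrite /Gp he andbT eh; apply: S_pq. Qed.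

Lemma Lam_props : ev (fun n => [/\ 1 <= L n, L n <= Lam n, 1 <= sqrt (Lam n),
  sqrt (Lam n) <= 2 ^ k * L n ^ k & sqrt (Lam n) * sqrt (Lam n) = Lam n]).
Proof.
apply: ev_imp ev_L_gt1 => n L1.
have h1 : L n <= Lam n.
  rewrite /Lam; have k0 := k_gt0 hm; rewrite -/k in k0.
  apply: Rle_trans (_ : (1 + L n) ^ 1 <= _); first by rewrite pow_1; lra.
  by apply: Rle_pow; [lra | apply/leP].
have h0 : 1 <= Lam n by lra.
have sq : sqrt (Lam n) * sqrt (Lam n) = Lam n by apply: sqrt_sqrt; lra.
have s1 : 1 <= sqrt (Lam n) by rewrite -sqrt_1; apply: sqrt_le_1_alt.
split=> //; apply: Rle_trans (proj2 (Lam_bounds m L1)).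
by apply: Rle_trans (_ : Lam n <= _); [rewrite -[X in _ <= X]sq; nra | right].
Qed.

Lemma ev_rt : ev (fun n => forall r, saddle n r ->
  [/\ 0 < r, 0 < rt n r, / INR n <= rt n r * (2 ^ k * L n ^ k),
      / INR (2 * qn n).+1 <= / INR n & / INR (2 * qn n).+1 <= rt n r] /\ rt n r <= / 2).
Proof.
have := Lam_props; move/ev_and => /(_ _ (ev_saddle_r d p C2)); move/ev_and => /(_ _ (ev_ge 1)).
move/ev_and => /(_ _ (ev_pow_exp (2 ^ k) k (ltac:(lra) : 0 < 1))).
move/ev_and => /(_ _ (ev_ln (2 * ln 2))).
apply: ev_imp => n [[[[[L1 hL s1 s2 sq] hr] n0] hn] L2] r sr.
have [r0 r1] := hr r sr.
have nR : 1 <= INR n by apply: (@INR_leq 1).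
have srt0 : 0 < rt n r by apply: Rmult_lt_0_compat => //; apply: Rinv_0_lt_compat; lra.
have rE : r = rt n r * sqrt (Lam n) by rewrite /rt; field; lra.
have h1 : / INR n <= rt n r * (2 ^ k * L n ^ k).
  apply: Rle_trans (_ : r <= _); first by case: sr.
  by rewrite {1}rE; apply: Rmult_le_compat_l; lra.
have q1 : INR n * INR n <= INR (2 * qn n).+1.
  rewrite -mult_INR; apply: INR_leq; apply: leqW; rewrite mul2n -addnn /qn.
  apply: leq_trans (leq_addr _ _); apply: leq_trans (leq_pmull _ _); last exact: ltnW.
  by rewrite -mulnn leq_mul.
rewrite Rmult_1_l exp_L // in hn.
have D0 : 0 < 2 ^ k * L n ^ k by apply: Rmult_lt_0_compat; apply: pow_lt; lra.
split; first split=> //.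
- by apply: Rinv_le_contravar; nra.
- apply: Rle_trans (_ : / (INR n * INR n) <= _); first by apply: Rinv_le_contravar; nra.
  apply: inv_le_of_mul; first nra.
  have := inv_le_of_mul; have i0' : 0 < / INR n by apply: Rinv_0_lt_compat; lra.
  have h2 : 1 <= INR n * (rt n r * (2 ^ k * L n ^ k)).
    have := Rmult_le_compat_l (INR n) _ _ ltac:(lra) h1; rewrite Rinv_r; lra.
  have h3 : rt n r * (2 ^ k * L n ^ k) <= rt n r * INR n by apply: Rmult_le_compat_l; lra.
  by move=> _; nra.
- apply: Rle_trans (_ : r <= _).
    by rewrite {2}rE; nra.
  have : 2 <= exp (/ 2 * L n) by rewrite -{1}[2]exp_ln; [apply: exp_le|]; lra.
  by nra.
Qed.

(** With [eta = L^K0 / n], [g] is [|phi|] itself for [|y| >= eta], which [minor_arcs] bounds on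
    average, and [exp(-c Lam)] below [eta], where the minimum in [major_phi] may be 1. The latter is
    at most [n^(-c)], so it beats every power of [L] between [eta] and [rt]. *)
Lemma major_bound : exists c, 0 < c /\ forall eps, 0 < eps ->
  ev (fun n => forall r, saddle n r -> forall e, exists g : R -> R,
   [/\ forall y, 0 <= g y, forall j, (j < (2 * qn n).+1)%N ->
        Cmod (phi (wr n r) (Gp n e) (freq (qn n) j)) <=
          exp (- (c * (freq (qn n) j / rt n r) ^ 2)) + g (freq (qn n) j)
     & avg (qn n) g <= eps * rt n r]).
Proof.
have [c [c0 hmaj]] := major_phi hd hm hp1 hcop i01 C2.
have [Kb [K0 hmin]] := minor_arcs hd hp1 hcop i01 C20 (k + 1).
exists c; split=> // eps e0.
have := hmaj; move/ev_and => /(_ _ hmin); move/ev_and => /(_ _ ev_rt); move/ev_and => /(_ _ Lam_props).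
move/ev_and => /(_ _ (ev_ge 1)); move/ev_and => /(_ _ (ev_pow_exp 1 K0 (ltac:(lra) : 0 < / 2))).
move/ev_and => /(_ _ (ev_ln (2 * 2 ^ k / eps))).
move/ev_and => /(_ _ (ev_pow_exp (20 * 2 ^ k / eps) (K0 + k) c0)).
apply: ev_imp => n [[[[[[[hM hm1] hrt] [L1 hL s1 s2 sq]] n0] hK0] hLe] hexp] r sr e.
have [[r0 rt0 rt1 q1 q2] _] := hrt r sr.
have nR : 0 < INR n by apply: INR_gt0.
set eta := L n ^ K0 / INR n in hm1.
have LL j : 1 <= L n ^ j by apply: pow_R1_Rle.
have eta0 : 0 < eta by apply: Rmult_lt_0_compat; [have := LL K0; lra | apply: Rinv_0_lt_compat].
have zG h : zset n e Kb h -> Gp n e h by apply: zset_Gp.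
have qX (a : {ffun 'I_n.+1 -> 'I_d}) : (XG xpredT a < (2 * qn n).+1)%N by apply: leq_ltn_trans (leq_addr _ _) (XG_qn xpredT a).
have hmn := hm1 r sr e (Gp n e) zG (qn n) qX.
set F := fun y => Cmod (phi (wr n r) (Gp n e) y) in hmn *.
pose g y := exp (- (c * Lam n)) * (1 - gei eta (Rabs y)) + gei eta (Rabs y) * F y.
have F0 y : 0 <= F y by exact: Cmod_ge_0.
have eL := exp_pos (- (c * Lam n)).
exists g; split.
- move=> y; have := gei01 eta (Rabs y) => h; have := F0 y => h2.
  by rewrite /g; apply: Rplus_le_le_0_compat; apply: Rmult_le_pos; lra.
- move=> j hj; set y := freq _ _; rewrite -/(F y) /g.
  have ep := exp_pos (- (c * (y / rt n r) ^ 2)).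
  case: (Rle_lt_dec eta (Rabs y)) => h; rewrite ?(geiT h) ?(geiF h); first lra.
  have hy : Rabs y * exp (/ 2 * L n) <= 1.
    have ex := exp_pos (/ 2 * L n).
    apply: Rle_trans (_ : eta * exp (/ 2 * L n) <= _); first by apply: Rmult_le_compat_r; lra.
    apply: (Rmult_le_reg_r (INR n)) => //; rewrite Rmult_1_l in hK0.
    rewrite (_ : _ * _ * _ = L n ^ K0 * exp (/ 2 * L n)); last by rewrite /eta; field; lra.
    rewrite Rmult_1_l -[X in _ <= X](exp_L n0).
    have -> : exp (L n) = exp (/ 2 * L n) * exp (/ 2 * L n) by rewrite -exp_plus; congr exp; field.
    by apply: Rmult_le_compat_r; lra.
  have hF : F y <= exp (- (c * Lam n * Rmin 1 ((y / r) ^ 2))) := hM r sr e y hy.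
  apply: Rle_trans hF _; rewrite Rminus_0_r Rmult_1_r Rmult_0_l Rplus_0_r.
  have e1 : (y / rt n r) ^ 2 = Lam n * (y / r) ^ 2.
    by rewrite -sq /rt; field; split; lra.
  rewrite e1 /Rmin; case: Rle_dec => _ /=; rewrite ?Rmult_1_r.
    by have := exp_pos (- (c * (Lam n * (y / r * (y / r))))); lra.
  by rewrite Rmult_assoc; lra.
rewrite /g avg_add avg_scal.
have h1 := avg_below (qn n) eta0.
have i_eta : / INR n <= eta.
  by rewrite /eta -[X in X <= _]Rmult_1_l; apply: Rmult_le_compat_r; [left; apply: Rinv_0_lt_compat | exact: LL].
have h2 : avg (qn n) (fun y => 1 - gei eta (Rabs y)) <= 10 * eta by lra.
have ex : exp (- (c * Lam n)) <= exp (- (c * L n)).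
  by apply: exp_le; apply: Ropp_le_contravar; apply: Rmult_le_compat_l; lra.
have D0 : 0 < 2 ^ k * L n ^ k by apply: Rmult_lt_0_compat; apply: pow_lt; lra.
have h3 : exp (- (c * Lam n)) * (10 * eta) <= eps / 2 * rt n r.
  apply: Rle_trans (_ : exp (- (c * L n)) * (10 * eta) <= _).
    by apply: Rmult_le_compat_r; lra.
  apply: Rle_trans (_ : eps / 2 * (/ INR n / (2 ^ k * L n ^ k)) <= _); last first.
    apply: Rmult_le_compat_l; first lra.
    apply: (Rmult_le_reg_r (2 ^ k * L n ^ k)) => //.
    by rewrite /Rdiv Rmult_assoc Rinv_l ?Rmult_1_r; lra.
  rewrite exp_Ropp; have ep := exp_pos (c * L n).
  apply: (Rmult_le_reg_r (exp (c * L n) * (INR n * (2 ^ k * L n ^ k)))).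
    by apply: Rmult_lt_0_compat => //; apply: Rmult_lt_0_compat.
  have p2 : 0 < 2 ^ k by apply: pow_lt; lra.
  have pL := LL k.
  rewrite (_ : _ * _ = eps / 2 * (20 * 2 ^ k / eps * L n ^ (K0 + k))); last first.
    by rewrite pow_add /eta; field; lra.
  rewrite (_ : eps / 2 * (/ INR n / (2 ^ k * L n ^ k)) * _ = eps / 2 * exp (c * L n)); last first.
    by field; lra.
  by apply: Rmult_le_compat_l; lra.
have h4 : / L n ^ (k + 1) / INR n <= eps / 2 * rt n r.
  apply: Rle_trans (_ : / L n ^ (k + 1) * (rt n r * (2 ^ k * L n ^ k)) <= _).
    apply: Rmult_le_compat_l => //; left; apply: Rinv_0_lt_compat; have := LL (k + 1)%N; lra.
  rewrite pow_add pow_1; have pL := LL k.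
  rewrite (_ : / (L n ^ k * L n) * _ = rt n r * (2 ^ k / L n)); last by field; lra.
  rewrite Rmult_comm; apply: Rmult_le_compat_r; first lra.
  apply: (Rmult_le_reg_r (L n)); first lra.
  rewrite /Rdiv Rmult_assoc Rinv_l ?Rmult_1_r; last lra.
  have := Rmult_le_compat_l (eps / 2) _ _ ltac:(lra) hLe.
  by rewrite (_ : eps / 2 * (2 * 2 ^ k / eps) = 2 ^ k); [lra | field; lra].
have h5 : exp (- (c * Lam n)) * avg (qn n) (fun y => 1 - gei eta (Rabs y)) <=
  exp (- (c * Lam n)) * (10 * eta) by apply: Rmult_le_compat_l; lra.
have hmn' : avg (qn n) (fun y => gei eta (Rabs y) * F y) <= / L n ^ (k + 1) / INR n := hmn.
lra.
Qed.

(** Beyond [A rt], [exp(-z) <= 1/z] turns the Gaussian into a Cauchy profile of width [A rt] and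
    height [2/(c A^2)], whose average is at most [10/(c A) * rt]; [major_bound] with error [1/A]
    accounts for the rest. *)
Lemma phi_tail : exists C, 0 < C /\ forall A, 1 <= A ->
  ev (fun n => forall r, saddle n r -> forall e,
   avg (qn n) (fun y => gei (A * rt n r) (Rabs y) * Cmod (phi (wr n r) (Gp n e) y)) <= C / A * rt n r).
Proof.
have [c [c0 hmb]] := major_bound.
exists (10 / c + 1); split; first by have : 0 < 10 / c by [apply: Rmult_lt_0_compat; [lra | apply: Rinv_0_lt_compat]]; lra.
move=> A A1; have iA : 0 < / A by apply: Rinv_0_lt_compat; lra.
have := hmb _ iA; move/ev_and => /(_ _ ev_rt).
apply: ev_imp => n [hb hrt] r sr e.
have [[r0 rt0 rt1 q1 q2] _] := hrt r sr.
have [g [g0 hg hga]] := hb r sr e.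
set y0 := A * rt n r; have y00 : 0 < y0 by apply: Rmult_lt_0_compat; lra.
have cA : 0 < c * A ^ 2 by apply: Rmult_lt_0_compat => //; apply: pow_lt; lra.
apply: Rle_trans (_ : avg (qn n) (fun y => 2 / (c * A ^ 2) * / (1 + (y / y0) ^ 2) + g y) <= _).
  apply: avg_le => j hj; have := hg j hj; set y := freq _ _ => hy.
  have gy := g0 y; have sq := pow2_ge_0 (y / y0).
  have il : 0 < / (1 + (y / y0) ^ 2) by apply: Rinv_0_lt_compat; lra.
  have i2 : 0 < 2 / (c * A ^ 2) by apply: Rmult_lt_0_compat; [lra | apply: Rinv_0_lt_compat].
  case: (Rle_lt_dec y0 (Rabs y)) => h; rewrite ?(geiT h) ?(geiF h); last by nra.
  rewrite Rmult_1_l; apply: Rle_trans hy _; apply: Rplus_le_compat_r.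
  have z1 : 1 <= (y / y0) ^ 2.
    rewrite -(pow2_abs (y / y0)) -(pow1 2); apply: pow_incr; split; first lra.
    rewrite /Rdiv Rabs_mult (Rabs_pos_eq (/ y0)); last by left; apply: Rinv_0_lt_compat.
    by apply: (Rmult_le_reg_r y0) => //; rewrite Rmult_assoc Rinv_l; lra.
  have e1 : c * (y / rt n r) ^ 2 = c * A ^ 2 * (y / y0) ^ 2 by rewrite /y0; field; split; lra.
  rewrite e1; set z := (y / y0) ^ 2 in z1 sq il *.
  have x0 : 0 < c * A ^ 2 * z by apply: Rmult_lt_0_compat; lra.
  rewrite exp_Ropp; apply: Rle_trans (_ : / (c * A ^ 2 * z) <= _).
    apply: Rinv_le_contravar => //; have := exp_ineq1_le (c * A ^ 2 * z); lra.
  rewrite /Rdiv Rinv_mult Rmult_comm (Rmult_comm 2) Rmult_assoc (Rmult_comm (/ z)).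
  apply: Rmult_le_compat_l; first by left; apply: Rinv_0_lt_compat.
  apply: (Rmult_le_reg_r (z * (1 + z))); first by nra.
  rewrite (_ : / z * _ = 1 + z); last by field; lra.
  rewrite (_ : 2 * _ * _ = 2 * z); last by field; lra.
  by lra.
rewrite avg_add avg_scal.
have h1 := avg_cauchy (qn n) y00.
have h2 : avg (qn n) (fun y => / (1 + (y / y0) ^ 2)) <= 5 * y0.
  by have : rt n r <= y0 by [rewrite /y0; nra]; lra.
have h3 : 2 / (c * A ^ 2) * avg (qn n) (fun y => / (1 + (y / y0) ^ 2)) <= 2 / (c * A ^ 2) * (5 * y0).
  by apply: Rmult_le_compat_l => //; left; apply: Rmult_lt_0_compat; [lra | apply: Rinv_0_lt_compat].
have h4 : 2 / (c * A ^ 2) * (5 * y0) = 10 / c / A * rt n r by rewrite /y0; field; lra.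
rewrite h4 in h3; apply: Rle_trans (Rplus_le_compat _ _ _ _ h3 hga) _.
by right; field; lra.
Qed.

Lemma phi_avg : exists C, 0 < C /\
  ev (fun n => forall r, saddle n r -> forall e,
   avg (qn n) (fun y => Cmod (phi (wr n r) (Gp n e) y)) <= C * rt n r).
Proof.
have [C [C0 hC]] := phi_tail; exists (10 + C); split; first lra.
have := hC 1 (Rle_refl 1); move/ev_and => /(_ _ ev_rt).
apply: ev_imp => n [ht hrt] r sr e.
have [[r0 rt0 rt1 q1 q2] _] := hrt r sr.
have := ht r sr e; rewrite Rmult_1_l /Rdiv Rinv_1 Rmult_1_r => h1.
have h2 := avg_below (qn n) rt0.
apply: Rle_trans (_ : avg (qn n) (fun y => (1 - gei (rt n r) (Rabs y)) +
   gei (rt n r) (Rabs y) * Cmod (phi (wr n r) (Gp n e) y)) <= _).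
  apply: avg_le => j _; set y := freq _ _.
  have h3 : Cmod (phi (wr n r) (Gp n e) y) <= 1 by apply: Cmod_phi_le1; [exact: wr_ge0 | exact: wr_sum1].
  have := gei01 (rt n r) (Rabs y); nra.
by rewrite avg_add; lra.
Qed.

(** One half of [S] alone has point masses of order [rt], the order of the lower bound [prob_low]
    for the full sum. Letting that half absorb the condition therefore costs only a constant. *)
Lemma prob_sup : exists C, 0 < C /\
  ev (fun n => forall r, saddle n r -> forall e u,
    (forall a : {ffun 'I_n.+1 -> 'I_d}, XG (Gp n e) a + u < (2 * qn n).+1)%N ->
    Ex (wr n r) (fun a => indic (XG (Gp n e) a + u == n)%N) <= C * rt n r).
Proof.
have [C [C0 hC]] := phi_avg; exists C; split=> //.
apply: ev_imp hC => n h r sr e u hu; apply: Rle_trans (h r sr e).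
by apply: prob_le_avg => //; exact: n_lt_qn.
Qed.

(** For [|y| >= eta] the average of [|phi|] is small by [minor_arcs]. Below [eta] the factor
    [|e(ty) - 1|] is at most [2 pi t eta], and such frequencies have proportion at most [10 eta]. *)
Lemma prob_smooth (K : nat) : exists Kb K4, ev (fun n => forall r, saddle n r ->
  forall e (G : pred 'I_n.+1), (forall h, zset n e Kb h -> G h) ->
  forall t u, INR t <= INR n / L n ^ K4 ->
  (forall a : {ffun 'I_n.+1 -> 'I_d}, XG G a + (t + u) < (2 * qn n).+1)%N ->
  Rabs (Ex (wr n r) (fun a => indic (XG G a + (t + u) == n)%N) -
        Ex (wr n r) (fun a => indic (XG G a + u == n)%N)) <= / L n ^ K / INR n).
Proof.
have [Kb [K0 hmin]] := minor_arcs hd hp1 hcop i01 C20 (K + 1).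
(* From [t eta^2 <= (n / L^K4) (L^K0 / n)^2], which is to be [L^(-(K+1)) / n]; the spare [L] absorbs
   the constants. *)
exists Kb, (2 * K0 + K + 1)%N; set K4 := (2 * K0 + K + 1)%N.
have := hmin; move/ev_and => /(_ _ ev_rt); move/ev_and => /(_ _ (ev_ge 1)).
move/ev_and => /(_ _ ev_L_gt1); move/ev_and => /(_ _ (ev_ln 100)).
apply: ev_imp => n [[[[hm1 hrt] n0] L1] L100] r sr e G zG t u ht hu.
have [[r0 rt0 rt1 q1 q2] _] := hrt r sr.
have nR : 0 < INR n by apply: INR_gt0.
have qX (a : {ffun 'I_n.+1 -> 'I_d}) : (XG xpredT a < (2 * qn n).+1)%N by apply: leq_ltn_trans (leq_addr _ _) (XG_qn xpredT a).
have hmn := hm1 r sr e G zG (qn n) qX.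
set eta := L n ^ K0 / INR n in hmn.
have LL j : 1 <= L n ^ j by apply: pow_R1_Rle.
have eta0 : 0 < eta by apply: Rmult_lt_0_compat; [have := LL K0; lra | apply: Rinv_0_lt_compat].
have i_eta : / INR n <= eta.
  by rewrite /eta -[X in X <= _]Rmult_1_l; apply: Rmult_le_compat_r; [left; apply: Rinv_0_lt_compat | exact: LL].
apply: Rle_trans (prob_shift (wr n r) (n_lt_qn n) hu) _.
have P0 := PI_RGT_0; have P4 := PI_4; have t0 := pos_INR t.
apply: Rle_trans (_ : avg (qn n) (fun y => 2 * (gei eta (Rabs y) * Cmod (phi (wr n r) G y)) +
   2 * PI * (INR t * eta) * (1 - gei eta (Rabs y))) <= _).
  apply: avg_le => j _; set y := freq _ _.
  have F0 := Cmod_ge_0 (phi (wr n r) G y).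
  have F1 : Cmod (phi (wr n r) G y) <= 1 by apply: Cmod_phi_le1; [exact: wr_ge0 | exact: wr_sum1].
  have m1 := Rmin_l 2 (2 * PI * Rabs (INR t * y)); have m2 := Rmin_r 2 (2 * PI * Rabs (INR t * y)).
  case: (Rle_lt_dec eta (Rabs y)) => h; rewrite ?(geiT h) ?(geiF h).
    by rewrite Rminus_eq_0 Rmult_0_r Rmult_1_l; nra.
  rewrite Rmult_0_l Rmult_0_r Rplus_0_l Rminus_0_r Rmult_1_r.
  rewrite Rabs_mult (Rabs_pos_eq (INR t)) // in m1 m2 *.
  have : INR t * Rabs y <= INR t * eta by apply: Rmult_le_compat_l; lra.
  have : 0 <= INR t * Rabs y by apply: Rmult_le_pos => //; exact: Rabs_pos.
  set z := INR t * Rabs y in m1 m2 *; set z' := INR t * eta => z0 zz.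
  have h2 : 2 * PI * z <= 2 * PI * z' by apply: Rmult_le_compat_l; lra.
  have h3 : 0 <= 2 * PI * z by apply: Rmult_le_pos; lra.
  have mm : 0 <= Rmin 2 (2 * PI * z) by apply: Rmin_glb; lra.
  have := Rmult_le_compat_r _ _ _ mm F1; lra.
rewrite avg_add !avg_scal.
have h1 := avg_below (qn n) eta0.
have h2 : avg (qn n) (fun y => 1 - gei eta (Rabs y)) <= 10 * eta by lra.
have te : INR t * eta * (10 * eta) <= 10 * (/ L n ^ (K + 1) / INR n).
  apply: Rle_trans (_ : INR n / L n ^ K4 * eta * (10 * eta) <= _).
    by do 2 (apply: Rmult_le_compat_r; first lra).
  right; rewrite /eta /K4 mul2n -addnn -!addnA !pow_add pow_1.
  have := LL K0; have := LL K => *; field; lra.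
set W := / L n ^ (K + 1) / INR n in hmn te.
have W0 : 0 < W by apply: Rmult_lt_0_compat; apply: Rinv_0_lt_compat => //; have := LL (K + 1)%N; lra.
have h3 : 2 * PI * (INR t * eta) * avg (qn n) (fun y => 1 - gei eta (Rabs y)) <= 2 * PI * (10 * W).
  apply: Rle_trans (_ : 2 * PI * (INR t * eta * (10 * eta)) <= _); last first.
    by apply: Rmult_le_compat_l; lra.
  rewrite -(Rmult_assoc (2 * PI) (INR t * eta)); apply: Rmult_le_compat_l => //.
  by apply: Rmult_le_pos; [lra | apply: Rmult_le_pos; lra].
have h4 : 2 * PI * (10 * W) <= 80 * W by nra.
have h5 : / L n ^ K / INR n = L n * W.
  by rewrite /W pow_add pow_1; have := LL K => ?; field; lra.
by rewrite h5; nra.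
Qed.

End LocalLimit.

Arguments rt m n r : clear implicits.
Arguments Lam m n : clear implicits.

Section Moments.
Variables (d n : nat) (S : pred nat) (r : R) (h : 'I_n.+1).
Hypotheses (hd : (2 <= d)%N) (r0 : 0 <= r) (Sh : S h).
Let w := @wS d S r n h.
Let mu := digit_mean d S r h.
Let E := exp (- (r * INR h)).

Lemma digit_mean_bounds : 0 <= mu <= INR d.
Proof.
split.
  by apply: rsum_ge0 => j _; apply: Rmult_le_pos; [exact: wS_ge0 | exact: pos_INR].
rewrite -[INR d]Rmult_1_l -(wS_sum1 S r hd h) big_distrl; apply: rsum_le => j _.
apply: Rmult_le_compat_l; first exact: wS_ge0.
by apply: INR_leq; apply: ltnW.
Qed.

Lemma digit_dev (j : 'I_d) : Rabs (INR j - mu) <= INR d.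
Proof.
have [m0 m1] := digit_mean_bounds.
have : INR j <= INR d by apply: INR_leq; apply: ltnW.
by have := pos_INR j => *; apply: Rabs_le; lra.
Qed.

(** Positive digits have weight at most [exp(-r h)], and so, up to a constant, has the mean. This
    factor makes the sums of higher moments over [S] amenable to [S_moment]. *)
Lemma digit_moment1 : \big[Rplus/0]_j (w j * Rabs (INR j - mu)) <= 2 * INR d ^ 2 * E.
Proof.
have [m0 m1] := digit_mean_bounds.
apply: Rle_trans (_ : \big[Rplus/0]_j (w j * INR j + mu * w j) <= _).
  apply: rsum_le => j _; have j0 := pos_INR j.
  have : Rabs (INR j - mu) <= INR j + mu by apply: Rabs_le; lra.
  by move=> hh; have := Rmult_le_compat_l _ _ _ (wS_ge0 S r hd h j) hh; rewrite -/w; lra.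
rewrite big_split -big_distrr -[X in X <= _]/(mu + mu * \big[Rplus/0]_j w j) wS_sum1 //.
have := digit_mean_le hd r0 Sh; rewrite -/mu -/E; lra.
Qed.

Lemma digit_moment2 z : \big[Rplus/0]_j (w j * (z * (INR j - mu)) ^ 2) <= z ^ 2 * (2 * INR d ^ 3 * E).
Proof.
have d0 := pos_INR d.
apply: Rle_trans (_ : z ^ 2 * (INR d * \big[Rplus/0]_j (w j * Rabs (INR j - mu))) <= _); last first.
  apply: Rmult_le_compat_l; first exact: pow2_ge_0.
  by have := Rmult_le_compat_l _ _ _ d0 digit_moment1; rewrite /=; lra.
rewrite -Rmult_assoc big_distrr; apply: rsum_le => j _.
have w0 : 0 <= w j by exact: wS_ge0.
have h1 := digit_dev j; have h2 := Rabs_pos (INR j - mu).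
rewrite Rpow_mult_distr -(pow2_abs (INR j - mu)) -[X in _ <= X]/(Rmult _ _).
have h3 : Rabs (INR j - mu) ^ 2 <= INR d * Rabs (INR j - mu) by rewrite /=; nra.
have h4 := Rmult_le_compat_l _ _ _ (Rmult_le_pos _ _ w0 (pow2_ge_0 z)) h3.
lra.
Qed.

Lemma digit_moment3 z : \big[Rplus/0]_j (w j * Rabs (z * (INR j - mu)) ^ 3) <=
  Rabs z ^ 3 * (2 * INR d ^ 4 * E).
Proof.
have d0 := pos_INR d; have z0 : 0 <= Rabs z ^ 3 by apply: pow_le; exact: Rabs_pos.
apply: Rle_trans (_ : Rabs z ^ 3 * (INR d ^ 2 * \big[Rplus/0]_j (w j * Rabs (INR j - mu))) <= _); last first.
  apply: Rmult_le_compat_l => //.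
  by have := Rmult_le_compat_l (INR d ^ 2) _ _ ltac:(apply: pow2_ge_0) digit_moment1; rewrite /=; lra.
rewrite -Rmult_assoc big_distrr; apply: rsum_le => j _.
have w0 : 0 <= w j by exact: wS_ge0.
have h1 := digit_dev j; have h2 := Rabs_pos (INR j - mu).
rewrite Rabs_mult Rpow_mult_distr -[X in _ <= X]/(Rmult _ _).
have h3 : Rabs (INR j - mu) ^ 3 <= INR d ^ 2 * Rabs (INR j - mu).
  have : Rabs (INR j - mu) ^ 2 <= INR d ^ 2 by apply: pow_incr.
  by move=> hh; have := Rmult_le_compat_r _ _ _ h2 hh; rewrite /=; lra.
have h4 := Rmult_le_compat_l _ _ _ (Rmult_le_pos _ _ w0 z0) h3.
lra.
Qed.

End Moments.

(** * The lower bound for the point mass at the mean *)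

Section LowerBound.
Variables (d m : nat) (p : 'I_m -> nat).
Hypotheses (hd : (2 <= d)%N) (hm : (2 <= m)%N)
  (hp1 : forall i : 'I_m, (1 < p i)%N)
  (hcop : forall i j : 'I_m, i <> j -> coprime (p i) (p j)).
Variables (i0 i1 : 'I_m).
Hypothesis i01 : i0 <> i1.
Variable C2 : R.
Hypothesis C20 : 0 < C2.

Let S := inSb m p.
Let k := m.-1.

Notation saddle := (saddle d p C2).
Notation wr := (wr d p).
Notation Gp := (Gp p i0 i1).
Notation qn := (qn d).
Notation rt := (rt m).
Notation Lam := (Lam m).

Definition psi_h (n : nat) (r y : R) (h : 'I_n.+1) : C :=
  \big[Cplus/RtoC 0]_(j < d) (RtoC (wr n r h j) * ce ((y * INR h) * (INR j - digit_mean d S r h)))%C.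

(** The saddle point equation distributes the phase [e(-y n)] over the digits as their means, which
    centres every factor. *)
Lemma psi_prod n r y : total_mean d S r n = INR n ->
  (ce (y * (INR 0 - INR n)) * phi (wr n r) xpredT y)%C =
  \big[Cmult/RtoC 1]_(h < n.+1 | S h) psi_h r y h.
Proof.
move=> hmean.
have -> : phi (wr n r) xpredT y = \big[Cmult/RtoC 1]_(h < n.+1 | S h) cf (wr n r) h y.
  rewrite phi_prod; last exact: wr_sum1.
  rewrite [RHS]big_mkcond; apply: eq_bigr => h _; case Sh: (S h) => //.
  rewrite /cf (bigD1 (jd0 hd)) //= big1 => [|j hj].
    by rewrite /wr /wS -/S Sh /indic /= ?mul0n Rmult_0_l ce0 Cmult_1_l Cplus_0_r.
  rewrite /wr /wS -/S Sh /indic; case: eqP => e; last by rewrite Cmult_0_l.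
  by move: hj; rewrite -val_eqE /= -e eqxx.
have -> : ce (y * (INR 0 - INR n)) =
    \big[Cmult/RtoC 1]_(h < n.+1 | S h) ce (- (y * (INR h * digit_mean d S r h))).
  have -> : y * (INR 0 - INR n) = - (y * total_mean d S r n) by rewrite hmean /=; ring.
  rewrite /total_mean big_distrr -rsum_opp.
  elim/big_ind2: _ => [|x1 x2 y1 y2 <- <-|//]; first exact: ce0.
  exact: ceD.
rewrite -big_split; apply: eq_bigr => h _.
rewrite -[LHS]/(Cmult _ _) /cf big_distrr; apply: eq_bigr => j _.
have H (a b c : C) : (a * (b * c) = b * (a * c))%C by ring.
rewrite -[LHS]/(Cmult _ (Cmult _ _)) H -ceD; congr (_ * ce _)%C.
by rewrite mult_INR; ring.
Qed.

Lemma Cmod_psi_le1 n r y h : Cmod (@psi_h n r y h) <= 1.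
Proof.
apply: Rle_trans (Cmod_sum _ _ _) _; rewrite -(wr_sum1 p hd r h); apply: rsum_le => j _.
by rewrite Cmod_mult Cmod_ce Cmod_R Rabs_pos_eq; [lra | exact: wr_ge0].
Qed.

(** The centred product is compared with the product of the [1 - v h], where [v h] is the quadratic
    term; the differences add up to third moments. That product is real and nonnegative as soon as
    all [v h <= 1], which yields the first bound; it serves at frequencies where the second one has
    become negative. *)
Lemma psi_local : exists D2 D3, 0 < D2 /\ 0 < D3 /\ forall n r y, (0 < n)%N -> 0 < r ->
  1 <= Lam n -> total_mean d S r n = INR n ->
  D2 * (y / r) ^ 2 <= 1 ->
  (0 - D3 * (Rabs (y / r) ^ 3 * Lam n) <= Re (ce (y * (INR 0 - INR n)) * phi (wr n r) xpredT y)%C /\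
  1 - D2 * ((y / r) ^ 2 * Lam n) - D3 * (Rabs (y / r) ^ 3 * Lam n) <=
    Re (ce (y * (INR 0 - INR n)) * phi (wr n r) xpredT y)%C).
Proof.
have [C1 [C10 hC1]] := S_moment hm hp1 hcop.
have P0 := PI_RGT_0; have d0 : 0 < INR d by apply: INR_gt0; apply: ltnW.
set F3 := INR 3`! * (C1 + 1); set F4 := INR 4`! * (C1 + 1).
have f3 : 0 < F3 by apply: Rmult_lt_0_compat; [apply: INR_gt0 | lra].
have f4 : 0 < F4 by apply: Rmult_lt_0_compat; [apply: INR_gt0 | lra].
pose B2 := (2 * PI) ^ 2 * INR d ^ 3; pose B3 := (2 * PI) ^ 3 * (2 * INR d ^ 4).
have B20 : 0 < B2 by apply: Rmult_lt_0_compat; apply: pow_lt; lra.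
have B30 : 0 < B3 by apply: Rmult_lt_0_compat; [apply: pow_lt | have := pow_lt _ 4 d0]; lra.
(* The summand 2 secures [v h <= 1], through [x^2 exp(-x) <= 2!]. *)
exists (B2 * (F3 + 2)), (B3 * F4).
split; first by apply: Rmult_lt_0_compat; lra.
split; first by apply: Rmult_lt_0_compat.
move=> n r y n0 r0 L1 hmean hy.
rewrite psi_prod //.
pose z (h : 'I_n.+1) := 2 * PI * (y * INR h).
pose v (h : 'I_n.+1) := \big[Rplus/0]_j (wr n r h j * (z h * (INR j - digit_mean d S r h)) ^ 2) / 2.
have v0 (h : 'I_n.+1) : 0 <= v h.
  apply: Rmult_le_pos; last lra.
  by apply: rsum_ge0 => j _; apply: Rmult_le_pos; [exact: wr_ge0 | exact: pow2_ge_0].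
have vE (h : 'I_n.+1) : S h -> v h <= B2 * (y / r) ^ 2 * ((r * INR h) ^ 2 * exp (- (r * INR h))).
  move=> Sh; have := digit_moment2 hd (Rlt_le _ _ r0) Sh (z h); rewrite -/(wr n r) => hh.
  apply: Rle_trans (Rmult_le_compat_r (/ 2) _ _ ltac:(lra) hh) _.
  by right; rewrite /z /B2; field; lra.
have v1 (h : 'I_n.+1) : S h -> v h <= 1.
  move=> Sh; apply: Rle_trans (vE h Sh) _.
  have rh : 0 <= r * INR h by apply: Rmult_le_pos; [lra | exact: pos_INR].
  have := pow_exp_bound 2 rh; rewrite (_ : INR 2`! = 2) // => hh.
  apply: Rle_trans (_ : B2 * (y / r) ^ 2 * 2 <= _).
    by apply: Rmult_le_compat_l => //; apply: Rmult_le_pos; [lra | exact: pow2_ge_0].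
  have : 0 <= B2 * F3 * (y / r) ^ 2 by apply: Rmult_le_pos; [nra | exact: pow2_ge_0].
  lra.
have vsum : \big[Rplus/0]_(h < n.+1 | S h) v h <= B2 * (F3 + 2) * ((y / r) ^ 2 * Lam n).
  apply: Rle_trans (_ : B2 * y ^ 2 * \big[Rplus/0]_(h < n.+1 | S h) (INR h ^ 2 * exp (- (r * INR h))) <= _).
    rewrite big_distrr; apply: rsum_le => h Sh; apply: Rle_trans (vE h Sh) _.
    by right; rewrite -[RHS]/(Rmult _ _); field; lra.
  have q0 : 0 <= B2 * y ^ 2 by apply: Rmult_le_pos; [lra | exact: pow2_ge_0].
  apply: Rle_trans (Rmult_le_compat_l _ _ _ q0 (hC1 n 1%N r n0 r0)) _.
  have u0 : 0 <= (y / r) ^ 2 * Lam n by apply: Rmult_le_pos; [exact: pow2_ge_0 | lra].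
  rewrite (_ : B2 * y ^ 2 * _ = B2 * (INR 3`! * C1) * ((y / r) ^ 2 * Lam n)); last first.
    by rewrite /Lam; field; lra.
  apply: Rmult_le_compat_r => //; apply: Rmult_le_compat_l; first lra.
  by have := pos_INR 3`!; rewrite /F3; lra.
have dsum : \big[Rplus/0]_(h < n.+1 | S h) Cmod (psi_h r y h - RtoC (1 - v h))%C <=
    B3 * F4 * (Rabs (y / r) ^ 3 * Lam n).
  apply: Rle_trans (_ : B3 * Rabs y ^ 3 * \big[Rplus/0]_(h < n.+1 | S h) (INR h ^ 3 * exp (- (r * INR h))) <= _).
    rewrite big_distrr; apply: rsum_le => h Sh.
    have c1 := centred_factor (wt := wr n r h) (mu := digit_mean d S r h) (y * INR h)
      (fun j => wr_ge0 p hd r h j) (wr_sum1 p hd r h) erefl.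
    have c3 := digit_moment3 hd (Rlt_le _ _ r0) Sh (z h).
    apply: Rle_trans c1 _; apply: Rle_trans c3 _; right.
    have e2 : Rabs (z h) = 2 * PI * (Rabs y * INR h).
      by rewrite /z Rabs_mult (Rabs_pos_eq (2 * PI)) ?Rabs_mult ?(Rabs_pos_eq (INR h)) //; [exact: pos_INR | lra].
    by rewrite -[RHS]/(Rmult _ _) e2 /B3; ring.
  have a0 := Rabs_pos y.
  have q0 : 0 <= B3 * Rabs y ^ 3 by apply: Rmult_le_pos; [lra | apply: pow_le].
  apply: Rle_trans (Rmult_le_compat_l _ _ _ q0 (hC1 n 2%N r n0 r0)) _.
  have yr : Rabs (y / r) = Rabs y / r.
    by rewrite /Rdiv Rabs_mult (Rabs_pos_eq (/ r)) //; left; apply: Rinv_0_lt_compat.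
  have u0 : 0 <= Rabs (y / r) ^ 3 * Lam n by apply: Rmult_le_pos; [apply: pow_le; exact: Rabs_pos | lra].
  rewrite (_ : B3 * Rabs y ^ 3 * _ = B3 * (INR 4`! * C1) * (Rabs (y / r) ^ 3 * Lam n)); last first.
    by rewrite yr /Lam; field; lra.
  apply: Rmult_le_compat_r => //; apply: Rmult_le_compat_l; first lra.
  by have := pos_INR 4`!; rewrite /F4; lra.
set Z := \big[Cmult/_]_(h < n.+1 | S h) psi_h r y h.
pose W := \big[Rmult/1]_(h < n.+1 | S h) (1 - v h).
have dif : Cmod (Z - RtoC W)%C <= B3 * F4 * (Rabs (y / r) ^ 3 * Lam n).
  rewrite /W RtoC_prod; apply: Rle_trans dsum; apply: Cprod_diff => h Sh.
    exact: Cmod_psi_le1.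
  by rewrite Cmod_R Rabs_pos_eq; have := v1 h Sh; have := v0 h; lra.
have reZ : W - B3 * F4 * (Rabs (y / r) ^ 3 * Lam n) <= Re Z.
  have := re_le_Cmod (Z - RtoC W)%C; rewrite (_ : Re (Z - RtoC W)%C = Re Z - W) // => hh.
  by have := Rle_abs (- (Re Z - W)); rewrite Rabs_Ropp; lra.
have W0 : 0 <= W by apply: rprod_ge0 => h Sh; have := v1 h Sh; lra.
have W1 : 1 - \big[Rplus/0]_(h < n.+1 | S h) v h <= W.
  by apply: rprod_ge_1sub => h Sh; have := v1 h Sh; have := v0 h; lra.
by split; lra.
Qed.

(** Frequencies below [a0 rt] contribute at least [a0/2 * rt]; up to [A rt] the real part is at
    least [-Err], which tends to 0 for fixed [A]; beyond, [phi_tail] applies. The constants make the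
    two losses at most [a0/8 * rt] each. *)
Lemma prob_low : exists c, 0 < c /\
  ev (fun n => forall r, saddle n r -> c * rt n r <= Ex (wr n r) (fun a => indic (XG xpredT a == n))).
Proof.
have [D2 [D3 [D20 [D30 hloc]]]] := psi_local.
have [C [C0 htail]] := phi_tail hd hm hp1 hcop i01 C20.
pose a0 := / (1 + 2 * D2).
have a00 : 0 < a0 by apply: Rinv_0_lt_compat; lra.
have a01 : a0 < 1 by rewrite -Rinv_1; apply: Rinv_lt_contravar; lra.
have a0D : D2 * a0 ^ 2 <= / 2.
  have h1 : (1 + 2 * D2) * a0 = 1 by rewrite /a0 Rinv_r; lra.
  by nra.
pose A := 1 + 8 * C / a0.
have A1 : 1 <= A.
  by have : 0 < 8 * C / a0 by [apply: Rmult_lt_0_compat; [lra | apply: Rinv_0_lt_compat]]; rewrite /A; lra.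
have CA : C / A <= a0 / 8.
  apply: (Rmult_le_reg_r A); first lra.
  rewrite /Rdiv Rmult_assoc Rinv_l ?Rmult_1_r; last lra.
  by rewrite /A (_ : _ * (1 + _) = a0 / 8 + C); [lra | field; lra].
exists (a0 / 4); split; first lra.
(* The size of [sqrt (Lam n)] that makes [Err * 10 A] at most [a0/8]; [10 A rt] bounds the
   proportion of frequencies below [A rt]. *)
pose T := 80 * D3 * A ^ 4 / a0.
have A40 : 0 < A ^ 4 by apply: pow_lt; lra.
have T0 : 0 < T by apply: Rmult_lt_0_compat; [nra | apply: Rinv_0_lt_compat].
have := htail A A1; move/ev_and => /(_ _ (ev_rt p hd hm C2)); move/ev_and => /(_ _ (Lam_props hm)).
move/ev_and => /(_ _ (ev_ge 1)); move/ev_and => /(_ _ (ev_ln (T ^ 2)));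
move/ev_and => /(_ _ (ev_ln (D2 * A ^ 2))).
apply: ev_imp => n [[[[[ht hrt] [L1 hL s1 s2 sq]] n0] hT] hA] r sr.
have [[r0 rt0 rt1 q1 q2] rt2] := hrt r sr.
have hmean : total_mean d S r n = INR n by case: sr.
have La1 : 1 <= Lam n by lra.
set sg := rt n r in rt0 rt1 q2 rt2 ht *.
have rE : r = sg * sqrt (Lam n) by rewrite /sg /rt; field; lra.
set Err := D3 * A ^ 3 / sqrt (Lam n).
have Err0 : 0 <= Err.
  apply: Rmult_le_pos; first by apply: Rmult_le_pos; [lra | apply: pow_le; lra].
  by left; apply: Rinv_0_lt_compat; lra.
have yr y : (y / r) ^ 2 * Lam n = (y / sg) ^ 2.
  by rewrite rE; set s := sqrt (Lam n) in s1 sq *; rewrite -sq; field; split; lra.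
have yr3 y : Rabs (y / r) ^ 3 * Lam n = Rabs (y / sg) ^ 3 / sqrt (Lam n).
  have -> : y / r = (y / sg) * / sqrt (Lam n) by rewrite rE; field; split; lra.
  rewrite Rabs_mult (Rabs_pos_eq (/ _)); last by left; apply: Rinv_0_lt_compat; lra.
  by set s := sqrt (Lam n) in s1 sq *; rewrite -sq; field; lra.
have bd y B : Rabs y <= B * sg -> Rabs (y / sg) <= B.
  move=> hy; rewrite /Rdiv Rabs_mult (Rabs_pos_eq (/ sg)); last by left; apply: Rinv_0_lt_compat.
  by apply: (Rmult_le_reg_r sg) => //; rewrite Rmult_assoc Rinv_l; lra.
rewrite (Ex_ext (G := fun a => indic (XG xpredT a + 0 == n)%N)); last by move=> a; rewrite addn0.
rewrite (prob_fourier (wr n r) (q := qn n)); last first.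
- by move=> a; apply: leq_ltn_trans (XG_qn hd xpredT a); rewrite addn0 leq_addr.
- exact: n_lt_qn.
apply: Rle_trans (_ : avg (qn n) (fun y => / 2 * (1 - gei (a0 * sg) (Rabs y))
   - Err * (1 - gei (A * sg) (Rabs y)) - gei (A * sg) (Rabs y) * Cmod (phi (wr n r) (Gp n false) y)) <= _); last first.
  apply: avg_le => j _; set y := freq _ _.
  have aA : a0 * sg <= A * sg by apply: Rmult_le_compat_r; lra.
  case: (Rle_lt_dec (A * sg) (Rabs y)) => hy.
    rewrite !(geiT hy) (geiT (Rle_trans _ _ _ aA hy)) Rminus_eq_0 !Rmult_0_r Rmult_1_l.
    set Z := (_ * _)%C.
    have : Cmod Z <= Cmod (phi (wr n r) (Gp n false) y).
      rewrite /Z Cmod_mult Cmod_ce Rmult_1_l.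
      by apply: Cmod_phi_sub; [exact: wr_ge0 | exact: wr_sum1 | by []].
    by have := re_le_Cmod Z; have := Rle_abs (- Re Z); rewrite Rabs_Ropp; lra.
  rewrite !(geiF hy) Rminus_0_r Rmult_1_r Rmult_0_l Rminus_0_r.
  have b1 := bd y A (Rlt_le _ _ hy).
  have hD : D2 * (y / r) ^ 2 <= 1.
    apply: (Rmult_le_reg_r (Lam n)); first lra.
    rewrite Rmult_assoc yr Rmult_1_l -(pow2_abs (y / sg)).
    apply: Rle_trans (_ : D2 * A ^ 2 <= _); last lra.
    by apply: Rmult_le_compat_l; [lra | apply: pow_incr; split; [exact: Rabs_pos|]].
  have [z1 z2] := hloc n r y n0 r0 La1 hmean hD.
  have eb : D3 * (Rabs (y / r) ^ 3 * Lam n) <= Err.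
    rewrite yr3 /Err /Rdiv -Rmult_assoc; apply: Rmult_le_compat_r.
      by left; apply: Rinv_0_lt_compat; lra.
    by apply: Rmult_le_compat_l; [lra | apply: pow_incr; split; [exact: Rabs_pos|]].
  case: (Rle_lt_dec (a0 * sg) (Rabs y)) => hy2; rewrite ?(geiT hy2) ?(geiF hy2); first lra.
  have b2 := bd y a0 (Rlt_le _ _ hy2).
  have : D2 * (y / sg) ^ 2 <= D2 * a0 ^ 2.
    apply: Rmult_le_compat_l; first lra.
    by rewrite -(pow2_abs (y / sg)); apply: pow_incr; split; [exact: Rabs_pos|].
  by rewrite yr in z2; lra.
rewrite !avg_sub !avg_scal.
have asg : 0 < a0 * sg by apply: Rmult_lt_0_compat.
have Asg : 0 < A * sg by apply: Rmult_lt_0_compat; lra.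
have l1 := avg_below_ge (qn n) asg ltac:(nra).
have l2 := avg_below (qn n) Asg.
have l3 := ht r sr false; rewrite -/sg in l3.
have l4 : avg (qn n) (fun y => 1 - gei (A * sg) (Rabs y)) <= 10 * (A * sg) by nra.
have l5 : Err * (10 * A) <= a0 / 8.
  have sT : T <= sqrt (Lam n).
    rewrite -(sqrt_pow2 T); last lra.
    by apply: sqrt_le_1_alt; lra.
  apply: (Rmult_le_reg_r (sqrt (Lam n))); first lra.
  rewrite (_ : Err * _ * _ = 10 * D3 * A ^ 4); last by rewrite /Err; field; lra.
  have := Rmult_le_compat_l (a0 / 8) _ _ ltac:(lra) sT.
  by rewrite /T (_ : a0 / 8 * (80 * D3 * A ^ 4 / a0) = 10 * D3 * A ^ 4); [lra | field; lra].
have l6 : Err * avg (qn n) (fun y => 1 - gei (A * sg) (Rabs y)) <= a0 / 8 * sg.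
  apply: Rle_trans (Rmult_le_compat_l _ _ _ Err0 l4) _.
  by have := Rmult_le_compat_r _ _ _ (Rlt_le _ _ rt0) l5; lra.
have l7 : C / A * sg <= a0 / 8 * sg by apply: Rmult_le_compat_r; lra.
lra.
Qed.

End LowerBound.

(** * Decoupling small and large elements *)

Section Decoupling.
Variables (n d : nat) (w : 'I_n.+1 -> 'I_d -> R).
Hypothesis w_ge0 : forall i j, 0 <= w i j.
Hypothesis w_sum1 : forall i, \big[Rplus/0]_j w i j = 1.
Implicit Types (f g : {ffun 'I_n.+1 -> 'I_d} -> R).

Definition rho (G : pred 'I_n.+1) (u : nat) : R := Ex w (fun a => indic (XG G a + u == n)%N).

Lemma indic01 b : 0 <= indic b <= 1.
Proof. by rewrite /indic; case: b; lra. Qed.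

Lemma decouple (T V G : pred 'I_n.+1) f g eta :
  (forall h, V h -> ~~ T h) -> (forall h, G h -> ~~ T h) -> (forall h, G h -> ~~ V h) ->
  depends_on T f -> depends_on V g ->
  (forall a : {ffun 'I_n.+1 -> 'I_d}, Rabs (rho G (XG T a + XG V a)%N - rho G (XG V a)) <= eta) ->
  Rabs (Ex w (fun a => f a * g a * indic (XG T a + XG V a + XG G a == n)%N)
        - Ex w f * Ex w (fun a => g a * rho G (XG V a))) <=
  eta * (Ex w (fun a => Rabs (f a)) * Ex w (fun a => Rabs (g a))).
Proof.
move=> VT GT GV hf hg heta; pose A : pred 'I_n.+1 := fun h => T h || V h.
have GA h : G h -> ~~ A h by move=> Gh; rewrite /A negb_or GT // GV.
have TA h : T h -> A h by rewrite /A => ->.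
have VA h : V h -> A h by rewrite /A orbC => ->.
rewrite (Ex_merge w_sum1 A).
rewrite (Ex_ext (G := fun a => f a * g a * rho G (XG T a + XG V a)%N)); last first.
  move=> a; rewrite /rho -Ex_scal; apply: Ex_ext => a'.
  rewrite (merge_dep_l _ _ (depends_mono TA hf)) (merge_dep_l _ _ (depends_mono VA hg)).
  rewrite (merge_dep_l _ _ (depends_mono TA (@XG_dep _ _ T))).
  rewrite (merge_dep_l _ _ (depends_mono VA (@XG_dep _ _ V))).
  by rewrite (merge_dep_r _ _ (@XG_dep _ _ G) GA) addnC.
have hgr : depends_on V (fun a => g a * rho G (XG V a)).
  by move=> a a' e; rewrite (hg _ _ e) (XG_dep e).
rewrite -(Ex_indep w_sum1 hf hgr VT) -Ex_sub.
apply: Rle_trans (Ex_abs w_ge0 _) _.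
have habs : depends_on T (fun a => Rabs (f a)) by move=> a a' e; rewrite (hf _ _ e).
have gabs : depends_on V (fun a => Rabs (g a)) by move=> a a' e; rewrite (hg _ _ e).
rewrite -(Ex_indep w_sum1 habs gabs VT) -Ex_scal; apply: Ex_le => // a.
rewrite (_ : f a * g a * _ - _ = f a * g a * (rho G (XG T a + XG V a)%N - rho G (XG V a))); last ring.
rewrite !Rabs_mult; have := heta a; have := Rmult_le_pos _ _ (Rabs_pos (f a)) (Rabs_pos (g a)).
by move=> h1 h2; have := Rmult_le_compat_l _ _ _ h1 h2; lra.
Qed.

(** Given the coordinates in [A], the sum over [G] must take one prescribed value, which has
    probability at most [B] whatever they are. *)
Lemma half_bound (A G : pred 'I_n.+1) f B :
  (forall h, G h -> ~~ A h) -> depends_on A f -> (forall a, 0 <= f a) ->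
  (forall a : {ffun 'I_n.+1 -> 'I_d}, rho G (XG A a) <= B) ->
  Ex w (fun a => f a * indic (XG A a + XG G a == n)%N) <= B * Ex w f.
Proof.
move=> GA hf f0 hB; rewrite (Ex_merge w_sum1 A).
rewrite (Ex_ext (G := fun a => f a * rho G (XG A a))); last first.
  move=> a; rewrite /rho -Ex_scal; apply: Ex_ext => a'.
  rewrite (merge_dep_l _ _ hf) (merge_dep_l _ _ (@XG_dep _ _ A)).
  by rewrite (merge_dep_r _ _ (@XG_dep _ _ G) GA) addnC.
rewrite -Ex_scal; apply: Ex_le => // a.
by have := Rmult_le_compat_l _ _ _ (f0 a) (hB a); lra.
Qed.

Variable jb : 'I_d.

Definition NG (V : pred 'I_n.+1) (a : {ffun 'I_n.+1 -> 'I_d}) : R :=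
  \big[Rplus/0]_(h < n.+1 | V h) indic (a h == jb).
Definition nuG (V : pred 'I_n.+1) : R := \big[Rplus/0]_(h < n.+1 | V h) w h jb.

Lemma NG_dep V : depends_on V (NG V).
Proof. by move=> a a' e; apply: eq_bigr => h Vh; rewrite e. Qed.

Lemma NG_bounds V a : 0 <= NG V a <= INR #|V|.
Proof.
split; first by apply: rsum_ge0 => h _; have := indic01 (a h == jb); lra.
rewrite -[INR _]Rmult_1_r -rsum_const; apply: rsum_le => h _.
by have := indic01 (a h == jb); lra.
Qed.

Lemma w_le1 h j : w h j <= 1.
Proof.
rewrite -(w_sum1 h) (bigD1 j) //= -[X in X <= _]Rplus_0_r.
by apply: Rplus_le_compat_l; apply: rsum_ge0.
Qed.

Lemma nuG_bounds V : 0 <= nuG V <= INR #|V|.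
Proof.
split; first by apply: rsum_ge0.
by rewrite -[INR _]Rmult_1_r -rsum_const; apply: rsum_le => h _; apply: w_le1.
Qed.

Lemma Ex_digit h : Ex w (fun a => indic (a h == jb)) = w h jb.
Proof.
rewrite (Ex_coord w_sum1 h (fun j => indic (j == jb))) (bigD1 jb) //= eqxx /indic.
by rewrite big1 ?Rplus_0_r ?Rmult_1_r // => j /negbTE ->; rewrite Rmult_0_r.
Qed.

Lemma Ex_NG V : Ex w (NG V) = nuG V.
Proof. by rewrite Ex_sum; apply: eq_bigr => h _; exact: Ex_digit. Qed.

Lemma NG_var V : Ex w (fun a => (NG V a - nuG V) ^ 2) =
  \big[Rplus/0]_(h < n.+1 | V h) (w h jb * (1 - w h jb)).
Proof.
pose xi h a := indic (a h == jb) - w h jb.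
have E0 h : Ex w (xi h) = 0 by rewrite Ex_sub Ex_digit Ex_const //; lra.
have xd h : depends_on (pred1 h) (xi h) by move=> a a' e; rewrite /xi e //= eqxx.
rewrite (Ex_ext (G := fun a => \big[Rplus/0]_(h < n.+1 | V h)
   \big[Rplus/0]_(h' < n.+1 | V h') (xi h a * xi h' a))); last first.
  move=> a; rewrite -[LHS]/((NG V a - nuG V) * ((NG V a - nuG V) * 1)) Rmult_1_r.
  rewrite /NG /nuG -rsum_sub.
  exact: big_distrlr.
rewrite Ex_sum; apply: eq_bigr => h Vh; rewrite Ex_sum (bigD1 h) //= big1 ?Rplus_0_r.
  rewrite (Ex_ext (G := fun a => (1 - 2 * w h jb) * indic (a h == jb) + w h jb ^ 2)); last first.
    by move=> a; rewrite /xi /indic; case: eqP => _ /=; ring.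
  by rewrite Ex_add Ex_scal Ex_digit Ex_const //; ring.
move=> h' /andP [_ hh]; rewrite (Ex_indep w_sum1 (xd h) (xd h')) ?E0; first ring.
by move=> i /= /eqP ->.
Qed.

Lemma NG_var_le V : Ex w (fun a => (NG V a - nuG V) ^ 2) <= INR #|V|.
Proof.
rewrite NG_var -[INR _]Rmult_1_r -rsum_const; apply: rsum_le => h _.
by have := w_ge0 h jb; have := w_le1 h jb; nra.
Qed.

Lemma NG_abs_le V a : Rabs (NG V a - nuG V) <= INR #|V|.
Proof. by have := NG_bounds V a; have := nuG_bounds V => *; apply: Rabs_le; lra. Qed.

Lemma NGU (V1 V2 : pred 'I_n.+1) a : (forall h, V1 h -> ~~ V2 h) ->
  NG (fun h => V1 h || V2 h) a = NG V1 a + NG V2 a.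
Proof.
move=> dj; rewrite /NG big_mkcond [X in X + _]big_mkcond [X in _ + X]big_mkcond.
rewrite -big_split; apply: eq_bigr => h _ /=.
by have := dj h; case: (V1 h); case: (V2 h) => //=; rewrite ?Rplus_0_r ?Rplus_0_l //; move/(_ isT).
Qed.

End Decoupling.

Section Support.
Variables (n d : nat) (S : pred nat) (r : R).
Hypothesis hd : (2 <= d)%N.
Let w := @wS d S r n.

Lemma Ex_support F F' : (forall a : {ffun 'I_n.+1 -> 'I_d}, (forall h : 'I_n.+1, ~~ S h -> val (a h) = 0%N) -> F a = F' a) ->
  Ex w F = Ex w F'.
Proof.
move=> hF; apply: eq_bigr => a _.
case: (classic (forall h : 'I_n.+1, ~~ S h -> val (a h) = 0%N)) => [h|]; first by rewrite hF.
move=> /not_all_ex_not [h hh].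
suff -> : wt w a = 0 by rewrite !Rmult_0_l.
rewrite /wt (bigD1 h) //= /w /wS; case Sh: (S h); first by case: hh; rewrite Sh.
rewrite /indic; case: eqP => e; last by rewrite Rmult_0_l.
by case: hh => _; exact: e.
Qed.

Lemma XG_support (a : {ffun 'I_n.+1 -> 'I_d}) : (forall h : 'I_n.+1, ~~ S h -> val (a h) = 0%N) ->
  XG xpredT a = XG S a.
Proof.
move=> h0; rewrite /XG [RHS]big_mkcond; apply: eq_bigr => h _.
by have := h0 h; case: (S h) => // ->.
Qed.

Lemma NG_support (jb : 'I_d) (a : {ffun 'I_n.+1 -> 'I_d}) : (0 < val jb)%N ->
  (forall h : 'I_n.+1, ~~ S h -> val (a h) = 0%N) -> NG jb xpredT a = NG jb S a.
Proof.
move=> b0 h0; rewrite /NG [RHS]big_mkcond; apply: eq_bigr => h _.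
have := h0 h; case: (S h) => // /(_ isT) e; rewrite /indic -val_eqE /= e.
by case: eqP => // e2; move: b0; rewrite /= -e2.
Qed.

End Support.

Lemma INR_thr (x : R) : 0 <= x -> x <= INR (Z.to_nat (up x)) <= x + 1.
Proof.
move=> x0; have [h1 h2] := archimed x.
have u0 : (0 <= up x)%Z by apply: le_IZR; lra.
by rewrite INR_IZR_INZ Z2Nat.id //; lra.
Qed.

Section Structure.
Variables (d m : nat) (p : 'I_m -> nat).
Hypotheses (hd : (2 <= d)%N) (hm : (2 <= m)%N)
  (hp1 : forall i : 'I_m, (1 < p i)%N)
  (hcop : forall i j : 'I_m, i <> j -> coprime (p i) (p j)).
Variables (i0 i1 : 'I_m).
Hypothesis i01 : i0 <> i1.

Let S := inSb m p.
Let k := m.-1.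
Let P := p i0.
Let Q := p i1.
Let pr := par p i0 i1.

Notation wr := (wr d p).
Notation Gp := (Gp p i0 i1).
Notation zset := (zset p i0 i1).
Notation qn := (qn d).
Notation rt := (rt m).

Definition thr (K1 n : nat) : nat := Z.to_nat (up (INR n / L n ^ K1)).
(* Besides the large elements, [U] contains all of [zset], which alone makes the point masses of [XG] vary slowly. *)
Definition Uset (n K1 Kb : nat) : pred 'I_n.+1 := fun h =>
  S h && ((thr K1 n <= h) || (pq_pow P Q h && (vp Q h < Kb * lnn n)))%N.
Arguments Uset : clear implicits.

Lemma cnt_upper : exists C, 0 < C /\ ev (fun n => INR (cnt p n) <= C * L n ^ m).
Proof.
have [C [C0 hC]] := cS_count (cbb hp1 hcop) (size_bases_k p hm).
have V0 := genl_vol_gt0 (cbb hp1 hcop).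
have km : m.-1.+1 = m by rewrite prednK // ltnW.
exists (genl_vol (bases p) + C * 2 ^ k); split.
  by have : 0 <= C * 2 ^ k by [apply: Rmult_le_pos => //; apply: pow_le; lra]; lra.
apply: ev_imp (ev_and (ev_ge 1) ev_L_gt1) => n [n0 L1].
have /Rabs_le_between [_ h] := hC n n0; rewrite -/k in h.
have h2 := proj2 (Lam_bounds m L1); rewrite -/k in h2.
have Lk : 0 < L n ^ k by apply: pow_lt; lra.
have := Rmult_le_compat_l _ _ _ C0 h2.
have Em : L n ^ m = L n * L n ^ k by rewrite -[in LHS]km.
rewrite km Em in h; rewrite Em.
have : C * (2 ^ k * L n ^ k) <= C * (2 ^ k * (L n * L n ^ k)).
  apply: Rmult_le_compat_l => //; apply: Rmult_le_compat_l; first by apply: pow_le; lra.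
  by nra.
rewrite /cnt; lra.
Qed.

Lemma zset_card (n Kb : nat) : (0 < n)%N ->
  (#|[pred h : 'I_n.+1 | pq_pow P Q h && (vp Q h < Kb * lnn n)%N]| <=
   (trunc_log P n).+1 * (Kb * lnn n))%N.
Proof.
move=> n0; have P1 : (1 < P)%N := hp1 i0.
case: (posnP (Kb * lnn n)%N) => [->|b0].
  by rewrite muln0 leqn0; apply/eqP; apply: eq_card0 => h; rewrite !inE ltn0 andbF.
set Z := [pred h : 'I_n.+1 | _]; set A := (trunc_log P n).+1; set B := (Kb * lnn n)%N in b0 *.
have B1 : B = B.-1.+1 by rewrite prednK.
pose f (h : 'I_n.+1) : 'I_A * 'I_B.-1.+1 := (inord (vp P h), inord (vp Q h)).
have vA (h : 'I_n.+1) : Z h -> (vp P h < A)%N.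
  move=> /andP [/eqP eh _]; rewrite /A ltnS; apply: trunc_log_max => //.
  apply: leq_trans (_ : h <= n)%N; last by rewrite -ltnS.
  by rewrite {2}eh leq_pmulr // expn_gt0 ltnW // hp1.
have fi : {in Z &, injective f}.
  move=> h h' Zh Zh' [/(congr1 val) e1 /(congr1 val) e2].
  have /andP [/eqP eh hb] := Zh; have /andP [/eqP eh' hb'] := Zh'.
  rewrite /= !inordK ?vA // in e1; rewrite /= !inordK -?B1 // in e2.
  by apply: val_inj => /=; rewrite eh eh' e1 e2.
rewrite -(card_in_image fi); apply: leq_trans (max_card _) _.
by rewrite card_prod !card_ord -B1.
Qed.

(** The elements above [n / L^K1] fill a window of logarithmic width [O(ln L)], hence number
    [O(L^k ln L)]. The others are given by [O(L)] exponents of [P] and [O(ln L)] exponents of [Q],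
    and [L <= L^k] since [m >= 2]. *)
Lemma U_card K1 Kb : exists C, 0 < C /\ ev (fun n => INR #|Uset n K1 Kb| <= C * ln (L n) * L n ^ k).
Proof.
have [C [C0 hC]] := cS_upper (cbb hp1 hcop) (size_bases_k p hm).
have P1 : (1 < P)%N := hp1 i0.
have K10 := pos_INR K1; have Kb0 := pos_INR Kb.
exists (C * (2 + INR K1) * 2 ^ k + 6 * INR Kb + 1).
have p2 : 0 < 2 ^ k by apply: pow_lt; lra.
have c2 : 0 < C * (2 + INR K1) * 2 ^ k by do 2?[apply: Rmult_lt_0_compat]; lra.
split; first lra.
have := ev_L_gt1; move/ev_and => /(_ _ lnn_bounds); move/ev_and => /(_ _ (ev_ge 1)).
move/ev_and => /(_ _ (ev_pow_exp 4 K1 (ltac:(lra) : 0 < 1))).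
apply: ev_imp => n [[[L1 [l1 [l2 l3]]] n0] hn].
rewrite Rmult_1_l exp_L // in hn.
have nR : 0 < INR n by apply: INR_gt0.
have LK : 0 < L n ^ K1 by apply: pow_lt; lra.
have Lk : 1 <= L n ^ k by apply: pow_R1_Rle.
have LLk : L n <= L n ^ k.
  have k0 := k_gt0 hm; rewrite -{1}[L n]pow_1; apply: Rle_pow => //; exact/leP.
set x := INR n / L n ^ K1.
have x4 : 4 <= x.
  apply: (Rmult_le_reg_r (L n ^ K1)) => //; rewrite /x /Rdiv Rmult_assoc Rinv_l; lra.
have [t1 t2] := INR_thr (x := x) ltac:(lra); rewrite -/(thr K1 n) in t1 t2.
set t := thr K1 n in t1 t2 *.
have t4 : (4 <= t)%N by apply/leP; apply: INR_le; rewrite (_ : INR 4 = 4) /=; lra.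
have tn : (t.-1 <= n)%N.
  apply/leP; apply: INR_le; rewrite -subn1 minus_INR; last by apply/leP; apply: leq_trans t4.
  have : x <= INR n.
    apply: (Rmult_le_reg_r (L n ^ K1)) => //; rewrite /x /Rdiv Rmult_assoc Rinv_l ?Rmult_1_r; last lra.
    by have : 1 <= L n ^ K1 by [apply: pow_R1_Rle]; nra.
  by rewrite /=; lra.
have t10 : (0 < t.-1)%N by rewrite -ltnS prednK; apply: leq_trans t4.
pose W := [pred h : 'I_n.+1 | S h && (t.-1 < h <= n)%N].
pose Z := [pred h : 'I_n.+1 | pq_pow P Q h && (vp Q h < Kb * lnn n)%N].
have hU : (#|Uset n K1 Kb| <= #|W| + #|Z|)%N.
  rewrite -cardUI; apply: leq_trans (leq_addr _ _); apply: subset_leq_card.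
  apply/subsetP => h; rewrite !inE unfold_in /Uset => /andP [Sh /orP [hh|hh]].
    have hle : (h <= n)%N by rewrite -ltnS ltn_ord.
    rewrite Sh hle andbT /= prednK ?hh //; by apply: leq_trans t4.
  by rewrite /= hh orbT.
apply: Rle_trans (INR_leq hU) _; rewrite plus_INR.
have hW : INR #|W| <= C * (2 + INR K1) * 2 ^ k * ln (L n) * L n ^ k.
  rewrite card_window //; apply: Rle_trans (hC _ _ t10 tn) _.
  have lt : L n - INR K1 * ln (L n) - ln 2 <= ln (INR t.-1).
    have -> : L n - INR K1 * ln (L n) - ln 2 = ln (x / 2).
      rewrite /x /Rdiv !ln_mult ?ln_Rinv ?ln_pow; try lra.
      - by apply: Rinv_0_lt_compat.
      - by apply: Rmult_lt_0_compat => //; apply: Rinv_0_lt_compat.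
    have tx : x / 2 <= INR t.-1.
      by rewrite -subn1 minus_INR /=; [lra | apply/leP; apply: leq_trans t4].
    by case: tx => [h|->]; [left; apply: ln_increasing => //; lra | right].
  have l22 : ln 2 <= 1.
    by rewrite -[X in _ <= X]ln_exp; left; apply: ln_increasing; [lra | have := exp_ineq1 1 ltac:(lra); lra].
  have h2 := proj2 (Lam_bounds m L1); rewrite -/k in h2.
  have hm1 : 1 + (L n - ln (INR t.-1)) <= (2 + INR K1) * ln (L n) by nra.
  have h0 : 0 <= (1 + L n) ^ k by apply: pow_le; lra.
  rewrite (_ : C * (2 + INR K1) * 2 ^ k * ln (L n) * L n ^ k = C * ((2 + INR K1) * ln (L n)) * (2 ^ k * L n ^ k)); last ring.
  apply: Rle_trans (_ : C * ((2 + INR K1) * ln (L n)) * (1 + L n) ^ k <= _).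
    by apply: Rmult_le_compat_r => //; apply: Rmult_le_compat_l; lra.
  by apply: Rmult_le_compat_l => //; apply: Rmult_le_pos; nra.
have hZ : INR #|Z| <= 6 * INR Kb * ln (L n) * L n ^ k.
  apply: Rle_trans (INR_leq (zset_card Kb n0)) _; rewrite !mult_INR S_INR.
  have hA : INR (trunc_log P n) <= 2 * L n.
    have h1 : INR (trunc_log P n) * ln (INR P) <= L n.
      rewrite -ln_INR_expn; last exact: ltnW.
      by apply: ln_INR_le; [rewrite expn_gt0 ltnW | apply: trunc_logP].
    have h2 : / 2 <= ln (INR P).
      have h3 : / 2 < ln 2 by exact: ln_lt_2.
      have := @ln_INR_le 2 P isT P1; rewrite (_ : INR 2 = 2) //; lra.
    have := Rmult_le_compat_l _ _ _ (pos_INR (trunc_log P n)) h2; lra.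
  have A0 := pos_INR (trunc_log P n); have B0 := pos_INR (lnn n).
  apply: Rle_trans (_ : 3 * L n ^ k * (INR Kb * (2 * ln (L n))) <= _); last by right; ring.
  apply: Rmult_le_compat; [lra | nra | lra |].
  by apply: Rmult_le_compat_l; lra.
have : 0 <= ln (L n) * L n ^ k by apply: Rmult_le_pos; lra.
lra.
Qed.

Definition Ue n K1 Kb (e : bool) : pred 'I_n.+1 := fun h => Uset n K1 Kb h && (pr h == e).
Definition Ts n K1 Kb : pred 'I_n.+1 := fun h => S h && ~~ Uset n K1 Kb h.
Arguments Ue : clear implicits.
Arguments Ts : clear implicits.

Lemma Ts_small n K1 Kb h : 0 < L n ^ K1 -> Ts n K1 Kb h -> INR h <= INR n / L n ^ K1.
Proof.
move=> LK /andP [Sh]; rewrite /Uset Sh /= negb_or -ltnNge => /andP [ht _].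
have x0 : 0 <= INR n / L n ^ K1 by apply: Rmult_le_pos; [exact: pos_INR | left; apply: Rinv_0_lt_compat].
have [_ t2] := INR_thr x0; have := INR_leq ht; rewrite S_INR -/(thr K1 n) in t2 *; lra.
Qed.

(** The sums come from two different digit vectors; [merge] glues them into one, to which [XG_qn]
    applies. *)
Lemma XG_pair_lt n (A B : pred 'I_n.+1) (a a' : {ffun 'I_n.+1 -> 'I_d}) :
  (forall h, A h -> ~~ B h) -> (XG A a + XG B a' < (2 * qn n).+1)%N.
Proof.
move=> AB; have BA h : B h -> ~~ A h by move=> Bh; apply/negP => /AB; rewrite Bh.
have := XG_qn hd (fun h => A h || B h) (merge A a a').
rewrite XGU // (merge_dep_l _ _ (@XG_dep _ _ A)) (merge_dep_r _ _ (@XG_dep _ _ B) BA).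
by apply: leq_ltn_trans; apply: leq_addr.
Qed.

Variable jb : 'I_d.

(* [cE] is the expectation conditioned on the sum being [n], that is, the average over the representations of [n]. *)
Definition PX n r : R := Ex (wr n r) (fun a => indic (XG xpredT a == n)).
Definition cE n r (F : {ffun 'I_n.+1 -> 'I_d} -> R) : R :=
  Ex (wr n r) (fun a => F a * indic (XG xpredT a == n)) / PX n r.
Arguments PX : clear implicits.
Arguments cE : clear implicits.

(** All that the sequel uses about the condition: statistics of [T] keep their unconditional law,
    they are almost uncorrelated with the count on [U], and that count keeps a variance [O(#U)]. The
    errors are [L^(-(2m+1))], since they will be multiplied by up to [#T * #U = O(L^(2m))]. *)
Lemma conditioned_decoupling : exists C, 0 < C /\ ev (fun n => exists (T U : pred 'I_n.+1) r,
  let w := wr n r in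
  [/\ 0 < PX n r, forall h, T h -> ~~ U h & forall h : 'I_n.+1, S h = T h || U h] /\
  [/\ INR #|U| <= C * ln (L n) * L n ^ k,
      INR #|T| <= C * L n ^ m,
      INR #|T| = INR (cnt p n) - INR #|U| &
      exists dt, [/\ 0 <= dt, INR #|T| * dt <= / L n & forall h j, T h ->
        exp (- dt) / INR d <= w h j <= exp dt / INR d]] /\
  [/\ forall f, depends_on T f -> Rabs (cE n r f - Ex w f) <= / L n ^ (2 * m + 1) * Ex w (fun a => Rabs (f a)),
      forall f, depends_on T f -> Ex w f = 0 ->
        Rabs (cE n r (fun a => f a * (NG jb U a - nuG w jb U))) <=
          / L n ^ (2 * m + 1) * (Ex w (fun a => Rabs (f a)) * INR #|U|) &
      cE n r (fun a => (NG jb U a - nuG w jb U) ^ 2) <= C * INR #|U|]).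
Proof.
have [C2 [N0 [C20 hsad]]] := saddle_exists hd hm hp1 hcop.
have [cl [cl0 hlow]] := prob_low hd hm hp1 hcop i01 C20.
have [Cs [Cs0 hsup]] := prob_sup hd hm hp1 hcop i01 C20.
have [Cc [Cc0 hcnt]] := cnt_upper.
(* Dividing by [P(X = n)], which may be as small as a constant times [1 / (n L^k)], costs [L^k]; one
   more [L] absorbs the constants, leaving [L^(-(2m+1))]. *)
have [Kb [K4 hsm]] := prob_smooth hd hm hp1 hcop i01 C20 (k + (2 * m + 2)).
(* The part [K4 + (m + 1)] keeps the sum over the [O(L^m)] elements of [T] below [n / L^K4]; the
   part [k + m + 2] makes [#T * dt] small, given [r n = O(L^k)]. *)
pose K1 := (K4 + (m + 1) + (k + m + 2))%N.
have [Cu [Cu0 hU]] := U_card K1 Kb.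
exists (Cu + Cc + 2 * Cs / cl).
have Csc : 0 < 2 * Cs / cl by apply: Rmult_lt_0_compat; [lra | apply: Rinv_0_lt_compat].
split; first lra.
have d0 : 0 < INR d by apply: INR_gt0; apply: ltnW.
have := hlow; move/ev_and => /(_ _ hsup); move/ev_and => /(_ _ hcnt); move/ev_and => /(_ _ hsm).
move/ev_and => /(_ _ hU); move/ev_and => /(_ _ (ev_rt p hd hm C2)); move/ev_and => /(_ _ lnn_bounds).
move/ev_and => /(_ _ (ev_ge (maxn 1 N0))); move/ev_and => /(_ _ ev_L_gt1).
move/ev_and => /(_ _ (ev_ln (2 * 2 ^ k / cl))); move/ev_and => /(_ _ (ev_ln (INR d * Cc))).
move/ev_and => /(_ _ (ev_ln (INR d * C2 * 2 ^ k * Cc))).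
apply: ev_imp => n [[[[[[[[[[[hl hs] hc] hsm'] hu] hrt] [l1 _]] nN] L1] Lcl] LdC] LdC2].
move: nN; rewrite geq_max => /andP [n0 nN0].
have [r sr0] := hsad n nN0.
have sr : saddle d p C2 n r by [].
exists (Ts n K1 Kb), (Uset n K1 Kb), r => w.
set T := Ts n K1 Kb; set U := Uset n K1 Kb.
have [[r0 rt0 rt1 q1 q2] _] := hrt r sr.
have nR : 0 < INR n by apply: INR_gt0.
have LL j : 1 <= L n ^ j by apply: pow_R1_Rle.
have LK1 : 0 < L n ^ K1 by have := LL K1; lra.
have w_ge0 : forall i j, 0 <= w i j by exact: wr_ge0.
have w_sum1 : forall i, \big[Rplus/0]_j w i j = 1 by exact: wr_sum1.
have TU h : T h -> ~~ U h by case/andP.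
have STU (h : 'I_n.+1) : S h = T h || U h.
  rewrite /T /Ts -/U; case Uh: (U h); last by rewrite andbT orbF.
  by rewrite andbF /=; case/andP: Uh.
have hcard : INR #|T| = INR (cnt p n) - INR #|U|.
  rewrite -(card_cnt hp1 hcop (leqnn n)).
  suff -> : #|[pred h : 'I_n.+1 | S h && (h <= n)%N]| = (#|T| + #|U|)%N by rewrite plus_INR; ring.
  rewrite -cardUI [X in (_ + X)%N](_ : _ = 0%N) ?addn0.
    by apply: eq_card => h; rewrite !inE -[(h <= n)%N]ltnS ltn_ord andbT; exact: STU.
  apply: eq_card0 => h; rewrite !inE; apply/negP => /andP [Th Uh].
  by have := TU h Th; rewrite -[U h]/(h \in U) Uh.
have U0 := pos_INR #|U|.
have Tc : INR #|T| <= Cc * L n ^ m by lra.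
have PX0 : cl * rt n r <= PX n r by apply: hl.
have PXp : 0 < PX n r by have := Rmult_lt_0_compat _ _ cl0 rt0; lra.
set V := Ue n K1 Kb.
have TV e h : V e h -> ~~ T h.
  by case/andP => Uh _; apply/negP => /TU; rewrite -/U in Uh; rewrite Uh.
have VV e h : V e h -> ~~ V (~~ e) h.
  by case/andP => Uh /eqP pe; rewrite /V /Ue pe negb_and; case: (e); rewrite orbT.
have UV a : NG jb U a = NG jb (V true) a + NG jb (V false) a.
  rewrite -NGU; last by move=> h; apply: (VV true).
  apply: eq_bigl => h; rewrite /V /Ue -/U; case: (U h) => //=; by case: (pr h).
have nuUV : nuG w jb U = nuG w jb (V true) + nuG w jb (V false).
  rewrite -!Ex_NG // -Ex_add; apply: Ex_ext => a; exact: UV.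
have cUV : INR #|U| = INR #|V true| + INR #|V false|.
  suff -> : #|U| = (#|V true| + #|V false|)%N by rewrite plus_INR.
  rewrite -cardUI [X in (_ + X)%N](_ : _ = 0%N) ?addn0.
    apply: eq_card => h; rewrite !inE -[LHS]/(U h) -[h \in V true]/(V true h) -[h \in V false]/(V false h).
    by rewrite /V /Ue -/U; case: (U h) => //=; case: (pr h).
  apply: eq_card0 => h; rewrite !inE; apply/negP => /andP [h1 h2].
  by have := VV true h h1; rewrite -[V _ h]/(h \in V false) h2.
have XS e a : (XG T a + XG (V e) a + XG (V (~~ e)) a = XG S a)%N.
  rewrite -XGU; last by move=> h Th; apply/negP => /TV; rewrite Th.
  rewrite -XGU; last first.
    move=> h /orP [Th|/VV //]; apply/negP => /TV; by rewrite Th.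
  apply: eq_bigl => h; rewrite STU /V /Ue -/U; case: (T h) => //=; case: (U h) => //=.
  by case: (pr h); case: (e).
have Xsupp F : Ex w (fun a => F a * indic (XG xpredT a == n)) = Ex w (fun a => F a * indic (XG S a == n)).
  by apply: Ex_support => a ha; rewrite (XG_support ha).
have PXS : PX n r = Ex w (fun a => indic (XG S a == n)).
  have := Xsupp (fun _ => 1).
  rewrite (Ex_ext (G := fun a => indic (XG xpredT a == n))); last by move=> a; ring.
  rewrite [RHS](Ex_ext (G := fun a => indic (XG S a == n))) //; by move=> a; ring.
set eta := / L n ^ (k + (2 * m + 2)) / INR n in hsm'.
have eta0 : 0 < eta.
  by apply: Rmult_lt_0_compat; apply: Rinv_0_lt_compat => //; have := LL (k + (2 * m + 2))%N; lra.
have Xt a : INR (XG (d := d) T a) <= INR n / L n ^ K4.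
  apply: Rle_trans (_ : INR #|T| * (INR d * (INR n / L n ^ K1)) <= _).
    rewrite /XG INR_sum -rsum_const; apply: rsum_le => h Th; rewrite mult_INR.
    apply: Rmult_le_compat; [exact: pos_INR | exact: pos_INR | |].
      by apply: INR_leq; apply: ltnW.
    exact: Ts_small LK1 Th.
  have x0 : 0 <= INR d * (INR n / L n ^ K1).
    by apply: Rmult_le_pos; [lra | apply: Rmult_le_pos; [lra | left; apply: Rinv_0_lt_compat]].
  apply: Rle_trans (Rmult_le_compat_r _ _ _ x0 Tc) _.
  have -> : L n ^ K1 = L n ^ K4 * (L n ^ m * L n) * L n ^ (k + m + 2).
    by rewrite /K1 (pow_add _ (K4 + (m + 1))) (pow_add _ K4) (pow_add _ m) pow_1.
  have g1 := LL m; have g2 := LL K4; have g3 := LL (k + m + 2)%N.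
  apply: (Rmult_le_reg_r (L n ^ K4 * (L n * L n ^ (k + m + 2)))).
    by apply: Rmult_lt_0_compat; [lra | nra].
  rewrite (_ : _ * _ = INR d * Cc * INR n); last first.
    by field; repeat split; lra.
  rewrite (_ : INR n / L n ^ K4 * _ = L n * L n ^ (k + m + 2) * INR n); last by field; lra.
  by apply: Rmult_le_compat_r; [lra | nra].
(* [V (~~ e)] contains the whole [zset] of its parity, so its point masses vary slowly although it
   is only half of [U]. *)
have Hrho e (a : {ffun 'I_n.+1 -> 'I_d}) : Rabs (rho w (V (~~ e)) (XG T a + XG (V e) a)%N - rho w (V (~~ e)) (XG (V e) a)) <= eta.
  rewrite /rho; refine (hsm' r sr (~~ e) (V (~~ e)) _ _ _ (Xt a) _).
    move=> h /and3P [h1 h2 h3]; rewrite /V /Ue /Uset h3 h1 h2 orbT !andbT.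
    by rewrite (eqP h1); apply: S_pq.
  move=> a'; rewrite -XGU; last by move=> h Th; apply/negP => /TV; rewrite Th.
  apply: XG_pair_lt => h hV; rewrite negb_or (TV _ _ hV) /=.
  by apply/negP => /VV; rewrite hV.
have dec e f g : depends_on T f -> depends_on (V e) g ->
  Rabs (Ex w (fun a => f a * g a * indic (XG S a == n)) - Ex w f * Ex w (fun a => g a * rho w (V (~~ e)) (XG (V e) a))) <=
   eta * (Ex w (fun a => Rabs (f a)) * Ex w (fun a => Rabs (g a))).
  move=> hf hg.
  have := decouple w_ge0 w_sum1 (TV e) (TV (~~ e)) _ hf hg (Hrho e).
  rewrite (Ex_ext (G := fun a => f a * g a * indic (XG S a == n))); last by move=> a; rewrite XS.
  by apply=> h hV; apply/negP => /VV; rewrite hV.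
have hdp c : depends_on (V true) (fun _ : {ffun 'I_n.+1 -> 'I_d} => c : R) by [].
have hdT c : depends_on T (fun _ : {ffun 'I_n.+1 -> 'I_d} => c : R) by [].
(* [B] approximates [P(X = n)]: both [f] and the constant 1 are decoupled against it, whence the
   factor 2 in [kap]. *)
set B := Ex w (fun a => 1 * rho w (V false) (XG (V true) a)).
have dec1 f : depends_on T f -> Rabs (Ex w (fun a => f a * indic (XG S a == n)) - Ex w f * B) <= eta * Ex w (fun a => Rabs (f a)).
  move=> hf; have := dec true f (fun _ => 1) hf (hdp 1).
  rewrite (Ex_ext (G := fun a => f a * indic (XG S a == n))); last by move=> a; ring.
  by rewrite Rabs_R1 (Ex_const w_sum1) Rmult_1_r.
have decP : Rabs (PX n r - B) <= eta.
  have := dec1 (fun _ => 1) (hdT 1).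
  rewrite (Ex_ext (G := fun a => indic (XG S a == n))); last by move=> a; ring.
  by rewrite Rabs_R1 !(Ex_const w_sum1) Rmult_1_r Rmult_1_l -PXS.
have kap : 2 * eta / PX n r <= / L n ^ (2 * m + 1).
  apply: Rle_trans (_ : 2 * eta / (cl * rt n r) <= _).
    apply: Rmult_le_compat_l; first lra.
    by apply: Rinv_le_contravar => //; apply: Rmult_lt_0_compat.
  have g1 := LL k; have g2 := LL (2 * m + 1)%N; have p2 : 0 < 2 ^ k by apply: pow_lt; lra.
  apply: (Rmult_le_reg_r (cl * rt n r)); first by apply: Rmult_lt_0_compat.
  rewrite (_ : _ / _ * _ = 2 * eta); last by field; lra.
  apply: Rle_trans (_ : / L n ^ (2 * m + 1) * (cl * (/ INR n / (2 ^ k * L n ^ k))) <= _); last first.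
    apply: Rmult_le_compat_l; first by left; apply: Rinv_0_lt_compat; lra.
    apply: Rmult_le_compat_l; first lra.
    apply: (Rmult_le_reg_r (2 ^ k * L n ^ k)); first by apply: Rmult_lt_0_compat; lra.
    rewrite /Rdiv Rmult_assoc Rinv_l ?Rmult_1_r; [by [] | nra].
  rewrite /eta (_ : (2 * m + 2 = 2 * m + 1 + 1)%N); last by rewrite -addnA.
  rewrite [in X in X <= _]pow_add [in X in X <= _](pow_add _ (2 * m + 1)) pow_1.
  set X1 := L n ^ k in g1 *; set X2 := L n ^ (2 * m + 1) in g2 *.
  apply: (Rmult_le_reg_r (X1 * X2 * L n * INR n * 2 ^ k)).
    by do 4?[apply: Rmult_lt_0_compat]; lra.
  rewrite (_ : _ * _ = 2 * 2 ^ k); last by field; lra.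
  rewrite (_ : / X2 * _ * _ = cl * L n); last by field; lra.
  have := Rmult_le_compat_l cl _ _ (Rlt_le _ _ cl0) Lcl.
  by rewrite (_ : cl * (2 * 2 ^ k / cl) = 2 * 2 ^ k); [lra | field; lra].
split; first by split.
split.
  split=> //.
  - apply: Rle_trans hu _; have : 0 <= ln (L n) * L n ^ k by apply: Rmult_le_pos; [lra | have := LL k; lra].
    by have : 0 < Cc by []; nra.
  - by apply: Rle_trans Tc _; apply: Rmult_le_compat_r; [have := LL m; lra | lra].
  exists (INR d * (r * (INR n / L n ^ K1))).
  have dt0 : 0 <= r * (INR n / L n ^ K1).
    by apply: Rmult_le_pos; [lra | apply: Rmult_le_pos; [lra | left; apply: Rinv_0_lt_compat]].
  split; first by apply: Rmult_le_pos; lra.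
    have hr2 : r * INR n <= C2 * (2 ^ k * L n ^ k).
      have [_ hr _] := sr; have h2 := proj2 (Lam_bounds m L1).
      have := Rmult_le_compat_r _ _ _ (Rlt_le _ _ nR) hr; rewrite /Rdiv Rmult_assoc Rinv_l ?Rmult_1_r; last lra.
      by move=> h3; apply: Rle_trans h3 _; apply: Rmult_le_compat_l; [left | exact: h2].
    have g1 := LL k; have g2 := LL m; have g3 := LL (K4 + (m + 1))%N.
    have iK : 0 < / L n ^ K1 by apply: Rinv_0_lt_compat.
    apply: Rle_trans (_ : Cc * L n ^ m * (INR d * (C2 * (2 ^ k * L n ^ k) * / L n ^ K1)) <= _).
      apply: Rmult_le_compat => //; [exact: pos_INR | by apply: Rmult_le_pos; lra |].
      apply: Rmult_le_compat_l; first lra.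
      by rewrite /Rdiv -Rmult_assoc; apply: Rmult_le_compat_r; lra.
    rewrite /K1 [in X in X <= _](pow_add _ (K4 + (m + 1))) [in X in X <= _](pow_add _ (k + m)) [in X in X <= _](pow_add _ k m).
    set X1 := L n ^ k in g1 *; set X2 := L n ^ m in g2 *; set X3 := L n ^ (K4 + (m + 1)) in g3 *.
    rewrite (_ : _ * _ = INR d * C2 * 2 ^ k * Cc * / (X3 * L n ^ 2)); last by rewrite /=; field; lra.
    apply: (Rmult_le_reg_r (X3 * L n ^ 2)); first by rewrite /=; nra.
    rewrite Rmult_assoc Rinv_l ?Rmult_1_r; last by rewrite /=; nra.
    by rewrite (_ : / L n * _ = X3 * L n); [nra | rewrite /=; field; lra].
  move=> h j Th; have Sh : S h by rewrite STU Th.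
  have hs1 := Ts_small LK1 Th.
  have rh : r * INR h <= r * (INR n / L n ^ K1) by apply: Rmult_le_compat_l; lra.
  have drh := Rmult_le_compat_l _ _ _ (Rlt_le _ _ d0) rh.
  have [w1 w2] := wS_near hd (Rlt_le _ _ r0) j Sh.
  have id : 0 <= / INR d by left; apply: Rinv_0_lt_compat.
  split.
    by apply: Rle_trans w1; apply: Rmult_le_compat_r => //; apply: exp_le; lra.
  by apply: Rle_trans w2 _; apply: Rmult_le_compat_r => //; apply: exp_le; lra.
have PXi : 0 < / PX n r by apply: Rinv_0_lt_compat.
split.
- move=> f hf; have h1 := dec1 f hf.
  have fa0 : 0 <= Ex w (fun a => Rabs (f a)) by apply: Ex_ge0 => // a; exact: Rabs_pos.
  have h3 : Rabs (Ex w f) <= Ex w (fun a => Rabs (f a)) by apply: Ex_abs.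
  rewrite /cE Xsupp.
  rewrite (_ : _ - _ = (Ex w (fun a => f a * indic (XG S a == n)) - Ex w f * B - Ex w f * (PX n r - B)) * / PX n r); last by field; lra.
  rewrite Rabs_mult (Rabs_pos_eq (/ _)); last lra.
  apply: Rle_trans (_ : 2 * eta / PX n r * Ex w (fun a => Rabs (f a)) <= _); last first.
    by apply: Rmult_le_compat_r.
  rewrite (_ : 2 * eta / PX n r * _ = 2 * eta * Ex w (fun a => Rabs (f a)) * / PX n r); last by rewrite /Rdiv; ring.
  apply: Rmult_le_compat_r; first lra.
  apply: Rle_trans (Rabs_triang _ _) _; rewrite Rabs_Ropp Rabs_mult.
  have := Rmult_le_compat _ _ _ _ (Rabs_pos (Ex w f)) (Rabs_pos (PX n r - B)) h3 decP; lra.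
- move=> f hf f0.
  have fa0 : 0 <= Ex w (fun a => Rabs (f a)) by apply: Ex_ge0 => // a; exact: Rabs_pos.
  (* As [f] has mean 0, the main term of [dec] vanishes. The count is split by parity so that the
     opposite half of [U] is free to absorb the condition. *)
  have hg e : Rabs (Ex w (fun a => f a * (NG jb (V e) a - nuG w jb (V e)) * indic (XG S a == n))) <=
     eta * (Ex w (fun a => Rabs (f a)) * INR #|V e|).
    have gd : depends_on (V e) (fun a => NG jb (V e) a - nuG w jb (V e)).
      by move=> a a' ha; rewrite (NG_dep jb ha).
    have := dec e f _ hf gd; rewrite f0 Rmult_0_l Rminus_0_r => h1; apply: Rle_trans h1 _.
    apply: Rmult_le_compat_l; first lra.
    apply: Rmult_le_compat_l => //.
    rewrite -[X in _ <= X](Ex_const w_sum1); apply: Ex_le => // a; exact: NG_abs_le.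
  rewrite /cE Xsupp.
  rewrite (Ex_ext (G := fun a => f a * (NG jb (V true) a - nuG w jb (V true)) * indic (XG S a == n) +
     f a * (NG jb (V false) a - nuG w jb (V false)) * indic (XG S a == n))); last first.
    by move=> a; rewrite UV nuUV; ring.
  rewrite Ex_add /Rdiv Rabs_mult (Rabs_pos_eq (/ _)); last lra.
  apply: Rle_trans (_ : 2 * eta / PX n r * (Ex w (fun a => Rabs (f a)) * INR #|U|) <= _); last first.
    by apply: Rmult_le_compat_r => //; apply: Rmult_le_pos.
  rewrite (_ : 2 * eta / PX n r * _ = 2 * eta * (Ex w (fun a => Rabs (f a)) * INR #|U|) * / PX n r); last by rewrite /Rdiv; ring.
  apply: Rmult_le_compat_r; first lra.
  apply: Rle_trans (Rabs_triang _ _) _.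
  have := hg true; have := hg false; rewrite cUV.
  have v1 := pos_INR #|V true|; have v2 := pos_INR #|V false|.
  have q3 : 0 <= eta * (Ex w (fun a => Rabs (f a)) * (INR #|V true| + INR #|V false|)).
    by apply: Rmult_le_pos; [lra | apply: Rmult_le_pos; lra].
  by lra.
have GG e h : Gp n e h -> ~~ Gp n (~~ e) h.
  by case/andP => _ /eqP pe; rewrite /Gp pe negb_and; case: (e); rewrite orbT.
(* Here the whole opposite half of [S] absorbs the condition, at the price of a factor [Cs * rt];
   the division by [P(X = n) >= cl * rt] cancels [rt]. *)
have half e : Ex w (fun a => (NG jb (V e) a - nuG w jb (V e)) ^ 2 * indic (XG S a == n)) <=
    Cs * rt n r * INR #|V e|.
  have VG h : V e h -> Gp n e h.
    by case/andP => Uh pe; rewrite /Gp -[par _ _ _ h]/(pr h) pe andbT; case/andP: Uh.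
  have fd : depends_on (Gp n e) (fun a => (NG jb (V e) a - nuG w jb (V e)) ^ 2).
    by move=> a a' ha; rewrite (depends_mono VG (@NG_dep _ _ jb (V e)) ha).
  rewrite (Ex_ext (G := fun a => (NG jb (V e) a - nuG w jb (V e)) ^ 2 * indic (XG (Gp n e) a + XG (Gp n (~~ e)) a == n)%N)); last first.
    move=> a; congr (_ * indic (_ == _)); rewrite -XGU; last exact: GG.
    apply: eq_bigl => h; rewrite /Gp -[inSb m p h]/(S h); case: (S h) => //=; by case: (par _ _ _ h); case: (e).
  apply: Rle_trans (half_bound w_ge0 w_sum1 (B := Cs * rt n r) _ fd _ _) _.
  - by move=> h hG; apply/negP => /GG; rewrite hG.
  - by move=> a; exact: pow2_ge_0.
  - move=> a; apply: hs => // a'; apply: XG_pair_lt => h hG.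
    by apply/negP => /GG; rewrite hG.
  apply: Rmult_le_compat_l; first by apply: Rmult_le_pos; lra.
  exact: NG_var_le.
rewrite /cE Xsupp.
apply: Rle_trans (_ : 2 * (Cs * rt n r * INR #|U|) / PX n r <= _).
  apply: Rmult_le_compat_r; first lra.
  apply: Rle_trans (_ : Ex w (fun a => 2 * ((NG jb (V true) a - nuG w jb (V true)) ^ 2 * indic (XG S a == n)) +
     2 * ((NG jb (V false) a - nuG w jb (V false)) ^ 2 * indic (XG S a == n))) <= _).
    apply: Ex_le => // a; rewrite UV nuUV; have := indic01 (XG S a == n).
    set x := NG jb (V true) a - _; set y := NG jb (V false) a - _.
    rewrite (_ : _ - _ = x + y); last by rewrite /x /y; ring.
    have := pow2_ge_0 (x - y) => h1 h2.
    have : (x + y) ^ 2 <= 2 * x ^ 2 + 2 * y ^ 2 by rewrite /= in h1 *; lra.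
    by move=> h3; have := Rmult_le_compat_r _ _ _ (proj1 h2) h3; lra.
  rewrite Ex_add !Ex_scal; have := half true; have := half false; rewrite cUV; lra.
rewrite (_ : 2 * _ / _ = 2 * Cs * INR #|U| * (rt n r / PX n r)); last by rewrite /Rdiv; ring.
have hq : rt n r / PX n r <= / cl.
  apply: (Rmult_le_reg_r (PX n r)) => //; rewrite /Rdiv Rmult_assoc Rinv_l ?Rmult_1_r; last lra.
  apply: (Rmult_le_reg_l cl) => //; rewrite -Rmult_assoc Rinv_r; lra.
apply: Rle_trans (_ : 2 * Cs * INR #|U| * / cl <= _).
  by apply: Rmult_le_compat_l => //; apply: Rmult_le_pos; lra.
rewrite (_ : 2 * Cs * INR #|U| * / cl = 2 * Cs / cl * INR #|U|); last by rewrite /Rdiv; ring.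
by apply: Rmult_le_compat_r; lra.
Qed.

End Structure.

(** * The Gaussian integral *)

Section Gaussian.

Let phi (t : R) : R := exp (- (t ^ 2) / 2).
Let Gf (x t : R) : R := exp (- (x ^ 2 * (1 + t ^ 2)) / 2) / (1 + t ^ 2).

Lemma phi_cont t : continuous phi t.
Proof. by apply: (@ex_derive_continuous R_AbsRing R_NormedModule); rewrite /phi; auto_derive. Qed.

Lemma phi_int a b : ex_RInt phi a b.
Proof. by apply: (@ex_RInt_continuous R_CompleteNormedModule) => t _; exact: phi_cont. Qed.

Lemma one_sq t : 0 < 1 + t ^ 2.
Proof. by have := pow2_ge_0 t; lra. Qed.

Lemma Gf_derive x t : is_derive (fun u => Gf u t) x (- x * phi x * phi (x * t)).
Proof.
have := one_sq t => h; rewrite /Gf /phi; auto_derive; first lra.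
rewrite (Rmult_assoc (- x)) -exp_plus.
rewrite (_ : - x ^ 2 / 2 + - (x * t) ^ 2 / 2 = - (x * (x * 1) * (1 + t * (t * 1))) * / 2); last by rewrite /=; field.
by field; rewrite /= in h; lra.
Qed.

Lemma Gf_cont x t : continuous (Gf x) t.
Proof.
apply: (@ex_derive_continuous R_AbsRing R_NormedModule); have := one_sq t; rewrite /Gf => h; auto_derive.
by rewrite /= in h; lra.
Qed.

Lemma Gf_int x a b : ex_RInt (Gf x) a b.
Proof. by apply: (@ex_RInt_continuous R_CompleteNormedModule) => t _; exact: Gf_cont. Qed.

Lemma Gint_derive x : is_derive (fun u => RInt (Gf u) 0 1) x (- phi x * RInt phi 0 x).
Proof.
have hD u t : Derive (fun z => Gf z t) u = - u * phi u * phi (u * t) by apply: is_derive_unique; exact: Gf_derive.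
have := @is_derive_RInt_param Gf 0 1 x.
have -> : RInt (fun t => Derive (fun u => Gf u t) x) 0 1 = - phi x * RInt phi 0 x.
  rewrite (RInt_ext _ (fun t => scal (- phi x) (scal x (phi (x * t + 0))))); last first.
    by move=> t _; rewrite hD Rplus_0_r /scal /= /mult /=; ring.
  rewrite RInt_scal ?RInt_comp_lin; first by rewrite /scal /= /mult /= Rmult_0_r Rplus_0_l Rmult_1_r Rplus_0_r.
    exact: phi_int.
  apply: (@ex_RInt_continuous R_CompleteNormedModule) => t _.
  by apply: (@ex_derive_continuous R_AbsRing R_NormedModule); rewrite /phi /scal /= /mult /=; auto_derive.
apply.
- by apply: filter_forall => u t _; exists (- u * phi u * phi (u * t)); exact: Gf_derive.
- move=> t _; apply: (continuity_2d_pt_ext (fun u v => (- u * phi u) * phi (u * v))); first by move=> u v; rewrite hD.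
  apply: continuity_2d_pt_mult.
    apply: (continuity_1d_2d_pt_comp (fun u => - u * phi u) (fun u _ => u)); last exact: continuity_2d_pt_id1.
    by apply: derivable_continuous_pt; apply: ex_derive_Reals_0; rewrite /phi; auto_derive.
  apply: (continuity_1d_2d_pt_comp phi (fun u v => u * v)).
    by apply: derivable_continuous_pt; apply: ex_derive_Reals_0; rewrite /phi; auto_derive.
  by apply: continuity_2d_pt_mult; [exact: continuity_2d_pt_id1 | exact: continuity_2d_pt_id2].
- by apply: filter_forall => u; exact: Gf_int.
Qed.

Lemma Fint_derive x : is_derive (fun u => RInt phi 0 u) x (phi x).
Proof.
apply: (@is_derive_RInt R_NormedModule _ _ 0); last exact: phi_cont.
by apply: filter_forall => u; apply: RInt_correct; exact: phi_int.
Qed.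

(* Polar coordinates in disguise: the sum below has derivative zero, and equals pi/2 at 0. *)
Lemma gauss_square x : RInt phi 0 x ^ 2 + 2 * RInt (Gf x) 0 1 = PI / 2.
Proof.
pose H u := RInt phi 0 u ^ 2 + 2 * RInt (Gf u) 0 1.
have hH u : is_derive H u 0.
  have h1 := Fint_derive u; have h2 := Gint_derive u.
  have := is_derive_plus _ _ _ _ _ (is_derive_mult _ _ _ _ _ h1 h1 Rmult_comm) (is_derive_scal _ _ 2 _ h2).
  rewrite (_ : plus _ _ = 0); last by rewrite /plus /= /mult /=; match goal with |- ?a = ?b => change (@eq R a b) end; ring.
  apply: is_derive_ext => v; rewrite /H /plus /= /mult /=. by rewrite Rmult_1_r.
have H0 : H 0 = PI / 2.
  rewrite /H RInt_point (RInt_ext _ (fun t => / (1 + t ^ 2))); last first.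
    by move=> t _; rewrite /Gf (_ : - _ / 2 = 0) ?exp_0; [rewrite /Rdiv Rmult_1_l | rewrite /=; field].
  have := @is_RInt_derive R_CompleteNormedModule atan (fun t => / (1 + t ^ 2)) 0 1 _ _.
  move=> h; rewrite (is_RInt_unique _ _ _ _ (h _ _)).
  - by rewrite /minus /plus /opp /= atan_0 atan_1 /zero /=; field.
  - by move=> t _; have := is_derive_atan t; rewrite /Rsqr /= Rmult_1_r.
  - move=> t _; apply: (@ex_derive_continuous R_AbsRing R_NormedModule); auto_derive.
    by have := one_sq t; rewrite /=; lra.
suff : H x = H 0 by rewrite H0.
have hc t : continuity_pt H t by apply: derivable_continuous_pt; exists 0; apply/is_derive_Reals; exact: hH.
have [c [_ hx]] := MVT_gen H 0 x (fun _ => 0) (fun t _ => hH t) (fun t _ => hc t).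
by move: hx; lra.
Qed.

Lemma Gint_bounds x : 0 <= RInt (Gf x) 0 1 <= phi x.
Proof.
split.
  apply: RInt_ge_0; [lra | exact: Gf_int |] => t _.
  by left; apply: Rmult_lt_0_compat; [exact: exp_pos | apply: Rinv_0_lt_compat; exact: one_sq].
have -> : phi x = RInt (fun _ => phi x) 0 1 by rewrite RInt_const /scal /= /mult /=; ring.
apply: RInt_le; [lra | exact: Gf_int | exact: ex_RInt_const |] => t _.
have h := one_sq t; have h2 := pow2_ge_0 t.
apply: Rle_trans (_ : exp (- (x ^ 2 * (1 + t ^ 2)) / 2) <= _).
  rewrite -[X in _ <= X]Rmult_1_r /Gf; apply: Rmult_le_compat_l; first by left; exact: exp_pos.
  by rewrite -[X in _ <= X]Rinv_1; apply: Rinv_le_contravar; lra.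
have : - (x ^ 2 * (1 + t ^ 2)) / 2 <= - x ^ 2 / 2 by have := pow2_ge_0 x; nra.
by rewrite /phi; case=> [h3|->]; [left; exact: exp_increasing | right].
Qed.

Definition J (a b : R) : R := RInt gauss a b.

Lemma s2pi : 1 < sqrt (2 * PI).
Proof.
rewrite -{1}sqrt_1; apply: sqrt_lt_1; have := PI_RGT_0; have := PI2_1; lra.
Qed.

Lemma gaussE t : gauss t = / sqrt (2 * PI) * phi t.
Proof. by rewrite /gauss /phi /Rdiv Rmult_comm. Qed.

Lemma gauss_cont t : continuous gauss t.
Proof.
by apply: (@ex_derive_continuous R_AbsRing R_NormedModule); rewrite /gauss; auto_derive.
Qed.

Lemma J_int a b : ex_RInt gauss a b.
Proof. by apply: (@ex_RInt_continuous R_CompleteNormedModule) => t _; exact: gauss_cont. Qed.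

Lemma gauss_intE a b : gauss_int a b = J a b.
Proof. by rewrite /gauss_int /J; symmetry; exact: RInt_Reals. Qed.

Lemma J_add a b c : J a b + J b c = J a c.
Proof. exact: (RInt_Chasles gauss a b c (J_int _ _) (J_int _ _)). Qed.

Lemma gauss_bounds t : 0 < gauss t <= 1.
Proof.
have h := s2pi; rewrite /gauss; split.
  by apply: Rmult_lt_0_compat; [exact: exp_pos | apply: Rinv_0_lt_compat; lra].
apply: (Rmult_le_reg_r (sqrt (2 * PI))); first lra.
rewrite /Rdiv Rmult_assoc Rinv_l; last lra.
have : exp (- t ^ 2 / 2) <= 1; last lra.
by rewrite -exp_0; have : - t ^ 2 / 2 <= 0 by [have := pow2_ge_0 t; lra]; case=> [h3|->]; [left; exact: exp_increasing | right].
Qed.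

Lemma J_bounds a b : a <= b -> 0 <= J a b <= b - a.
Proof.
move=> ab; split.
  by apply: RInt_ge_0 => //; [exact: J_int | move=> t _; have := gauss_bounds t; lra].
have -> : b - a = RInt (fun _ => 1) a b by rewrite RInt_const /scal /= /mult /=; ring.
by apply: RInt_le => //; [exact: J_int | exact: ex_RInt_const | move=> t _; have := gauss_bounds t; lra].
Qed.

Lemma J_sym a : J (- a) 0 = J 0 a.
Proof.
have := RInt_comp_lin gauss (-1) 0 a 0 (J_int _ _).
rewrite (_ : -1 * a + 0 = - a); last ring.
rewrite (_ : -1 * 0 + 0 = 0); last ring.
rewrite /J => <-; rewrite -(opp_RInt_swap _ 0 a); last first.
  by apply: (@ex_RInt_continuous R_CompleteNormedModule) => t _; apply: (@ex_derive_continuous R_AbsRing R_NormedModule); rewrite /gauss /scal /= /mult /=; auto_derive.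
rewrite -RInt_opp; last first.
  by apply: (@ex_RInt_continuous R_CompleteNormedModule) => t _; apply: (@ex_derive_continuous R_AbsRing R_NormedModule); rewrite /gauss /scal /= /mult /=; auto_derive.
apply: RInt_ext => t _; rewrite /scal /opp /= /mult /=.
by rewrite (_ : gauss (-1 * t + 0) = gauss t); [ring | rewrite /gauss; congr (exp _ / _); field].
Qed.

(** By [gauss_square] the square of [J 0 x] is 1/4 minus a term at most half of [exp(-x^2/2)], and
    [exp(-z) <= 1/(1+z)] makes the tail explicit. *)
Lemma J_half x : 0 <= x -> / 2 - / (1 + x ^ 2 / 2) <= J 0 x <= / 2.
Proof.
move=> x0; have PI0 := PI_RGT_0.
have F0 : 0 <= RInt phi 0 x by apply: RInt_ge_0 => //; [exact: phi_int | move=> t _; left; exact: exp_pos].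
have [G0 G1] := Gint_bounds x; have sq := gauss_square x.
have JE : J 0 x = / sqrt (2 * PI) * RInt phi 0 x.
  rewrite /J (RInt_ext _ (fun t => scal (/ sqrt (2 * PI)) (phi t))); first by rewrite RInt_scal //; exact: phi_int.
  by move=> t _; rewrite gaussE.
have s1 := s2pi.
have J0 : 0 <= J 0 x by apply: (proj1 (J_bounds _)).
have J2 : J 0 x ^ 2 = / 4 - RInt (Gf x) 0 1 / PI.
  rewrite JE Rpow_mult_distr (_ : (/ sqrt (2 * PI)) ^ 2 = / (2 * PI)); last by rewrite pow_inv pow2_sqrt //; lra.
  have -> : RInt phi 0 x ^ 2 = PI / 2 - 2 * RInt (Gf x) 0 1 by lra.
  by field; lra.
have P2 := PI2_1.
have h1 : 0 <= RInt (Gf x) 0 1 / PI by apply: Rmult_le_pos => //; left; apply: Rinv_0_lt_compat; lra.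
have h2 : RInt (Gf x) 0 1 / PI <= / 2 * phi x.
  apply: (Rmult_le_reg_r PI) => //; rewrite /Rdiv Rmult_assoc Rinv_l; last lra.
  by have : 0 < phi x by [exact: exp_pos]; nra.
have h3 : phi x <= / (1 + x ^ 2 / 2).
  have q2 := pow2_ge_0 x.
  rewrite /phi (_ : - x ^ 2 / 2 = - (x ^ 2 / 2)); last by field.
  rewrite exp_Ropp; apply: Rinv_le_contravar; first lra.
  by case: (Req_dec (x ^ 2 / 2) 0) => [->|h]; [rewrite exp_0; lra | left; apply: exp_ineq1].
have q3 : 0 < / (1 + x ^ 2 / 2) by apply: Rinv_0_lt_compat; have := pow2_ge_0 x; lra.
have Jle : J 0 x <= / 2 by rewrite /= in J2; nra.
split=> //; rewrite /= Rmult_1_r in J2; nra.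
Qed.

(** The standard normal distribution function, with the integral over the negative axis already
    replaced by 1/2. *)
Definition PhiG (x : R) : R := / 2 + J 0 x.

Lemma PhiG_diff x y : x <= y -> 0 <= PhiG y - PhiG x <= y - x.
Proof. by move=> xy; have := J_bounds xy; have := J_add 0 x y; rewrite /PhiG; lra. Qed.

Lemma J_le1 a b : a <= b -> J a b <= 1.
Proof.
move=> ab; have H c : 0 <= c -> J 0 c <= / 2 by move=> c0; have := J_half c0; lra.
have H2 c : c <= 0 -> - / 2 <= J 0 c.
  by move=> c0; have := @J_half (- c) ltac:(lra); rewrite -J_sym Ropp_involutive; have := J_add 0 c 0; rewrite {3}/J RInt_point /zero /=; lra.
have H3 c : - / 2 <= J 0 c <= / 2.
  case: (Rle_lt_dec 0 c) => h.
    by have := H c h; have := J_bounds h; lra.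
  by have := H2 c ltac:(lra); have := J_bounds (Rlt_le _ _ h); have := J_add 0 c 0; rewrite {3}/J RInt_point /zero /=; lra.
by have := J_add 0 a b; have := H3 a; have := H3 b; lra.
Qed.

Lemma J_PhiG A x : 0 <= A -> PhiG x - / (1 + A ^ 2 / 2) <= J (- A) x <= PhiG x.
Proof.
by move=> A0; have := J_half A0; rewrite -J_sym; have := J_add (- A) 0 x; rewrite /PhiG; lra.
Qed.

Lemma gauss_lim x : Un_cv (fun M : nat => gauss_int (- INR M) x) (PhiG x).
Proof.
move=> eps e0; have [N hN] := archimed_cor1 eps e0.
exists N.+1 => n hn; rewrite gauss_intE /Rdist.
have nN : INR N + 1 <= INR n by rewrite -S_INR; exact: le_INR.
have N0 : 0 < INR N by apply: lt_0_INR; lia.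
have := J_PhiG x (pos_INR n).
have : / (1 + INR n ^ 2 / 2) < eps.
  apply: Rle_lt_trans (proj1 hN); apply: Rinv_le_contravar => //.
  by have := pow2_ge_0 (INR n - 1); rewrite /=; lra.
by move=> h1 h2; rewrite Rabs_left1; lra.
Qed.

End Gaussian.

(** * The de Moivre-Laplace theorem *)

Section Binomial.
Variables p q : R.
Hypotheses (p0 : 0 < p) (q0 : 0 < q) (pq1 : p + q = 1).

Lemma qE : q = 1 - p.
Proof. lra. Qed.

(* The expectation of [F] under the binomial law with parameters [M] and [p]. *)
Fixpoint BE (M : nat) (F : nat -> R) : R :=
  if M is M'.+1 then p * BE M' (fun k => F k.+1) + q * BE M' F else F 0%N.

Lemma BE_ext M F G : (forall k, F k = G k) -> BE M F = BE M G.
Proof.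
elim: M F G => [|M IH] F G h /=; first by rewrite h.
by congr (_ * _ + _ * _); apply: IH.
Qed.

Lemma BE_const M c : BE M (fun _ => c) = c.
Proof. by elim: M => //= M ->; rewrite -Rmult_plus_distr_r pq1 Rmult_1_l. Qed.

Lemma BE_add M F G : BE M (fun k => F k + G k) = BE M F + BE M G.
Proof. by elim: M F G => //= M IH F G; rewrite !IH; ring. Qed.

Lemma BE_scal M c F : BE M (fun k => c * F k) = c * BE M F.
Proof. by elim: M F => //= M IH F; rewrite !IH; ring. Qed.

Lemma BE_le M F G : (forall k, F k <= G k) -> BE M F <= BE M G.
Proof.
elim: M F G => [|M IH] F G h; first exact: h.
have := IH F G h; have := IH (fun k => F k.+1) (fun k => G k.+1) (fun k => h k.+1).
by rewrite /=; nra.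
Qed.

(* Stein's identity for the binomial law; [F] an indicator gives the ratio of consecutive point masses, [F = 1] and [F = id] give mean and variance. *)
Lemma BE_stein M F : BE M (fun k => (INR M - INR k) * p * F k.+1 - INR k * q * F k) = 0.
Proof.
elim: M F => [|M IH] F; first by rewrite /=; ring.
cbn [BE]; have I1 := IH (fun k => F k.+1); cbv beta in I1.
have -> : BE M (fun k => (INR M.+1 - INR k.+1) * p * F k.+2 - INR k.+1 * q * F k.+1) = - q * BE M (fun k => F k.+1).
  rewrite (BE_ext M (G := fun k => ((INR M - INR k) * p * F k.+2 - INR k * q * F k.+1) + - q * F k.+1)).
    by rewrite BE_add BE_scal I1; ring.
  by move=> k; rewrite !S_INR; ring.
have -> : BE M (fun k => (INR M.+1 - INR k) * p * F k.+1 - INR k * q * F k) = p * BE M (fun k => F k.+1).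
  rewrite (BE_ext M (G := fun k => ((INR M - INR k) * p * F k.+1 - INR k * q * F k) + p * F k.+1)).
    by rewrite BE_add BE_scal IH; ring.
  by move=> k; rewrite !S_INR; ring.
ring.
Qed.

Lemma BE_mean M : BE M (fun k => INR k) = INR M * p.
Proof.
have := BE_stein M (fun _ => 1).
rewrite (BE_ext M (G := fun k => INR M * p + -1 * INR k)); last first.
  by move=> k; rewrite qE; ring.
by rewrite BE_add (BE_scal M (-1)) BE_const => h; set z := BE _ _ in h *; lra.
Qed.

Lemma BE_var M : BE M (fun k => (INR k - INR M * p) ^ 2) = INR M * p * q.
Proof.
have := BE_stein M INR.
rewrite (BE_ext M (G := fun k => INR M * p + ((INR M * p - p) * INR k + -1 * INR k ^ 2))); last first.
  by move=> k; rewrite S_INR; rewrite qE; ring.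
rewrite !BE_add !BE_scal BE_const BE_mean => h.
rewrite (BE_ext M (G := fun k => INR k ^ 2 + (- 2 * INR M * p * INR k + (INR M * p) ^ 2))); last by move=> k; ring.
rewrite !BE_add !BE_scal BE_const BE_mean; rewrite qE.
have {h} -> : BE M (fun k => INR k ^ 2) = INR M * p + (INR M * p - p) * (INR M * p) by lra.
ring.
Qed.

Definition beta (M k : nat) : R := BE M (fun j => indic (j == k)).

Lemma beta_ge0 M k : 0 <= beta M k.
Proof.
by rewrite -(BE_const M 0); apply: BE_le => j; rewrite /indic; case: ifP; lra.
Qed.

Lemma beta_ratio M k : (INR M - INR k) * p * beta M k = (INR k + 1) * q * beta M k.+1.
Proof.
have := BE_stein M (fun j => indic (j == k.+1)).
rewrite (BE_ext M (G := fun j => ((INR M - INR k) * p) * indic (j == k) + - ((INR k + 1) * q) * indic (j == k.+1))); last first.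
  move=> j; rewrite eqSS; case: (eqVneq j k) => [->|_]; first by rewrite (ltn_eqF (ltnSn k)) /indic; ring.
  by case: eqP => [->|_]; rewrite /indic ?S_INR; ring.
by rewrite BE_add !BE_scal -/(beta M k) -/(beta M k.+1); lra.
Qed.

Lemma BE_succ M b : BE M (fun k => indic (k < b.+1)%N) = BE M (fun k => indic (k < b)%N) + beta M b.
Proof.
rewrite -BE_add; apply: BE_ext => k; rewrite /indic ltnS leq_eqVlt.
by case: eqP => [->|_]; rewrite ?ltnn /= ?Rplus_0_l ?Rplus_0_r.
Qed.

Lemma exp_lower x : Rabs x <= / 4 -> exp (x - x ^ 2) <= 1 + x.
Proof.
move=> /Rabs_le_between [h1 h2].
(* Halving is essential: [exp(t) <= 1/(1-t)] applied directly to [t = x - x^2] would need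
   [(1+x)(1-x+x^2) = 1 + x^3 >= 1], false for negative [x]. *)
set z := (x - x ^ 2) / 2.
have hz : 0 < 1 - z by rewrite /z /=; nra.
have he : exp z <= / (1 - z).
  have := exp_ineq1_le (- z); rewrite exp_Ropp => h; have e0 := exp_pos z.
  by rewrite -[X in X <= _]Rinv_inv; apply: Rinv_le_contravar; lra.
have -> : x - x ^ 2 = z + z by rewrite /z; field.
rewrite exp_plus; apply: Rle_trans (_ : / (1 - z) * / (1 - z) <= _).
  by have e0 := exp_pos z; apply: Rmult_le_compat; lra.
rewrite -Rinv_mult; apply: (Rmult_le_reg_r ((1 - z) * (1 - z))); first by nra.
rewrite Rinv_l; last by nra.
rewrite (_ : (1 + x) * _ = 1 + x ^ 2 * (x + (1 + x) * (1 - x) ^ 2 / 4)); last by rewrite /z; field.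
have : 0 <= x + (1 + x) * (1 - x) ^ 2 / 4 by rewrite /=; nra.
by have := pow2_ge_0 x; nra.
Qed.

(* [rho] is the ratio of consecutive values of [beta k * exp (u^2 / (2 s^2))], [u = k - M p]. *)
Lemma ratio_step (s u A : R) : 0 <= A -> 1 <= s -> 4 * (A + 1) <= s -> Rabs u <= A * s ->
  let rho := (s ^ 2 - u * p) / (s ^ 2 + (u + 1) * q) * exp ((2 * u + 1) / (2 * s ^ 2)) in
  let eta := (1 + (A + 1) ^ 2) / s ^ 2 in
  [/\ 0 < s ^ 2 + (u + 1) * q, exp (- eta) <= rho & rho <= exp eta].
Proof.
move=> A0 s1 hs /Rabs_le_between [u1 u2] rho eta.
have s2 : 0 < s ^ 2 by apply: pow_lt; lra.
pose a := u * p / s ^ 2; pose b := (u + 1) * q / s ^ 2.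
have p1 : p < 1 by lra.
have q1 : q < 1 by lra.
have is0 : 0 < / s by apply: Rinv_0_lt_compat; lra.
have uA : Rabs (u / s) <= A.
  apply: Rabs_le; split; apply: (Rmult_le_reg_r s); try lra; rewrite /Rdiv Rmult_assoc Rinv_l; lra.
have u1A : Rabs ((u + 1) / s) <= A + 1.
  apply: Rabs_le; split; apply: (Rmult_le_reg_r s); try lra; rewrite /Rdiv Rmult_assoc Rinv_l; nra.
have ha : Rabs a <= (A + 1) * / s.
  rewrite /a (_ : _ / _ = (u / s) * p * / s); last by field; lra.
  rewrite (Rabs_mult (u / s * p)) (Rabs_mult (u / s)) (Rabs_pos_eq p) ?(Rabs_pos_eq (/ s)); try lra.
  by apply: Rmult_le_compat_r; [lra | have := Rabs_pos (u / s); nra].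
have hb : Rabs b <= (A + 1) * / s.
  rewrite /b (_ : _ / _ = ((u + 1) / s) * q * / s); last by field; lra.
  rewrite (Rabs_mult ((u + 1) / s * q)) (Rabs_mult ((u + 1) / s)) (Rabs_pos_eq q) ?(Rabs_pos_eq (/ s)); try lra.
  by apply: Rmult_le_compat_r; [lra | have := Rabs_pos ((u + 1) / s); nra].
have h4 : (A + 1) * / s <= / 4.
  apply: (Rmult_le_reg_r s); first lra. rewrite Rmult_assoc Rinv_l; lra.
have sq x : Rabs x <= (A + 1) * / s -> x ^ 2 <= (A + 1) ^ 2 / s ^ 2.
  move=> h; rewrite -(pow2_abs x) (_ : _ / _ = ((A + 1) * / s) ^ 2); last by field; lra.
  by apply: pow_incr; split=> //; exact: Rabs_pos.
have a2 := sq _ ha; have b2 := sq _ hb.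
have /Rabs_le_between [b3 b4] := hb; have /Rabs_le_between [a3 a4] := ha.
have b1 : 0 < 1 + b by lra.
have e1 : s ^ 2 + (u + 1) * q = s ^ 2 * (1 + b) by rewrite /b; field; lra.
have e2 : s ^ 2 - u * p = s ^ 2 * (1 - a) by rewrite /a; field; lra.
have rE : rho = (1 - a) * / (1 + b) * exp (a + b + (/ 2 - q) / s ^ 2).
  rewrite /rho e1 e2; congr (_ * exp _); first by field; lra.
  rewrite /a /b; have -> : p = 1 - q by lra.
  by field; lra.
have qq : Rabs ((/ 2 - q) / s ^ 2) <= 1 / s ^ 2.
  rewrite Rabs_mult (Rabs_pos_eq (/ _)); last by left; apply: Rinv_0_lt_compat.
  by apply: Rmult_le_compat_r; [left; apply: Rinv_0_lt_compat | apply: Rabs_le; lra].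
have /Rabs_le_between [qq1 qq2] := qq.
have etaE : eta = 1 / s ^ 2 + (A + 1) ^ 2 / s ^ 2 by rewrite /eta; field; lra.
have l1 := exp_lower (Rle_trans _ _ _ hb h4).
have l2 := @exp_lower (- a) ltac:(rewrite Rabs_Ropp; lra).
have l3 := exp_ineq1_le b; have l4 := exp_ineq1_le (- a).
split.
- by rewrite e1; apply: Rmult_lt_0_compat.
- rewrite rE; apply: Rle_trans (_ : exp (- a - (- a) ^ 2) * exp (- b) * exp (a + b + (/ 2 - q) / s ^ 2) <= _).
    rewrite -!exp_plus; apply: exp_le; rewrite (_ : (- a) ^ 2 = a ^ 2); last ring.
    by lra.
  apply: Rmult_le_compat_r; first by left; exact: exp_pos.
  apply: Rmult_le_compat; [left; exact: exp_pos | left; exact: exp_pos | lra |].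
  by rewrite exp_Ropp; apply: Rinv_le_contravar; lra.
- rewrite rE; apply: Rle_trans (_ : exp (- a) * exp (- (b - b ^ 2)) * exp (a + b + (/ 2 - q) / s ^ 2) <= _); last first.
    by rewrite -!exp_plus; apply: exp_le; lra.
  apply: Rmult_le_compat_r; first by left; exact: exp_pos.
  apply: Rmult_le_compat; [lra | left; exact: Rinv_0_lt_compat | lra |].
  by rewrite exp_Ropp; apply: Rinv_le_contravar => //; exact: exp_pos.
Qed.

(** A termwise comparison of the ratios [f/g] at two places passes to partial sums. Only ratios are
    compared, so binomial masses can be matched with Gaussian ones without their normalising
    constant, and no Stirling formula is involved. *)
Lemma cross_sum (f g W G : nat -> R) (E : R) (a c : nat) : 0 <= E ->
  (forall k, W k.+1 = W k + f k) -> (forall k, G k.+1 = G k + g k) ->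
  (forall k l, (a <= k < c)%N -> (a <= l < c)%N -> f k * g l <= E * (f l * g k)) ->
  forall b b', (a <= b <= c)%N -> (a <= b' <= c)%N ->
  (W b - W a) * (G b' - G a) <= E * ((W b' - W a) * (G b - G a)).
Proof.
move=> E0 hW hG hfg.
have h1 b l : (a <= l < c)%N -> (a <= b <= c)%N -> (W b - W a) * g l <= E * (f l * (G b - G a)).
  move=> hl; elim: b => [|b IH] /andP [ab bc].
    by move: ab; rewrite leqn0 => /eqP ->; lra.
  move: ab; rewrite leq_eqVlt => /orP [/eqP <-|ab]; first by lra.
  have hb : (a <= b < c)%N by rewrite -ltnS ab.
  have := IH _; rewrite (ltnW bc) andbT -ltnS ab => /(_ isT).
  by have := hfg b l hb hl; rewrite hW hG; lra.
move=> b b' hb; elim: b' => [|l IH] /andP [al lc].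
  by move: al; rewrite leqn0 => /eqP ->; lra.
move: al; rewrite leq_eqVlt => /orP [/eqP <-|al]; first by lra.
have hl : (a <= l < c)%N by rewrite -ltnS al.
have := IH _; rewrite (ltnW lc) andbT -ltnS al => /(_ isT).
by have := h1 b l hl hb; rewrite hW hG; lra.
Qed.

Section Local.
Variables (M : nat) (A : R).
Let s := sqrt (INR M * p * q).
Let mu := INR M * p.
Hypotheses (A0 : 0 <= A) (s1 : 1 <= s) (hs : 4 * (A + 1) <= s).

Definition xk (k : nat) : R := (INR k - mu) / s.
Let gam k := J (xk k) (xk k.+1).
Let eta := (1 + (A + 1) ^ 2) / s ^ 2.
Let h k := beta M k * exp (xk k ^ 2 / 2).

Lemma s_sq : s ^ 2 = INR M * p * q.
Proof.
by rewrite pow2_sqrt //; have := pos_INR M => h0; apply: Rmult_le_pos; [apply: Rmult_le_pos|]; lra.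
Qed.

Lemma xkS k : xk k.+1 = xk k + / s.
Proof. by rewrite /xk S_INR; field; lra. Qed.

Lemma h_ge0 k : 0 <= h k.
Proof. by apply: Rmult_le_pos; [exact: beta_ge0 | left; exact: exp_pos]. Qed.

Lemma h_step k : Rabs (INR k - mu) <= A * s -> h k.+1 <= exp eta * h k /\ h k <= exp eta * h k.+1.
Proof.
move=> hu; set u := INR k - mu in hu.
have [b0 r1 r2] := ratio_step A0 s1 hs hu; set rho := _ * _ in r1 r2.
have s2 : 0 < s ^ 2 by apply: pow_lt; lra.
have hb : (s ^ 2 - u * p) * beta M k = (s ^ 2 + (u + 1) * q) * beta M k.+1.
  have := beta_ratio M k; rewrite s_sq /u /mu qE => hr.
  rewrite (_ : _ - _ = (INR M - INR k) * p); last ring.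
  by rewrite hr; congr (_ * _); ring.
have hh : h k.+1 = rho * h k.
  rewrite /h /rho; apply: (Rmult_eq_reg_l (s ^ 2 + (u + 1) * q)); last lra.
  rewrite -Rmult_assoc -hb (_ : xk k.+1 ^ 2 / 2 = (2 * u + 1) / (2 * s ^ 2) + xk k ^ 2 / 2); last first.
    by rewrite xkS /xk -/u; field; lra.
  by rewrite exp_plus; field; lra.
have := h_ge0 k => h0; rewrite hh -/eta in r1 r2 *; split.
  by apply: Rmult_le_compat_r.
rewrite -Rmult_assoc -{1}[h k]Rmult_1_l; apply: Rmult_le_compat_r => //.
rewrite -exp_0 -(Rplus_opp_r eta) exp_plus; apply: Rmult_le_compat_l => //.
by left; exact: exp_pos.
Qed.

Lemma gam_bounds k : Rabs (INR k - mu) <= A * s ->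
  exp (- ((A + 1) / s)) * gauss (xk k) / s <= gam k <= exp ((A + 1) / s) * gauss (xk k) / s.
Proof.
move=> hu.
have is0 : 0 < / s by apply: Rinv_0_lt_compat; lra.
have is1 : / s <= 1 by rewrite -Rinv_1; apply: Rinv_le_contravar; lra.
have xA : Rabs (xk k) <= A.
  rewrite /xk Rabs_mult (Rabs_pos_eq (/ s)); last lra.
  by apply: (Rmult_le_reg_r s); [lra | rewrite Rmult_assoc Rinv_l; lra].
move: xA => /Rabs_le_between [x1 x2].
have ht t : xk k <= t <= xk k + / s -> Rabs (t ^ 2 / 2 - xk k ^ 2 / 2) <= (A + 1) / s.
  move=> [t1 t2]; rewrite (_ : _ - _ = (t - xk k) * ((t + xk k) / 2)); last field.
  rewrite Rabs_mult (Rabs_pos_eq (t - _)); last lra.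
  rewrite /Rdiv Rmult_comm; apply: Rmult_le_compat; [exact: Rabs_pos | lra | apply: Rabs_le; lra | lra].
have g0 := gauss_bounds (xk k).
have hI c : RInt (fun _ => c) (xk k) (xk k.+1) = c / s.
  by rewrite RInt_const /scal /= /mult /= xkS /Rdiv; ring.
have sp := s2pi.
have ie t : gauss t = exp (xk k ^ 2 / 2 - t ^ 2 / 2) * gauss (xk k).
  by rewrite /gauss /Rdiv -Rmult_assoc -exp_plus; congr (exp _ * _); field.
rewrite /gam /J -(hI (exp (- ((A + 1) / s)) * gauss (xk k))) -(hI (exp ((A + 1) / s) * gauss (xk k))); split; apply: RInt_le; rewrite ?xkS; try (lra || exact: ex_RInt_const || exact: J_int).
  move=> t ht0; rewrite (ie t); apply: Rmult_le_compat_r; first lra.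
  by apply: exp_le; have /Rabs_le_between := ht t ltac:(lra); lra.
move=> t ht0; rewrite (ie t); apply: Rmult_le_compat_r; first lra.
by apply: exp_le; have /Rabs_le_between := ht t ltac:(lra); lra.
Qed.

Variables a c : nat.
Hypothesis win : forall k, (a <= k <= c)%N -> Rabs (INR k - mu) <= A * s.

Let CA := 2 * A * (1 + (A + 1) ^ 2) + 2 * (A + 1).

Lemma eta_ge0 : 0 <= eta.
Proof.
have s2 : 0 < s ^ 2 by apply: pow_lt; lra.
apply: Rmult_le_pos; [have := pow2_ge_0 (A + 1); lra | left; exact: Rinv_0_lt_compat].
Qed.

Lemma h_le k i : (a <= k)%N -> (k + i <= c)%N ->
  h (k + i) <= exp (eta * INR i) * h k /\ h k <= exp (eta * INR i) * h (k + i).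
Proof.
move=> ak; elim: i => [|i IH] hi; first by rewrite addn0 Rmult_0_r exp_0; lra.
rewrite addnS in hi *.
have [i1 i2] := IH (ltnW hi).
have [j1 j2] := h_step (win (k := k + i) ltac:(rewrite (ltnW hi) andbT; exact: leq_trans (leq_addr _ _))).
have e1 : exp (eta * INR i.+1) = exp eta * exp (eta * INR i) by rewrite S_INR -exp_plus; congr exp; ring.
have := exp_pos eta; have := exp_pos (eta * INR i) => E1 E2; rewrite e1.
have := Rmult_le_compat_l _ _ _ (Rlt_le _ _ E2) i1; have := Rmult_le_compat_l _ _ _ (Rlt_le _ _ E1) j2.
by lra.
Qed.

(** Two points of the window are at most [2 A s] steps apart, and a step costs [exp(eta)] with [eta]
    of order [1/s^2]. *)
Lemma h_cmp k l : (a <= k < c)%N -> (a <= l < c)%N -> h k <= exp (2 * A * (1 + (A + 1) ^ 2) / s) * h l.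
Proof.
move=> hk hl.
have e0 := eta_ge0.
suff H i : INR i <= 2 * A * s -> exp (eta * INR i) <= exp (2 * A * (1 + (A + 1) ^ 2) / s).
  have D k' l' : (a <= k' < c)%N -> (a <= l' < c)%N -> (k' <= l')%N -> INR (l' - k') <= 2 * A * s.
    move=> /andP [k1 k2] /andP [l1 l2] kl; rewrite minus_INR; last exact/leP.
    have /Rabs_le_between := win (k := k') ltac:(rewrite k1; exact: ltnW).
    have /Rabs_le_between := win (k := l') ltac:(rewrite l1; exact: ltnW); lra.
  case: (leqP k l) => [kl|/ltnW kl].
    have := @h_le k (l - k); rewrite subnKC //; case/andP: (hk) => -> _; case/andP: (hl) => _ /ltnW -> /(_ isT isT) [_ hh].
    by apply: Rle_trans hh _; apply: Rmult_le_compat_r; [exact: h_ge0 | apply: H; exact: D].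
  have := @h_le l (k - l); rewrite subnKC //; case/andP: (hl) => -> _; case/andP: (hk) => _ /ltnW -> /(_ isT isT) [hh _].
  by apply: Rle_trans hh _; apply: Rmult_le_compat_r; [exact: h_ge0 | apply: H; exact: D].
move=> hi; apply: exp_le; apply: Rle_trans (Rmult_le_compat_l _ _ _ e0 hi) _.
by right; rewrite /eta; field; lra.
Qed.

(** The ratio of the binomial mass to the Gaussian mass of the corresponding cell is nearly constant
    on the window. In [CA] the first summand is that of [h_cmp], the second comes from [gam_bounds]
    at the two points. *)
Lemma local_cmp k l : (a <= k < c)%N -> (a <= l < c)%N ->
  beta M k * gam l <= exp (CA / s) * (beta M l * gam k).
Proof.
move=> hk hl.
have Wk : Rabs (INR k - mu) <= A * s by apply: win; case/andP: hk => -> /ltnW.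
have Wl : Rabs (INR l - mu) <= A * s by apply: win; case/andP: hl => -> /ltnW.
have [_ g2] := gam_bounds Wl; have [g1 _] := gam_bounds Wk.
have hh := h_cmp hk hl.
have bE j : beta M j = h j * exp (- (xk j ^ 2 / 2)).
  by rewrite /h Rmult_assoc -exp_plus Rplus_opp_r exp_0 Rmult_1_r.
have gE j : gauss (xk j) = exp (- (xk j ^ 2 / 2)) / sqrt (2 * PI).
  by rewrite /gauss; congr (exp _ / _); field.
set z := (A + 1) / s in g1 g2.
have CE : exp (CA / s) = exp (2 * A * (1 + (A + 1) ^ 2) / s) * (exp z * exp z).
  by rewrite -!exp_plus /CA /z; congr exp; field; lra.
apply: Rle_trans (_ : beta M k * (exp z * gauss (xk l) / s) <= _).
  by apply: Rmult_le_compat_l => //; exact: beta_ge0.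
apply: Rle_trans (_ : exp (CA / s) * (beta M l * (exp (- z) * gauss (xk k) / s)) <= _); last first.
  apply: Rmult_le_compat_l; first by left; exact: exp_pos.
  by apply: Rmult_le_compat_l => //; exact: beta_ge0.
rewrite (bE k) (bE l) !gE CE (exp_Ropp z).
have sp := s2pi; have ez := exp_pos z.
set X := exp (- (xk k ^ 2 / 2)); set Y := exp (- (xk l ^ 2 / 2)).
set E1 := exp (2 * A * _ / s) in hh *.
rewrite (_ : E1 * _ * _ = E1 * h l * (X * Y * exp z / (sqrt (2 * PI) * s))); last by field; lra.
rewrite (_ : _ * X * _ = h k * (X * Y * exp z / (sqrt (2 * PI) * s))); last by field; lra.
apply: Rmult_le_compat_r => //.
apply: Rmult_le_pos; last by left; apply: Rinv_0_lt_compat; nra.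
by apply: Rmult_le_pos; [apply: Rmult_le_pos|]; left; exact: exp_pos.
Qed.

End Local.

Lemma BE_chebyshev M (K : R) (F : nat -> R) : 0 < K ->
  (forall k, F k <= K * (INR k - INR M * p) ^ 2) -> BE M F <= K * (INR M * p * q).
Proof. by move=> K0 hF; rewrite -BE_var -BE_scal; apply: BE_le. Qed.

Lemma BE_pred M F : (forall k, 0 <= F k <= 1) -> 0 <= BE M F <= 1.
Proof.
by move=> h; rewrite -{1}(BE_const M 0) -[X in _ <= _ <= X](BE_const M 1); split; apply: BE_le => k; have := h k; lra.
Qed.

(** By [cross_sum] the share of the window's mass lying below [b] is nearly the same for the
    binomial and the Gaussian law. Both windows carry almost the whole mass, by Chebyshev and by
    [J_half], so the shares are nearly the distribution functions. *)
Lemma binom_clt_aux (x e A : R) (M : nat) :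
  let s := sqrt (INR M * p * q) in let C := 2 * A * (1 + (A + 1) ^ 2) + 2 * (A + 1) in
  0 < e -> e <= / 10 -> Rabs x + 3 + / e <= A -> 4 * (A + 1) <= s -> / e <= s -> 2 * C <= e * s ->
  Rabs (BE M (fun k => gei (INR k - INR M * p) (x * s)) - PhiG x) <= 9 * e.
Proof.
move=> s C e0 e1 hA hs1 hs2 hs3.
set mu := INR M * p.
have ie0 : 0 < / e by apply: Rinv_0_lt_compat.
have ie : 10 <= / e by rewrite -[10]Rinv_inv; apply: Rinv_le_contravar; lra.
have ee : e * / e = 1 by rewrite Rinv_r; lra.
have ax := Rabs_pos x; have /Rabs_le_between [x1 x2] := Rle_refl (Rabs x).
have s1 : 10 <= s by lra.
have is0 : 0 < / s by apply: Rinv_0_lt_compat; lra.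
have is1 : / s <= e by rewrite -[e]Rinv_inv; apply: Rinv_le_contravar; lra.
have s_sqE : s ^ 2 = mu * q by rewrite s_sq.
have M0 := pos_INR M.
have mu0 : 0 <= mu by apply: Rmult_le_pos; lra.
have muA : A * s <= mu.
  have : s ^ 2 <= mu by rewrite s_sqE; nra.
  by rewrite /=; nra.
have [a' [a1' a2']] := nat_floor (z := mu - A * s) ltac:(lra).
have [c [c1 c2]] := nat_floor (z := mu + A * s) ltac:(nra).
have [b' [b1 b2]] := nat_floor (z := mu + x * s) ltac:(nra).
(* [a] and [b] are the first integers above [mu - A s] and [mu + x s], while [c] is rounded down;
   thus [k <= mu + x s] means [k < b], and [[a, c]] stays within [A s] of the mean. *)
pose a := a'.+1; pose b := b'.+1.
have a1 : INR a - 1 <= mu - A * s by rewrite S_INR; lra.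
have a2 : mu - A * s < INR a by rewrite S_INR.
have bb1 : INR b - 1 <= mu + x * s by rewrite S_INR; lra.
have bb2 : mu + x * s < INR b by rewrite S_INR.
have ab : (a <= b)%N by apply/leP; apply: INR_le; nra.
have bc : (b <= c)%N by apply/leP; apply: INR_le; nra.
pose W k := BE M (fun j => indic (j < k)%N).
pose G k := J 0 (xk M k).
have gE : BE M (fun k => gei (INR k - mu) (x * s)) = W b.
  apply: BE_ext => k; rewrite /indic ltnS; case: leqP => h.
    by rewrite geiT //; have := INR_leq h; lra.
  by rewrite geiF //; have := INR_leq h; rewrite S_INR -/b; rewrite S_INR in bb2; lra.
(* Chebyshev at distance [(A - 1) s], since rounding [c] down may lose 1, which is at most [s]. *)
have tail : W a + (1 - W c) <= e.
  have A1 : / e + 2 <= A - 1 by lra.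
  have K0 : 0 < / ((A - 1) * s) ^ 2 by apply: Rinv_0_lt_compat; apply: pow_lt; nra.
  have := @BE_chebyshev M (/ ((A - 1) * s) ^ 2) (fun k => indic (k < a)%N + (1 - indic (k < c)%N)) K0.
  have -> : BE M (fun k => indic (k < a)%N + (1 - indic (k < c)%N)) = W a + (1 - W c).
    rewrite BE_add; congr (_ + _); rewrite (BE_ext M (G := fun k => 1 + -1 * indic (k < c)%N)); last by move=> k; ring.
    by rewrite BE_add BE_const (BE_scal M (-1)) /W; ring.
  move=> hc; apply: Rle_trans (hc _) _; last first.
    rewrite -/mu -s_sqE (_ : _ * s ^ 2 = / (A - 1) ^ 2); last by field; lra.
    by rewrite -[e]Rinv_inv; apply: Rinv_le_contravar => //; rewrite /=; nra.
  move=> k; have key : (A - 1) * s <= Rabs (INR k - mu) -> 1 <= / ((A - 1) * s) ^ 2 * (INR k - INR M * p) ^ 2.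
    move=> hk; have : ((A - 1) * s) ^ 2 <= (INR k - mu) ^ 2.
      by rewrite -[X in _ <= X]pow2_abs; apply: pow_incr; split=> //; nra.
    move=> h; have := Rmult_le_compat_l _ _ _ (Rlt_le _ _ K0) h; rewrite Rinv_l //.
    by apply: Rgt_not_eq; apply: pow_lt; nra.
  have q2 : 0 <= / ((A - 1) * s) ^ 2 * (INR k - INR M * p) ^ 2 by apply: Rmult_le_pos; [lra | exact: pow2_ge_0].
  case: (ltnP k a) => ha.
    have kc : (k < c)%N by apply: leq_trans ha _; apply: leq_trans bc.
    rewrite kc /indic; have : INR k <= mu - A * s by have := INR_leq ha; rewrite /a !S_INR; lra.
    by move=> h; have := key _; rewrite Rabs_left1; [move=> /(_ ltac:(nra)); lra | nra].
  case: ltnP => hc'; rewrite /indic; first lra.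
  have h := INR_leq hc'.
  by have := key _; rewrite Rabs_pos_eq; [move=> /(_ ltac:(nra)); lra | nra].
have win k : (a <= k <= c)%N -> Rabs (INR k - INR M * p) <= A * s.
  by move=> /andP [h1 h2]; have := INR_leq h1; have := INR_leq h2 => h3 h4; apply: Rabs_le; rewrite -/mu; lra.
set E := exp (C / s).
have E1 : E <= 1 + e.
  have C0 : C / s <= e / 2.
    by apply: (Rmult_le_reg_r s); [lra | rewrite /Rdiv Rmult_assoc Rinv_l; lra].
  have := exp_ineq1_le (- (C / s)); rewrite exp_Ropp -/E => h.
  have E0 : 0 < E := exp_pos _.
  have : E <= / (1 - e / 2) by rewrite -[E]Rinv_inv; apply: Rinv_le_contravar; lra.
  move=> h2; apply: Rle_trans h2 _; apply: (Rmult_le_reg_r (1 - e / 2)); first lra.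
  by rewrite Rinv_l; nra.
have xE k : xk M k * s = INR k - mu by rewrite /xk -/s -/mu; field; lra.
have W1 k : 0 <= W k <= 1 by apply: BE_pred => j; rewrite /indic; case: ifP; lra.
have WS k : W k.+1 = W k + beta M k by exact: BE_succ.
have GS k : G k.+1 = G k + J (xk M k) (xk M k.+1) by rewrite /G J_add.
have A0 : 0 <= A by lra.
have loc k l (hk : (a <= k < c)%N) (hl : (a <= l < c)%N) := @local_cmp M A A0 ltac:(rewrite -/s; lra) hs1 a c win k l hk hl.
have cr := cross_sum (Rlt_le _ _ (exp_pos _)) WS GS loc.
have ac := leq_trans ab bc.
have c1' := cr b c ltac:(by rewrite ab bc) ltac:(by rewrite ac leqnn).
have c2' := cr c b ltac:(by rewrite ac leqnn) ltac:(by rewrite ab bc).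
rewrite -/C -/s -/E in c1' c2'.
have GJ k : G k - G a = J (xk M a) (xk M k) by rewrite /G -(J_add 0 (xk M a) (xk M k)); ring.
rewrite !GJ in c1' c2'.
have xmul y z : y * s <= z * s -> y <= z by move=> h; apply: (Rmult_le_reg_r s) => //; lra.
have es : 1 <= e * s by have := Rmult_le_compat_l _ _ _ (Rlt_le _ _ e0) hs2; lra.
have xa1 : - A <= xk M a by apply: xmul; rewrite xE; lra.
have xa2 : xk M a <= - A + e by apply: xmul; rewrite xE; lra.
have xb1 : x <= xk M b by apply: xmul; rewrite xE; lra.
have xb2 : xk M b <= x + e by apply: xmul; rewrite xE; lra.
have xc1 : A - e <= xk M c by apply: xmul; rewrite xE; lra.
have xc2 : xk M c <= A by apply: xmul; rewrite xE; lra.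
have dA : / (1 + A ^ 2 / 2) <= e.
  by rewrite -[e]Rinv_inv; apply: Rinv_le_contravar => //; rewrite /=; nra.
have jx := J_PhiG x A0; have jA := J_PhiG A A0; have hA2 := J_half A0.
have P0 : PhiG x <= 1.
  have h1 := J_le1 (ltac:(lra) : - A <= A); have h2 := PhiG_diff (ltac:(lra) : x <= A).
  by rewrite /PhiG in h2 *; lra.
have P00 : 0 <= PhiG x by have := J_bounds (ltac:(lra) : - A <= x); lra.
have j1 := J_add (- A) (xk M a) (xk M b); have j2 := J_add (- A) x (xk M b).
have j3 := J_bounds xa1; have j4 := J_bounds xb1.
have j5 := J_add (- A) (xk M a) (xk M c); have j6 := J_add (- A) (xk M c) A; have j7 := J_bounds xc2.
have j8 := J_le1 (ltac:(lra) : xk M a <= xk M c).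
have j9 := J_bounds (ltac:(lra) : xk M a <= xk M b).
have PA : PhiG A = / 2 + J 0 A by [].
set J1 := J (xk M a) (xk M b) in c1' c2' j1 j9.
set J2 := J (xk M a) (xk M c) in c1' c2' j5 j8.
have J2l : 1 - 4 * e <= J2 by lra.
have J1u : J1 <= PhiG x + e by lra.
have J1l : PhiG x - 2 * e <= J1 by lra.
have Wa := W1 a; have Wb := W1 b; have Wc := W1 c.
have Wab : 0 <= W b - W a.
  suff : W a <= W b by lra.
  by apply: BE_le => k; rewrite /indic; case: (ltnP k a) => h; [rewrite (leq_trans h ab); lra | case: ifP; lra].
rewrite gE; apply: Rabs_le.
set B1 := W b - W a in c1' c2' Wab; set B2 := W c - W a in c1' c2'.
have B2b : 1 - e <= B2 <= 1 by rewrite /B2; lra.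
have B1b : B1 <= 1 by rewrite /B1; lra.
have E0 : 0 < E := exp_pos _.
have eP : 0 <= e * PhiG x <= e.
  by have := Rmult_le_compat_l _ _ _ (Rlt_le _ _ e0) P0; have := Rmult_le_pos _ _ (Rlt_le _ _ e0) P00; lra.
have eB : 0 <= e * B1 <= e.
  by have := Rmult_le_compat_l _ _ _ (Rlt_le _ _ e0) B1b; have := Rmult_le_pos _ _ (Rlt_le _ _ e0) Wab; lra.
have e2 : 0 <= e * e <= e / 10.
  by have := Rmult_le_compat_l _ _ _ (Rlt_le _ _ e0) e1; have := Rmult_le_pos _ _ (Rlt_le _ _ e0) (Rlt_le _ _ e0); lra.
have up : B1 * (1 - 4 * e) <= PhiG x + 3 * e + e * e.
  apply: Rle_trans (_ : B1 * J2 <= _); first by apply: Rmult_le_compat_l.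
  apply: Rle_trans c1' _; apply: Rle_trans (_ : (1 + e) * (1 * (PhiG x + e)) <= _); last lra.
  apply: Rmult_le_compat => //; try lra; first by apply: Rmult_le_pos; lra.
  by apply: Rmult_le_compat; lra.
have lo : (1 - e) * (PhiG x - 2 * e) <= (1 + e) * B1.
  apply: Rle_trans (_ : B2 * J1 <= _).
    apply: Rle_trans (_ : (1 - e) * J1 <= _); first by apply: Rmult_le_compat_l; lra.
    by apply: Rmult_le_compat_r; lra.
  apply: Rle_trans c2' _; apply: Rmult_le_compat => //; try lra; first by apply: Rmult_le_pos; lra.
  by rewrite -[X in _ <= X]Rmult_1_r; apply: Rmult_le_compat_l; lra.
have Bb : B1 = W b - W a by [].
by split; lra.
Qed.

Lemma binom_clt x eps : 0 < eps -> exists N, forall M, (N <= M)%N ->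
  Rabs (BE M (fun k => gei (INR k - INR M * p) (x * sqrt (INR M * p * q))) - PhiG x) <= eps.
Proof.
move=> eps0; pose e := Rmin (eps / 9) (/ 10).
have e0 : 0 < e by apply: Rmin_pos; lra.
have e1 : e <= eps / 9 := Rmin_l _ _; have e2 : e <= / 10 := Rmin_r _ _.
pose A := Rabs x + 3 + / e; pose C := 2 * A * (1 + (A + 1) ^ 2) + 2 * (A + 1).
have ie0 : 0 < / e by apply: Rinv_0_lt_compat.
have A0 : 0 < A by rewrite /A; have := Rabs_pos x; lra.
have C0 : 0 < C by rewrite /C /=; nra.
pose S0 := 4 * (A + 1) + / e + 2 * C / e.
have C1 : 0 < C / e by apply: Rmult_lt_0_compat.
have pq0 : 0 < p * q by apply: Rmult_lt_0_compat.
exists (Z.to_nat (up (S0 ^ 2 / (p * q)))) => M hM.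
have hS : S0 <= sqrt (INR M * p * q).
  rewrite -(sqrt_pow2 S0); last by rewrite /S0; lra.
  apply: sqrt_le_1_alt; rewrite Rmult_assoc.
  have h0 : 0 <= S0 ^ 2 / (p * q) by apply: Rmult_le_pos; [exact: pow2_ge_0 | left; exact: Rinv_0_lt_compat].
  have [h1 _] := archimed (S0 ^ 2 / (p * q)).
  have u0 : (0 <= up (S0 ^ 2 / (p * q)))%Z by apply: le_IZR; lra.
  have := INR_leq hM; rewrite INR_IZR_INZ Z2Nat.id // => h2.
  apply: (Rmult_le_reg_r (/ (p * q))); first exact: Rinv_0_lt_compat.
  rewrite Rmult_assoc Rinv_r; rewrite /Rdiv in h1; lra.
have := @binom_clt_aux x e A M e0 e2 (Rle_refl _); rewrite -/C => h.
apply: Rle_trans (h _ _ _) _; rewrite /S0 in hS; try lra.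
have : 2 * C / e <= sqrt (INR M * p * q) by lra.
move=> h3; have := Rmult_le_compat_l _ _ _ (Rlt_le _ _ e0) h3.
by rewrite (_ : e * (2 * C / e) = 2 * C); [|field; lra].
Qed.

End Binomial.

(** * Sums of independent indicators with nearly equal probabilities *)

Section PoissonBinomial.
Variables (n d : nat) (w : 'I_n.+1 -> 'I_d -> R).
Hypothesis w_ge0 : forall i j, 0 <= w i j.
Hypothesis w_sum1 : forall i, \big[Rplus/0]_j w i j = 1.
Variables (jb : 'I_d) (p dt : R).
Hypotheses (p0 : 0 < p) (p1 : 0 < 1 - p) (dt0 : 0 <= dt).

Definition cn (s : seq 'I_n.+1) (a : {ffun 'I_n.+1 -> 'I_d}) : nat := \sum_(h <- s) (a h == jb).

Lemma cn_NG (T : pred 'I_n.+1) a : INR (cn (enum T) a) = NG jb T a.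
Proof.
by rewrite /cn INR_sum big_enum /NG; apply: eq_bigr => h _; rewrite /indic; case: eqP.
Qed.

Lemma cn_dep (T : pred 'I_n.+1) s : (forall h, h \in s -> T h) -> depends_on T (cn s).
Proof. by move=> sT a a' e; apply: eq_big_seq => h /sT Th; rewrite e. Qed.

(** Revealing one coordinate follows the recursion of [BE] with both weights off by a factor at most
    [exp(dt)], so the laws differ by at most [exp(#s dt)]. Multiplicative bounds are preserved by
    the recursion for every nonnegative [F]. *)
Lemma Ex_binom (s : seq 'I_n.+1) : uniq s ->
  (forall h, h \in s -> exp (- dt) * p <= w h jb <= exp dt * p /\
     exp (- dt) * (1 - p) <= 1 - w h jb <= exp dt * (1 - p)) ->
  forall F : nat -> R, (forall k, 0 <= F k) ->
  exp (- (INR (size s) * dt)) * BE p (1 - p) (size s) F <= Ex w (fun a => F (cn s a)) <=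
  exp (INR (size s) * dt) * BE p (1 - p) (size s) F.
Proof.
elim: s => [|h s IH].
  move=> _ _ F F0; rewrite (Ex_ext (G := fun _ => F 0%N)); last by move=> a; rewrite /cn big_nil.
  by rewrite Ex_const // Rmult_0_l Ropp_0 exp_0 /=; lra.
case/andP => hs us hw F F0.
have {}IH := IH us (fun h' hh => hw h' (mem_behead (s := h :: s) hh)).
have [[w1 w2] [w3 w4]] := hw h (mem_head _ _).
pose xi a : R := indic (a h == jb).
have xd : depends_on (pred1 h) xi by move=> a a' e; rewrite /xi e //= eqxx.
have dis h' : pred1 h h' -> ~~ (fun i => i \in s) h' by move=> /= /eqP ->.
have fd (G : nat -> R) : depends_on (fun i => i \in s) (fun a => G (cn s a)).
  by move=> a a' e; rewrite (cn_dep (fun i hi => hi) e).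
have Exi : Ex w xi = w h jb := Ex_digit w_sum1 jb h.
have -> : Ex w (fun a => F (cn (h :: s) a)) =
    w h jb * Ex w (fun a => F (cn s a).+1) + (1 - w h jb) * Ex w (fun a => F (cn s a)).
  rewrite (Ex_ext (G := fun a => F (cn s a).+1 * xi a + (F (cn s a) - F (cn s a) * xi a))); last first.
    by move=> a; rewrite /cn big_cons /xi /indic; case: (a h == jb) => /=; rewrite ?add1n ?add0n; ring.
  rewrite Ex_add Ex_sub (Ex_indep w_sum1 (fd (fun k => F k.+1)) xd dis) (Ex_indep w_sum1 (fd F) xd dis) Exi; ring.
have := IH (fun k => F k.+1) (fun k => F0 k.+1); have := IH F F0.
cbn [size BE]; set B0 := BE _ _ _ F; set B1 := BE _ _ _ _; set E0 := Ex _ _; set E1 := Ex _ _.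
have B00 : 0 <= B0 by rewrite -(BE_const (_ : p + (1 - p) = 1) (size s) 0); [apply: BE_le | ring].
have B10 : 0 <= B1 by rewrite -(BE_const (_ : p + (1 - p) = 1) (size s) 0); [apply: BE_le => // k; exact: F0 | ring].
have eu : exp (INR (size s).+1 * dt) = exp dt * exp (INR (size s) * dt) by rewrite S_INR -exp_plus; congr exp; ring.
have el : exp (- (INR (size s).+1 * dt)) = exp (- dt) * exp (- (INR (size s) * dt)).
  by rewrite S_INR -exp_plus; congr exp; ring.
rewrite eu el.
have x1 := exp_pos dt; have x2 := exp_pos (- dt); have x3 := exp_pos (INR (size s) * dt); have x4 := exp_pos (- (INR (size s) * dt)).
set a1 := exp dt in w2 w4 x1 *; set a2 := exp (- dt) in w1 w3 x2 *.
set a3 := exp (INR _ * dt) in x3 *; set a4 := exp (- (INR _ * dt)) in x4 *.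
move=> [f1 f2] [g1 g2]; split.
  apply: Rle_trans (_ : (a2 * p) * (a4 * B1) + (a2 * (1 - p)) * (a4 * B0) <= _); first by right; ring.
  apply: Rplus_le_compat; apply: Rmult_le_compat => //; try (by apply: Rmult_le_pos; lra).
apply: Rle_trans (_ : (a1 * p) * (a3 * B1) + (a1 * (1 - p)) * (a3 * B0) <= _); last by right; ring.
have q1 : 0 < a2 * p by apply: Rmult_lt_0_compat.
have q2 : 0 < a2 * (1 - p) by apply: Rmult_lt_0_compat.
have q3 : 0 <= a4 * B0 by apply: Rmult_le_pos; lra.
have q4 : 0 <= a4 * B1 by apply: Rmult_le_pos; lra.
by apply: Rplus_le_compat; apply: Rmult_le_compat => //; lra.
Qed.

End PoissonBinomial.

(** * Moments of a main part plus a small part under a positive linear functional *)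

Section Functional.
Variables (A : Type) (E : (A -> R) -> R).
Hypothesis E_ext : forall F G, (forall a, F a = G a) -> E F = E G.
Hypothesis E_add : forall F G, E (fun a => F a + G a) = E F + E G.
Hypothesis E_scal : forall c F, E (fun a => c * F a) = c * E F.
Hypothesis E_one : E (fun _ => 1) = 1.
Hypothesis E_ge0 : forall F, (forall a, 0 <= F a) -> 0 <= E F.

Lemma E_const c : E (fun _ => c) = c.
Proof. by rewrite -[RHS]Rmult_1_r -E_one -E_scal; apply: E_ext => a; ring. Qed.

Lemma E_sq F c : E (fun a => (F a - c) ^ 2) = E (fun a => F a ^ 2) - 2 * c * E F + c ^ 2.
Proof.
rewrite (E_ext (G := fun a => F a ^ 2 + ((- 2 * c) * F a + c ^ 2))); last by move=> a; ring.
by rewrite !E_add E_scal E_const; ring.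
Qed.

Lemma E_dom F G c c' : (forall a, F a <= c * G a + c') -> E F <= c * E G + c'.
Proof.
move=> h; have : 0 <= E (fun a => c * G a + (c' + -1 * F a)) by apply: E_ge0 => a; have := h a; lra.
by rewrite !E_add !E_scal E_const; lra.
Qed.

Lemma E_jensen F : E F ^ 2 <= E (fun a => F a ^ 2).
Proof.
have : 0 <= E (fun a => (F a - E F) ^ 2) by apply: E_ge0 => a; exact: pow2_ge_0.
by rewrite E_sq; rewrite /=; lra.
Qed.

(** [Y] enters only through its second moment: Jensen gives [(E Y)^2 <= B], hence [|E Y| <= 1 + B].
    The covariance must be supplied separately, because Cauchy-Schwarz would only bound it by the
    square root of [v B], too large for the variance estimate. *)
Lemma two_part_moments (X Y : A -> R) (m0 v k1 B : R) :
  Rabs (E X) <= k1 -> Rabs (E (fun a => X a ^ 2) - v) <= k1 -> Rabs (E (fun a => X a * Y a)) <= k1 ->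
  E (fun a => Y a ^ 2) <= B ->
  let N a := X a + Y a + m0 in
  [/\ Rabs (E N - m0) <= k1 + 1 + B,
      Rabs (E (fun a => (N a - E N) ^ 2) - v) <= 3 * k1 + 2 * k1 ^ 2 + 3 * B &
      E (fun a => (N a - E N - X a) ^ 2) <= B + k1 ^ 2].
Proof.
move=> /Rabs_le_between [x1 x2] /Rabs_le_between [y1 y2] /Rabs_le_between [z1 z2] yB N.
have EN : E N = E X + E Y + m0 by rewrite /N !E_add E_const.
have Y2 := E_jensen Y; have := pow2_ge_0 (E Y) => Y0.
have X2 : E X ^ 2 <= k1 ^ 2 by rewrite /=; nra.
have X0 := pow2_ge_0 (E X).
have EYa : Rabs (E Y) <= 1 + E Y ^ 2.
  by apply: Rabs_le; have := pow2_ge_0 (E Y - 1); have := pow2_ge_0 (E Y + 1); rewrite /=; lra.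
move: EYa => /Rabs_le_between [e1 e2]; split.
- by rewrite EN; apply: Rabs_le; lra.
- have -> : E (fun a => (N a - E N) ^ 2) = E (fun a => X a ^ 2) + 2 * E (fun a => X a * Y a) + E (fun a => Y a ^ 2) - (E X + E Y) ^ 2.
    rewrite (E_ext (G := fun a => (X a + Y a - (E X + E Y)) ^ 2)); last by move=> a; rewrite EN /N; ring.
    rewrite E_sq E_add (E_ext (G := fun a => X a ^ 2 + (2 * (X a * Y a) + Y a ^ 2))); last by move=> a; ring.
    by rewrite !E_add E_scal; ring.
  have h2 : 0 <= (E X + E Y) ^ 2 <= 2 * E X ^ 2 + 2 * E Y ^ 2.
    by split; [exact: pow2_ge_0 | have := pow2_ge_0 (E X - E Y); rewrite /=; lra].
  have k10 : 0 <= k1 by lra.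
  by apply: Rabs_le; lra.
- rewrite (E_ext (G := fun a => (Y a - (E X + E Y)) ^ 2)); last by move=> a; rewrite EN /N; ring.
  by rewrite E_sq; rewrite /= in X2 Y2 yB *; lra.
Qed.

End Functional.

(** * Moments and limit law *)

Section Bridge.
Variables (d m : nat) (p : 'I_m -> nat) (b : nat).
Hypotheses (hd : (2 <= d)%N) (hm : (2 <= m)%N)
  (hp1 : forall i : 'I_m, (1 < p i)%N)
  (hcop : forall i j : 'I_m, i <> j -> coprime (p i) (p j)).
Variables (i0 i1 : 'I_m).
Hypothesis i01 : i0 <> i1.
Variable jb : 'I_d.
Hypotheses (jb0 : (0 < val jb)%N) (jbE : val jb = b).

Let S := inSb m p.
Let k := m.-1.
Notation ell n := (ln (ln (INR n))).
Let V := genl_vol (bases p).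
Let pd := / INR d.

Lemma pd_bounds : [/\ 0 < pd, 0 < 1 - pd & pd <= / 2].
Proof.
have d2 : 2 <= INR d by rewrite (_ : 2 = INR 2) //; apply: INR_leq.
have : pd <= / 2 by apply: Rinv_le_contravar; lra.
by have : 0 < pd by [apply: Rinv_0_lt_compat; lra]; split; lra.
Qed.

Section Avg.
Variables (n : nat) (r : R).
Hypothesis PX0 : 0 < PX d p n r.
Let E := @cE d m p n r.

Lemma cE_ext F G : (forall a, F a = G a) -> E F = E G.
Proof. by move=> h; rewrite /E /cE; congr (_ / _); apply: Ex_ext => a; rewrite h. Qed.

Lemma cE_add F G : E (fun a => F a + G a) = E F + E G.
Proof.
rewrite /E /cE (Ex_ext (G := fun a => F a * indic (XG xpredT a == n) + G a * indic (XG xpredT a == n))).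
  by rewrite Ex_add /Rdiv; ring.
by move=> a; ring.
Qed.

Lemma cE_scal c F : E (fun a => c * F a) = c * E F.
Proof.
rewrite /E /cE (Ex_ext (G := fun a => c * (F a * indic (XG xpredT a == n)))).
  by rewrite Ex_scal /Rdiv; ring.
by move=> a; ring.
Qed.

Lemma cE_one : E (fun _ => 1) = 1.
Proof.
rewrite /E /cE (Ex_ext (G := fun a => indic (XG xpredT a == n))); last by move=> a; ring.
by rewrite -/(PX d p n r); field; lra.
Qed.

Lemma cE_ge0 F : (forall a, 0 <= F a) -> 0 <= E F.
Proof.
move=> h; rewrite /E /cE; apply: Rmult_le_pos; last by left; apply: Rinv_0_lt_compat.
apply: Ex_ge0 => [i j|a]; first exact: wr_ge0.
by apply: Rmult_le_pos => //; have := indic01 (XG xpredT a == n); lra.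
Qed.

Lemma cE_support F G : (forall a : {ffun 'I_n.+1 -> 'I_d}, (forall h : 'I_n.+1, ~~ S h -> val (a h) = 0%N) -> F a = G a) -> E F = E G.
Proof. by move=> h; rewrite /E /cE; congr (_ / _); apply: Ex_support => a ha; rewrite h. Qed.

Lemma rep_avg F :
  \big[Rplus/0]_(a : {ffun 'I_n.+1 -> 'I_d} | is_rep d m p n a) F a / INR (Pn d m p n) = E F.
Proof.
have [K [K0 hK]] := @rep_sum d m n p r hd.
have -> : INR (Pn d m p n) = K * PX d p n r.
  have -> : INR (Pn d m p n) = \big[Rplus/0]_(a : {ffun 'I_n.+1 -> 'I_d} | is_rep d m p n a) 1.
    by rewrite rsum_const Rmult_1_r; congr INR; apply: eq_card => a; rewrite !inE.
  by rewrite hK /PX; congr (_ * _); apply: Ex_ext => a; ring.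
rewrite hK /E /cE -/(wr d p n r); field; lra.
Qed.

(** The counted digit is nonzero, so positions off [S], where the digit is 0, do not contribute. *)
Lemma Nb_NG (T U : pred 'I_n.+1) (a : {ffun 'I_n.+1 -> 'I_d}) :
  (forall h, T h -> ~~ U h) -> (forall h : 'I_n.+1, S h = T h || U h) ->
  (forall h : 'I_n.+1, ~~ S h -> val (a h) = 0%N) -> INR (Nb d n b a) = NG jb T a + NG jb U a.
Proof.
move=> TU STU ha; rewrite -NGU //.
have -> : INR (Nb d n b a) = NG jb xpredT a.
  rewrite /Nb -rsum_card /NG; apply: eq_bigr => h _; congr indic.
  by rewrite -val_eqE /= -jbE.
rewrite (NG_support (S := S) jb0 ha); apply: eq_bigl => h; exact: STU.
Qed.

End Avg.

Lemma exp_near x : 0 <= x -> x <= / 2 -> exp x <= 1 + 2 * x /\ 1 - x <= exp (- x).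
Proof.
move=> x0 x2; have h := exp_ineq1_le (- x); split; last lra.
have e0 := exp_pos (- x).
rewrite -[x]Ropp_involutive exp_Ropp Ropp_involutive.
apply: (Rmult_le_reg_r (exp (- x))) => //; rewrite Rinv_l; last lra.
by nra.
Qed.

(** The probability of failure is the sum of the [d - 1] other weights, each within the same factor
    of [1/d]; this is why uniformity is recorded for all digits and not just for the one counted. *)
Lemma weights_near n (w : 'I_n.+1 -> 'I_d -> R) (T : pred 'I_n.+1) dt :
  (forall h, \big[Rplus/0]_j w h j = 1) ->
  (forall h j, T h -> exp (- dt) / INR d <= w h j <= exp dt / INR d) ->
  forall h, h \in enum T -> exp (- dt) * pd <= w h jb <= exp dt * pd /\
     exp (- dt) * (1 - pd) <= 1 - w h jb <= exp dt * (1 - pd).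
Proof.
move=> w1 hw h; rewrite mem_enum => Th; split; first exact: hw.
have -> : 1 - w h jb = \big[Rplus/0]_(j < d | j != jb) w h j by have h1 := w1 h; rewrite (bigD1 jb) //= in h1; apply: (Rplus_eq_reg_l (w h jb)); rewrite h1; ring.
have [pd0 _ _] := pd_bounds.
have cd c : \big[Rplus/0]_(j < d | j != jb) (c / INR d) = c * (1 - pd).
  rewrite rsum_const (_ : #|_| = d.-1); last first.
    by have := cardC1 jb; rewrite card_ord => <-; apply: eq_card => j; rewrite !inE.
  have -> : INR d.-1 = INR d - 1 by rewrite -subn1 minus_INR //; apply/leP; apply: ltnW.
  by rewrite /pd; field; apply: Rgt_not_eq; apply: INR_gt0; apply: ltnW.
by rewrite -!cd; split; apply: rsum_le => j _; case: (hw h j Th).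
Qed.

Lemma nu_near n (w : 'I_n.+1 -> 'I_d -> R) (T : pred 'I_n.+1) dt :
  (forall h, \big[Rplus/0]_j w h j = 1) -> 0 <= dt -> INR #|T| * dt <= / 2 ->
  (forall h j, T h -> exp (- dt) / INR d <= w h j <= exp dt / INR d) ->
  Rabs (nuG w jb T - INR #|T| * pd) <= 1 /\
  Rabs (\big[Rplus/0]_(h < n.+1 | T h) (w h jb * (1 - w h jb)) - INR #|T| * (pd * (1 - pd))) <= 1.
Proof.
move=> w1 dt0 hdt hw; have [p0 p1 p2] := pd_bounds.
have wn h : T h -> Rabs (w h jb - pd) <= dt.
  move=> Th; have [] := weights_near w1 hw (h := h); first by rewrite mem_enum.
  have T1 : 1 <= INR #|T| by rewrite (_ : 1 = INR 1) //; apply: INR_leq; apply/card_gt0P; exists h.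
  have [e1 e2] := exp_near dt0 ltac:(nra).
  by move=> [h1 h2] _; apply: Rabs_le; nra.
split.
  rewrite -[INR _ * pd]rsum_const /nuG -rsum_sub; apply: Rle_trans (rsum_abs _ _ _) _.
  apply: Rle_trans (_ : \big[Rplus/0]_(h < n.+1 | T h) dt <= _); first by apply: rsum_le.
  by rewrite rsum_const; have : #|[pred h | T h]| = #|T| by []; move=> ->; lra.
rewrite -[INR _ * _]rsum_const -rsum_sub; apply: Rle_trans (rsum_abs _ _ _) _.
apply: Rle_trans (_ : \big[Rplus/0]_(h < n.+1 | T h) (2 * dt) <= _); last first.
  by rewrite rsum_const; have : #|[pred h | T h]| = #|T| by []; move=> ->; lra.
apply: rsum_le => h Th; have hp := wn h Th.
have [_] := weights_near w1 hw (h := h) ltac:(rewrite mem_enum //).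
have [] := weights_near w1 hw (h := h) ltac:(rewrite mem_enum //).
move=> [q1 _] _ [q2 _]; have e0 := exp_pos (- dt).
have w0 : 0 <= w h jb by have := Rmult_lt_0_compat _ _ e0 p0; lra.
have w2 : 0 <= 1 - w h jb by have := Rmult_lt_0_compat _ _ e0 p1; lra.
rewrite (_ : _ - _ = (w h jb - pd) * (1 - w h jb - pd)); last ring.
rewrite Rabs_mult (Rmult_comm 2); apply: Rmult_le_compat => //; try exact: Rabs_pos.
by apply: Rabs_le; lra.
Qed.

(** Collects what the limit law needs, with [T] carrying a nearly binomial count and [D] the order
    of all errors. In [3 / L n] one part comes from decoupling and two from
    [exp(M dt) <= 1 + 2 M dt]. *)
Lemma moment_bounds : exists C, 0 < C /\ ev (fun n => exists (T : pred 'I_n.+1) r,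
  let D := ell n * L n ^ k in let M := INR #|T| in
  [/\ 0 < PX d p n r, 1 <= ell n, ell n <= L n, 1 <= L n & Rabs (M - V * L n ^ m) <= C * D] /\
  [/\ Rabs (ExpN d m p n b - M * pd) <= C * D,
      Rabs (VarN d m p n b - M * (pd * (1 - pd))) <= C * D,
      @cE d m p n r (fun a => (INR (Nb d n b a) - ExpN d m p n b - (NG jb T a - M * pd)) ^ 2) <= C * D &
      forall F : nat -> R, (forall j, 0 <= F j <= 1) ->
       Rabs (@cE d m p n r (fun a => F (cn jb (enum T) a)) - BE pd (1 - pd) #|T| F) <= 3 / L n]).
Proof.
have [C [C0 hst]] := conditioned_decoupling hd hm hp1 hcop i01 jb.
have [C' [C0' hcnt]] := cS_count (cbb hp1 hcop) (size_bases_k p hm).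
have km : m.-1.+1 = m by rewrite prednK // ltnW.
have p2 : 0 < 2 ^ k by apply: pow_lt; lra.
(* [k1] majorises three errors: [C] for the mean on [T], [C + 1] for its second moment and [C * C]
   for the covariance with [U]. *)
pose k1 := C + 3 + C * C.
pose C1 := C' * 2 ^ k + C + (k1 + 2 + C * C + C) + (3 * k1 + 2 * k1 ^ 2 + 3 * (C * C)) + (2 * (C * C + k1 ^ 2) + 2).
have CC : 0 < C * C by apply: Rmult_lt_0_compat.
have k10 : 0 < k1 by rewrite /k1; lra.
have k12 := pow2_ge_0 k1.
have C2k : 0 <= C' * 2 ^ k by apply: Rmult_le_pos; lra.
exists C1; split; first by rewrite /C1; lra.
have := hst; move/ev_and => /(_ _ ev_L_gt1); move/ev_and => /(_ _ (ev_ge 1)).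
move/ev_and => /(_ _ (ev_ln (exp 1))).
apply: ev_imp => n [[[[T [U [r hstr]]] L1] n0] Le].
cbv zeta in hstr; set w := wr d p n r in hstr.
move: hstr => [[PX0 TU STU] [[hU hT hTU [dt [dt0 hdt hw]]] [F1 F2 F3]]].
exists T, r; cbv zeta; set D := ell n * L n ^ k; set M := INR #|T|.
have e12 := exp_ineq1_le 1.
have L2 : 2 <= L n by lra.
have l1 : 1 <= ell n.
  by rewrite -{1}[1]ln_exp; case: Le => [h|<-]; [left; apply: ln_increasing => //; exact: exp_pos | right].
have lL : ell n <= L n.
  by have := exp_ineq1_le (ell n); rewrite exp_ln; lra.
have LL j : 1 <= L n ^ j by apply: pow_R1_Rle; lra.
have D1 : 1 <= D by rewrite /D; have := LL k; nra.
have Em : L n ^ m = L n * L n ^ k by rewrite -[in LHS]km.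
have Dm : D <= L n ^ m by rewrite /D Em; apply: Rmult_le_compat_r; [have := LL k; lra | lra].
have hU' : INR #|U| <= C * D by rewrite /D; move: hU; rewrite Rmult_assoc.
have U0 := pos_INR #|U|; have M0 : 0 <= M := pos_INR _.
have w0 : forall i j, 0 <= w i j by exact: wr_ge0.
have w1 : forall i, \big[Rplus/0]_j w i j = 1 by exact: wr_sum1.
have iL2 : / L n <= / 2 by apply: Rinv_le_contravar; lra.
have iL0 : 0 < / L n by apply: Rinv_0_lt_compat; lra.
have [nu1 nu2] := nu_near w1 dt0 (Rle_trans _ _ _ hdt iL2) hw.
rewrite -/M in hT hTU hdt nu1 nu2.
set kp := / L n ^ (2 * m + 1) in F1 F2.
have kp0 : 0 < kp by apply: Rinv_0_lt_compat; have := LL (2 * m + 1)%N; lra.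
(* The exponent [2m + 1] pays for the sizes of [T] and [U], each [O(L^m)], and leaves [1/L]. *)
have kpE : kp * (L n ^ m * L n ^ m) = / L n.
  rewrite /kp (_ : (2 * m + 1 = m + m + 1)%N); last by rewrite mul2n -addnn.
  by rewrite (pow_add _ (m + m)) (pow_add _ m) pow_1; have := LL m => h; field; lra.
have Lm := LL m.
have kpm : kp * L n ^ m <= 1.
  have : kp * L n ^ m <= kp * (L n ^ m * L n ^ m) by apply: Rmult_le_compat_l; [lra | nra].
  by lra.
have kpM : kp * M <= C.
  apply: Rle_trans (_ : kp * (C * L n ^ m) <= _); first by apply: Rmult_le_compat_l; lra.
  by have := Rmult_le_compat_l _ _ _ (Rlt_le _ _ C0) kpm; lra.
have kpMu : kp * (M * INR #|U|) <= C * C.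
  apply: Rle_trans (_ : kp * (C * L n ^ m * (C * L n ^ m)) <= _).
    apply: Rmult_le_compat_l; first lra.
    apply: Rmult_le_compat => //; apply: Rle_trans hU' _; apply: Rmult_le_compat_l; lra.
  rewrite (_ : kp * _ = C * C * (kp * (L n ^ m * L n ^ m))); last ring.
  by rewrite kpE -[X in _ <= X]Rmult_1_r; apply: Rmult_le_compat_l; lra.
pose X a := NG jb T a - nuG w jb T.
pose Y a := NG jb U a - nuG w jb U.
have Xd : depends_on T X by move=> a a' e; rewrite /X (NG_dep jb e).
have EX0 : Ex w X = 0 by rewrite Ex_sub Ex_NG // Ex_const //; ring.
have EXa : Ex w (fun a => Rabs (X a)) <= M.
  rewrite -[X in _ <= X](Ex_const w1); apply: Ex_le => // a; exact: NG_abs_le.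
have EXa0 : 0 <= Ex w (fun a => Rabs (X a)) by apply: Ex_ge0 => // a; exact: Rabs_pos.
have x1 : Rabs (cE p r X) <= k1.
  have := F1 X Xd; rewrite EX0 Rminus_0_r => h; apply: Rle_trans h _.
  by have := Rmult_le_compat_l _ _ _ (Rlt_le _ _ kp0) EXa; rewrite /k1; lra.
have x2 : Rabs (cE p r (fun a => X a ^ 2) - M * (pd * (1 - pd))) <= k1.
  have d2 : depends_on T (fun a => X a ^ 2) by move=> a a' e; rewrite (Xd a a' e).
  have := F1 _ d2; rewrite (Ex_ext (G := fun a => X a ^ 2) (F := fun a => Rabs (X a ^ 2))); last first.
    by move=> a; apply: Rabs_pos_eq; exact: pow2_ge_0.
  have h1 : Ex w (fun a => X a ^ 2) <= M := NG_var_le w0 w1 jb T.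
  have nu2' : Rabs (Ex w (fun a => X a ^ 2) - M * (pd * (1 - pd))) <= 1.
    by rewrite [X in Rabs (X - _)](NG_var w1).
  set z := Ex w _ in h1 nu2' *.
  have h6 := Rmult_le_compat_l _ _ _ (Rlt_le _ _ kp0) h1.
  move: nu2' => /Rabs_le_between [h4 h5] /Rabs_le_between [h2 h3].
  have h2' : - (kp * z) <= cE p r (fun a => X a ^ 2) - z := h2.
  have h3' : cE p r (fun a => X a ^ 2) - z <= kp * z := h3.
  by apply: Rabs_le; rewrite /k1; lra.
have x3 : Rabs (cE p r (fun a => X a * Y a)) <= k1.
  apply: Rle_trans (F2 X Xd EX0) _.
  apply: Rle_trans (_ : kp * (M * INR #|U|) <= _); last by rewrite /k1; lra.
  by apply: Rmult_le_compat_l; [lra | apply: Rmult_le_compat_r].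
have x4 : cE p r (fun a => Y a ^ 2) <= C * C * D.
  by apply: Rle_trans F3 _; rewrite Rmult_assoc; apply: Rmult_le_compat_l; lra.
have := two_part_moments (@cE_ext n r) (@cE_add n r) (@cE_scal n r) (cE_one PX0) (cE_ge0 PX0) (nuG w jb T + nuG w jb U) x1 x2 x3 x4.
set N := fun a => X a + Y a + _ => -[t1 t2 t3].
have NE (g : {ffun 'I_n.+1 -> 'I_d} -> R -> R) : cE p r (fun a => g a (INR (Nb d n b a))) = cE p r (fun a => g a (N a)).
  apply: cE_support => a ha; congr (g a _); rewrite (Nb_NG TU STU ha) /N /X /Y; ring.
have EN : ExpN d m p n b = cE p r N by rewrite /ExpN (rep_avg PX0); exact: (NE (fun _ x => x)).
have VN : VarN d m p n b = cE p r (fun a => (N a - cE p r N) ^ 2).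
  by rewrite /VarN (rep_avg PX0) EN; exact: (NE (fun _ x => (x - cE p r N) ^ 2)).
have nuU := nuG_bounds w0 w1 jb U.
have DC c : 0 <= c -> c <= c * D by move=> c0; rewrite -{1}[c]Rmult_1_r; apply: Rmult_le_compat_l.
have q1 := DC _ (Rlt_le _ _ C0); have q2 := DC _ (Rlt_le _ _ k10); have q3 := DC _ k12.
have q4 : C * C <= C * C * D by apply: DC; lra.
have q5 := DC _ C2k.
have C1E : C1 * D = C' * 2 ^ k * D + C * D + (k1 * D + 2 * D + C * C * D + C * D) +
  (3 * (k1 * D) + 2 * (k1 ^ 2 * D) + 3 * (C * C * D)) + (2 * (C * C * D + k1 ^ 2 * D) + 2 * D) by rewrite /C1; ring.
move: nu1 => /Rabs_le_between [nu3 nu4].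
split; split => //.
- rewrite hTU C1E.
  have := hcnt n n0; rewrite km -/k -/V -/(cnt p n) => /Rabs_le_between [c1 c2].
  have h := proj2 (Lam_bounds m L1); rewrite -/k in h.
  have : C' * (1 + L n) ^ k <= C' * 2 ^ k * D.
    rewrite Rmult_assoc; apply: Rmult_le_compat_l => //; apply: Rle_trans h _; apply: Rmult_le_compat_l; first lra.
    by rewrite /D; have := LL k; nra.
  by move=> h'; apply: Rabs_le; lra.
- by rewrite EN C1E; move: t1 => /Rabs_le_between [t4 t5]; apply: Rabs_le; lra.
- by rewrite VN C1E; move: t2 => /Rabs_le_between [t4 t5]; apply: Rabs_le; lra.
- rewrite EN (NE (fun a x => (x - cE p r N - (NG jb T a - M * pd)) ^ 2)).
  have dif : cE p r (fun a => (N a - cE p r N - (NG jb T a - M * pd)) ^ 2) <= 2 * cE p r (fun a => (N a - cE p r N - X a) ^ 2) + 2.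
    apply: (E_dom (@cE_ext n r) (@cE_add n r) (@cE_scal n r) (cE_one PX0) (cE_ge0 PX0)) => a.
    rewrite /X; set z := N a - _; set nu := nuG w jb T in nu3 nu4 *; set x := NG jb T a.
    have nn : (nu - M * pd) ^ 2 <= 1 by rewrite /=; nra.
    have := pow2_ge_0 ((z - (x - nu)) + (nu - M * pd)); rewrite /= in nn *; lra.
  by apply: Rle_trans dif _; rewrite C1E; lra.
- move=> F hF.
  have fd : depends_on T (fun a => F (cn jb (enum T) a)).
    by move=> a a' e; rewrite (@cn_dep _ _ jb T (enum T) _ a a' e) // => h; rewrite mem_enum.
  have [pd0 pd1 _] := pd_bounds.
  have [b1 b2] := Ex_binom w0 w1 pd0 pd1 (enum_uniq T) (weights_near w1 hw) (fun j => proj1 (hF j)).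
  have := F1 _ fd; rewrite -cardE in b1 b2.
  have [B0 B1] := BE_pred pd0 pd1 (ltac:(ring) : pd + (1 - pd) = 1) #|T| hF.
  rewrite -/M in b1 b2.
  have [e1 e2] := @exp_near (M * dt) ltac:(apply: Rmult_le_pos; lra) ltac:(lra).
  have Fa : Ex w (fun a => Rabs (F (cn jb (enum T) a))) <= 1.
    by rewrite -[X in _ <= X](Ex_const w1); apply: Ex_le => // a; rewrite Rabs_pos_eq; have := hF (cn jb (enum T) a); lra.
  have kpL : kp <= / L n.
    by rewrite -kpE -{1}[kp]Rmult_1_r; apply: Rmult_le_compat_l; [lra | nra].
  have Fa0 : 0 <= Ex w (fun a => Rabs (F (cn jb (enum T) a))) by apply: Ex_ge0 => // a; exact: Rabs_pos.
  set B := BE _ _ _ _ in b1 b2 B0 B1 *; set Z := Ex w _ in b1 b2 *.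
  move=> /Rabs_le_between [f1 f2].
  have f3 : kp * Ex w (fun a => Rabs (F (cn jb (enum T) a))) <= / L n.
    apply: Rle_trans kpL; rewrite -[X in _ <= X]Rmult_1_r; apply: Rmult_le_compat_l; lra.
  have Md : 0 <= M * dt by apply: Rmult_le_pos.
  have MB : 0 <= M * dt * B <= / L n.
    split; first by apply: Rmult_le_pos.
    by apply: Rle_trans hdt; rewrite -[X in _ <= X]Rmult_1_r; apply: Rmult_le_compat_l.
  have g1 := Rmult_le_compat_r _ _ _ B0 e1; have g2 := Rmult_le_compat_r _ _ _ B0 e2.
  have f1' : - (kp * Ex w (fun a => Rabs (F (cn jb (enum T) a)))) <= cE p r (fun a => F (cn jb (enum T) a)) - Z := f1.
  have f2' : cE p r (fun a => F (cn jb (enum T) a)) - Z <= kp * Ex w (fun a => Rabs (F (cn jb (enum T) a))) := f2.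
  by apply: Rabs_le; rewrite /Rdiv; lra.
Qed.

End Bridge.

Lemma ev_lnln (delta : R) : 0 < delta -> ev (fun n => ln (ln (INR n)) <= delta * ln (INR n)).
Proof.
move=> d0; pose t := 2 / delta.
have t0 : 0 < t by apply: Rmult_lt_0_compat; [lra | apply: Rinv_0_lt_compat].
apply: ev_imp (ev_and (ev_ln (2 * ln t / delta)) (ev_ln 1)) => n [h1 h2].
have it : / t = delta / 2 by rewrite /t; field; lra.
have Lt : 0 < ln (INR n) / t by apply: Rmult_lt_0_compat; [lra | apply: Rinv_0_lt_compat].
have := exp_ineq1_le (ln (ln (INR n) / t)); rewrite exp_ln // ln_div; [|lra|lra].
rewrite /Rdiv it => h3.
have := Rmult_le_compat_l _ _ _ (Rlt_le _ _ d0) h1.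
by rewrite (_ : delta * (2 * ln t / delta) = 2 * ln t); [lra | field; lra].
Qed.

Lemma ev_INR (A : nat -> Prop) : ev A -> exists N0 : R, forall n, N0 <= INR n -> A n.
Proof. by case=> N h; exists (INR N) => n hn; apply: h; apply/leP; exact: INR_le. Qed.

(** A pointwise form of Slutsky's theorem. The events can differ only if [|w - a| >= e s], in which
    case the quadratic term is at least 1; one [e] pays for this and the other for replacing [sg] by
    [s]. *)
Lemma slutsky_indic (w a x e s sg : R) : 0 < e -> 0 < s -> 0 < sg -> Rabs x * Rabs (sg - s) <= e * s ->
  gei (w / sg) x <= gei a ((x + 2 * e) * s) + (w - a) ^ 2 / (e * s) ^ 2 /\
  gei a ((x - 2 * e) * s) - (w - a) ^ 2 / (e * s) ^ 2 <= gei (w / sg) x.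
Proof.
move=> e0 s0 sg0; rewrite -Rabs_mult => /Rabs_le_between [h1 h2].
have es : 0 < e * s by apply: Rmult_lt_0_compat.
have es2 : 0 < (e * s) ^ 2 by apply: pow_lt.
have q0 : 0 <= (w - a) ^ 2 / (e * s) ^ 2.
  by apply: Rmult_le_pos; [exact: pow2_ge_0 | left; exact: Rinv_0_lt_compat].
have big : e * s <= Rabs (w - a) -> 1 <= (w - a) ^ 2 / (e * s) ^ 2.
  move=> h; apply: (Rmult_le_reg_r ((e * s) ^ 2)) => //.
  rewrite /Rdiv Rmult_assoc Rinv_l ?Rmult_1_r ?Rmult_1_l; last lra.
  by rewrite -(pow2_abs (w - a)); apply: pow_incr; lra.
have g1 u v : gei u v <= 1 := proj2 (gei01 u v).
have g0 u v : 0 <= gei u v := proj1 (gei01 u v).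
have wx : w / sg * sg = w by field; lra.
split.
- case: (Rle_lt_dec (w / sg) x) => h; last by rewrite (geiF h); have := g0 a ((x + 2 * e) * s); lra.
  case: (Rle_lt_dec a ((x + 2 * e) * s)) => h'; first by rewrite (geiT h'); have := g1 (w / sg) x; lra.
  have hw : w <= x * sg by rewrite -wx; apply: Rmult_le_compat_r; lra.
  have := big _; rewrite Rabs_left1; last nra.
  move=> /(_ ltac:(nra)); have := g1 (w / sg) x; have := g0 a ((x + 2 * e) * s); lra.
- case: (Rle_lt_dec a ((x - 2 * e) * s)) => h; last by rewrite (geiF h); have := g0 (w / sg) x; lra.
  case: (Rle_lt_dec (w / sg) x) => h'; first by rewrite (geiT h'); have := g1 a ((x - 2 * e) * s); lra.
  have hw : x * sg < w by rewrite -wx; apply: Rmult_lt_compat_r.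
  have := big _; rewrite Rabs_pos_eq; last nra.
  move=> /(_ ltac:(nra)); have := g1 a ((x - 2 * e) * s); have := g0 (w / sg) x; lra.
Qed.

Section Final.
Variables (d m : nat) (p : 'I_m -> nat) (b : nat).
Hypotheses (hd : (2 <= d)%N) (hm : (2 <= m)%N)
  (hp1 : forall i : 'I_m, (1 < p i)%N)
  (hcop : forall i j : 'I_m, i <> j -> coprime (p i) (p j)).
Variables (i0 i1 : 'I_m).
Hypothesis i01 : i0 <> i1.
Variable jb : 'I_d.
Hypotheses (jb0 : (0 < val jb)%N) (jbE : val jb = b).

Let k := m.-1.
Notation ell n := (ln (ln (INR n))).
Let V := genl_vol (bases p).
Let pd := / INR d.

Lemma rep_cdf n r x : 0 < PX d p n r ->
  cdfZ d m p b n x = @cE d m p n r (fun a => gei ((INR (Nb d n b a) - ExpN d m p n b) / sqrt (VarN d m p n b)) x).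
Proof.
move=> PX0; rewrite -(rep_avg hd PX0) /cdfZ; congr (_ / _).
rewrite -rsum_card [RHS]rsum_ind; apply: eq_bigr => a _; rewrite /= /gei.
by case: (is_rep _ _ _ _ _); case: Rle_dec => ?; rewrite /indic /=; ring.
Qed.

Lemma cdf_tends_to x eps : 0 < eps -> ev (fun n => Rabs (cdfZ d m p b n x - PhiG x) <= eps).
Proof.
(* Five errors of size [e]: the binomial limit, the passage to the binomial law, the quadratic term,
   and two for shifting [x] by [2e]. *)
move=> eps0; pose e := eps / 5; have e0 : 0 < e by rewrite /e; lra.
have [C [C0 hsum]] := moment_bounds hd hm hp1 hcop i01 jb0 jbE.
have [pd0 pd1 pd2] := pd_bounds hd; rewrite -/pd in pd0 pd1 pd2.
have V0 : 0 < V := genl_vol_gt0 (cbb hp1 hcop).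
have pq : 0 < pd * (1 - pd) <= 1 by split; nra.
have [N1 hN1] := binom_clt pd0 pd1 ltac:(ring) (x + 2 * e) e0.
have [N2 hN2] := binom_clt pd0 pd1 ltac:(ring) (x - 2 * e) e0.
have x0 := Rabs_pos x.
(* [g] bounds the relative error of the variance: [e^3] makes the quadratic term at most [e],
   [e / (|x| + 1)] allows the exchange of standard deviations, and [1/2] keeps the variance positive
   and [M] of order [L^m]. *)
pose g := Rmin (e ^ 3) (Rmin (e / (Rabs x + 1)) (/ 2)).
have g0 : 0 < g.
  apply: Rmin_pos; first by apply: pow_lt.
  by apply: Rmin_pos; [apply: Rmult_lt_0_compat => //; apply: Rinv_0_lt_compat |]; lra.
have g1 : g <= e ^ 3 := Rmin_l _ _.
have g2 : g <= e / (Rabs x + 1) by apply: Rle_trans (Rmin_r _ _) (Rmin_l _ _).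
have g3 : g <= / 2 by apply: Rle_trans (Rmin_r _ _) (Rmin_r _ _).
pose delta := g * (pd * (1 - pd)) * V / (2 * C).
have gpV : 0 < g * (pd * (1 - pd)) * V by apply: Rmult_lt_0_compat => //; apply: Rmult_lt_0_compat; lra.
have de0 : 0 < delta by apply: Rmult_lt_0_compat => //; apply: Rinv_0_lt_compat; lra.
have Cde : C * delta = g * (pd * (1 - pd)) * V / 2 by rewrite /delta; field; lra.
have := hsum; move/ev_and => /(_ _ (ev_lnln de0)); move/ev_and => /(_ _ (ev_ln (3 / e))).
move/ev_and => /(_ _ (ev_ln (2 * INR (N1 + N2) / V))).
apply: ev_imp => n [[[[T [r hT]]] hde] Le] LN.
move: hT; cbv zeta; set D := ell n * L n ^ m.-1; set M := INR #|T|.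
move=> [[PX0 l1 lL L1 hM] [hE hV hQ hF]].
have km : m.-1.+1 = m by rewrite prednK // ltnW.
have Em : L n ^ m = L n * L n ^ k by rewrite -[in LHS]km.
have Lk : 1 <= L n ^ k by apply: pow_R1_Rle.
have CD : C * D <= g * (pd * (1 - pd)) * (V / 2 * L n ^ m).
  apply: Rle_trans (_ : C * (delta * L n ^ m) <= _).
    apply: Rmult_le_compat_l; first lra.
    by rewrite /D Em -Rmult_assoc; apply: Rmult_le_compat_r; [rewrite -/k; lra | exact: hde].
  by rewrite -Rmult_assoc Cde; right; field.
have Lm : 1 <= L n ^ m by apply: pow_R1_Rle.
have VL : 0 < V / 2 * L n ^ m by apply: Rmult_lt_0_compat; lra.
have MV : V / 2 * L n ^ m <= M.
  move: hM => /Rabs_le_between [h1 _]; rewrite -/V in h1.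
  have : g * (pd * (1 - pd)) * (V / 2 * L n ^ m) <= V / 2 * L n ^ m.
    by rewrite -[X in _ <= X]Rmult_1_l; apply: Rmult_le_compat_r; [lra | nra].
  lra.
have MN : INR (N1 + N2) <= M.
  apply: Rle_trans MV; apply: Rle_trans (_ : V / 2 * L n <= _).
    have := Rmult_le_compat_l (V / 2) _ _ ltac:(lra) LN.
    by rewrite (_ : V / 2 * (2 * INR (N1 + N2) / V) = INR (N1 + N2)); last by field; lra.
  by apply: Rmult_le_compat_l; [lra | rewrite Em; nra].
have hN : (N1 + N2 <= #|T|)%N by apply/leP; exact: INR_le.
pose s := sqrt (M * pd * (1 - pd)); set sg := sqrt (VarN d m p n b).
have M0 : 0 < M by lra.
have s2 : s ^ 2 = M * (pd * (1 - pd)).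
  by rewrite pow2_sqrt; [ring | rewrite Rmult_assoc; apply: Rmult_le_pos; lra].
have s20 : 0 < s ^ 2 by rewrite s2; apply: Rmult_lt_0_compat; lra.
have s0 : 0 < s by apply: sqrt_lt_R0; rewrite Rmult_assoc -s2.
have CDs : C * D <= g * s ^ 2.
  apply: Rle_trans CD _; rewrite s2 Rmult_assoc (Rmult_comm M); apply: Rmult_le_compat_l; first lra.
  by apply: Rmult_le_compat_l; lra.
move: hV; rewrite -/pd -s2 => /Rabs_le_between [v1 v2].
have gs : g * s ^ 2 <= s ^ 2 / 2 by have := Rmult_le_compat_r _ _ _ (Rlt_le _ _ s20) g3; lra.
have Var0 : 0 < VarN d m p n b by lra.
have sg0 : 0 < sg by apply: sqrt_lt_R0.
have sg2 : sg ^ 2 = VarN d m p n b by rewrite pow2_sqrt //; lra.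
have sgs : Rabs x * Rabs (sg - s) <= e * s.
  have h1 : Rabs (sg - s) * s <= C * D.
    apply: Rle_trans (_ : Rabs (sg - s) * (sg + s) <= _).
      by apply: Rmult_le_compat_l; [exact: Rabs_pos | lra].
    rewrite -(Rabs_pos_eq (sg + s)) -?Rabs_mult; last lra.
    by rewrite (_ : (sg - s) * (sg + s) = sg ^ 2 - s ^ 2); [rewrite sg2; apply: Rabs_le; lra | ring].
  have h2 : (Rabs x + 1) * g <= e.
    have := Rmult_le_compat_l (Rabs x + 1) _ _ ltac:(lra) g2.
    by rewrite (_ : (Rabs x + 1) * (e / (Rabs x + 1)) = e); last by field; lra.
  apply: (Rmult_le_reg_r s) => //; rewrite Rmult_assoc.
  apply: Rle_trans (_ : (Rabs x + 1) * (g * s ^ 2) <= _).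
    by apply: Rmult_le_compat; try lra; apply: Rmult_le_pos; [exact: Rabs_pos | lra].
  by rewrite -Rmult_assoc (_ : e * s * s = e * s ^ 2); [apply: Rmult_le_compat_r; lra | ring].
have es2 : 0 < (e * s) ^ 2 by apply: pow_lt; apply: Rmult_lt_0_compat.
have quad : C * D / (e * s) ^ 2 <= e.
  apply: (Rmult_le_reg_r ((e * s) ^ 2)) => //; rewrite /Rdiv Rmult_assoc Rinv_l ?Rmult_1_r; last lra.
  apply: Rle_trans CDs _; rewrite (_ : e * (e * s) ^ 2 = e ^ 3 * s ^ 2); last ring.
  by apply: Rmult_le_compat_r; lra.
have Lne : 3 / L n <= e.
  apply: (Rmult_le_reg_r (L n)); first lra; rewrite /Rdiv Rmult_assoc Rinv_l ?Rmult_1_r; last lra.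
  have := Rmult_le_compat_l _ _ _ (Rlt_le _ _ e0) Le; rewrite (_ : e * (3 / e) = 3); [lra | field; lra].
have cdf y : Rabs (@cE d m p n r (fun a => gei (NG jb T a - M * pd) (y * s)) - BE pd (1 - pd) #|T| (fun j => gei (INR j - M * pd) (y * s))) <= e.
  apply: Rle_trans Lne; have := hF (fun j => gei (INR j - M * pd) (y * s)) (fun j => gei01 _ _).
  rewrite (@cE_ext d m p n r _ (fun a => gei (NG jb T a - M * pd) (y * s))) // => a.
  by rewrite cn_NG.
set Q := fun a => _ in hQ.
have b1 := hN1 _ (leq_trans (leq_addr _ _) hN); have b2 := hN2 _ (leq_trans (leq_addl _ _) hN).
rewrite -/M -/s in b1 b2.
have c1 := cdf (x + 2 * e); have c2 := cdf (x - 2 * e).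
have f1 := PhiG_diff (ltac:(lra) : x <= x + 2 * e); have f2 := PhiG_diff (ltac:(lra) : x - 2 * e <= x).
have Ed := E_dom (@cE_ext d m p n r) (@cE_add d m p n r) (@cE_scal d m p n r) (cE_one PX0) (cE_ge0 hd PX0).
have Qe : @cE d m p n r (fun a => Q a / (e * s) ^ 2) <= e.
  rewrite (@cE_ext d m p n r _ (fun a => / (e * s) ^ 2 * Q a)); last by move=> a; rewrite /Rdiv; ring.
  rewrite cE_scal; apply: Rle_trans quad; rewrite /Rdiv Rmult_comm; apply: Rmult_le_compat_r => //.
  by left; apply: Rinv_0_lt_compat.
rewrite (rep_cdf x PX0) -/sg; set W := fun a => gei _ x.
have up : @cE d m p n r W <= 1 * @cE d m p n r (fun a => gei (NG jb T a - M * pd) ((x + 2 * e) * s) + Q a / (e * s) ^ 2) + 0.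
  apply: Ed => a; have [sl _] := slutsky_indic (INR (Nb d n b a) - ExpN d m p n b) (NG jb T a - M * pd) e0 s0 sg0 sgs.
  have sl' : W a <= gei (NG jb T a - M * pd) ((x + 2 * e) * s) + Q a / (e * s) ^ 2 := sl.
  by lra.
have lo : @cE d m p n r (fun a => gei (NG jb T a - M * pd) ((x - 2 * e) * s)) <= 1 * @cE d m p n r (fun a => W a + Q a / (e * s) ^ 2) + 0.
  apply: Ed => a; have [_ sl] := slutsky_indic (INR (Nb d n b a) - ExpN d m p n b) (NG jb T a - M * pd) e0 s0 sg0 sgs.
  have sl' : gei (NG jb T a - M * pd) ((x - 2 * e) * s) - Q a / (e * s) ^ 2 <= W a := sl.
  by lra.
rewrite cE_add in up; rewrite cE_add in lo.
move: b1 b2 c1 c2 => /Rabs_le_between [b1 b1'] /Rabs_le_between [b2 b2'] /Rabs_le_between [c1 c1'] /Rabs_le_between [c2 c2'].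
have := Rplus_le_compat_l (@cE d m p n r W) _ _ Qe => h.
by apply: Rabs_le; rewrite /e in e0 f1 f2 b1 b1' b2 b2' c1 c1' c2 c2' Qe up lo h *; lra.
Qed.

End Final.
Theorem mainTheorem5 (d m : nat) (p : 'I_m -> nat) (b : nat)
  (hd : (2 <= d)%N) (hm : (2 <= m)%N)
  (hp1 : forall i : 'I_m, (1 < p i)%N)
  (hpinc : forall i j : 'I_m, (i < j)%N -> (p i < p j)%N)
  (hcop : forall i j : 'I_m, i <> j -> coprime (p i) (p j))
  (hb1 : (1 <= b)%N) (hb2 : (b <= d - 1)%N) :
  (exists C N0 : R, forall n : nat, N0 <= INR n ->
     Rabs (ExpN d m p n b
           - kappa d m p / (INR d * ln (INR d)) * ln (INR n) ^ m)
     <= C * (ln (INR n) ^ (m - 1) * ln (ln (INR n))))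
  /\
  (exists C N0 : R, forall n : nat, N0 <= INR n ->
     Rabs (VarN d m p n b
           - kappa d m p * (INR d - 1) / (INR d ^ 2 * ln (INR d)) * ln (INR n) ^ m)
     <= C * (ln (INR n) ^ (m - 1) * ln (ln (INR n))))
  /\
  (forall x : R, exists l : R,
     Un_cv (fun M : nat => gauss_int (- INR M) x) l
     /\ Un_cv (fun n : nat => cdfZ d m p b n x) l).
Proof.
have m0 : (0 < m)%N by apply: ltnW.
(* As [m >= 2], the first two bases can serve as [P] and [Q]. *)
pose i0 : 'I_m := Ordinal m0; pose i1 : 'I_m := Ordinal hm.
have i01 : i0 <> i1 by move/(congr1 val).
have bd : (b < d)%N by rewrite -(prednK (ltnW hd)) ltnS -subn1.
pose jb : 'I_d := Ordinal bd.
have [C [C0 hsum]] := moment_bounds hd hm hp1 hcop i01 (jb := jb) hb1 (erefl b).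
have d2 : 2 <= INR d by rewrite (_ : 2 = INR 2) //; apply: INR_leq.
have ld : 0 < ln (INR d) by apply: ln_INR_gt0.
have [pd0 pd1 pd2] := pd_bounds hd.
have kE : kappa d m p = ln (INR d) * genl_vol (bases p) by exact: kappa_vol.
split; [|split].
(* One [C] for the distance of the mean to [#T / d], another for the distance of [#T] to its main
   term; the variance is treated alike. *)
- have [N0 h] := ev_INR hsum; exists (2 * C), N0 => n /h [T [r]]; cbv zeta.
  set D := ln (ln (INR n)) * _; set M := INR #|_| => -[[_ _ _ _ /Rabs_le_between [h1 h2]] [/Rabs_le_between [h3 h4] _ _ _]].
  rewrite kE subn1 (Rmult_comm _ (ln (ln _))) -/D.
  rewrite (_ : ln (INR d) * genl_vol (bases p) / _ * _ = genl_vol (bases p) * ln (INR n) ^ m * / INR d); last by field; lra.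
  set v := genl_vol _ * _ in h1 h2 *.
  have CD : 0 <= C * D by lra.
  have c0 : 0 <= C * D * (1 - / INR d) by apply: Rmult_le_pos; lra.
  have h5 : (M - v) * / INR d <= C * D.
    by have := Rmult_le_compat_r _ _ _ (Rlt_le _ _ pd0) h2; lra.
  have h6 : - (C * D) <= (M - v) * / INR d.
    by have := Rmult_le_compat_r _ _ _ (Rlt_le _ _ pd0) h1; lra.
  by apply: Rabs_le; lra.
- have [N0 h] := ev_INR hsum; exists (2 * C), N0 => n /h [T [r]]; cbv zeta.
  set D := ln (ln (INR n)) * _; set M := INR #|_| => -[[_ _ _ _ /Rabs_le_between [h1 h2]] [_ /Rabs_le_between [h3 h4] _ _]].
  rewrite kE subn1 (Rmult_comm _ (ln (ln _))) -/D.
  rewrite (_ : ln (INR d) * genl_vol (bases p) * (INR d - 1) / _ * _ = genl_vol (bases p) * ln (INR n) ^ m * (/ INR d * (1 - / INR d))); last by field; lra.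
  set v := genl_vol _ * _ in h1 h2 *; set c := / INR d * _ in h3 h4 *.
  have c01 : 0 <= c <= 1 by rewrite /c; nra.
  have CD : 0 <= C * D by lra.
  have h5 : (M - v) * c <= C * D by nra.
  have h6 : - (C * D) <= (M - v) * c by nra.
  by apply: Rabs_le; lra.
- move=> x; exists (PhiG x); split; first exact: gauss_lim.
  move=> eps eps0; have [N h] := cdf_tends_to hd hm hp1 hcop i01 (jb := jb) hb1 (erefl b) x (ltac:(lra) : 0 < eps / 2).
  by exists N => n /leP hn; apply: Rle_lt_trans (h n hn) _; lra.
Qed.
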